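(* Let $d\ge1$, $B>0$, and let $\{(X_i,Y_i)\}_{i=1}^n$, $n\ge2$, be i.i.d. copies of $(X,Y)$ with distribution supported on $\mathbb{B}^d\times\mathbb{R}$ and $|Y|\le B$ a.s. Let $\mu$ be the law of $X$, $h(x)=\mathbb{E}[Y\mid X=x]$, and assume $h\in\mathcal{H}$ with $\mathcal{H}$ as below. For $\lambda_n>0$ let $\widehat f_{n,\lambda_n}$ be a solution of \[ \min_{f\in\mathcal{NN}(N_n)}\frac1n\sum_{i=1}^n(f(X_i)-Y_i)^2+\lambda_n\kappa(f). \] (1) If $\mathcal{H}=\mathcal{H}^\alpha$ with $0<\alpha<(d+3)/2$ and we choose $N_n\gtrsim n^{\frac{d}{d+2\alpha}}$ and $\lambda_n\asymp n^{-\frac{d+3+2\alpha}{2d+4\alpha}}\log n$, then there are constants $c_1,c_2>0$ such that $\|\mathcal{T}_B\widehat f_{n,\lambda_n}-h\|_{L^2(\mu)}^2\lesssim n^{-\frac{2\alpha}{d+2\alpha}}\log n$ with probability at least $1-c_1\exp(-c_2n^{\frac{d}{d+2\alpha}}\log n)$. (2) If $\mathcal{H}=\mathcal{F}_\sigma(1)$ and we choose $N_n\gtrsim n^{\frac{d}{2d+3}}$ and $\lambda_n\asymp n^{-\frac{d+3}{2d+3}}\log n$, then there are constants $c_1,c_2>0$ such that $\|\mathcal{T}_B\widehat f_{n,\lambda_n}-h\|_{L^2(\mu)}^2\lesssim n^{-\frac{d+3}{2d+3}}\log n$ with probability at least $1-c_1\exp(-c_2n^{\frac{d}{2d+3}}\log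 n)$.
   Context: $\sigma(t)=\max\{t,0\}$; $\mathbb{B}^d$ is the closed unit ball in $\mathbb{R}^d$, $\mathbb{S}^d$ the unit sphere in $\mathbb{R}^{d+1}$. For $\theta=(a_1,w_1^\intercal,\dots,a_N,w_N^\intercal)^\intercal\in\mathbb{R}^{(d+2)N}$, $f_\theta(x)=\sum_{i=1}^Na_i\sigma((x^\intercal,1)w_i)$ on $\mathbb{B}^d$; $\mathcal{NN}(N)=\{f_\theta:\theta\in\mathbb{R}^{(d+2)N}\}$. For a finite signed Borel measure $\mu$ on $\mathbb{S}^d$, $f_\mu(x)=\int\sigma((x^\intercal,1)v)d\mu(v)$; for $f\in\mathcal{NN}(N)$, $\kappa(f)=\inf\{|\mu|(\mathbb{S}^d):\mu\text{ finitely supported signed measure on }\mathbb{S}^d, f=f_\mu\text{ on }\mathbb{B}^d\}$. $\mathcal{F}_\sigma$ is the set of all $f_\mu$ ($\mu$ finite signed Borel measure), $\gamma(f)=\inf\{|\mu|(\mathbb{S}^d):f=f_\mu\}$, $\mathcal{F}_\sigma(M)=\{\gamma(f)\le M\}$. For $\alpha=r+\beta$, $r\in\mathbb{N}_0$, $\beta\in(0,1]$, $\mathcal{H}^\alpha$ is the closed unit ball of the Hölder space $C^{r,\beta}(\mathbb{B}^d)$ (restrictions of $C^{r,\beta}(\mathbb{R}^d)$ functions with the infimum-over-extensions norm, where $\|f\|_{C^{r,\beta}(\mathbb{R}^d)}=\max\{\max_{\|s\|_1\le r}\|\partial^sf\|_\infty,\max_{\|s\|_1=r}\sup_{x\ne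 y}|\partial^sf(x)-\partial^sf(y)|/\|x-y\|_2^\beta\}$). $\mathcal{T}_Bf(x)=f(x)$ if $|f(x)|\le B$, else $\mathrm{sgn}(f(x))B$. $A\lesssim C$ means $A\le cC$ for a constant $c$ independent of $n$; $A\asymp C$ means $A\lesssim C\lesssim A$. *)

(* Defs.v *)
From HB Require Import structures.
From mathcomp Require Import all_boot all_order all_algebra.
From mathcomp Require Import all_classical all_reals all_analysis.

Set Implicit Arguments.
Unset Strict Implicit.
Unset Printing Implicit Defensive.

Import Order.TTheory GRing.Theory Num.Theory.
Import numFieldNormedType.Exports.

Local Open Scope classical_set_scope.
Local Open Scope ring_scope.

Notation borel_rV R n := (g_sigma_algebraType (@open 'rV[R]_n)).

Section Defs.
Variable R : realType.

Definition relu (t : R) : R := Num.max t 0.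

Definition norm2 n (v : 'rV[R]_n) : R := Num.sqrt (\sum_(j < n) (v 0 j) ^+ 2).

Definition inball d (x : 'rV[R]_d) : Prop := norm2 x <= 1.
Definition sphere d (v : 'rV[R]_(d.+1)) : Prop := norm2 v = 1.

Definition aff d (x : 'rV[R]_d) (v : 'rV[R]_(d.+1)) : R :=
  \sum_(j < d) x 0 j * v 0 (widen_ord (leqnSn d) j) + v 0 ord_max.

Definition nn d N (a : 'I_N -> R) (w : 'I_N -> 'rV[R]_(d.+1)) (x : 'rV[R]_d) : R :=
  \sum_(i < N) a i * relu (aff x (w i)).

Definition inNN d N (f : 'rV[R]_d -> R) : Prop :=
  exists (a : 'I_N -> R) (w : 'I_N -> 'rV[R]_(d.+1)),
    forall x, inball x -> f x = nn a w x.

(* kappa(f): infimum of |mu|(S^d) over finitely supported signed measures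
   mu = sum_j c_j delta_{v_j} (v_j distinct points of S^d) with f = f_mu on B^d;
   for such mu, |mu|(S^d) = sum_j |c_j|. *)
Definition kappa d (f : 'rV[R]_d -> R) : \bar R :=
  ereal_inf [set z | exists (k : nat) (c : 'I_k -> R) (v : 'I_k -> 'rV[R]_(d.+1)),
    [/\ injective v, (forall j, sphere (v j)),
        (forall x, inball x -> f x = \sum_(j < k) c j * relu (aff x (v j))) &
        z = (\sum_(j < k) `|c j|)%:E]].

(* A finite signed Borel measure on S^d is represented as mu = m1 - m2 with
   m1, m2 finite Borel measures on R^(d+1) vanishing outside S^d. *)
Definition sphere_measure d (m : {finite_measure set (borel_rV R d.+1) -> \bar R}) : Prop :=
  m (~` [set v | sphere v]) = 0%E.

Definition tv_diff n (m1 m2 : set (borel_rV R n) -> \bar R) : \bar R :=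
  ereal_sup [set z | exists (k : nat) (A : 'I_k -> set (borel_rV R n)),
    [/\ (forall i, measurable (A i)), trivIset setT A,
        \bigcup_(i in setT) A i = setT &
        z = (\sum_(i < k) `|fine (m1 (A i)) - fine (m2 (A i))|)%:E]].

Definition f_mu d (m1 m2 : {finite_measure set (borel_rV R d.+1) -> \bar R})
    (x : 'rV[R]_d) : R :=
  fine (\int[m1]_v (relu (aff x v))%:E) - fine (\int[m2]_v (relu (aff x v))%:E).

Definition gamma d (f : 'rV[R]_d -> R) : \bar R :=
  ereal_inf [set z | exists m1 m2 : {finite_measure set (borel_rV R d.+1) -> \bar R},
    [/\ sphere_measure m1, sphere_measure m2,
        (forall x, inball x -> f x = f_mu m1 m2 x) & z = tv_diff m1 m2]].

Definition F_sigma1 d (f : 'rV[R]_d -> R) : Prop := (gamma f <= 1%:E)%E.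

Definition partial d (j : 'I_d) (F : 'rV[R]_d -> R) : 'rV[R]_d -> R :=
  'D_(delta_mx 0 j) F.

Definition dmulti d (s : 'I_d -> nat) (F : 'rV[R]_d -> R) : 'rV[R]_d -> R :=
  foldr (fun j G => iter (s j) (partial j) G) F (enum 'I_d).

Definition mi_norm d (s : 'I_d -> nat) : nat := (\sum_(j < d) s j)%N.

Fixpoint Ck d (k : nat) (F : 'rV[R]_d -> R) : Prop :=
  match k with
  | 0 => continuous F
  | k'.+1 => (forall x, differentiable F x) /\ (forall j, Ck k' (partial j F))
  end.

Definition holder_norm_Rd d (r : nat) (beta : R) (F : 'rV[R]_d -> R) : \bar R :=
  if `[< Ck r F >] then
    Order.max
      (ereal_sup [set z | exists s x, (mi_norm s <= r)%N /\ z = (`|dmulti s F x|)%:E])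
      (ereal_sup [set z | exists s x y, [/\ mi_norm s = r, x != y &
         z = (`|dmulti s F x - dmulti s F y| / (norm2 (x - y) `^ beta))%:E]])
  else +oo%E.

Definition holder_norm d (r : nat) (beta : R) (f : 'rV[R]_d -> R) : \bar R :=
  ereal_inf [set holder_norm_Rd r beta F | F in
    [set F : 'rV[R]_d -> R | forall x, inball x -> F x = f x]].

Definition holder_ball d (alpha : R) (f : 'rV[R]_d -> R) : Prop :=
  exists (r : nat) (beta : R), [/\ alpha = r%:R + beta, 0 < beta, beta <= 1 &
    (holder_norm r beta f <= 1%:E)%E].

Definition truncB d (B : R) (f : 'rV[R]_d -> R) (x : 'rV[R]_d) : R :=
  if `|f x| <= B then f x else Num.sg (f x) * B.

End Defs.

Section Prob.
Variable R : realType.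
Local Open Scope ereal_scope.

Definition iid_seq (dO : measure_display) (O : measurableType dO)
    (dT : measure_display) (T : measurableType dT)
    (P : probability O R) (Z : nat -> O -> T) : Prop :=
  [/\ (forall i, measurable_fun setT (Z i)),
      (forall (s : seq nat) (A : nat -> set T), uniq s ->
         (forall i, measurable (A i)) ->
         P [set w | forall i, i \in s -> A i (Z i w)]
           = \prod_(i <- s) P (Z i @^-1` A i)) &
      (forall i (A : set T), measurable A -> P (Z i @^-1` A) = P (Z 0%N @^-1` A))].

Definition cond_exp_version (dO : measure_display) (O : measurableType dO)
    (P : probability O R) d (X : O -> 'rV[R]_d) (Y : O -> R)
    (h : 'rV[R]_d -> R) : Prop :=
  measurable_fun setT (h : borel_rV R d -> R) /\
  forall A : set (borel_rV R d), measurable A ->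
    \int[P]_(w in X @^-1` A) (Y w)%:E = \int[P]_(w in X @^-1` A) (h (X w))%:E.

End Prob.

Section Estimator.
Variable R : realType.
Local Open Scope ereal_scope.

Definition pen_risk (O : Type) d (X : nat -> O -> 'rV[R]_d) (Y : nat -> O -> R)
    (n : nat) (lam : R) (w : O) (f : 'rV[R]_d -> R) : \bar R :=
  (((n%:R)^-1 * \sum_(i < n) (f (X i w) - Y i w) ^+ 2)%R)%:E + lam%:E * kappa f.

Definition is_estimator (O : Type) d (X : nat -> O -> 'rV[R]_d) (Y : nat -> O -> R)
    (N : nat -> nat) (lam : nat -> R) (fhat : nat -> O -> 'rV[R]_d -> R) : Prop :=
  forall n w, (2 <= n)%N ->
    inNN (N n) (fhat n w) /\
    forall g, inNN (N n) g -> pen_risk X Y n (lam n) w (fhat n w) <= pen_risk X Y n (lam n) w g.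

End Estimator.

(* Main.v *)
(** Call a function of cost at most [M] if on the ball it is a finite sum of ridge units
    [c_j relu (aff x v_j)] with [sum_j |c_j| |v_j| <= M]; the penalty of the estimator is the
    least cost. Put [a = 1/2 + 3/(2d)] and [tau = (d+3)/2 - alpha].

    - Sparsification. A function of cost [M] is within [C M m^-a sqrt (log m)] of a network with
      [m] units. Among the light atoms, Haussler's packing lemma finds [d+2] with nearly the same
      activation pattern on a finite net of the ball; moving mass along an affine dependency of
      these kills one of them, and choosing between the two opposite moves by an exponential
      potential keeps the accumulated error small.
    - Approximation. A function of the Hoelder ball is within [C 2^(-J alpha)] of a function of
      cost [C 2^(J tau)]: discrete heat semigroups are telescoped over dyadic scales, and each
      heat kernel is written as an average of plane waves, whose ridge profiles are resolved into
      relu units by their second differences. For [F_sigma(1)], cutting the sphere into small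
      cells gives functions of bounded cost, which is the case [alpha = (d+3)/2], [tau = 0].
    - Concentration. Quantising the sparse networks of [2^j m] units gives finite nets of
      log-cardinality [2^j m log n]; chaining over [j] with Bernstein at the coarsest level and
      Hoeffding above bounds the excess risk by twice the empirical excess risk plus
      [C m log n / n] uniformly over cost [M], as soon as [M^2 n <= m^(2 + 3/d)].

    With [n = t^(d + 2 alpha)], peel over cost levels [2^i t^tau], taking
    [m ~ t^d 2^(i theta)] with [theta = 2d/(2d+3)]: since [theta < 1], the penalty absorbs the
    growth in [i], and comparison with a sparse approximant of [h] gives the rate. *)

Require Import Defs.
From mathcomp Require Import all_boot all_order all_algebra.
From mathcomp Require Import all_classical all_reals all_analysis measurable_realfun.
From mathcomp Require Import zify ring lra.

Set Implicit Arguments.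
Unset Strict Implicit.
Unset Printing Implicit Defensive.

Import Order.TTheory GRing.Theory Num.Theory.
Import numFieldNormedType.Exports.

Local Open Scope ring_scope.

(** The exponent [a] is that of a random walk. Killing one of M atoms moves the output by about
    M^(-1-1/d), and only on a share M^(-1/d) of the net, measured by the current exponential
    weights; the squares, summed over all M above m, give m^(-1-3/d). In dimension one this step is
    too coarse for the exponential bound, and a quantile argument replaces it. The critical cost
    exponent (d+3)/2 is the delicate point of the smooth case. Expanding a heat kernel in plane
    waves of a single period would cost half a power of the frequency L more. The same kernel is
    therefore expanded with L different periods sharing their integer directions, and averaged:
    along one direction the L frequencies are orthogonal, so energies add instead of amplitudes. All
    this happens on a lattice whose mesh does not enter the cost, so the mesh can be refined after
    everything else is fixed. The costs of the scales form a geometric series only for [tau] > 0,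
    hence the separate source of approximants when [tau] = 0. *)

Module Packing.
Import mathcomp.boot.finset.

(** * Weighted set families and the one-inclusion graph *)

Section VC.
Local Open Scope nat_scope.
Variable T : finType.
Implicit Types (A B S D : {set T}) (w : {set T} -> nat).

Definition shattered (U : pred {set T}) S :=
  forall B, B \subset S -> exists2 A, U A & A :&: S = B.

Definition vcle (U : pred {set T}) d := forall S, shattered U S -> #|S| <= d.

Definition wsupp w : pred {set T} := fun A => w A != 0.

(** Deleting [x] from the ground set merges [A] with [x |: A]. Keeping the larger and the smaller
    multiplicity as two families loses no mass; the value 0 on sets containing [x] makes both live
    on the smaller ground set. *)
Definition wmax x w A := if x \in A then 0 else maxn (w A) (w (x |: A)).
Definition wmin x w A := if x \in A then 0 else minn (w A) (w (x |: A)).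

Lemma sum_setU1_split x (f : {set T} -> nat) :
  \sum_A f A = \sum_(A : {set T} | x \notin A) (f A + f (x |: A)).
Proof.
rewrite big_split /= (bigID (fun A => x \notin A)) /=; congr (_ + _).
rewrite (reindex_onto (fun A => x |: A) (fun A => A :\ x)) /=; last first.
  by move=> A; rewrite negbK => xA; rewrite setD1K.
apply: eq_bigl => A; rewrite setU11 /=.
apply/eqP/idP => [<-|xA]; first by rewrite setD11.
by rewrite setU1K.
Qed.

Lemma sum_wmax_wmin x w : \sum_A w A = \sum_A wmax x w A + \sum_A wmin x w A.
Proof.
rewrite (sum_setU1_split x) -big_split /= [RHS](bigID (fun A => x \in A)) /=.
rewrite [X in _ = X + _]big1 ?add0n; last by move=> A xA; rewrite /wmax /wmin xA.
by apply: eq_bigr => A /negbTE xA; rewrite /wmax /wmin xA; lia.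
Qed.

(** A set shattered after the merge cannot contain [x], since no weight is left there; adding [x] to
    a member then leaves its trace unchanged. *)
Lemma vcle_wmax x w d : vcle (wsupp w) d -> vcle (wsupp (wmax x w)) d.
Proof.
move=> vc S shS; apply: vc => B BS.
have xS : x \notin S.
  have [A wA AS] := shS S (subxx _).
  apply/negP => xS; move: wA; rewrite /wsupp /wmax.
  by move: xS; rewrite -AS inE => /andP[-> _].
have [A wA <-] := shS B BS.
move: wA; rewrite /wsupp /wmax; case: (boolP (x \in A)) => //= xA.
have [w0|] := eqVneq (w A) 0; last by exists A.
rewrite w0 max0n => w1; exists (x |: A) => //.
by apply/setP => y; rewrite !inE; case: (eqVneq y x) => // ->; rewrite (negbTE xS) !andbF.
Qed.

(** The minimum is nonzero only where both [A] and [x |: A] occur, so [x] can be added to any set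
    that the minimum family shatters. *)
Lemma vcle_wmin x w d : vcle (wsupp w) d ->
  forall S, shattered (wsupp (wmin x w)) S -> #|S| < d.
Proof.
move=> vc S shS.
have xS : x \notin S.
  have [A wA AS] := shS S (subxx _).
  apply/negP => xS; move: wA; rewrite /wsupp /wmin.
  by move: xS; rewrite -AS inE => /andP[-> _].
have -> : (#|S| < d) = (#|x |: S| <= d) by rewrite cardsU1 xS.
apply: vc => B BS.
have [|A wA AS] := shS (B :\ x); first by rewrite subDset.
move: wA; rewrite /wsupp /wmin; case: (boolP (x \in A)) => //= xA w0.
have [w1 w2] : w A != 0 /\ w (x |: A) != 0 by lia.
have [xB|xB] := boolP (x \in B); [exists (x |: A) => //|exists A => //];
  apply/setP => y; move/setP: AS => /(_ y); rewrite !inE;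
  case: (eqVneq y x) => [->|] //=; rewrite ?xB ?(negbTE xA) ?(negbTE xB) //.
Qed.

(** Edges of the one-inclusion graph, joining sets that differ in one point; an edge counts as often
    as its rarer endpoint. *)
Definition edges (D : {set T}) w :=
  \sum_(x in D) \sum_(A : {set T} | x \notin A) minn (w A) (w (x |: A)).

Lemma minn_max_min a b c d :
  minn a b + minn c d <= minn (maxn a c) (maxn b d) + minn (minn a c) (minn b d).
Proof. lia. Qed.

(* Density of the one-inclusion graph and Sauer's bound, by deleting one point of the ground set. *)
Lemma density_sauer n : forall D w d, #|D| = n ->
  (forall A, w A != 0 -> A \subset D) -> vcle (wsupp w) d ->
  edges D w <= d * \sum_A w A /\
  ((forall A, w A <= 1) -> \sum_A w A <= n.+1 ^ d).
Proof.
elim: n => [|n IHn] D w d Dn wD vc.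
  have D0 : D = set0 by apply: cards0_eq.
  split; first by rewrite /edges D0 big_set0.
  move=> w1; rewrite (bigD1 set0) //= big1 ?addn0 ?exp1n ?w1 // => A A0.
  apply/eqP; apply: contraNT A0 => /wD; rewrite D0 subset0 //.
have [x xD] : exists x, x \in D by apply/card_gt0P; rewrite Dn.
have D'n : #|D :\ x| = n by move: Dn; rewrite (cardsD1 x) xD => -[].
have subW A : x \notin A -> (w A != 0) || (w (x |: A) != 0) -> A \subset D :\ x.
  move=> xA /orP[] /wD AD; rewrite subsetD1 xA andbT //.
  by move: AD; rewrite subUset => /andP[].
have [e1 s1] : edges (D :\ x) (wmax x w) <= d * \sum_A wmax x w A /\
  ((forall A, wmax x w A <= 1) -> \sum_A wmax x w A <= n.+1 ^ d).
  apply: IHn => //; last exact: vcle_wmax.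
  move=> A; rewrite /wmax; case: (boolP (x \in A)) => // xA wA.
  by apply: subW => //; lia.
have [e2 s2] : edges (D :\ x) (wmin x w) <= d.-1 * \sum_A wmin x w A /\
  ((forall A, wmin x w A <= 1) -> \sum_A wmin x w A <= n.+1 ^ d.-1).
  apply: IHn => //.
    move=> A; rewrite /wmin; case: (boolP (x \in A)) => // xA wA.
    by apply: subW => //; lia.
  by move=> S shS; have := vcle_wmin vc shS; lia.
(* For d = 0 not even the empty set can be shattered by the minimum family, which therefore
   vanishes; this repairs the truncated predecessor [d.-1]. *)
have d0 : d = 0 -> \sum_A wmin x w A = 0.
  move=> dE; apply: big1 => A _; apply/eqP; apply: contraT => wA.
  have := @vcle_wmin x w d vc set0; rewrite cards0 dE => H.
  by exfalso; suff: (0 < 0)%N by []; apply: H => B; rewrite subset0 => /eqP ->; exists A; rewrite ?setI0.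
split; last first.
  move=> w1; rewrite (sum_wmax_wmin x).
  have m1 A : wmax x w A <= 1.
    by rewrite /wmax; case: ifP => // _; have := w1 A; have := w1 (x |: A); lia.
  have m2 A : wmin x w A <= 1.
    by rewrite /wmin; case: ifP => // _; have := w1 A; have := w1 (x |: A); lia.
  have := s1 m1; have := s2 m2; case: d {vc e1 e2 s1 s2} d0 => [|d] d0 /=.
    by rewrite d0 // !expn0; lia.
  move=> h1 h2; rewrite expnS in h2.
  apply: (@leq_trans (n.+2 * n.+1 ^ d)); first by lia.
  by rewrite expnS leq_mul2l /=; case: (d) => [//|e]; rewrite leq_exp2r.
(* Edges in direction [x] are exactly the mass of the minimum family. The others survive the merge
   by [minn_max_min], and d for the maximum plus (d - 1) + 1 for the minimum gives d times the total
   mass. *)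
have -> : edges D w = \sum_A wmin x w A + edges (D :\ x) w.
  rewrite /edges (big_setD1 x) //=; congr (_ + _).
  rewrite [RHS](bigID (fun A => x \notin A)) /= [X in _ + X]big1 ?addn0.
    by apply: eq_bigr => A /negbTE xA; rewrite /wmin xA.
  by move=> A /negPn xA; rewrite /wmin xA.
have h : edges (D :\ x) w <= edges (D :\ x) (wmax x w) + edges (D :\ x) (wmin x w).
  rewrite /edges -big_split /=; apply: leq_sum => y; rewrite !inE => /andP[yx yD].
  rewrite -big_split /= [X in X <= _]big_mkcond /= (sum_setU1_split x).
  rewrite [X in _ <= X]big_mkcond /= [X in _ <= X](bigID (fun A => x \notin A)) /=.
  apply: (leq_trans _ (leq_addr _ _)); apply: leq_sum => A xA.
  rewrite !inE negb_or yx /=; case: ifP => // yA.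
  rewrite /wmax /wmin !inE (negbTE xA) eq_sym (negbTE yx) /=.
  by rewrite [y |: (x |: A)]setUCA; exact: minn_max_min.
move: d0 e1 e2 h; rewrite (sum_wmax_wmin x w).
move: (\sum_A wmax x w A) (\sum_A wmin x w A) (edges _ w) (edges _ _) (edges _ _).
move=> a b e f g; case: d vc {s1 s2} => [|d] vc d0 /=; first by have := d0 erefl; lia.
by clear d0; rewrite mulSn !mulnDr; nia.
Qed.

End VC.

(** * Haussler's packing lemma *)

Section Haussler.
Variables (R : realFieldType) (G V : finType) (pi : G -> R) (b : V -> G -> bool).
Variables (X : {set V}) (d : nat) (e : R).
Hypothesis pi_ge0 : forall g, 0 <= pi g.
Hypothesis pi_sum : \sum_g pi g = 1.
Hypothesis b_vc : forall g : 'I_d.+1 -> G, exists B : {set 'I_d.+1},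
  forall v, v \in X -> [set k | b v (g k)] != B.

Definition sepw v v' := \sum_g pi g * (b v g != b v' g)%:R.

Hypothesis X_sep : forall v v', v \in X -> v' \in X -> v != v' -> e <= sepw v v'.

Section Sample.
Variable s : nat.
Implicit Types (g : {ffun 'I_s -> G}) (A : {set 'I_s}) (k : 'I_s).

Definition pat g v : {set 'I_s} := [set k | b v (g k)].
(** Points of [X] sharing a pattern are counted with multiplicity; this is why the density bound is
    proved for weighted families. *)
Definition patw g A : nat := #|[set v in X | pat g v == A]|.
Definition flips g k : nat := \sum_(A : {set 'I_s} | k \notin A) minn (patw g A) (patw g (k |: A)).
Definition upd g k a : {ffun 'I_s -> G} := [ffun j => if j == k then a else g j].
Definition wt g : R := \prod_i pi (g i).

Lemma sum_patw g : (\sum_A patw g A = #|X|)%N.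
Proof.
rewrite -sum1_card (partition_big (pat g) predT) //=.
by apply: eq_bigr => A _; rewrite sum1dep_card.
Qed.

Lemma patw_vcle g w : (forall A, w A != 0%N -> patw g A != 0%N) -> vcle (wsupp w) d.
Proof.
move=> hw S shS; rewrite leqNgt; apply/negP => dS.
pose f (i : 'I_d.+1) : 'I_s := enum_val (widen_ord dS i).
have f_inj : injective f by move=> i i' /enum_val_inj /(congr1 val) /= /val_inj.
have [B HB] := b_vc (fun i => g (f i)).
have [|A wA AS] := shS [set f i | i in B].
  by apply/fintype.subsetP => _ /imsetP[i _ ->]; exact: enum_valP.
have /hw := wA; rewrite -lt0n => /card_gt0P[v]; rewrite inE => /andP[vX /eqP pv].
have /negP := HB v vX; apply; apply/eqP/setP => i; rewrite inE.
have -> : b v (g (f i)) = (f i \in A :&: S) by rewrite -pv !inE enum_valP andbT.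
by rewrite AS mem_imset.
Qed.

Lemma npat_le g : (\sum_A (patw g A != 0%N) <= s.+1 ^ d)%N.
Proof.
have [|||_] := @density_sauer 'I_s s [set: 'I_s] (fun A => (patw g A != 0%N) : nat) d.
- by rewrite cardsT card_ord.
- by move=> A; rewrite finset.subsetT.
- by apply: (@patw_vcle g) => A; case: (patw g A).
- by apply=> A; case: (_ != _).
Qed.

Lemma sum_flips g : (\sum_k flips g k <= d * #|X|)%N.
Proof.
have [|||h _] := @density_sauer 'I_s s [set: 'I_s] (patw g) d.
- by rewrite cardsT card_ord.
- by move=> A; rewrite finset.subsetT.
- exact: (@patw_vcle g).
rewrite -(sum_patw g); apply: leq_trans h.
by rewrite /edges; under [X in (_ <= X)%N]eq_bigl do rewrite inE.
Qed.

Lemma wt_ge0 g : 0 <= wt g. Proof. exact: prodr_ge0. Qed.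

Lemma sum_wt : \sum_g wt g = 1.
Proof. by rewrite /wt -(bigA_distr_bigA (fun _ => pi)) big1. Qed.

Lemma wt_upd g k a : wt (upd g k a) * pi (g k) = wt g * pi a.
Proof.
rewrite /wt (bigD1 k) //= [in RHS](bigD1 k) //= ffunE eqxx.
rewrite [X in pi a * X](eq_bigr (fun i => pi (g i))); last first.
  by move=> i /negbTE ik; rewrite ffunE ik.
by ring.
Qed.

(** One sample point may be redrawn without changing the law of the sample: the involution
    exchanging the old and the new point preserves the product weight. *)
Lemma resample k (phi : {ffun 'I_s -> G} -> R) :
  \sum_g wt g * phi g = \sum_g wt g * \sum_a pi a * phi (upd g k a).
Proof.
have -> : \sum_g wt g * (\sum_a pi a * phi (upd g k a)) =
    \sum_(p : {ffun 'I_s -> G} * G) wt p.1 * pi p.2 * phi (upd p.1 k p.2).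
  under eq_bigr => g _ do rewrite mulr_sumr.
  by rewrite pair_bigA /=; apply: eq_bigr => p _; rewrite mulrA.
pose inv (p : {ffun 'I_s -> G} * G) := (upd p.1 k p.2, p.1 k).
have invK : involutive inv.
  move=> [g a]; rewrite /inv /= ffunE eqxx; congr (_, _).
  by apply/ffunP => j; rewrite !ffunE; case: eqP => // ->.
rewrite (reindex_inj (inv_inj invK)) /=.
under [RHS]eq_bigr => p _.
  rewrite wt_upd.
  have -> : upd (upd p.1 k p.2) k (p.1 k) = p.1.
    by apply/ffunP => j; rewrite !ffunE; case: eqP => // ->.
  over.
rewrite -(pair_bigA _ (fun g a => wt g * pi a * phi g)) /=.
apply: eq_bigr => g _.
by rewrite -mulr_suml -mulr_sumr pi_sum mulr1.
Qed.

(** If n0 and n1 members fall on the two sides, then n0 n1 <= |C| min(n0, n1), and the mean of n0 n1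
    is half the sum of the pairwise separations, hence at least e/2 |C| (|C| - 1). *)
Lemma split_class (C : {set V}) : C \subset X ->
  e / 2 * (#|C|%:R - (#|C| != 0%N)%:R) <=
  \sum_a pi a * (minn #|[set v in C | ~~ b v a]| #|[set v in C | b v a]|)%:R.
Proof.
move=> CX; have [->|C0] := eqVneq #|C| 0%N.
  rewrite subrr mulr0; apply: sumr_ge0 => a _; exact: mulr_ge0.
rewrite -(ler_pM2l (_ : 0 < #|C|%:R)) ?ltr0n ?lt0n //.
have h1 : \sum_a pi a * (#|[set v in C | ~~ b v a]| * #|[set v in C | b v a]|)%:R <=
   #|C|%:R * \sum_a pi a * (minn #|[set v in C | ~~ b v a]| #|[set v in C | b v a]|)%:R.
  rewrite mulr_sumr; apply: ler_sum => a _; rewrite mulrCA ler_wpM2l //.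
  rewrite -natrM ler_nat.
  have -> : #|C| = (#|[set v in C | ~~ b v a]| + #|[set v in C | b v a]|)%N.
    rewrite -[in LHS](cardsID [set v | b v a] C) addnC; congr (_ + _)%N.
      by congr #|pred_of_set _|; apply/setP => v; rewrite !inE andbC.
    by congr #|pred_of_set _|; apply/setP => v; rewrite !inE.
  by nia.
apply: le_trans h1.
pose q v v' := \sum_a pi a * (~~ b v a && b v' a)%:R.
have -> : \sum_a pi a * (#|[set v in C | ~~ b v a]| * #|[set v in C | b v a]|)%:R =
   \sum_(v in C) \sum_(v' in C) q v v'.
  under [RHS]eq_bigr => v _ do rewrite /q exchange_big /=.
  rewrite /q [RHS]exchange_big /=; apply: eq_bigr => a _.
  have cnt (p : pred V) : #|[set v in C | p v]|%:R = \sum_(v in C) (p v)%:R :> R.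
    rewrite -sum1dep_card natr_sum big_mkcondr /=.
    by apply: eq_bigr => v _; case: (p v).
  rewrite natrM !cnt mulr_suml mulr_sumr; apply: eq_bigr => v _.
  rewrite !mulr_sumr; apply: eq_bigr => v' _.
  by case: (b v a); case: (b v' a) => /=; ring.
have h2 : \sum_(v in C) \sum_(v' in C) q v v' + \sum_(v in C) \sum_(v' in C) q v v' =
  \sum_(v in C) \sum_(v' in C) sepw v v'.
  rewrite {2}exchange_big /= -big_split; apply: eq_bigr => v _.
  rewrite -big_split; apply: eq_bigr => v' _; rewrite /q /sepw -big_split.
  by apply: eq_bigr => a _; case: (b v a); case: (b v' a) => /=; ring.
have h3 : e * (#|C|%:R * (#|C|%:R - 1)) <= \sum_(v in C) \sum_(v' in C) sepw v v'.
  have -> : e * (#|C|%:R * (#|C|%:R - 1)) = \sum_(v in C) (e * (#|C|%:R - 1)).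
    by rewrite sumr_const -[_ *+ #|_|]mulr_natl; ring.
  apply: ler_sum => v vC; rewrite (bigD1 v) //=.
  have -> : sepw v v = 0 by rewrite /sepw big1 // => a _; rewrite eqxx mulr0.
  rewrite add0r.
  apply: (@le_trans _ _ (\sum_(v' in C | v' != v) e)).
    rewrite sumr_const -[e *+ _]mulr_natr.
    have -> : #|[pred v' | v' \in C & v' != v]| = #|C|.-1.
      rewrite (cardsD1 v C) vC /=; apply: eq_card => x; rewrite !inE.
      by rewrite andbC.
    by rewrite -(@natrB _ _ 1) ?lt0n // subn1.
  apply: ler_sum => v' /andP[v'C nv]; apply: X_sep.
  - exact: (fintype.subsetP CX).
  - exact: (fintype.subsetP CX).
  - by rewrite eq_sym.
by move: h3; rewrite -h2 /=; lra.
Qed.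

(** The redrawn point splits each class of members that agree at the other coordinates. At most
    (s+1)^d classes are nonempty, since each produces a pattern on the full sample. *)
Lemma flips_upd_ge g k : 0 <= e ->
  e / 2 * (#|X|%:R - (s.+1 ^ d)%:R) <= \sum_a pi a * (flips (upd g k a) k)%:R.
Proof.
move=> e0.
pose C A := [set v in X | pat g v :\ k == A].
have patU a v : pat (upd g k a) v = (if b v a then k |: (pat g v :\ k) else pat g v :\ k).
  apply/setP => j; rewrite !inE ffunE; case: (eqVneq j k) => [->|jk].
    by case bva: (b v a); rewrite !inE eqxx.
  by case: (b v a); rewrite !inE ?jk ?(negbTE jk).
have h a A : k \notin A -> patw (upd g k a) A = #|[set v in C A | ~~ b v a]| /\
    patw (upd g k a) (k |: A) = #|[set v in C A | b v a]|.
  move=> kA; split; congr #|pred_of_set _|; apply/setP => v; rewrite !inE patU.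
    case: (v \in X) => //=; case: (b v a); rewrite ?andbT ?andbF //.
    by apply/negbTE; apply: contraNneq kA => <-; rewrite setU11.
  case: (v \in X) => //=; case: (b v a); rewrite ?andbT ?andbF.
    apply/eqP/eqP => [hh|-> //]; apply/setP => j; move/setP: hh => /(_ j).
    by rewrite !inE; case: (eqVneq j k) => [->|//]; rewrite (negbTE kA).
  by apply/negbTE; apply/eqP => /setP/(_ k); rewrite !inE eqxx.
have -> : \sum_a pi a * (flips (upd g k a) k)%:R = \sum_(A : {set 'I_s} | k \notin A)
    \sum_a pi a * (minn #|[set v in C A | ~~ b v a]| #|[set v in C A | b v a]|)%:R.
  rewrite exchange_big /=; apply: eq_bigr => a _; rewrite /flips natr_sum mulr_sumr.
  by apply: eq_bigr => A /(h a)[-> ->].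
apply: (@le_trans _ _ (\sum_(A : {set 'I_s} | k \notin A)
   e / 2 * (#|C A|%:R - (#|C A| != 0%N)%:R))); last first.
  apply: ler_sum => A kA; apply: split_class.
  by apply/fintype.subsetP => v; rewrite inE => /andP[].
rewrite -mulr_sumr ler_wpM2l ?divr_ge0 //.
rewrite sumrB; apply: lerB.
  rewrite -natr_sum ler_nat -sum1_card.
  rewrite (partition_big (fun v => pat g v :\ k) (fun A => k \notin A)) /=.
    by apply: leq_sum => A _; rewrite sum1dep_card.
  by move=> v _; rewrite !inE eqxx.
rewrite -natr_sum ler_nat; apply: leq_trans (npat_le g).
rewrite (sum_setU1_split k); apply: leq_sum => A kA.
case: (eqVneq #|C A| 0%N) => //=; rewrite -lt0n => /card_gt0P[v]; rewrite inE => /andP[vX /eqP vA].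
suff : (0 < patw g A)%N || (0 < patw g (k |: A))%N.
  by case/orP => h0; lia.
apply/orP; have [kv|kv] := boolP (k \in pat g v); [right|left];
  apply/card_gt0P; exists v; rewrite inE vX /= -vA.
  by rewrite setD1K.
by apply/eqP/setP => j; rewrite !inE; case: (eqVneq j k) => //= ->; move: kv; rewrite inE => /negbTE.
Qed.

(** Double counting of flips over all directions: at most d |X| by the density bound, at least s e/2
    (|X| - (s+1)^d) by redrawing. *)
Lemma haussler_packing : (0 < d)%N -> 0 <= e -> 4 * d%:R <= s%:R * e ->
  (#|X| <= 2 * s.+1 ^ d)%N.
Proof.
move=> d0 e0 se.
have h1 : \sum_g wt g * (\sum_k flips g k)%:R <= d%:R * #|X|%:R.
  rewrite -[leRHS]mul1r -{2}sum_wt mulr_suml; apply: ler_sum => g _.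
  by rewrite ler_wpM2l ?wt_ge0 // -natrM ler_nat sum_flips.
have h2 : s%:R * (e / 2 * (#|X|%:R - (s.+1 ^ d)%:R)) <= \sum_g wt g * (\sum_k flips g k)%:R.
  under [leRHS]eq_bigr => g _ do rewrite natr_sum mulr_sumr.
  rewrite exchange_big /=.
  have -> : s%:R * (e / 2 * (#|X|%:R - (s.+1 ^ d)%:R)) =
      \sum_(k < s) e / 2 * (#|X|%:R - (s.+1 ^ d)%:R) :> R.
    by rewrite mulr_natl sumr_const card_ord.
  apply: ler_sum => k _; rewrite (resample k).
  rewrite -[leLHS]mul1r -{1}sum_wt mulr_suml; apply: ler_sum => g _.
  by rewrite ler_wpM2l ?wt_ge0 // flips_upd_ge.
have h3 := le_trans h2 h1.
rewrite -(ler_nat R) natrM.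
have [hs|hs] := lerP (#|X|%:R : R) (s.+1 ^ d)%:R.
  by rewrite (le_trans hs) // ler_peMl // ler1n.
have d1 : 0 < d%:R :> R by rewrite ltr0n.
rewrite -(ler_pM2l d1).
have h4 : 2 * d%:R * (#|X|%:R - (s.+1 ^ d)%:R) <= s%:R * (e / 2 * (#|X|%:R - (s.+1 ^ d)%:R)) :> R.
  rewrite mulrA ler_pM2r ?subr_gt0 //; lra.
have := le_trans h4 h3; lra.
Qed.

End Sample.
End Haussler.
End Packing.

(** * Removing one atom *)

Module OneStep.
Import mathcomp.boot.finset.
Import Packing.

Section Affine.
Variable R : realType.

Lemma kernel_vector (n m : nat) (a : 'I_n -> 'I_m -> R) : (m < n)%N ->
  exists t : 'I_n -> R, (exists i, t i != 0) /\ forall j, \sum_i t i * a i j = 0.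
Proof.
move=> mn; pose M := (\matrix_(i < n, j < m) a i j)%R.
have kn : kermx M != 0.
  rewrite kermx_eq0 /row_free; apply/negP => /eqP h.
  by have := rank_leq_col M; rewrite h leqNgt mn.
pose t := nz_row (kermx M).
have t0 : t != 0 by rewrite nz_row_eq0.
have tM : t *m M = 0 by apply/sub_kermxP; exact: nz_row_sub.
exists (fun i => t 0 i); split.
  apply: contrapT => h; move/negP: t0; apply; apply/eqP/rowP => i; rewrite mxE.
  by apply: contrapT => ti; apply: h; exists i; apply/eqP.
move=> j; transitivity ((t *m M) 0 j); last by rewrite tM mxE.
by rewrite mxE; apply: eq_bigr => i _; rewrite [M i j]mxE.
Qed.

(** The d + 1 linear parts are dependent, so a combination with coefficients t of the affine forms
    is constant. Depending on the sign of this constant, the set where t is positive, or its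
    complement, is not a positivity pattern. *)
Lemma affine_vc d (a : 'I_d.+1 -> 'I_d -> R) (c : 'I_d.+1 -> R) :
  exists B : {set 'I_d.+1}, forall v : 'I_d -> R,
    [set k | 0 < \sum_j a k j * v j + c k] != B.
Proof.
have [t [t0 ta]] : exists t : 'I_d.+1 -> R,
    (exists i, 0 < t i) /\ forall j, \sum_i t i * a i j = 0.
  have [t [[i ti] ta]] := kernel_vector a (ltnSn d).
  have [ti0|ti0|/eqP] := ltrgtP 0 (t i); [by exists t; split; [exists i|]| |by rewrite eq_sym (negbTE ti)].
  exists (fun i => - t i); split; first by exists i; rewrite oppr_gt0.
  by move=> j; under eq_bigr do rewrite mulNr; rewrite sumrN ta oppr0.
have E v : \sum_k t k * (\sum_j a k j * v j + c k) = \sum_k t k * c k.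
  under eq_bigr do rewrite mulrDr; rewrite big_split /=.
  rewrite [X in X + _](_ : _ = 0) ?add0r //.
  under eq_bigr do rewrite mulr_sumr; rewrite exchange_big /= big1 // => j _.
  by under eq_bigr do rewrite mulrA; rewrite -mulr_suml ta mul0r.
have [b0|b0] := lerP (\sum_k t k * c k) 0.
  exists [set k | 0 < t k] => v; apply/eqP => /setP h.
  have h' k : (0 < \sum_j a k j * v j + c k) = (0 < t k) by have := h k; rewrite !inE.
  move: b0; rewrite leNgt -(E v) => /negP; apply.
  have [i ti] := t0; rewrite (bigD1 i) //= ltr_pwDl //.
    by rewrite mulr_gt0 // h'.
  apply: sumr_ge0 => k _; have [tk|tk] := ltP 0 (t k).
    by apply: mulr_ge0; apply: ltW; rewrite ?h'.
  by rewrite mulr_le0 // leNgt h' -leNgt.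
exists [set k | t k <= 0] => v; apply/eqP => /setP h.
have h' k : (0 < \sum_j a k j * v j + c k) = (t k <= 0) by have := h k; rewrite !inE.
move: b0; rewrite ltNge -(E v) => /negP; apply.
apply: sumr_le0 => k _; have [tk|tk] := ltP 0 (t k).
  by apply: mulr_ge0_le0; rewrite ?(ltW tk) // leNgt h' -ltNge.
by apply: mulr_le0_ge0 => //; apply: ltW; rewrite h'.
Qed.

(** A constant coordinate is appended to turn linear into affine dependency. The zero sum forces
    entries of both signs, so that mass can be moved in either direction until an atom dies. *)
Lemma affine_dependency d (I : finType) (u : I -> 'I_d -> R) (S : {set I}) :
  (d.+1 < #|S|)%N ->
  exists t : I -> R, [/\ (forall i, i \notin S -> t i = 0), \sum_i t i = 0,
    (forall j, \sum_i t i * u i j = 0), (exists i, t i < 0) & (exists i, 0 < t i)].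
Proof.
move=> dS.
pose a (i : 'I_#|S|) (j : 'I_d.+1) : R :=
  if unlift ord_max j is Some j' then u (enum_val i) j' else 1.
have [t [[i0 ti0] ta]] := kernel_vector a dS.
pose f i := \sum_(k < #|S|) t k * (enum_val k == i)%:R.
have fE (g : I -> R) : \sum_i f i * g i = \sum_k t k * g (enum_val k).
  rewrite /f; under eq_bigr do rewrite mulr_suml; rewrite exchange_big /=.
  apply: eq_bigr => k _; rewrite (bigD1 (enum_val k)) //= eqxx mulr1 big1 ?addr0 //.
  by move=> i ik; rewrite eq_sym (negbTE ik) mulr0 mul0r.
have fv k : f (enum_val k) = t k.
  rewrite /f (bigD1 k) //= eqxx mulr1 big1 ?addr0 // => k' kk.
  by rewrite (inj_eq enum_val_inj) (negbTE kk) mulr0.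
have f0 : \sum_i f i = 0.
  transitivity (\sum_i f i * 1); first by apply: eq_bigr => i _; rewrite mulr1.
  rewrite (fE (fun=> 1)); transitivity (\sum_k t k * a k ord_max); last exact: ta.
  by apply: eq_bigr => k _; rewrite /a unlift_none.
have fi0 : f (enum_val i0) != 0 by rewrite fv.
have aux (g : I -> R) i : g i != 0 -> \sum_i g i = 0 -> exists i, g i < 0.
  move=> gi gs; apply: contrapT => h.
  have g_ge0 k : 0 <= g k by rewrite leNgt; apply/negP => gk; apply: h; exists k.
  move/eqP: gs; rewrite psumr_eq0 // => /allP /(_ i).
  by rewrite mem_index_enum (negbTE gi) => /(_ isT).
exists f; split => //.
- move=> i iS; rewrite /f big1 // => k _; case: eqP => [E|]; last by rewrite mulr0.
  by move: iS; rewrite -E enum_valP.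
- move=> j; rewrite fE; transitivity (\sum_k t k * a k (lift ord_max j)); last exact: ta.
  by apply: eq_bigr => k _; rewrite /a liftK.
- exact: (aux f (enum_val i0)).
have [||i] := aux (fun i => - f i) (enum_val i0).
- by rewrite oppr_eq0.
- by rewrite sumrN f0 oppr0.
by rewrite oppr_lt0 => hi; exists i.
Qed.

(** The ratio test of the simplex method: the first weight to vanish limits the step. *)
Lemma move_to_boundary (I : finType) (w t : I -> R) :
  (forall i, 0 <= w i) -> (forall i, t i != 0 -> 0 < w i) -> (exists i, t i < 0) ->
  exists p, [/\ 0 < p, (forall i, 0 <= w i + p * t i) &
    exists i, t i < 0 /\ w i + p * t i = 0].
Proof.
move=> w0 wt [i0 ti0].
have [i ti imin] := @Order.TotalTheory.arg_minP _ R I i0 (fun i => t i < 0) (fun i => w i / - t i) ti0.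
exists (w i / - t i); split.
- by rewrite divr_gt0 ?oppr_gt0 // wt // lt_eqF.
- move=> k; have [tk|tk] := ltP (t k) 0.
    have := imin k tk; rewrite ler_pdivlMr ?oppr_gt0 //; lra.
  by rewrite addr_ge0 // mulr_ge0 // divr_ge0 // oppr_ge0 ltW.
exists i; split => //.
rewrite invrN mulrN mulNr -mulrA mulVf ?lt_eqF //; lra.
Qed.

(** From expR (- y/2) >= 1 - y/2 follows expR y <= (1 - y/2)^(-2), and this rational function stays
    below the quadratic for y <= 1/4. *)
Lemma expR_le_quadratic (y : R) : y <= 4^-1 -> expR y <= 1 + y + y ^+ 2.
Proof.
move=> y4.
have h : expR (- (y / 2)) >= 1 - y / 2 by have := expR_ge1Dx (- (y / 2)).
have p : 0 < 1 - y / 2 by lra.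
have E : expR y * expR (- (y / 2)) ^+ 2 = 1.
  rewrite expr2 mulrA -!expRD (_ : y + - (y / 2) + - (y / 2) = 0) ?expR0 //; lra.
have h2 : (1 - y / 2) ^+ 2 <= expR (- (y / 2)) ^+ 2 by rewrite ler_sqr ?nnegrE // ltW ?expR_gt0.
have h3 : expR y * (1 - y / 2) ^+ 2 <= 1.
  by apply: (le_trans (ler_wpM2l (expR_ge0 y) h2)); rewrite E.
have h4 : 1 <= (1 + y + y ^+ 2) * (1 - y / 2) ^+ 2.
  have -> : (1 + y + y ^+ 2) * (1 - y / 2) ^+ 2 = 1 + (y ^+ 2) / 4 * (1 - 3 * y + y ^+ 2) by field.
  rewrite lerDl mulr_ge0 //; first by rewrite divr_ge0 // sqr_ge0.
  have := sqr_ge0 y; lra.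
have := le_trans h3 h4; by rewrite ler_pM2r // exprn_gt0.
Qed.

End Affine.

Section Group.
Variables (R : realType) (G I : finType) (pi : G -> R) (b : I -> G -> bool).
Variables (A : {set I}) (d s : nat) (e : R).
Hypothesis pi_ge0 : forall g, 0 <= pi g.
Hypothesis pi_sum : \sum_g pi g = 1.
Hypothesis b_vc : forall g : 'I_d.+1 -> G, exists B : {set 'I_d.+1},
  forall v, [set k | b v (g k)] != B.

(** A maximal separated subset is small by packing, and by maximality every atom is within [e] of
    one of its members; the pigeonhole principle then finds d + 2 atoms around one centre. *)
Lemma close_group : (0 < d)%N -> 0 < e -> 4 * d%:R <= s%:R * e ->
  (d.+1 * (2 * s.+1 ^ d) < #|A|)%N ->
  exists c (S : {set I}), [/\ S \subset A, c \in S, #|S| = d.+2 &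
    forall i, i \in S -> sepw pi b c i <= e].
Proof.
move=> d0 e0 se cA.
pose sepP (Y : {set I}) := (Y \subset A) &&
  [forall v in Y, forall v' in Y, (v != v') ==> (e <= sepw pi b v v')].
have sep0 : sepP set0.
  by rewrite /sepP sub0set; apply/forall_inP => v; rewrite inE.
have [Y /andP[YA /forall_inP Ysep] Ymax] := @fintype.arg_maxnP _ set0 sepP (fun Y => #|Y|) sep0.
have {}Ysep v v' : v \in Y -> v' \in Y -> v != v' -> e <= sepw pi b v v'.
  by move=> vY v'Y vv; have /forall_inP /(_ _ v'Y) /implyP := Ysep v vY; exact.
have Yc : (#|Y| <= 2 * s.+1 ^ d)%N.
  apply: (@haussler_packing R G I pi b Y d e) => //; last exact: ltW.
  by move=> g; have [B HB] := b_vc g; exists B.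
have sepC v v' : sepw pi b v v' = sepw pi b v' v.
  by apply: eq_bigr => g _; rewrite eq_sym.
have sepp v : sepw pi b v v = 0 by rewrite /sepw big1 // => g _; rewrite eqxx mulr0.
have near i : i \in A -> exists c, (c \in Y) && (sepw pi b c i < e).
  move=> iA; apply: contrapT => h.
  have far c : c \in Y -> e <= sepw pi b c i.
    by move=> cY; rewrite leNgt; apply/negP => ci; apply: h; exists c; rewrite cY.
  have iY : i \notin Y by apply/negP => /far; rewrite sepp leNgt e0.
  suff /Ymax : sepP (i |: Y) by rewrite /= cardsU1 iY /=; lia.
  rewrite /sepP subUset sub1set iA YA /=.
  apply/forall_inP => v; rewrite !inE => vY; apply/forall_inP => v'; rewrite !inE => v'Y.
  apply/implyP; case/orP: vY => [/eqP ->|vY]; case/orP: v'Y => [/eqP ->|v'Y].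
  - by rewrite eqxx.
  - by move=> _; rewrite sepC; exact: far.
  - by move=> _; exact: far.
  - exact: Ysep.
pose f i := odflt i [pick c | (c \in Y) && (sepw pi b c i < e)].
have fP i : i \in A -> (f i \in Y) && (sepw pi b (f i) i < e).
  move=> /near[c hc]; rewrite /f; case: pickP => //= h.
  by move: (h c); rewrite hc.
have [c cY hc] : exists2 c, c \in Y & (d.+1 < #|[set i in A | f i == c]|)%N.
  apply: contrapT => h.
  have : (#|A| <= \sum_(c in Y) d.+1)%N.
    rewrite -sum1_card (partition_big f (mem Y)) /=; last by move=> i /fP/andP[].
    apply: leq_sum => c cY; rewrite sum1dep_card leqNgt; apply/negP => hc.
    by apply: h; exists c.
  rewrite sum_nat_const; move: cA Yc.
  by move: (2 * _)%N => z; nia.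
set F := [set i in A | f i == c] in hc.
have cF : c \in F.
  have cA' : c \in A by exact: (fintype.subsetP YA).
  rewrite inE cA' /=; have /andP[fcY fce] := fP c cA'.
  by apply: contraT => fcc; move: fce; rewrite ltNge Ysep.
pose S := c |: [set x in take d.+1 (enum (F :\ c))].
have szF : (d.+1 <= #|F :\ c|)%N by move: hc; rewrite (cardsD1 c F) cF.
have subF : {subset take d.+1 (enum (F :\ c)) <= F :\ c}.
  by move=> x /mem_take; rewrite mem_enum.
exists c, S; split.
- apply/fintype.subsetP => x; rewrite !inE => /orP[/eqP ->|/subF]; last by rewrite !inE => /and3P[].
  by move: cF; rewrite inE => /andP[].
- by rewrite !inE eqxx.
- rewrite cardsU1 inE; have -> : (c \in take d.+1 (enum (F :\ c))) = false.
    by apply/negbTE/negP => /subF; rewrite !inE eqxx.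
  rewrite cardsE (card_uniqP _) ?take_uniq ?enum_uniq // size_takel // -cardE //.
move=> i; rewrite !inE => /orP[/eqP ->|/subF]; first by rewrite sepp ltW.
by rewrite !inE => /and3P[_ iA /eqP <-]; apply: ltW; have /andP[] := fP i iA.
Qed.

End Group.

Section Step.
Variables (R : realType) (d : nat) (I X : finType).
Variables (u : I -> 'I_d -> R) (la : X -> 'I_d -> R) (lb : X -> R) (Lam : R).
Hypothesis u1 : forall i j, `|u i j| <= 1.
Hypothesis la_Lam : forall x, \sum_j `|la x j| <= Lam.
Hypothesis Lam0 : 0 <= Lam.

Definition lin x i := \sum_j la x j * u i j + lb x.
Definition rho x i := relu (lin x i).

Lemma rho_ge0 x i : 0 <= rho x i.
Proof. by rewrite /rho /relu le_max lexx orbT. Qed.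

(** Away from the kink relu is linear or zero, and the dependency annihilates affine functions. *)
Lemma dependency_same_side (t : I -> R) (S : {set I}) c x :
  (forall i, i \notin S -> t i = 0) -> \sum_i t i = 0 ->
  (forall j, \sum_i t i * u i j = 0) ->
  (forall i, i \in S -> (0 < lin x i) = (0 < lin x c)) -> \sum_i t i * rho x i = 0.
Proof.
move=> tS t0 tu hS; have [xc|xc] := boolP (0 < lin x c).
  transitivity (\sum_i t i * lin x i).
    apply: eq_bigr => i _; have [iS|/tS ->] := boolP (i \in S); last by rewrite !mul0r.
    by rewrite /rho /relu max_l // ltW // hS.
  rewrite /lin; under eq_bigr do rewrite mulrDr; rewrite big_split /= -mulr_suml t0 mul0r addr0.
  under eq_bigr do rewrite mulr_sumr; rewrite exchange_big /= big1 // => j _.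
  by under eq_bigr do rewrite mulrCA; rewrite -mulr_sumr tu mulr0.
apply: big1 => i _; have [iS|/tS ->] := boolP (i \in S); last by rewrite mul0r.
by rewrite /rho /relu max_r ?mulr0 // leNgt hS.
Qed.

Lemma lin_lip x i c r : 0 <= r -> (forall j, `|u i j - u c j| <= r) ->
  `|lin x i - lin x c| <= Lam * r.
Proof.
move=> r0 h; rewrite /lin opprD addrACA subrr addr0 -sumrB.
apply: le_trans (ler_norm_sum _ _ _) _.
apply: (@le_trans _ _ (\sum_j `|la x j| * r)); last by rewrite -mulr_suml ler_wpM2r.
by apply: ler_sum => j _; rewrite -mulrBr normrM ler_wpM2l.
Qed.

(** If the kink separates two members of the group, all members lie within the group's diameter of
    it, so their activations are that small. *)
Lemma rho_cross (S : {set I}) c x r : 0 <= r ->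
  (forall i, i \in S -> forall j, `|u i j - u c j| <= r) ->
  (exists2 i, i \in S & (0 < lin x i) != (0 < lin x c)) ->
  forall i, i \in S -> rho x i <= 2 * (Lam * r).
Proof.
move=> r0 hS [i0 i0S hx] i iS.
have h1 := lin_lip x r0 (hS _ iS); have h0 := lin_lip x r0 (hS _ i0S).
have p : 0 <= Lam * r by rewrite mulr_ge0.
rewrite /rho /relu ge_max; apply/andP; split; last by lra.
move: h1 h0; rewrite !ler_norml => /andP[h1 h2] /andP[h3 h4].
move: hx; case: (ltP 0 (lin x i0)); case: (ltP 0 (lin x c)) => //= hc hi _; lra.
Qed.

Lemma sum_ord_itv (n p q : nat) : (\sum_(k < n) (p <= k < q) = minn q n - p)%N.
Proof.
elim: n => [|n IH]; first by rewrite big_ord0; lia.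
by rewrite big_ord_recr /= IH; case: (leqP p n); case: (ltnP n q) => /=; lia.
Qed.

Lemma count_between (n : nat) (y z : R) : 0 <= y -> z <= n%:R ->
  z - y - 2 <= \sum_(k < n) ((y < k%:R) && (k%:R < z))%:R.
Proof.
move=> y0 zn; have [zy|yz] := lerP z y.
  by apply: (@le_trans _ _ 0); [lra|exact: sumr_ge0].
pose p := (Num.truncn y).+1; pose q := Num.truncn z.
have /andP[ty1 ty2] : (Num.truncn y)%:R <= y < (Num.truncn y).+1%:R by apply: truncn_itv.
have /andP[tz1 tz2] : (Num.truncn z)%:R <= z < (Num.truncn z).+1%:R by apply: truncn_itv; lra.
have qn : (q <= n)%N by rewrite -(ler_nat R) (le_trans tz1).
apply: (@le_trans _ _ (\sum_(k < n) (p <= k < q))%N%:R).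
  rewrite sum_ord_itv (minn_idPl qn).
  have : (q%:R - p%:R : R) <= (q - p)%N%:R.
    case: (leqP p q) => pq; first by rewrite natrB.
    by apply: le_trans (ler0n _ _); rewrite subr_le0 ler_nat ltnW.
  move: tz2 ty1; rewrite /p /q -!natr1; lra.
rewrite natr_sum; apply: ler_sum => k _; rewrite ler_nat.
case: (leqP p k) => //= pk; case: (ltnP k q) => //= kq.
rewrite (lt_le_trans ty2) ?ler_nat //=.
by rewrite (lt_le_trans _ tz1) // ltr_nat.
Qed.

Section Ground.
Variables (om : X -> R) (Lg : nat).
Hypothesis om_ge0 : forall x, 0 <= om x.
Let Om := \sum_x om x.
Hypothesis Om_gt0 : 0 < Om.
Hypothesis d_gt0 : (0 < d)%N.
Hypothesis Lg_gt0 : (0 < Lg)%N.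
(** Test points of two kinds, each kind with half of the probability: net points weighted by [om],
    and coordinate thresholds on a grid of mesh 1/[Lg]. Nearly equal patterns thus mean both rare
    separation by the net and closeness in every coordinate. *)
Let G : finType := (X + 'I_d * 'I_(2 * Lg).+1)%type.

Definition ga (g : G) (j' : 'I_d) : R :=
  match g with inl x => la x j' | inr jk => (j' == jk.1)%:R end.
Definition gb (g : G) : R :=
  match g with inl x => lb x | inr jk => - ((jk.2 : nat)%:R / Lg%:R - 1) end.
Definition side i (g : G) : bool := 0 < \sum_j ga g j * u i j + gb g.
Definition gw (g : G) : R :=
  match g with inl x => om x / (2 * Om) | inr _ => (2 * (d%:R * (2 * Lg).+1%:R))^-1 end.

Lemma side_grid i j k : side i (inr (j, k)) = ((k : nat)%:R < (u i j + 1) * Lg%:R).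
Proof.
rewrite /side /ga /gb /= (bigD1 j) //= eqxx mul1r big1 ?addr0; last first.
  by move=> j' /negbTE ->; rewrite mul0r.
by rewrite -ltr_pdivrMr ?ltr0n //; apply/idP/idP; lra.
Qed.

Lemma gw_ge0 g : 0 <= gw g.
Proof.
case: g => [x|jk] /=; first by rewrite divr_ge0 // mulr_ge0 // ltW.
by rewrite invr_ge0 !mulr_ge0.
Qed.

Lemma sum_gw : \sum_g gw g = 1.
Proof.
rewrite big_sumType /= -mulr_suml -/Om sumr_const card_prod !card_ord -[_ *+ (d * _)]mulr_natl natrM.
have h1 : d%:R != 0 :> R by rewrite pnatr_eq0 -lt0n.
have h2 : (2 * Lg).+1%:R != 0 :> R by rewrite pnatr_eq0.
have h3 : Om != 0 by rewrite gt_eqF.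
have half (x : R) : x != 0 -> x / (2 * x) = 2^-1 by move=> x0; field.
by rewrite !half ?mulf_neq0 //; lra.
Qed.

Lemma side_vc (g : 'I_d.+1 -> G) : exists B : {set 'I_d.+1},
  forall i, [set k | side i (g k)] != B.
Proof.
have [B hB] := affine_vc (fun k => ga (g k)) (fun k => gb (g k)).
by exists B => i; exact: hB.
Qed.

Lemma sepw_cross c i (e : R) : sepw gw side c i <= e ->
  \sum_x om x * ((0 < lin x c) != (0 < lin x i))%:R <= 2 * e * Om.
Proof.
move=> h; have : \sum_x om x / (2 * Om) * ((0 < lin x c) != (0 < lin x i))%:R <= e.
  apply: le_trans h; rewrite /sepw big_sumType /= lerDl.
  by apply: sumr_ge0 => g _; apply: mulr_ge0 => //; exact: (gw_ge0 (inr _)).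
under eq_bigr do rewrite mulrAC.
rewrite -mulr_suml ler_pdivrMr ?mulr_gt0 //; lra.
Qed.

(** Atoms at distance r in one coordinate are separated by about r [Lg] thresholds of probability of
    order 1/(d [Lg]) each. The loss 2 in [count_between] is absorbed by 1 <= [Lg] e and explains the
    2 in 6 d + 2. *)
Lemma sepw_dist c i (e : R) : 0 < e -> 1 <= Lg%:R * e -> sepw gw side c i <= e ->
  forall j, `|u i j - u c j| <= (6 * d%:R + 2) * e.
Proof.
move=> e0 Le h j.
have key c' i' : sepw gw side c' i' <= e -> u i' j - u c' j <= (6 * d%:R + 2) * e.
  move=> {}h.
  have h1 : \sum_(k < (2 * Lg).+1) (((u c' j + 1) * Lg%:R < k%:R) && (k%:R < (u i' j + 1) * Lg%:R))%:R
     <= 2 * (d%:R * (2 * Lg).+1%:R) * e.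
    rewrite -ler_pdivrMl; last by rewrite !mulr_gt0 ?ltr0n.
    apply: le_trans h; rewrite /sepw big_sumType /=.
    apply: ler_wpDl.
      by apply: sumr_ge0 => x _; apply: mulr_ge0 => //; exact: (gw_ge0 (inl x)).
    rewrite -mulr_sumr; apply: ler_wpM2l; first by rewrite invr_ge0 !mulr_ge0.
    have -> : \sum_(jk : 'I_d * 'I_(2 * Lg).+1) (side c' (inr jk) != side i' (inr jk))%:R =
       \sum_(j' : 'I_d) \sum_(k < (2 * Lg).+1) (side c' (inr (j', k)) != side i' (inr (j', k)))%:R :> R.
      by rewrite pair_bigA /=; apply: eq_bigr => -[].
    rewrite [leRHS](bigD1 j) //= ler_wpDr //; first by apply: sumr_ge0 => j' _; apply: sumr_ge0.
    apply: ler_sum => k _; rewrite !side_grid ler_nat.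
    case: (ltP ((u c' j + 1) * Lg%:R) k%:R) => //= hk.
    have -> : (k%:R < (u c' j + 1) * Lg%:R) = false by apply/negbTE; rewrite -leNgt ltW.
    by case: (_ < _).
  have h2 := @count_between (2 * Lg).+1 ((u c' j + 1) * Lg%:R) ((u i' j + 1) * Lg%:R).
  have L0 : 0 < Lg%:R :> R by rewrite ltr0n.
  have L1 : 1 <= Lg%:R :> R by rewrite ler1n.
  have hh : (u i' j + 1) * Lg%:R - (u c' j + 1) * Lg%:R - 2 <= 2 * (d%:R * (2 * Lg).+1%:R) * e.
    apply: le_trans h1; apply: h2.
      apply: mulr_ge0; last exact: ltW.
      by have := u1 c' j; rewrite ler_norml => /andP[h3 _]; lra.
    have := u1 i' j; rewrite ler_norml => /andP[_ h3].
    rewrite -[(2 * Lg).+1%:R]natr1 natrM; apply: (@le_trans _ _ (2 * Lg%:R)); last by lra.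
    by rewrite ler_pM2r //; lra.
  rewrite -(ler_pM2r L0).
  have d1 : 1 <= d%:R :> R by rewrite ler1n.
  move: hh; rewrite -[(2 * Lg).+1%:R]natr1 natrM => hh.
  have a1 : (u i' j - u c' j) * Lg%:R <= 2 * (d%:R * (2 * Lg%:R + 1)) * e + 2 by lra.
  apply: (le_trans a1).
  have a2 : d%:R * e <= d%:R * e * Lg%:R by rewrite ler_peMr // mulr_ge0 // ltW.
  have a3 : (2 * (d%:R * (2 * Lg%:R + 1)) * e) = 4 * (d%:R * e * Lg%:R) + 2 * (d%:R * e) by ring.
  have a4 : (6 * d%:R + 2) * e * Lg%:R = 6 * (d%:R * e * Lg%:R) + 2 * (Lg%:R * e) by ring.
  by rewrite a3 a4; lra.
rewrite ler_norml key // andbT.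
have : u c j - u i j <= (6 * d%:R + 2) * e; last by lra.
by apply: key; rewrite /sepw; under eq_bigr do rewrite eq_sym; exact: h.
Qed.

End Ground.

Variable w0 : I -> R.
Definition err (w : I -> R) x := \sum_i (w i - w0 i) * rho x i.
(** Twice the hyperbolic cosine of the scaled error: one potential controls both signs, and its sum
    over the net controls the maximum. *)
Definition potx (eta : R) (w : I -> R) x := expR (eta * err w x) + expR (- (eta * err w x)).
Definition pot eta w := \sum_x potx eta w x.

Lemma potx_gt0 eta w x : 0 < potx eta w x.
Proof. by rewrite addr_gt0 // expR_gt0. Qed.

Lemma err_move w t p x : err (fun i => w i + p * t i) x = err w x + p * \sum_i t i * rho x i.
Proof.
by rewrite /err mulr_sumr -big_split /=; apply: eq_bigr => i _ /=; ring.
Qed.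

(** Taken with weights q and p the two increments have mean zero, so only the second order term of
    the exponential survives. *)
Lemma exp_two_point (a y1 y2 p q b : R) : 0 < p -> 0 < q -> q * y1 + p * y2 = 0 ->
  `|y1| <= b -> `|y2| <= b -> b <= 4^-1 ->
  q * expR (a + y1) + p * expR (a + y2) <= (p + q) * (expR a * (1 + b ^+ 2)).
Proof.
move=> p0 q0 E h1 h2 b4; rewrite !expRD.
have b0 : 0 <= b by rewrite (le_trans _ h1).
have e1 : expR y1 <= 1 + y1 + b ^+ 2.
  apply: le_trans (expR_le_quadratic _) _; first by move: h1; rewrite ler_norml; lra.
  by rewrite lerD2l -(ler_sqr (normr_ge0 _)) ?nnegrE // real_normK ?num_real in h1 *.
have e2 : expR y2 <= 1 + y2 + b ^+ 2.
  apply: le_trans (expR_le_quadratic _) _; first by move: h2; rewrite ler_norml; lra.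
  by rewrite lerD2l -(ler_sqr (normr_ge0 _)) ?nnegrE // real_normK ?num_real in h2 *.
have -> : (p + q) * (expR a * (1 + b ^+ 2)) =
  expR a * (q * (1 + y1 + b ^+ 2) + p * (1 + y2 + b ^+ 2)).
  transitivity (expR a * ((p + q) * (1 + b ^+ 2) + (q * y1 + p * y2))); last by ring.
  by rewrite E; ring.
rewrite mulrCA [p * _]mulrCA -mulrDr; apply: ler_wpM2l; first exact: expR_ge0.
by apply: lerD; apply: ler_wpM2l => //; exact: ltW.
Qed.

(** The increments sum to zero, so their absolute sum is twice their negative part, and no atom can
    lose more than its weight. *)
Lemma norm_move_le (w t : I -> R) (S : {set I}) p :
  (forall i, 0 <= w i) -> (forall i, i \notin S -> t i = 0) -> \sum_i t i = 0 ->
  (forall i, 0 <= w i + p * t i) -> \sum_i `|p * t i| <= 2 * \sum_(i in S) w i.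
Proof.
move=> w0' tS t0 h; apply: (@le_trans _ _ (\sum_i (p * t i + 2 * (w i * (i \in S)%:R)))).
  apply: ler_sum => i _; have [iS|/tS ->] := boolP (i \in S); last first.
    by rewrite !mulr0 normr0 addr0.
  rewrite mulr1 ler_norml; have := h i; have := w0' i; lra.
rewrite big_split /= -mulr_sumr t0 mulr0 add0r -mulr_sumr ler_wpM2l //.
rewrite [leRHS]big_mkcond /=; apply: ler_sum => i _.
by case: ifP; rewrite ?mulr1 ?mulr0.
Qed.

Lemma err_move_le (w t : I -> R) (S : {set I}) p q x r : 0 <= r ->
  (forall i, i \notin S -> t i = 0) -> \sum_i `|p * t i| <= q ->
  (forall i, i \in S -> rho x i <= 2 * (Lam * r)) ->
  `|p * \sum_i t i * rho x i| <= q * (2 * (Lam * r)).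
Proof.
move=> r0 tS hq hr.
apply: (@le_trans _ _ (\sum_i `|p * t i| * (2 * (Lam * r)))); last first.
  by rewrite -mulr_suml ler_wpM2r // !mulr_ge0.
rewrite mulr_sumr; apply: le_trans (ler_norm_sum _ _ _) _; apply: ler_sum => i _.
have [iS|/tS ->] := boolP (i \in S); last by rewrite !(mul0r, mulr0, normr0).
by rewrite mulrA normrM (ger0_norm (rho_ge0 _ _)) ler_wpM2l // hr.
Qed.

Definition supp (w : I -> R) : {set I} := [set i | w i != 0].

(** Mass moved times activation: d + 2 light atoms allow a total move of 4 (d+2) W/M, and near a
    kink the activations are at most 2 Lam r with r = (6 d + 2) e from [sepw_dist]. *)
Definition step_size (W : R) (M : nat) (e : R) : R :=
  8 * d.+2%:R * (W / M%:R) * (Lam * ((6 * d%:R + 2) * e)).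

Lemma one_step (w : I -> R) W s (e eta : R) (x0 : X) : (0 < d)%N -> 0 < e ->
  4 * d%:R <= s%:R * e -> (4 * (d.+1 * s.+1 ^ d) < #|supp w|)%N ->
  (forall i, 0 <= w i) -> \sum_i w i = W -> 0 < eta ->
  eta * step_size W #|supp w| e <= 4^-1 ->
  exists w', [/\ (forall i, 0 <= w' i), \sum_i w' i = W,
    (#|supp w'| < #|supp w|)%N &
    pot eta w' <= pot eta w * (1 +
      (eta * step_size W #|supp w| e) ^+ 2 * (2 * d.+2%:R * e))].
Proof.
move=> d0 e0 se; set M := #|_| => sM w_ge0 wW eta0; set be := step_size _ _ _ => hbe.
have M0 : 0 < M%:R :> R by rewrite ltr0n; lia.
have W0 : 0 <= W by rewrite -wW sumr_ge0.
pose r := (6 * d%:R + 2) * e.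
have r0 : 0 <= r by rewrite mulr_ge0 // ?(ltW e0) // addr_ge0 // mulr_ge0.
have be0 : 0 <= be.
  by rewrite /be /step_size !mulr_ge0 // ?invr_ge0 // ?(ltW e0) // addr_ge0 // mulr_ge0.
pose Lg := (Num.truncn e^-1).+1.
have Le : 1 <= Lg%:R * e.
  rewrite -ler_pdivrMr // mul1r ltW //.
  by have /andP[] := @truncn_itv R e^-1 (ltW (eq_ind_r (fun b => is_true b) e0 (invr_gt0 e))).
(* Weighting net points by their current potential makes the growth of the potential proportional to
   the weighted share of points at which the group meets a kink. *)
pose om := potx eta w.
have om_ge0 x : 0 <= om x by rewrite ltW // potx_gt0.
have Om_gt0 : 0 < \sum_x om x.
  rewrite (bigD1 x0) //= ltr_pwDl ?potx_gt0 //; exact: sumr_ge0.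
(* Atoms of at most twice the mean weight; by Markov's inequality they are at least half of the
   support. *)
pose A := [set i | (w i != 0) && (w i <= 2 * (W / M%:R))].
pose H := [set i | 2 * (W / M%:R) < w i].
have cA : (M <= 2 * #|A|)%N.
  have h1 : (M <= #|A| + #|H|)%N.
    apply: (@leq_trans #|A :|: H|); last by rewrite leq_card_setU.
    apply: subset_leq_card; apply/fintype.subsetP => i.
    by rewrite !inE => ->; case: (leP (w i)).
  have [W00|W00] := eqVneq W 0.
    have /eqP M00 : M == 0%N; last by rewrite M00.
    rewrite /M cards_eq0; apply/eqP/setP => i; rewrite !inE; apply/negbTE; rewrite negbK.
    move/eqP: wW; rewrite W00 psumr_eq0 // => /allP /(_ i).
    by rewrite mem_index_enum => /(_ isT).
  have Wp : 0 < W by rewrite lt0r W00.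
  have : #|H|%:R * (2 * (W / M%:R)) <= W.
    rewrite -[leRHS]wW mulr_natl -sumr_const.
    rewrite [leRHS](bigID (mem H)) /= ler_wpDr ?sumr_ge0 //.
    by apply: ler_sum => i; rewrite inE => /ltW.
  have -> : #|H|%:R * (2 * (W / M%:R)) = W * ((2 * #|H|)%:R / M%:R) by rewrite natrM; ring.
  rewrite -[leRHS]mulr1 ler_pM2l // ler_pdivrMr // mul1r ler_nat => h2.
  by move: h1 h2; clear; lia.
have hA : (d.+1 * (2 * s.+1 ^ d) < #|A|)%N by rewrite mulnCA -(@ltn_pmul2l 2) // (leq_trans _ cA) // mulnA.
have Lg0 : (0 < Lg)%N by [].
have gw0 : forall g, 0 <= @gw om Lg g by apply: gw_ge0.
have gw1 : \sum_g @gw om Lg g = 1 by apply: sum_gw.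
have gvc := @side_vc Lg.
have [c [S [SA cS cardS hS]]] := close_group gw0 gw1 gvc d0 e0 se hA.
have wS i : i \in S -> w i != 0 /\ w i <= 2 * (W / M%:R).
  by move=> /(fintype.subsetP SA); rewrite inE => /andP[].
have hdist i : i \in S -> forall j, `|u i j - u c j| <= r.
  by move=> iS; apply: (@sepw_dist om Lg) => //; exact: hS.
have hcross i : i \in S -> \sum_x om x * ((0 < lin x c) != (0 < lin x i))%:R <= 2 * e * pot eta w.
  by move=> iS; apply: (@sepw_cross om Lg) => //; exact: hS.
have [|t [tS t0 tu tneg tpos]] := affine_dependency u (S := S); first by rewrite cardS.
have wt i : t i != 0 -> 0 < w i.
  move=> ti; have [iS|/tS] := boolP (i \in S); last by move/eqP: ti.
  by rewrite lt0r w_ge0 andbT; have [] := wS i iS.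
(* Both directions along the dependency end with the death of an atom, in general after different
   lengths p and q. *)
have [p [p0 hp [ip [tip wip]]]] := move_to_boundary w_ge0 wt tneg.
have [||q [q0 hq [iq [tiq wiq]]]] := @move_to_boundary R I w (fun i => - t i) w_ge0.
- by move=> i; rewrite oppr_eq0; exact: wt.
- by have [i ti] := tpos; exists i; rewrite oppr_lt0.
have sumS : \sum_(i in S) w i <= d.+2%:R * (2 * (W / M%:R)).
  rewrite mulr_natl -[leRHS](_ : \sum_(i in S) 2 * (W / M%:R) = _); last by rewrite sumr_const cardS.
  by apply: ler_sum => i /wS[].
have nt0 : \sum_i - t i = 0 by rewrite sumrN t0 oppr0.
have ntS i : i \notin S -> - t i = 0 by move=> /tS ->; rewrite oppr0.
pose dl x := \sum_i t i * rho x i.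
pose cross x := [exists i in S, (0 < lin x i) != (0 < lin x c)].
have dl0 x : ~~ cross x -> dl x = 0.
  move=> hx; apply: (@dependency_same_side t S c x) => // i iS.
  by apply/eqP; move: hx; rewrite negb_exists_in => /forall_inP /(_ i iS); rewrite negbK.
have bound (t' : I -> R) p' x : cross x -> (forall i, i \notin S -> t' i = 0) -> \sum_i t' i = 0 ->
    (forall i, 0 <= w i + p' * t' i) -> `|p' * \sum_i t' i * rho x i| <= be.
  move=> /exists_inP hx t'S t'0 h'.
  have h1 := norm_move_le w_ge0 t'S t'0 h'.
  have h2 : 2 * \sum_(i in S) w i <= 2 * (d.+2%:R * (2 * (W / M%:R))) by rewrite ler_wpM2l.
  apply: le_trans (err_move_le w r0 t'S (le_trans h1 h2) (rho_cross r0 hdist hx)) _.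
  by rewrite /be /step_size -/r le_eqVlt; apply/orP; left; apply/eqP; ring.
have hp1 x : cross x -> `|p * dl x| <= be by move=> hx; exact: bound.
have hq1 x : cross x -> `|q * dl x| <= be.
  move=> hx; have := bound _ q x hx ntS nt0 hq.
  rewrite (eq_bigr (fun i => - (t i * rho x i))); last by move=> i _; rewrite mulNr.
  by rewrite sumrN mulrN normrN.
pose w1 i := w i + p * t i; pose w2 i := w i + q * - t i.
have e1 x : err w1 x = err w x + p * dl x by rewrite /w1 err_move.
have e2 x : err w2 x = err w x - q * dl x.
  rewrite /w2 (err_move w (fun i => - t i)).
  rewrite (eq_bigr (fun i => - (t i * rho x i))); last by move=> i _; rewrite mulNr.
  by rewrite sumrN mulrN.
have step x : q * potx eta w1 x + p * potx eta w2 x <=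
    (p + q) * (potx eta w x * (1 + (eta * be) ^+ 2 * (cross x)%:R)).
  rewrite /potx e1 e2; case: (boolP (cross x)) => hx; last first.
    by rewrite (dl0 _ hx) !mulr0 subr0 !addr0 mulr1; lra.
  have n1 : `|eta * (p * dl x)| <= eta * be by rewrite normrM (gtr0_norm eta0) ler_pM2l // hp1.
  have n2 : `|eta * (q * dl x)| <= eta * be by rewrite normrM (gtr0_norm eta0) ler_pM2l // hq1.
  have k1 := @exp_two_point (eta * err w x) (eta * (p * dl x)) (- (eta * (q * dl x))) p q (eta * be) p0 q0.
  have k2 := @exp_two_point (- (eta * err w x)) (- (eta * (p * dl x))) (eta * (q * dl x)) p q (eta * be) p0 q0.
  have {}k1 : q * expR (eta * err w x + eta * (p * dl x)) + p * expR (eta * err w x - eta * (q * dl x))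
     <= (p + q) * (expR (eta * err w x) * (1 + (eta * be) ^+ 2)).
    by apply: k1; rewrite ?normrN //; ring.
  have {}k2 : q * expR (- (eta * err w x) - eta * (p * dl x)) + p * expR (- (eta * err w x) + eta * (q * dl x))
     <= (p + q) * (expR (- (eta * err w x)) * (1 + (eta * be) ^+ 2)).
    by apply: k2; rewrite ?normrN //; ring.
  have -> : eta * (err w x + p * dl x) = eta * err w x + eta * (p * dl x) by ring.
  have -> : eta * (err w x - q * dl x) = eta * err w x - eta * (q * dl x) by ring.
  rewrite !opprD opprK mulr1; lra.
have crossS : \sum_x potx eta w x * (cross x)%:R <= d.+2%:R * (2 * e * pot eta w).
  apply: (@le_trans _ _ (\sum_(i in S) \sum_x om x * ((0 < lin x c) != (0 < lin x i))%:R)).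
    rewrite exchange_big /=; apply: ler_sum => x _; rewrite -mulr_sumr ler_wpM2l //.
    case: (boolP (cross x)) => [/exists_inP[i iS hi]|_]; last by rewrite sumr_ge0.
    rewrite (bigD1 i) //= eq_sym hi ler_wpDr // sumr_ge0 //.
  rewrite mulr_natl -[leRHS](_ : \sum_(i in S) 2 * e * pot eta w = _); last by rewrite sumr_const cardS.
  exact: ler_sum.
set T := pot eta w * _.
(* The average with weights q and p stays below [T], so at least one of the two moves keeps the
   potential below [T]. *)
have tot : q * pot eta w1 + p * pot eta w2 <= (p + q) * T.
  rewrite /pot !mulr_sumr -big_split /=.
  apply: (@le_trans _ _ (\sum_x (p + q) * (potx eta w x * (1 + (eta * be) ^+ 2 * (cross x)%:R)))).
    by apply: ler_sum => x _; exact: step.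
  rewrite -mulr_sumr; apply: ler_wpM2l; first by apply: addr_ge0; exact: ltW.
  have -> : \sum_x potx eta w x * (1 + (eta * be) ^+ 2 * (cross x)%:R) =
    pot eta w + (eta * be) ^+ 2 * \sum_x potx eta w x * (cross x)%:R.
    by rewrite /pot mulr_sumr -big_split /=; apply: eq_bigr => x _; ring.
  have -> : T = pot eta w + (eta * be) ^+ 2 * (d.+2%:R * (2 * e * pot eta w)).
    by rewrite /T; ring.
  by apply: lerD => //; apply: ler_wpM2l => //; exact: sqr_ge0.
have red (p' : R) (t' : I -> R) i' : (forall i, t' i != 0 -> t i != 0) -> t' i' < 0 ->
    w i' + p' * t' i' = 0 -> (#|supp (fun i => (w i + p' * t' i)%R)| < M)%N.
  move=> tt ti' wi'; apply: (@leq_trans #|supp w :\ i'|.+1); last first.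
    by rewrite /M (cardsD1 i' (supp w)) inE gt_eqF // wt // tt // lt_eqF.
  rewrite ltnS; apply: subset_leq_card; apply/fintype.subsetP => i; rewrite !inE => hi.
  apply/andP; split; first by apply: contraNneq hi => ->; rewrite wi'.
  apply: contraNneq hi => wi; rewrite wi add0r.
  have [->|/tt/wt] := eqVneq (t' i) 0; first by rewrite mulr0.
  by rewrite wi ltxx.
have [le1|lt1] := lerP (pot eta w1) T.
  exists w1; split => //; first by rewrite /w1 big_split /= -mulr_sumr t0 mulr0 addr0.
  exact: (red p t ip).
exists w2; split => //.
- by rewrite /w2 big_split /= -mulr_sumr nt0 mulr0 addr0.
- by apply: (red q (fun i => - t i) iq) => // i; rewrite oppr_eq0.
rewrite -(ler_pM2l p0); have := ltr_pM2l q0 T (pot eta w1); rewrite lt1; lra.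
Qed.

End Step.
End OneStep.

(** * Iterating the removal down to m atoms *)

Module Reduction.
Import mathcomp.boot.finset.
Import OneStep.

Section Reduction.
Variable R : realType.

Definition kd (d m : nat) : R := m%:R `^ (d%:R^-1).

Lemma kd_gt0 d m : (0 < m)%N -> 0 < kd d m.
Proof. by move=> m0; rewrite powR_gt0 // ltr0n. Qed.

Lemma kd_le d m n : (m <= n)%N -> kd d m <= kd d n.
Proof.
by move=> mn; apply: ge0_ler_powR; rewrite ?nnegrE ?invr_ge0 // ler_nat.
Qed.

Lemma kd_exp d n : (0 < d)%N -> kd d (n ^ d) = n%:R.
Proof.
move=> d0; rewrite /kd natrX -powR_mulrn // -powRrM mulfV ?powRr1 //.
by rewrite pnatr_eq0 -lt0n.
Qed.

(** The largest admissible s is taken. Its successor fails, so M <= 4 (d+1) (s+2)^d, and s + 2 <= 3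
    s produces the factor 12. *)
Lemma choose_sample_size d M : (0 < d)%N -> (4 * (d.+1 * 2 ^ d) < M)%N ->
  exists s, [/\ (0 < s)%N, (4 * (d.+1 * s.+1 ^ d) < M)%N &
    kd d M <= 12 * d.+1%:R * s%:R].
Proof.
move=> d0 hM; pose P s := (4 * (d.+1 * s.+1 ^ d) < M)%N.
have exP : exists s, P s by exists 1%N.
have ubP s : P s -> (s <= M)%N.
  rewrite /P => hs; have : (s.+1 <= s.+1 ^ d)%N by rewrite -{1}(expn1 s.+1) leq_pexp2l.
  by move: (s.+1 ^ d)%N hs => z; nia.
have [s Ps smax] := ex_maxnP exP ubP.
have s0 : (0 < s)%N by exact: smax.
exists s; split => //.
have : ~~ P s.+1 by apply/negP => /smax; rewrite ltnn.
rewrite /P -leqNgt => Ms.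
apply: (@le_trans _ _ (kd d ((4 * d.+1 * s.+2) ^ d))).
  apply: kd_le; apply: (leq_trans Ms).
  rewrite expnMn mulnA leq_mul2r; apply/orP; right.
  by rewrite -{1}(expn1 (4 * d.+1)) leq_pexp2l.
rewrite kd_exp // -!natrM ler_nat; nia.
Qed.

Section Iterate.
Variables (d : nat) (I X : finType).
Variables (u : I -> 'I_d -> R) (la : X -> 'I_d -> R) (lb : X -> R) (Lam W : R).
Hypothesis u1 : forall i j, `|u i j| <= 1.
Hypothesis la_Lam : forall x, \sum_j `|la x j| <= Lam.
Hypothesis Lam_gt0 : 0 < Lam.
Hypothesis W_gt0 : 0 < W.
Hypothesis d_gt0 : (0 < d)%N.
Variables (w0 : I -> R) (x0 : X) (m : nat).
Hypothesis m_gt : (4 * (d.+1 * 2 ^ d) <= m)%N.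

(** 48 d (d+1) is 4 d times 12 (d+1), so the separation 4 d/s is at most [ce] M^(-1/d). [Bc] is the
    step size freed of its dependence on M, and [Dc] bounds M^2 times the relative growth of the
    potential in one step. *)
Let ce : R := 48 * d%:R * d.+1%:R.
Let Bc : R := 8 * d.+2%:R * W * (Lam * ((6 * d%:R + 2) * ce)).
Let Dc (eta : R) : R := eta ^+ 2 * Bc ^+ 2 * (2 * d.+2%:R * ce) / kd d m ^+ 3.

Let m_gt0 : (0 < m)%N.
Proof. by apply: leq_trans m_gt; rewrite !muln_gt0 expn_gt0. Qed.

Let ce_gt0 : 0 < ce.
Proof. by rewrite /ce !mulr_gt0 ?ltr0n. Qed.

Let Bc_gt0 : 0 < Bc.
Proof. by rewrite /Bc !mulr_gt0 ?ltr0n // addr_gt0 // mulr_gt0 // ltr0n. Qed.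

Lemma reduce_step (eta : R) (w : I -> R) : 0 < eta -> eta * (Bc / (m%:R * kd d m)) <= 4^-1 ->
  (forall i, 0 <= w i) -> \sum_i w i = W -> (m < #|supp w|)%N ->
  exists w', [/\ (forall i, 0 <= w' i), \sum_i w' i = W, (#|supp w'| < #|supp w|)%N &
    pot u la lb w0 eta w' <= pot u la lb w0 eta w * (1 + Dc eta / (#|supp w|%:R ^+ 2))].
Proof.
move=> eta0 he w_ge0 wW; set M := #|supp w| => mM.
have [s [s0 sM ks]] := choose_sample_size d_gt0 (leq_ltn_trans m_gt mM).
have s0' : 0 < s%:R :> R by rewrite ltr0n.
have M0 : 0 < M%:R :> R by rewrite ltr0n (leq_ltn_trans _ mM).
have k0 : 0 < kd d M by rewrite kd_gt0 // (leq_ltn_trans _ mM).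
have km0 : 0 < kd d m by exact: kd_gt0.
have kmM : kd d m <= kd d M by apply: kd_le; exact: ltnW.
have m0' : 0 < m%:R :> R by rewrite ltr0n.
pose e : R := 4 * d%:R / s%:R.
have e0 : 0 < e by rewrite !mulr_gt0 ?invr_gt0 // ltr0n.
have ele : e <= ce / kd d M.
  rewrite ler_pdivlMr // /e mulrAC ler_pdivrMr // /ce.
  have -> : 48 * d%:R * d.+1%:R * s%:R = 4 * d%:R * (12 * d.+1%:R * s%:R) :> R by ring.
  by rewrite ler_wpM2l // mulr_ge0.
have sle : step_size d Lam W M e <= Bc / (M%:R * kd d M).
  rewrite /step_size; have -> : Bc / (M%:R * kd d M) =
    8 * d.+2%:R * (W / M%:R) * (Lam * ((6 * d%:R + 2) * (ce / kd d M))).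
    by rewrite /Bc invfM; ring.
  apply: ler_wpM2l; first by rewrite !mulr_ge0 // ?invr_ge0 // ltW.
  apply: ler_wpM2l; first exact: ltW.
  by apply: ler_wpM2l => //; rewrite addr_ge0 // mulr_ge0.
have sge0 : 0 <= step_size d Lam W M e.
  by rewrite /step_size !mulr_ge0 // ?invr_ge0 ?(ltW e0) ?(ltW W_gt0) ?(ltW Lam_gt0) // addr_ge0 // mulr_ge0.
have smle : step_size d Lam W M e <= Bc / (m%:R * kd d m).
  apply: (le_trans sle); rewrite ler_pM2l // lef_pV2 ?posrE ?mulr_gt0 //.
  by apply: ler_pM => //; rewrite ?(ltW km0) // ler_nat ltnW.
have h1 : 4 * d%:R <= s%:R * e by rewrite /e mulrCA divff ?mulr1 // gt_eqF.
have h2 : eta * step_size d Lam W M e <= 4^-1.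
  by apply: le_trans he; rewrite ler_wpM2l // ltW.
have [w' [w'0 w'W w'M hp]] := one_step lb u1 la_Lam (ltW Lam_gt0) w0 x0 d_gt0 e0 h1 sM w_ge0 wW eta0 h2.
exists w'; split => //; apply: (le_trans hp); apply: ler_wpM2l.
  by apply: sumr_ge0 => x _; rewrite addr_ge0 ?expR_ge0.
rewrite lerD2l.
apply: (@le_trans _ _ ((eta * (Bc / (M%:R * kd d M))) ^+ 2 * (2 * d.+2%:R * (ce / kd d M)))).
  apply: ler_pM.
  - exact: sqr_ge0.
  - by rewrite !mulr_ge0 // ltW.
  - apply: lerXn2r; rewrite ?nnegrE.
    + by apply: mulr_ge0 => //; exact: ltW.
    + by apply: mulr_ge0; [exact: ltW|apply: divr_ge0; [exact: ltW|apply: mulr_ge0; exact: ltW]].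
    + by apply: ler_wpM2l => //; exact: ltW.
  - by rewrite ler_wpM2l // mulr_ge0.
have -> : (eta * (Bc / (M%:R * kd d M))) ^+ 2 * (2 * d.+2%:R * (ce / kd d M)) =
  (eta ^+ 2 * Bc ^+ 2 * (2 * d.+2%:R * ce)) / M%:R ^+ 2 * (kd d M ^+ 3)^-1.
  by field; rewrite !gt_eqF.
rewrite /Dc [leRHS]mulrAC; apply: ler_wpM2l.
  apply: mulr_ge0; last by rewrite invr_ge0 exprn_ge0.
  by rewrite !mulr_ge0 ?sqr_ge0 // ltW.
rewrite lef_pV2 ?posrE ?exprn_gt0 // lerXn2r ?nnegrE //; exact: ltW.
Qed.

Lemma reduce_all (eta : R) n : 0 < eta -> eta * (Bc / (m%:R * kd d m)) <= 4^-1 ->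
  forall w : I -> R, (forall i, 0 <= w i) -> \sum_i w i = W -> (#|supp w| <= n)%N -> (m < #|supp w|)%N ->
  exists w', [/\ (forall i, 0 <= w' i), \sum_i w' i = W, (#|supp w'| <= m)%N &
    pot u la lb w0 eta w' <= pot u la lb w0 eta w * expR (Dc eta * (m%:R^-1 - #|supp w|%:R^-1))].
Proof.
move=> eta0 he; have km0 : 0 < kd d m by exact: kd_gt0.
have D0 : 0 <= Dc eta.
  by rewrite /Dc !(mulr_ge0, sqr_ge0, invr_ge0, exprn_ge0) // ltW.
elim: n => [|n IHn] w w_ge0 wW; first by rewrite leqn0 => /eqP ->.
move=> wn mw.
have [w1 [w1_ge0 w1W w1M hp]] := reduce_step eta0 he w_ge0 wW mw.
set M := #|supp w| in wn mw w1M hp *.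
have M1 : (0 < M.-1)%N by apply: (leq_trans m_gt0); rewrite -ltnS (ltn_predK mw).
(* The growth factors telescope because 1/M^2 <= 1/(M-1) - 1/M. *)
have stepE : 1 + Dc eta / M%:R ^+ 2 <= expR (Dc eta * (M.-1%:R^-1 - M%:R^-1)).
  apply: le_trans (expR_ge1Dx _); rewrite lerD2l ler_wpM2l //.
  have -> : M%:R = M.-1%:R + 1 :> R by rewrite natr1 (ltn_predK mw).
  have z0 : 0 < M.-1%:R :> R by rewrite ltr0n.
  have -> : M.-1%:R^-1 - (M.-1%:R + 1)^-1 = (M.-1%:R * (M.-1%:R + 1))^-1 :> R.
    by field; rewrite !gt_eqF // addr_gt0.
  rewrite lef_pV2 ?posrE ?exprn_gt0 ?mulr_gt0 ?addr_gt0 // expr2 ler_pM2r ?addr_gt0 //; lra.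
have pot0 w2 : 0 <= pot u la lb w0 eta w2.
  by apply: sumr_ge0 => x _; rewrite addr_ge0 ?expR_ge0.
have hp' := le_trans hp (ler_wpM2l (pot0 w) stepE).
have invle (a b : nat) : (0 < a)%N -> (a <= b)%N -> b%:R^-1 <= a%:R^-1 :> R.
  by move=> a0 ab; rewrite lef_pV2 ?posrE ?ltr0n ?(leq_trans a0) // ler_nat.
have [w1m|mw1] := leqP #|supp w1| m.
  exists w1; split => //; apply: (le_trans hp'); rewrite ler_wpM2l //.
  rewrite ler_expR ler_wpM2l // lerD2r invle //.
  by rewrite -ltnS (ltn_predK mw).
have [|w' [w'0 w'W w'm hw']] := IHn w1 w1_ge0 w1W _ mw1.
  by rewrite -ltnS (leq_trans w1M).
exists w'; split => //; apply: (le_trans hw').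
apply: (@le_trans _ _ (pot u la lb w0 eta w * expR (Dc eta * (M.-1%:R^-1 - M%:R^-1)) *
   expR (Dc eta * (m%:R^-1 - #|supp w1|%:R^-1)))).
  by rewrite ler_wpM2r // expR_ge0.
rewrite -mulrA -expRD ler_wpM2l // ler_expR -mulrDr ler_wpM2l //.
have : M.-1%:R^-1 <= #|supp w1|%:R^-1 :> R.
  by apply: invle; [exact: leq_trans mw1|rewrite -ltnS (ltn_predK mw)].
lra.
Qed.

(** The logarithm of the final potential is at most l + [Dc]/m, with l for the initial value. The
    condition 16 l m^(1/d) <= m keeps all single steps in the range of the quadratic bound; it
    cannot hold in dimension one. *)
Lemma sparsify (l : R) : 0 < l -> (#|X| * 2)%:R <= expR l -> 16 * l * kd d m <= m%:R ->
  (forall i, 0 <= w0 i) -> \sum_i w0 i = W ->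
  exists w', [/\ (forall i, 0 <= w' i), \sum_i w' i = W, (#|supp w'| <= m)%N &
    forall x, `|err u la lb w0 w' x| <=
      (1 + 2 * d.+2%:R * ce) * Bc * Num.sqrt l / Num.sqrt (m%:R * kd d m ^+ 3)].
Proof.
move=> l0 hX hm w0_ge0 w0W.
have km0 : 0 < kd d m by exact: kd_gt0.
have m0' : 0 < m%:R :> R by rewrite ltr0n.
have err0 x : err u la lb w0 w0 x = 0.
  by rewrite /err big1 // => i _; rewrite subrr mul0r.
have S0 : 0 < Num.sqrt (m%:R * kd d m ^+ 3) by rewrite sqrtr_gt0 mulr_gt0 // exprn_gt0.
have sl0 : 0 < Num.sqrt l by rewrite sqrtr_gt0.
set S := Num.sqrt (m%:R * _) in S0 *.
have SE : S ^+ 2 = m%:R * kd d m ^+ 3 by rewrite sqr_sqrtr // mulr_ge0 // exprn_ge0 // ltW.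
have slE : Num.sqrt l ^+ 2 = l by rewrite sqr_sqrtr // ltW.
have bnd0 : 0 <= (1 + 2 * d.+2%:R * ce) * Bc * Num.sqrt l / S.
  by rewrite divr_ge0 ?mulr_ge0 ?addr_ge0 ?mulr_ge0 // ltW.
have [sm|ms] := leqP #|supp w0| m.
  by exists w0; split => // x; rewrite err0 normr0.
(* With this parameter [Dc]/m is a constant multiple of l, which balances the two contributions. *)
pose eta := Num.sqrt l * S / Bc.
have eta0 : 0 < eta by rewrite !mulr_gt0 ?invr_gt0.
have he : eta * (Bc / (m%:R * kd d m)) <= 4^-1.
  have -> : eta * (Bc / (m%:R * kd d m)) = Num.sqrt l * S / (m%:R * kd d m).
    by rewrite /eta; field; rewrite !gt_eqF.
  rewrite -ler_sqr ?nnegrE ?divr_ge0 ?mulr_ge0 ?(ltW km0) ?(ltW sl0) ?(ltW S0) ?invr_ge0 //.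
  rewrite expr_div_n exprMn slE SE.
  have -> : l * (m%:R * kd d m ^+ 3) / (m%:R * kd d m) ^+ 2 = l * kd d m / m%:R.
    by field; rewrite !gt_eqF.
  rewrite ler_pdivrMr //; lra.
have [w' [w'0 w'W w'm hp]] := reduce_all eta0 he w0_ge0 w0W (leqnn _) ms.
exists w'; split => // x.
have potE : pot u la lb w0 eta w0 = (#|X| * 2)%:R.
  rewrite /pot /potx; under eq_bigr do rewrite err0 mulr0 oppr0 expR0.
  by rewrite sumr_const natrM mulr_natl.
have hx : expR (eta * `|err u la lb w0 w' x|) <= expR (l + Dc eta / m%:R).
  apply: (@le_trans _ _ (pot u la lb w0 eta w')).
    rewrite /pot (bigD1 x) //= ler_wpDr //.
      by apply: sumr_ge0 => y _; rewrite addr_ge0 ?expR_ge0.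
    rewrite /potx; case: (ger0P (err u la lb w0 w' x)) => _.
      by rewrite lerDl expR_ge0.
    by rewrite mulrN lerDr expR_ge0.
  apply: (le_trans hp); rewrite potE expRD; apply: ler_pM => //; rewrite ?expR_ge0 //.
  rewrite ler_expR ler_wpM2l //; first by rewrite /Dc !(mulr_ge0, sqr_ge0, invr_ge0, exprn_ge0) // ltW.
  by rewrite gerBl invr_ge0.
move: hx; rewrite ler_expR -ler_pdivlMl // => /le_trans; apply.
have -> : Dc eta / m%:R = l * (2 * d.+2%:R * ce).
  rewrite /Dc /eta expr_div_n exprMn slE SE.
  by field; rewrite !gt_eqF.
rewrite le_eqVlt; apply/orP; left; apply/eqP.
have key (r c S' b : R) : r != 0 -> S' != 0 -> b != 0 ->
    (r * S' / b)^-1 * (r ^+ 2 + r ^+ 2 * c) = (1 + c) * b * r / S'.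
  by move=> r0 S'0 b0; field; rewrite r0 S'0 b0.
by rewrite -key ?gt_eqF // slE.
Qed.

End Iterate.
End Reduction.
End Reduction.

(** * Sparsification in dimension one *)

Module DimOne.
Import mathcomp.boot.finset.
Import OneStep.

Section Caratheodory.
Variables (R : realType) (d : nat) (I : finType) (u : I -> 'I_d -> R).

(** Atoms of [S] are killed along affine dependencies while more than d + 1 remain; mass and
    barycentre are kept, so affine functions do not see the change. *)
Lemma caratheodory (S : {set I}) (w : I -> R) : (forall i, 0 <= w i) ->
  exists w', [/\ (forall i, 0 <= w' i), (forall i, i \notin S -> w' i = w i),
    \sum_i (w' i - w i) = 0, (forall j, \sum_i (w' i - w i) * u i j = 0) &
    (#|supp w' :&: S| <= d.+1)%N].
Proof.
move: {2}#|supp w :&: S| (leqnn #|supp w :&: S|) => n.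
elim: n w => [|n IHn] w wn w0.
  exists w; split=> //; try by (move=> *; rewrite big1 // => i _; rewrite subrr ?mul0r).
  by rewrite (leq_trans wn).
have [hle|hgt] := leqP #|supp w :&: S| d.+1.
  by exists w; split=> //; try by (move=> *; rewrite big1 // => i _; rewrite subrr ?mul0r).
have [t [tS t0 tu tneg _]] := affine_dependency u hgt.
have wt i : t i != 0 -> 0 < w i.
  move=> ti; rewrite lt0r w0 andbT; have [|/tS] := boolP (i \in supp w :&: S).
    by rewrite !inE => /andP[].
  by move/eqP: ti.
have [p [p0 hp [i [ti wi]]]] := move_to_boundary w0 wt tneg.
pose w1 i := w i + p * t i.
have iS : i \in supp w :&: S by apply: contraLR ti => /tS ->; rewrite ltxx.
have w1n : (#|supp w1 :&: S| <= n)%N.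
  rewrite -ltnS (leq_trans _ wn) //; apply: (@leq_trans #|(supp w :&: S) :\ i|.+1).
    rewrite ltnS; apply: subset_leq_card; apply/fintype.subsetP => k.
    rewrite !inE => /andP[hk kS]; rewrite kS andbT; apply/andP; split.
      by apply: contraNneq hk => ->; rewrite /w1 wi.
    apply: contraNneq hk => wk; rewrite /w1 wk add0r.
    by rewrite tS ?mulr0 // !inE wk eqxx.
  by rewrite [leqRHS](cardsD1 i) iS.
have [w' [w'0 w'S w's w'u w'c]] := IHn w1 w1n hp.
exists w'; split => //.
- move=> k kS; rewrite w'S // /w1 tS ?mulr0 ?addr0 // !inE (negbTE kS) andbF //.
- transitivity (\sum_k (w' k - w1 k) + p * \sum_k t k); last by rewrite w's t0 mulr0 addr0.
  by rewrite mulr_sumr -big_split /=; apply: eq_bigr => k _; rewrite /w1; ring.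
- move=> j; transitivity (\sum_k (w' k - w1 k) * u k j + p * \sum_k t k * u k j).
    by rewrite mulr_sumr -big_split /=; apply: eq_bigr => k _; rewrite /w1; ring.
  by rewrite w'u tu mulr0 addr0.
Qed.

End Caratheodory.

Section One.
Variables (R : realType) (I X : finType).
Variables (u : I -> 'I_1 -> R) (la : X -> 'I_1 -> R) (lb : X -> R) (Lam W : R).
Hypothesis u1 : forall i j, `|u i j| <= 1.
Hypothesis la_Lam : forall x, \sum_j `|la x j| <= Lam.
Hypothesis Lam_gt0 : 0 < Lam.
Hypothesis W_gt0 : 0 < W.
Variables (w : I -> R) (m : nat).
Hypothesis m_gt0 : (0 < m)%N.
Hypothesis w_ge0 : forall i, 0 <= w i.
Hypothesis w_sum : \sum_i w i = W.

Let v i := u i ord0.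
Let below i := \sum_(k | v k < v i) w k.
(** The sum of two step functions, of the position and of the mass to its left. Both are monotone in
    the position, so equal sums force both to agree: cells are short and light, yet only 3 m + 1
    keys exist. *)
Let key i : nat := (Num.truncn (m%:R * (v i + 1)) + Num.truncn (m%:R * (below i / W)))%N.

Let m_gt0' : 0 < m%:R :> R. Proof. by rewrite ltr0n. Qed.

Let v_arg i : 0 <= m%:R * (v i + 1) <= 2 * m%:R.
Proof.
have := u1 i ord0; rewrite -/(v i) ler_norml => /andP[h1 h2].
by rewrite mulr_ge0 ?(ltW m_gt0') //=; [rewrite mulrC ler_pM2r //; lra|lra].
Qed.

Let below_arg i : 0 <= m%:R * (below i / W) <= m%:R.
Proof.
rewrite mulr_ge0 ?divr_ge0 ?sumr_ge0 ?(ltW W_gt0) //= -[leRHS]mulr1 ler_pM2l //.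
rewrite ler_pdivrMr // mul1r -w_sum /below [leRHS](bigID (fun k => v k < v i)) /=.
by rewrite lerDl sumr_ge0.
Qed.

Let key_lt i : (key i < (3 * m).+1)%N.
Proof.
have /andP[a1 a2] := v_arg i; have /andP[b1 b2] := below_arg i.
have /andP[t1 _] := truncn_itv a1; have /andP[t2 _] := truncn_itv b1.
rewrite ltnS /key -(ler_nat R) natrD natrM.
by apply: le_trans (lerD (le_trans t1 a2) (le_trans t2 b2)) _; lra.
Qed.

Let key_mono i k : v i <= v k -> (Num.truncn (m%:R * (v i + 1)) <= Num.truncn (m%:R * (v k + 1)))%N /\
  (Num.truncn (m%:R * (below i / W)) <= Num.truncn (m%:R * (below k / W)))%N.
Proof.
move=> h; split; apply: le_truncn; rewrite ler_pM2l //; first by rewrite lerD2r.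
rewrite ler_pM2r ?invr_gt0 // /below big_mkcond [leRHS]big_mkcond /=.
apply: ler_sum => l _; case: ifP => [hl|_]; last by case: ifP.
by rewrite (lt_le_trans hl h).
Qed.

Let key_eq i k : key i = key k -> `|m%:R * (v i - v k)| <= 1 /\
   `|m%:R * (below i - below k)| <= W.
Proof.
have hh i' k' : v i' <= v k' -> key i' = key k' -> `|m%:R * (v i' - v k')| <= 1 /\
   `|m%:R * (below i' - below k')| <= W.
  move=> /[dup] hv /key_mono; rewrite /key => -[h1 h2] h3.
  have /andP[a1 _] := v_arg i'; have /andP[b1 _] := below_arg i'.
  have /andP[a2 _] := v_arg k'; have /andP[b2 _] := below_arg k'.
  move: (truncn_itv a1) (truncn_itv a2) (truncn_itv b1) (truncn_itv b2).
  have -> : Num.truncn (m%:R * (v i' + 1)) = Num.truncn (m%:R * (v k' + 1)) by lia.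
  have -> : Num.truncn (m%:R * (below i' / W)) = Num.truncn (m%:R * (below k' / W)) by lia.
  move=> /andP[p1 p2] /andP[p3 p4] /andP[p5 p6] /andP[p7 p8].
  split; first by rewrite ler_norml; move: p1 p2 p3 p4; rewrite -natr1 !mulrDr mulrN; lra.
  have -> : m%:R * (below i' - below k') = W * (m%:R * (below i' / W) - m%:R * (below k' / W)).
    by field; rewrite gt_eqF.
  rewrite normrM (gtr0_norm W_gt0) -[leRHS]mulr1 ler_pM2l // ler_norml.
  by move: p5 p6 p7 p8; rewrite -natr1; lra.
move=> e; case: (lerP (v i) (v k)) => [h|/ltW h]; first exact: hh.
have [a b] := hh _ _ h (esym e); split.
  by rewrite -normrN -mulrN opprB.
by rewrite -normrN -mulrN opprB.
Qed.

(** The rightmost position of each cell is set apart. The mass at a point is not included in its own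
    [below], so a heavy atom there would escape the mass bound of the cell. *)
Let top i := [forall k, (key k == key i) ==> (v k <= v i)].
Let K : finType := ('I_(3 * m).+1 * bool)%type.
Let grp i : K := (Ordinal (key_lt i), top i).
Let S (g : K) : {set I} := [set i | grp i == g].

Let S_key g i k : i \in S g -> k \in S g -> key i = key k.
Proof.
by rewrite !inE => /eqP <- /eqP [] /esym.
Qed.

Let S_mass (g : K) : g.2 = false -> \sum_(i in S g) w i <= W / m%:R.
Proof.
move=> g2; have [S0|[i0 i0S]] := set_0Vmem (S g).
  by rewrite S0 big_set0 divr_ge0 // ltW.
have [i1 i1S i1min] := @Order.TotalTheory.arg_minP _ R I i0 (mem (S g)) v i0S.
have [i2 /= /eqP i2k i2max] := @Order.TotalTheory.arg_maxP _ R I i0 (fun k => key k == key i0) v (eqxx _).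
have lt2 i : i \in S g -> v i < v i2.
  move=> iS; have : ~~ top i by move: iS; rewrite inE => /eqP; move=> /(congr1 snd) /=; rewrite g2 => ->.
  rewrite negb_forall => /existsP[k]; rewrite negb_imply -ltNge => /andP[/eqP kk hk].
  by apply: (lt_le_trans hk); apply: i2max; rewrite kk (S_key iS i0S).
have [_] := @key_eq i2 i1 (etrans i2k (S_key i0S i1S)).
rewrite ler_norml => /andP[_ hb].
rewrite ler_pdivlMr // mulrC; apply: le_trans hb; rewrite ler_pM2l // lerBrDl /below.
rewrite [leRHS](bigID (fun k => v k < v i1)) /=; apply: lerD.
  rewrite le_eqVlt; apply/orP; left; apply/eqP; apply: eq_bigl => k.
  by case: (ltP (v k) (v i1)); rewrite ?andbF // andbT => h; rewrite (lt_trans h) // lt2.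
rewrite [leLHS]big_mkcond [leRHS]big_mkcond /=; apply: ler_sum => k _.
case: ifP => [kS|_]; last by case: ifP.
by rewrite lt2 //= -leNgt i1min.
Qed.

(** Mass W/m and width 1/m of the group met by the kink give the order m^(-2), which is m^(-1/2-3/(2
    d)) for d = 1. There are 2 (3 m + 1) groups with at most two surviving atoms each. *)
Lemma sparsify1 : exists w', [/\ (forall i, 0 <= w' i), \sum_i w' i = W,
    (#|supp w'| <= 16 * m)%N &
    forall x, `|err u la lb w w' x| <= 4 * W * Lam / m%:R ^+ 2].
Proof.
have [wf hwf] := boolp.choice (fun g => @caratheodory R 1 I u (S g) w w_ge0).
pose w' i := wf (grp i) i.
pose t g i := wf g i - w i.
have tS g i : i \notin S g -> t g i = 0.
  by move=> iS; have [_ h _ _ _] := hwf g; rewrite /t h // subrr.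
have t0 g : \sum_i t g i = 0 by have [] := hwf g.
have tu g j : \sum_i t g i * u i j = 0 by have [_ _ _ h _] := hwf g; exact: h.
have gsum (f : I -> R) : \sum_i (w' i - w i) * f i = \sum_g \sum_i t g i * f i.
  rewrite exchange_big /=; apply: eq_bigr => i _; rewrite (bigD1 (grp i)) //=.
  rewrite big1 ?addr0 // => g gi; rewrite tS ?mul0r // inE eq_sym //.
have w'0 i : 0 <= w' i by rewrite /w'; have [h _ _ _ _] := hwf (grp i); exact: h.
exists w'; split => //.
- have : \sum_i (w' i - w i) * 1 = 0.
    rewrite (gsum (fun=> 1)) big1 // => g _.
    by rewrite -[RHS](t0 g); apply: eq_bigr => i _; rewrite mulr1.
  by under eq_bigr do rewrite mulr1; rewrite sumrB w_sum => /eqP; rewrite subr_eq0 => /eqP.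
- apply: (@leq_trans (\sum_(g : K) 2)%N); last first.
    by rewrite sum_nat_const card_prod card_ord card_bool; lia.
  apply: (@leq_trans (\sum_(g : K) #|supp (wf g) :&: S g|)%N); last first.
    by apply: leq_sum => g _; have [] := hwf g.
  rewrite -sum1_card (partition_big grp predT) //=; apply: leq_sum => g _.
  rewrite sum1dep_card; apply: subset_leq_card; apply/fintype.subsetP => i.
  by rewrite !inE => /andP[hi /eqP <-]; rewrite hi eqxx.
move=> x; rewrite /err gsum.
have b0 : 0 <= 4 * W * Lam / m%:R ^+ 2 by rewrite !mulr_ge0 ?invr_ge0 ?exprn_ge0 ?(ltW W_gt0) ?(ltW Lam_gt0) // ltW.
(* Along a line the activation changes sign only once, so at most one group is cut and all others
   contribute zero. A group of top atoms sits at one position and is never cut. *)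
pose cross g := [exists i in S g, exists k in S g, (0 < lin u la lb x i) != (0 < lin u la lb x k)].
have ncr g : ~~ cross g -> \sum_i t g i * rho u la lb x i = 0.
  move=> hg; have [S0|[c cS]] := set_0Vmem (S g).
    by rewrite big1 // => i _; rewrite tS ?mul0r // S0 inE.
  apply: (@dependency_same_side R 1 I X u la lb (t g) (S g) c x) => // i; first exact: tS.
  move=> iS; apply/eqP; move: hg; rewrite negb_exists_in => /forall_inP /(_ i iS).
  by rewrite negb_exists_in => /forall_inP /(_ c cS); rewrite negbK.
have veq i k : v i = v k -> lin u la lb x i = lin u la lb x k.
  by move=> h; rewrite /lin !big_ord1 -/(v i) -/(v k) h.
have crf g : cross g -> g.2 = false.
  case: g => g1 [] //; move=> /exists_inP[i iS /exists_inP[k kS]].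
  suff -> : lin u la lb x i = lin u la lb x k by rewrite eqxx.
  apply: veq; have ki := S_key iS kS; apply/eqP; rewrite eq_le.
  move: iS kS; rewrite !inE => /eqP [_ ti] /eqP [_ tk].
  move/forallP: ti => /(_ k); rewrite ki eqxx /= => ->.
  by move/forallP: tk => /(_ i); rewrite ki eqxx /= => ->.
have linE i : lin u la lb x i = la x ord0 * v i + lb x by rewrite /lin big_ord1.
have key_lt_v i k : (key i < key k)%N -> v i < v k.
  move=> h; rewrite ltNge; apply/negP => /key_mono[a b]; move: h; rewrite /key; lia.
have cr1 g g' : cross g -> cross g' -> (g.1 < g'.1)%N -> False.
  move=> /exists_inP[i iS /exists_inP[k kS h1]] /exists_inP[i' i'S /exists_inP[k' k'S h2]] lt.
  have kyE h f : f \in S h -> key f = h.1 :> nat by rewrite inE => /eqP <-.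
  have lt1 f f' : f \in S g -> f' \in S g' -> v f < v f'.
    by move=> /kyE a /kyE b; apply: key_lt_v; rewrite a b.
  have aff1 f f' : f \in S g -> f' \in S g' -> 0 <= la x ord0 ->
     0 < lin u la lb x f -> 0 < lin u la lb x f'.
    move=> fS f'S a0 hf; apply: (lt_le_trans hf); rewrite !linE lerD2r ler_wpM2l // ltW //; exact: lt1.
  have aff2 f f' : f \in S g -> f' \in S g' -> la x ord0 <= 0 ->
     0 < lin u la lb x f' -> 0 < lin u la lb x f.
    move=> fS f'S a0 hf; apply: (lt_le_trans hf); rewrite !linE lerD2r ler_wnM2l // ltW //; exact: lt1.
  have ex1 : exists2 f, f \in S g & 0 < lin u la lb x f.
    by move: h1; case: (ltP 0 (lin u la lb x i)) => hi; [exists i|case: (ltP 0 (lin u la lb x k)) => // hk; exists k].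
  have ex2 : exists2 f, f \in S g' & 0 < lin u la lb x f.
    by move: h2; case: (ltP 0 (lin u la lb x i')) => hi; [exists i'|case: (ltP 0 (lin u la lb x k')) => // hk; exists k'].
  have [a0|a0] := lerP 0 (la x ord0).
    by have [f fS hf] := ex1; move: h2; rewrite (aff1 f i') // (aff1 f k').
  by have [f fS hf] := ex2; move: h1; rewrite (aff2 i f) // ?(aff2 k f) // ltW.
have bnd g : cross g -> `|\sum_i t g i * rho u la lb x i| <= 4 * W * Lam / m%:R ^+ 2.
  move=> hg; have g2 := crf g hg; have hm := S_mass g2.
  move: hg => /exists_inP[i iS /exists_inP[k kS h1]].
  have r0 : 0 <= m%:R^-1 :> R by rewrite invr_ge0 ltW.
  have hrho : forall f, f \in S g -> rho u la lb x f <= 2 * (Lam * m%:R^-1).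
    apply: (@rho_cross R 1 I X u la lb Lam la_Lam (ltW Lam_gt0) (S g) k x m%:R^-1) => //.
      move=> f fS j; rewrite (ord1 j) -/(v f) -/(v k).
      have [h _] := key_eq (S_key fS kS); move: h; rewrite normrM (gtr0_norm m_gt0').
      by rewrite -[m%:R^-1]mul1r ler_pdivlMr // mulrC.
    by exists i.
  have tsum : \sum_i `|1 * t g i| <= 2 * (W / m%:R).
    apply: (@le_trans _ _ (2 * \sum_(i in S g) w i)); last by rewrite ler_wpM2l.
    apply: (@norm_move_le R I w (t g) (S g) 1) => //; first exact: tS.
    by move=> f; rewrite mul1r /t addrC subrK; have [h _ _ _ _] := hwf g; exact: h.
  have := @err_move_le R 1 I X u la lb Lam (ltW Lam_gt0) w (t g) (S g) 1 _ x m%:R^-1 r0 (tS g) tsum hrho.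
  rewrite mul1r => /le_trans; apply.
  by rewrite le_eqVlt; apply/orP; left; apply/eqP; rewrite -exprVn; ring.
have [/existsP[g hg]|/existsPn hn] := boolP [exists g, cross g]; last first.
  by rewrite big1 ?normr0 // => g _; exact: ncr.
rewrite (bigD1 g) //= [X in _ + X]big1 ?addr0; first exact: bnd.
move=> g' gg'; apply: ncr; apply/negP => hg'.
have e2 := etrans (crf g hg) (esym (crf g' hg')).
have [lt|lt|e1] := ltngtP g.1 g'.1; [exact: (cr1 g g')|exact: (cr1 g' g)|].
by move/negP: gg'; apply; apply/eqP; case: g g' {hg hg'} e1 e2 => a b [a' b'] /= /val_inj -> ->.
Qed.

End One.

Lemma sparsify_dim1 (R : realType) (d : nat) (I X : finType) (u : I -> 'I_d -> R)
  (la : X -> 'I_d -> R) (lb : X -> R) (Lam W : R) (w : I -> R) (m : nat) : d = 1%N ->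
  (forall i j, `|u i j| <= 1) -> (forall x, \sum_j `|la x j| <= Lam) -> 0 < Lam -> 0 < W ->
  (0 < m)%N -> (forall i, 0 <= w i) -> \sum_i w i = W ->
  exists w', [/\ (forall i, 0 <= w' i), \sum_i w' i = W, (#|supp w'| <= 16 * m)%N &
    forall x, `|err u la lb w w' x| <= 4 * W * Lam / m%:R ^+ 2].
Proof.
move=> d1; subst d => u1 laL Lam0 W0 m0 w0 wW.
by apply: sparsify1.
Qed.

End DimOne.

(** * Charts for the directions and passage from a net to the ball *)

Module Networks.
Import mathcomp.boot.finset.
Import OneStep Reduction DimOne.

Section Rate.
Variable R : realType.
Variable d : nat.
Hypothesis d_gt0 : (0 < d)%N.

(** Equal to m^(1/2+3/(2 d)), the reciprocal of the approximation rate without its logarithm. *)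
Definition rt (m : nat) : R := Num.sqrt (m%:R * kd R d m ^+ 3).

Lemma rt_gt0 m : (0 < m)%N -> 0 < rt m.
Proof. by move=> m0; rewrite sqrtr_gt0 mulr_gt0 ?exprn_gt0 ?kd_gt0 ?ltr0n. Qed.

Lemma kd_leS m : (0 < m)%N -> kd R d m <= m%:R.
Proof.
move=> m0; rewrite -[leRHS]powRr1 //; apply: ler_powR; first by rewrite ler1n.
by rewrite invf_le1 ?ltr0n // ler1n.
Qed.

Lemma kd_ge0 m : 0 <= kd R d m. Proof. exact: powR_ge0. Qed.

Lemma kdM a b : kd R d (a * b) = kd R d a * kd R d b.
Proof. by rewrite /kd natrM powRM. Qed.

Lemma rt_le m n : (m <= n)%N -> rt m <= rt n.
Proof.
move=> mn; rewrite ler_wsqrtr //; apply: ler_pM; rewrite ?ler_nat //.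
  by rewrite exprn_ge0 // kd_ge0.
by rewrite lerXn2r ?nnegrE ?kd_ge0 // kd_le.
Qed.

(** The exponent 1/2 + 3/(2 d) never exceeds 2, its value in dimension one. *)
Lemma rt_mul a q : (0 < a)%N -> rt (a * q) <= a%:R ^+ 2 * rt q.
Proof.
move=> a0; rewrite (_ : a%:R ^+ 2 = Num.sqrt ((a%:R ^+ 2) ^+ 2)); last first.
  by rewrite sqrtr_sqr ger0_norm // exprn_ge0.
rewrite /rt -sqrtrM ?exprn_ge0 //.
rewrite ler_wsqrtr // natrM kdM exprMn.
have -> : (a%:R ^+ 2) ^+ 2 * (q%:R * kd R d q ^+ 3) = (a%:R * q%:R) * (a%:R ^+ 3 * kd R d q ^+ 3) by ring.
apply: ler_wpM2l => //; apply: ler_wpM2r; first by rewrite exprn_ge0 // kd_ge0.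
by rewrite lerXn2r ?nnegrE ?kd_ge0 // kd_leS.
Qed.

Lemma rt_le_sqr m : (0 < m)%N -> rt m <= m%:R ^+ 2.
Proof.
move=> m0; have := @rt_mul m 1 m0; rewrite muln1 => /le_trans; apply.
by rewrite /rt /kd powR1 expr1n mulr1 sqrtr1 mulr1.
Qed.

End Rate.

Section Charts.
Variable R : realType.
Variable d : nat.
Hypothesis d_gt0 : (0 < d)%N.

Definition ext (x : 'rV[R]_d) (k : 'I_d.+1) : R :=
  if unlift ord_max k is Some j then x 0 j else 1.

Lemma affE (x : 'rV[R]_d) v : aff x v = \sum_k ext x k * v 0 k.
Proof.
rewrite big_ord_recr /= /aff; congr (_ + _); last by rewrite /ext unlift_none mul1r.
apply: eq_bigr => j _; rewrite /ext.
have -> : widen_ord (leqnSn d) j = lift ord_max j by apply: val_inj; rewrite /= /bump leqNgt ltn_ord.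
by rewrite liftK.
Qed.

Lemma norm2_coord n (v : 'rV[R]_n) j : `|v 0 j| <= norm2 v.
Proof.
rewrite -sqrtr_sqr ler_wsqrtr // (bigD1 j) //= lerDl sumr_ge0 // => i _; exact: sqr_ge0.
Qed.

Lemma norm2_le_sum n (v : 'rV[R]_n) : norm2 v <= \sum_j `|v 0 j|.
Proof.
rewrite -[leRHS]ger0_norm ?sumr_ge0 // -sqrtr_sqr ler_wsqrtr //.
rewrite expr2 mulr_sumr; apply: ler_sum => j _; rewrite mulrC.
rewrite -[_ ^+ 2]real_normK ?num_real // expr2 ler_wpM2l //.
by rewrite (bigD1 j) //= lerDl sumr_ge0.
Qed.

Lemma ext_le1 (x : 'rV[R]_d) k : (forall j, `|x 0 j| <= 1) -> `|ext x k| <= 1.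
Proof. by move=> hx; rewrite /ext; case: unlift => [j|]; rewrite ?normr1. Qed.

Lemma ext_lip (x y : 'rV[R]_d) e k : 0 <= e -> (forall j, `|x 0 j - y 0 j| <= e) ->
  `|ext x k - ext y k| <= e.
Proof. by move=> e0 h; rewrite /ext; case: unlift => [j|]; rewrite ?subrr ?normr0. Qed.

(** Pairing of (x, 1) with the vector that has entry [s] at [j0] and entries [u] elsewhere. For s =
    1 or -1 and u in the unit cube these vectors form a face of the sup-norm sphere, parametrised
    affinely by d numbers. *)
Definition chl (j0 : 'I_d.+1) (s : R) (x : 'rV[R]_d) (u : 'I_d -> R) : R :=
  \sum_j ext x (lift j0 j) * u j + s * ext x j0.

Lemma relu_lip (a b : R) : `|relu a - relu b| <= `|a - b|.
Proof.
rewrite /relu; case: (lerP a 0) => ha; case: (lerP b 0) => hb.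
- by rewrite subrr normr0.
- by rewrite sub0r normrN (gtr0_norm hb) distrC ger0_norm; lra.
- by rewrite subr0 (gtr0_norm ha) ger0_norm; lra.
- by [].
Qed.

Lemma chl_lip j0 s (x y : 'rV[R]_d) u e : 0 <= e -> (forall j, `|x 0 j - y 0 j| <= e) ->
  (forall j, `|u j| <= 1) -> `|s| <= 1 -> `|chl j0 s x u - chl j0 s y u| <= d.+1%:R * e.
Proof.
move=> e0 hxy hu hs; rewrite /chl opprD addrACA -sumrB -mulrBr.
apply: le_trans (ler_normD _ _) _.
rewrite -natr1 mulrDl mul1r; apply: lerD.
  apply: le_trans (ler_norm_sum _ _ _) _.
  have -> : d%:R * e = \sum_(j < d) e by rewrite sumr_const card_ord mulr_natl.
  apply: ler_sum => j _; rewrite -mulrBl normrM -[leRHS]mulr1.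
  by apply: ler_pM => //; exact: ext_lip.
by rewrite normrM -[leRHS]mul1r; apply: ler_pM => //; exact: ext_lip.
Qed.

Lemma chl_le j0 s (x : 'rV[R]_d) u : (forall j, `|x 0 j| <= 1) ->
  (forall j, `|u j| <= 1) -> `|s| <= 1 -> `|chl j0 s x u| <= d.+1%:R.
Proof.
move=> hx hu hs; rewrite /chl; apply: le_trans (ler_normD _ _) _.
rewrite -natr1; apply: lerD.
  apply: le_trans (ler_norm_sum _ _ _) _.
  have -> : d%:R = \sum_(j < d) (1 : R) by rewrite sumr_const card_ord.
  apply: ler_sum => j _; rewrite normrM -[leRHS]mulr1.
  by apply: ler_pM => //; exact: ext_le1.
by rewrite normrM -[leRHS]mul1r; apply: ler_pM => //; exact: ext_le1.
Qed.

Lemma relu_norm (a : R) : `|relu a| <= `|a|.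
Proof. by have := relu_lip a 0; rewrite subr0 /relu maxxx subr0. Qed.

(** The shift by one keeps the logarithm positive at m = 1. *)
Definition lgm (m : nat) : R := ln m.+1%:R.

Lemma lgm_gt0 m : (0 < m)%N -> 0 < lgm m.
Proof. by move=> m0; rewrite ln_gt0 // ltr1n. Qed.

Lemma lgm_le m n : (m <= n)%N -> lgm m <= lgm n.
Proof. by move=> mn; rewrite ler_ln ?posrE ?ltr0n // ler_nat. Qed.

(** The first summand makes samples of size one admissible in the reduction, the second is what
    [mstarP] asks for. Below this threshold the zero network already has the required accuracy. *)
Definition mstar : nat := (4 * (d.+1 * 2 ^ d) + (128 * (1 + 3 * d)) ^ 4)%N.

(** With q = m^(1/4), m^(1/d) <= q^2 for d >= 2 and the logarithm is at most 8 q, so a factor q is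
    left to beat the constant. *)
Lemma mstarP m : (1 < d)%N -> (mstar <= m)%N ->
  16 * ((1 + 3 * d)%:R * lgm m) * kd R d m <= m%:R.
Proof.
move=> d2 hm; have m0 : (0 < m)%N by apply: leq_trans hm; rewrite /mstar addn_gt0 muln_gt0 muln_gt0 expn_gt0.
pose q := m%:R `^ 4^-1 : R.
have q0 : 0 <= q by exact: powR_ge0.
have qE : q ^+ 4 = m%:R by rewrite -powR_mulrn // -powRrM mulVf // powRr1.
have cq : (128 * (1 + 3 * d))%:R <= q.
  rewrite -(@ler_pXn2r _ 4) ?nnegrE // qE -natrX ler_nat.
  by apply: leq_trans hm; rewrite /mstar leq_addl.
have kq : kd R d m <= q ^+ 2.
  rewrite -powR_mulrn // -powRrM; apply: ler_powR; first by rewrite ler1n.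
  rewrite -[leRHS](_ : 2^-1 = _); last by lra.
  by rewrite lef_pV2 ?posrE ?ltr0n // ler_nat.
have q1 : 1 <= q by apply: le_trans cq; rewrite ler1n muln_gt0.
have lq : lgm m <= 8 * q.
  have h : m.+1%:R <= (2 * q) ^+ 4.
    rewrite exprMn qE -natrX -natrM ler_nat; lia.
  apply: (@le_trans _ _ (ln ((2 * q) ^+ 4))).
    by rewrite ler_ln ?posrE ?ltr0n // exprn_gt0 // mulr_gt0 // (lt_le_trans _ q1).
  rewrite lnXn ?mulr_gt0 ?(lt_le_trans _ q1) // -[_ *+ 4]mulr_natl.
  have := @ln_sublinear R (2 * q); rewrite mulr_gt0 ?(lt_le_trans _ q1) // => /(_ isT) h1.
  lra.
rewrite natrM in cq.
have c0 : 0 <= (1 + 3 * d)%:R :> R by [].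
apply: (@le_trans _ _ (16 * ((1 + 3 * d)%:R * (8 * q)) * q ^+ 2)).
  apply: ler_pM => //; first by rewrite !mulr_ge0 // ln_ge0 // ler1n.
    by rewrite kd_ge0.
  by rewrite ler_wpM2l // ler_wpM2l.
have -> : 16 * ((1 + 3 * d)%:R * (8 * q)) * q ^+ 2 = (128 * (1 + 3 * d)%:R) * q ^+ 3 by ring.
by rewrite -qE [leRHS]exprS ler_wpM2r // exprn_ge0.
Qed.

Definition zpt (L : nat) (p : {ffun 'I_d -> 'I_(2 * L).+1}) : 'rV[R]_d :=
  \row_j ((p j : nat)%:R / L%:R - 1).

Lemma zpt_le1 L p j : (0 < L)%N -> `|@zpt L p 0 j| <= 1.
Proof.
move=> L0; have L0' : 0 < L%:R :> R by rewrite ltr0n.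
rewrite mxE ler_norml; apply/andP; split; first by rewrite lerBrDr addNr divr_ge0.
have h : (p j : nat)%:R <= (2 * L)%:R :> R by rewrite ler_nat; have := ltn_ord (p j); lia.
by rewrite lerBlDr ler_pdivrMr //; move: h; rewrite natrM; lra.
Qed.

Lemma zpt_near L (x : 'rV[R]_d) : (0 < L)%N -> (forall j, `|x 0 j| <= 1) ->
  exists p, forall j, `|x 0 j - @zpt L p 0 j| <= L%:R^-1.
Proof.
move=> L0 hx; have L0' : 0 < L%:R :> R by rewrite ltr0n.
exists [ffun j => inord (Num.truncn (L%:R * (x 0 j + 1)))] => j.
rewrite mxE ffunE.
have := hx j; rewrite ler_norml => /andP[h1 h2].
have a0 : 0 <= L%:R * (x 0 j + 1) by rewrite mulr_ge0 //; lra.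
have /andP[t1 t2] := truncn_itv a0.
rewrite inordK; last first.
  rewrite ltnS -(ler_nat R) (le_trans t1) // natrM mulrC ler_pM2r //; lra.
rewrite -(ler_pM2l L0') divff ?gt_eqF // -[X in X * `|_|](gtr0_norm L0') -normrM.
have -> : L%:R * (x 0 j - ((Num.truncn (L%:R * (x 0 j + 1)))%:R / L%:R - 1)) =
   L%:R * (x 0 j + 1) - (Num.truncn (L%:R * (x 0 j + 1)))%:R.
  by field; rewrite gt_eqF.
by rewrite ler_norml; move: t1 t2; rewrite -natr1; lra.
Qed.

Definition ap (m : nat) : R := Num.sqrt (lgm m) / rt R d m.

Lemma ap_ge0 m : 0 <= ap m.
Proof. by rewrite divr_ge0 ?sqrtr_ge0. Qed.

Lemma inv_rt_le_ap m : (0 < m)%N -> (rt R d m)^-1 <= (Num.sqrt (ln 2))^-1 * ap m.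
Proof.
move=> m0; have l2 : 0 < ln 2 :> R by rewrite ln_gt0 // ltr1n.
rewrite /ap mulrA ler_peMl ?invr_ge0 ?sqrtr_ge0 // mulrC ler_pdivlMr ?sqrtr_gt0 // mul1r.
by rewrite ler_wsqrtr //; have := @lgm_le 1 m m0.
Qed.

Section ClassReduce.
Variables (I : finType) (u : I -> 'I_d -> R) (j0 : 'I_d.+1) (s : R).
Hypothesis u1 : forall i j, `|u i j| <= 1.
Hypothesis s1 : `|s| <= 1.

Definition cerr (w w' : I -> R) (x : 'rV[R]_d) : R :=
  \sum_i (w' i - w i) * relu (chl j0 s x (u i)).

Lemma cerr_lip (w w' : I -> R) W e (x y : 'rV[R]_d) : (forall i, 0 <= w i) -> (forall i, 0 <= w' i) ->
  \sum_i w i <= W -> \sum_i w' i <= W -> 0 <= e -> (forall j, `|x 0 j - y 0 j| <= e) ->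
  `|cerr w w' x - cerr w w' y| <= 2 * W * (d.+1%:R * e).
Proof.
move=> w0 w'0 wW w'W e0 hxy; rewrite /cerr -sumrB; apply: le_trans (ler_norm_sum _ _ _) _.
apply: (@le_trans _ _ (\sum_i (w' i + w i) * (d.+1%:R * e))).
  apply: ler_sum => i _; rewrite -mulrBr normrM; apply: ler_pM => //.
    by apply: le_trans (ler_normB _ _) _; rewrite !ger0_norm.
  by apply: le_trans (relu_lip _ _) _; exact: chl_lip.
rewrite -mulr_suml ler_wpM2r ?mulr_ge0 // big_split /=; lra.
Qed.

Lemma cerr_triv (w : I -> R) W (x : 'rV[R]_d) : (forall i, 0 <= w i) -> \sum_i w i <= W ->
  (forall j, `|x 0 j| <= 1) -> `|cerr w (fun=> 0) x| <= W * d.+1%:R.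
Proof.
move=> w0 wW hx; rewrite /cerr; apply: le_trans (ler_norm_sum _ _ _) _.
apply: (@le_trans _ _ (\sum_i w i * d.+1%:R)); last by rewrite -mulr_suml ler_wpM2r.
apply: ler_sum => i _; rewrite sub0r normrM normrN (ger0_norm (w0 i)) ler_wpM2l //.
by apply: le_trans (relu_norm _) _; exact: chl_le.
Qed.

End ClassReduce.

Definition c_one : R := 1 + 2 * d.+2%:R * (48 * d%:R * d.+1%:R).
Definition c_two : R :=
  8 * d.+2%:R * (d.+1%:R * ((6 * d%:R + 2) * (48 * d%:R * d.+1%:R))).
Definition c_big : R := c_one * c_two * Num.sqrt (1 + 3 * d)%:R.
Definition c_small : R := d.+1%:R * rt R d mstar / Num.sqrt (ln 2).
Definition c_dim1 : R := 4 * d.+1%:R * 32 ^+ 2 / Num.sqrt (ln 2).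
Definition c_net : R := 2 * d.+1%:R / Num.sqrt (ln 2).
(** One summand for each source of error: the reduction, m below the threshold, dimension one, and
    the passage from the net to all points; the final 1 ensures positivity. *)
Definition c_class : R := c_big + c_small + c_dim1 + c_net + 1.

Lemma c_parts : [/\ 0 <= c_big, 0 <= c_small, 0 <= c_dim1 & 0 <= c_net].
Proof.
have c1 : 0 <= c_one by rewrite /c_one addr_ge0 // !mulr_ge0.
have c2 : 0 <= c_two by rewrite /c_two !mulr_ge0 // addr_ge0 // mulr_ge0.
have l2 : 0 <= Num.sqrt (ln 2) :> R by exact: sqrtr_ge0.
by split; rewrite ?divr_ge0 ?mulr_ge0 // ?sqrtr_ge0.
Qed.

Lemma c_class_gt0 : 0 < c_class.
Proof. by have [] := c_parts; rewrite /c_class; lra. Qed.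

Lemma cube_bound k : ((2 * k ^ 2).+1 <= k.+1 ^ 3)%N.
Proof. by rewrite !expnS !expn0; nia. Qed.

Lemma div16_bound k : (16 <= k)%N -> (k <= 32 * (k %/ 16))%N.
Proof. by clear; lia. Qed.

Lemma class_reduce (I : finType) (u : I -> 'I_d -> R) (j0 : 'I_d.+1) (s : R)
  (w : I -> R) (M : R) (m : nat) :
  (forall i j, `|u i j| <= 1) -> `|s| <= 1 -> (forall i, 0 <= w i) -> \sum_i w i <= M ->
  (0 < m)%N ->
  exists w', [/\ (forall i, 0 <= w' i), \sum_i w' i <= M, (#|supp w'| <= m)%N &
    forall x : 'rV[R]_d, (forall j, `|x 0 j| <= 1) ->
      `|cerr u j0 s w w' x| <= c_class * M * ap m].
Proof.
move=> u1 s1 w0 wM m0.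
have M0 : 0 <= M by apply: le_trans wM; exact: sumr_ge0.
have [cb cs c1 cn] := c_parts.
have rtm := rt_gt0 R d m0.
have l2 : 0 < ln 2 :> R by rewrite ln_gt0 // ltr1n.
have apr := inv_rt_le_ap m0.
have ap0 := ap_ge0 m.
have cle c : c <= c_class -> c * M * ap m <= c_class * M * ap m.
  by move=> h; rewrite ler_wpM2r // ler_wpM2r.
have [mm|mm] := ltnP m mstar.
  exists (fun=> 0); split => //; first by rewrite big1.
    by rewrite (_ : supp _ = finset.set0) ?cards0 //; apply/setP => i; rewrite !inE eqxx.
  move=> x hx; apply: le_trans (cle c_small _); last by rewrite /c_class; lra.
  apply: (@le_trans _ _ (M * d.+1%:R)); first by apply: cerr_triv.
  rewrite /c_small; have -> : d.+1%:R * rt R d mstar / Num.sqrt (ln 2) * M * ap m =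
    M * d.+1%:R * (rt R d mstar * ((Num.sqrt (ln 2))^-1 * ap m)) by ring.
  rewrite ler_peMr ?mulr_ge0 //; apply: (@le_trans _ _ (rt R d mstar * (rt R d m)^-1)).
    by rewrite ler_pdivlMr // mul1r rt_le // ltnW.
  by rewrite ler_wpM2l // sqrtr_ge0.
have [W0|W0] := eqVneq (\sum_i w i) 0.
  exists w; split => //.
    rewrite (_ : supp _ = finset.set0) ?cards0 //; apply/setP => i; rewrite !inE; apply/negbTE.
    rewrite negbK; move/eqP: W0; rewrite psumr_eq0 // => /allP /(_ i).
    by rewrite mem_index_enum => /(_ isT).
  move=> x _; rewrite /cerr big1 ?normr0; last by move=> i _; rewrite subrr mul0r.
  by apply: mulr_ge0 => //; apply: mulr_ge0 => //; apply: ltW; exact: c_class_gt0.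
set W := \sum_i w i in wM W0.
have Wp : 0 < W by rewrite lt0r W0 sumr_ge0.
(* Mesh m^(-2) is finer than the target rate by [rt_le_sqr], while twice the size of the net is
   still at most (m+1)^(1+3 d). *)
pose L := (m ^ 2)%N.
have L0 : (0 < L)%N by rewrite expn_gt0 m0.
pose X : finType := {ffun 'I_d -> 'I_(2 * L).+1}.
pose la (p : X) (j : 'I_d) : R := ext (zpt p) (lift j0 j).
pose lb (p : X) : R := s * ext (zpt p) j0.
have laL p : \sum_j `|la p j| <= d.+1%:R.
  apply: (@le_trans _ _ (\sum_(j < d) 1)); last by rewrite sumr_const card_ord ler_nat.
  by apply: ler_sum => j _; apply: ext_le1 => k; exact: zpt_le1.
have errE w' p : err u la lb w w' p = cerr u j0 s w w' (zpt p) by [].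
suff [w' [w'0 w'W w'm hw']] : exists w', [/\ (forall i, 0 <= w' i), \sum_i w' i = W, (#|supp w'| <= m)%N &
    forall p, `|err u la lb w w' p| <= (c_big + c_dim1) * M * ap m].
  exists w'; split => //; first by rewrite w'W.
  move=> x hx; have [p hp] := zpt_near L0 hx.
  have hL : 0 <= L%:R^-1 :> R by rewrite invr_ge0.
  have eqW' (a b : R) : a = b -> a <= b by move=> ->.
  have h1 := cerr_lip j0 u1 s1 w0 w'0 (lexx W) (eqW' _ _ w'W) hL hp.
  have h2 := hw' p; rewrite errE in h2.
  have h3 : 2 * W * (d.+1%:R * L%:R^-1) <= c_net * M * ap m.
    rewrite /c_net; have -> : 2 * d.+1%:R / Num.sqrt (ln 2) * M * ap m =
      2 * M * (d.+1%:R * ((Num.sqrt (ln 2))^-1 * ap m)) by ring.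
    apply: ler_pM; rewrite ?mulr_ge0 // ?(ltW Wp) //; first by rewrite ler_wpM2l.
    rewrite ler_wpM2l //; apply: le_trans apr.
    by rewrite lef_pV2 ?posrE ?ltr0n // /L natrX rt_le_sqr.
  have h4 : `|cerr u j0 s w w' x| <= `|cerr u j0 s w w' x - cerr u j0 s w w' (zpt p)| + `|cerr u j0 s w w' (zpt p)|.
    by rewrite -{1}[cerr u j0 s w w' x](subrK (cerr u j0 s w w' (zpt p))) ler_normD.
  apply: (le_trans h4); apply: le_trans (lerD (le_trans h1 h3) h2) _.
  rewrite -mulrDl -mulrDl; apply: cle; rewrite /c_class; lra.
have mul_le (c : R) : 0 <= c -> c * W * ap m <= c * M * ap m.
  by move=> c0; rewrite ler_wpM2r // ler_wpM2l.
have [d2|d1] := ltnP 1 d.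
  have hm := mstarP d2 mm.
  have mg : (4 * (d.+1 * 2 ^ d) <= m)%N by apply: leq_trans mm; rewrite /mstar leq_addr.
  have l0 : 0 < (1 + 3 * d)%:R * lgm m by rewrite mulr_gt0 ?ltr0n // lgm_gt0.
  have hX : (#|X| * 2)%:R <= expR ((1 + 3 * d)%:R * lgm m).
    rewrite expRM_natl lnK ?posrE ?ltr0n // -natrX ler_nat card_ffun !card_ord.
    rewrite expnD expn1 expnM mulnC; apply: leq_mul => //.
    by rewrite leq_exp2r //; exact: cube_bound.
  have p0 : X := [ffun=> ord0].
  have [w' [w'0 w'W w'm hw']] := @sparsify R d I X u la lb d.+1%:R W u1 laL (ltr0Sn _ _) Wp d_gt0 w p0 m mg
    _ l0 hX hm w0 erefl.
  exists w'; split => // p; apply: (le_trans (hw' p)).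
  apply: (@le_trans _ _ (c_big * W * ap m)); last first.
    by apply: (le_trans (mul_le _ cb)); rewrite ler_wpM2r // ler_wpM2r //; lra.
  rewrite sqrtrM // le_eqVlt; apply/orP; left; apply/eqP.
  by rewrite /c_big /ap /c_one /c_two /rt; ring.
have d1' : d = 1%N by apply/eqP; rewrite eqn_leq d1.
pose q := (m %/ 16)%N.
have m16 : (16 <= m)%N.
  apply: leq_trans mm; apply: (@leq_trans (4 * (d.+1 * 2 ^ d))); last exact: leq_addr.
  by rewrite d1'.
have q0 : (0 < q)%N by rewrite divn_gt0.
have [w' [w'0 w'W w'm hw']] := sparsify_dim1 lb d1' u1 laL (ltr0Sn _ _) Wp q0 w0 erefl.
exists w'; split => //; first by apply: (leq_trans w'm); rewrite mulnC leq_trunc_div.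
move=> p; apply: (le_trans (hw' p)).
apply: (@le_trans _ _ (c_dim1 * W * ap m)); last first.
  by apply: (le_trans (mul_le _ c1)); rewrite ler_wpM2r // ler_wpM2r //; lra.
have q32 : m%:R <= 32 * q%:R :> R.
  by rewrite -natrM ler_nat; exact: div16_bound.
have qp : 0 < q%:R :> R by rewrite ltr0n.
rewrite /c_dim1; have -> : 4 * d.+1%:R * 32 ^+ 2 / Num.sqrt (ln 2) * W * ap m =
   4 * W * d.+1%:R * (32 ^+ 2 * ((Num.sqrt (ln 2))^-1 * ap m)) by ring.
apply: ler_wpM2l; first by rewrite !mulr_ge0 // ltW.
apply: (@le_trans _ _ (32 ^+ 2 * (rt R d m)^-1)); last by rewrite ler_wpM2l.
rewrite ler_pdivlMr // mulrC ler_pdivrMr ?exprn_gt0 // -exprMn.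
apply: (le_trans (rt_le_sqr R d_gt0 m0)); by rewrite lerXn2r ?nnegrE.
Qed.

End Charts.
End Networks.

(** * Functions of bounded cost approximated by m units *)

Module NetApprox.
Import mathcomp.boot.finset.
Import OneStep Networks.

Section NetApprox.
Variable R : realType.
Variable d : nat.
Hypothesis d_gt0 : (0 < d)%N.

(** Unlike in [kappa], directions need not be distinct or normalised, so such functions can simply
    be added; [kappa_lt_cost] and [cost_kappa] relate the two notions. *)
Definition cost_le (f : 'rV[R]_d -> R) (M : R) : Prop :=
  exists (I : finType) (c : I -> R) (v : I -> 'rV[R]_d.+1),
    \sum_i `|c i| * norm2 (v i) <= M /\
    forall x, inball x -> f x = \sum_i c i * relu (aff x (v i)).

(** Free slots are filled with zero units. Quantifying over all [H] that vanish at coefficient 0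
    lets one reindexing serve both the values and the cost. *)
Lemma compress_index (J : finType) (V : nmodType) (a : J -> R) (w : J -> V) m :
  (#|supp a| <= m)%N ->
  exists (a' : 'I_m -> R) (w' : 'I_m -> V),
    (forall i, (a' i = 0 /\ w' i = 0) \/ exists j, a' i = a j /\ w' i = w j) /\
    forall H : R -> V -> R, (forall v, H 0 v = 0) ->
    \sum_i H (a' i) (w' i) = \sum_j H (a j) (w j).
Proof.
set A := supp a => Am; pose g (i : nat) : option J := nth None (map Some (enum A)) i.
exists (fun i => oapp a 0 (g i)), (fun i => oapp w 0 (g i)); split.
  by move=> i; case: (g i) => [j|]; [right; exists j|left].
move=> H H0.
pose F (o : option J) := H (oapp a 0 o) (oapp w 0 o).
have szA : size (map Some (enum A)) = #|A| by rewrite size_map -cardE.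
transitivity (\sum_(0 <= i < m) F (g i)); first by rewrite big_mkord.
rewrite (@big_cat_nat _ _ _ #|A|) //= [X in _ + X]big_nat_cond [X in _ + X]big1 ?addr0; last first.
  by move=> i; rewrite andbT => /andP[hi _]; rewrite /g nth_default ?szA // /F /= H0.
rewrite -szA -(big_nth None xpredT F) big_map big_enum /=.
rewrite [RHS](bigID (mem A)) /= [X in _ = _ + X]big1 ?addr0 // => j.
by rewrite inE negbK => /eqP ->; rewrite H0.
Qed.

Lemma inball_coord (x : 'rV[R]_d) j : inball x -> `|x 0 j| <= 1.
Proof. by move=> hx; apply: le_trans (norm2_coord x j) hx. Qed.

Lemma aff_le (x : 'rV[R]_d) v : inball x -> `|aff x v| <= d.+1%:R * norm2 v.
Proof.
move=> hx; rewrite affE; apply: le_trans (ler_norm_sum _ _ _) _.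
have -> : d.+1%:R * norm2 v = \sum_(k < d.+1) norm2 v by rewrite sumr_const card_ord mulr_natl.
apply: ler_sum => k _; rewrite normrM -[leRHS]mul1r; apply: ler_pM => //.
  by apply: ext_le1 => j; exact: inball_coord.
exact: norm2_coord.
Qed.

Lemma relu_pM (a b : R) : 0 <= a -> relu (a * b) = a * relu b.
Proof. by move=> a0; rewrite /relu maxr_pMr // mulr0. Qed.

Lemma norm2_ge0 n (v : 'rV[R]_n) : 0 <= norm2 v. Proof. exact: sqrtr_ge0. Qed.

Lemma cost_le_bound f M x : cost_le f M -> inball x -> `|f x| <= d.+1%:R * M.
Proof.
move=> [I [c [v [hM hf]]]] hx; rewrite (hf _ hx); apply: le_trans (ler_norm_sum _ _ _) _.
apply: (@le_trans _ _ (\sum_i d.+1%:R * (`|c i| * norm2 (v i)))); last by rewrite -mulr_sumr ler_wpM2l.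
apply: ler_sum => i _; rewrite normrM mulrCA ler_wpM2l //.
by apply: le_trans (relu_norm _) _; exact: aff_le.
Qed.

Definition pt (j0 : 'I_d.+1) (s : R) (u : 'I_d -> R) : 'rV[R]_d.+1 :=
  \row_k (if unlift j0 k is Some j then u j else s).

Lemma aff_pt j0 s u x : aff x (pt j0 s u) = chl j0 s x u.
Proof.
rewrite affE (bigD1_ord j0) //= /chl addrC mxE unlift_none mulrC; congr (_ + _).
by apply: eq_bigr => j _; rewrite mxE liftK.
Qed.

Lemma norm2_pt j0 s u : `|s| <= 1 -> (forall j, `|u j| <= 1) -> norm2 (pt j0 s u) <= d.+1%:R.
Proof.
move=> hs hu; apply: le_trans (norm2_le_sum _) _.
have -> : d.+1%:R = \sum_(k < d.+1) (1 : R) by rewrite sumr_const card_ord.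
by apply: ler_sum => k _; rewrite mxE; case: unlift.
Qed.

(** The class of an atom: the position of its largest coordinate, the sign of that coordinate, and
    the sign of the coefficient. Within a class weights are nonnegative and all directions lie on
    one face of the cube. *)
Let K : finType := ('I_d.+1 * bool * bool)%type.
Let sg (b : bool) : R := if b then 1 else -1.

Let norm_sg b : `|sg b| = 1. Proof. by case: b; rewrite /sg ?normrN normr1. Qed.

Let cardK : #|K| = (4 * d.+1)%N.
Proof. by rewrite !card_prod card_ord !card_bool; lia. Qed.

(** By homogeneity a direction is divided by its largest coordinate. This is at most its Euclidean
    norm, so the mass does not grow. *)
Lemma chart_decomposition f M : cost_le f M -> 0 <= M ->
  exists (I : finType) (u : I -> 'I_d -> R) (w : K -> I -> R),
  [/\ (forall i j, `|u i j| <= 1), (forall k i, 0 <= w k i), (forall k, \sum_i w k i <= M) &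
   forall x, inball x -> f x = \sum_k sg k.2 * \sum_i w k i * relu (chl k.1.1 (sg k.1.2) x (u i))].
Proof.
move=> [I [c [v [hM hf]]]] M0.
pose jm i := [arg max_(j > (ord0 : 'I_d.+1)) `|v i 0 j|]%O.
pose n i := `|v i 0 (jm i)|.
have nmax i j : `|v i 0 j| <= n i by rewrite /n /jm; case: Order.TotalTheory.arg_maxP => // k _; apply.
pose cls i : K := (jm i, 0 < v i 0 (jm i), 0 < c i).
pose u i j := v i 0 (lift (jm i) j) / n i.
pose w (k : K) i := if cls i == k then `|c i| * n i else 0.
have n0 i : 0 <= n i by exact: normr_ge0.
exists I, u, w; split.
- move=> i j; rewrite /u normrM normfV (ger0_norm (n0 i)).
  have [->|ni] := eqVneq (n i) 0; first by rewrite invr0 mulr0.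
  have np : 0 < n i by rewrite lt0r ni n0.
  by rewrite ler_pdivrMr // mul1r.
- by move=> k i; rewrite /w; case: ifP => // _; rewrite mulr_ge0.
- move=> k; apply: le_trans hM; apply: ler_sum => i _; rewrite /w.
  have nv : n i <= norm2 (v i) by exact: norm2_coord.
  by case: ifP => _; [rewrite ler_wpM2l|rewrite mulr_ge0 // norm2_ge0].
move=> x hx; rewrite (hf _ hx).
under [RHS]eq_bigr => k _ do rewrite mulr_sumr.
rewrite exchange_big /=; apply: eq_bigr => i _.
rewrite (bigD1 (cls i)) //= [X in _ = _ + X]big1 ?addr0; last first.
  by move=> k /negbTE ki; rewrite /w eq_sym ki mul0r mulr0.
rewrite /w eqxx.
have -> : aff x (v i) = n i * chl (jm i) (sg (0 < v i 0 (jm i))) x (u i).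
  have [ni|ni] := eqVneq (n i) 0.
    rewrite ni mul0r affE big1 // => k _.
    by have := nmax i k; rewrite ni normr_le0 => /eqP ->; rewrite mulr0.
  rewrite affE (bigD1_ord (jm i)) //= /chl mulrDr addrC; congr (_ + _).
    rewrite mulr_sumr; apply: eq_bigr => j _; rewrite /u.
    by rewrite mulrCA [n i * _]mulrC divfK.
  rewrite mulrA [n i * _]mulrC [LHS]mulrC; congr (_ * _); rewrite /n /sg.
  by case: ltrP => h; rewrite ?mul1r ?mulN1r; [rewrite gtr0_norm|rewrite ler0_norm ?opprK].
rewrite relu_pM // !mulrA; congr (_ * _); congr (_ * _); rewrite /sg.
by case: ltrP => h; rewrite ?mul1r ?mulN1r; [rewrite gtr0_norm|rewrite ler0_norm ?opprK].
Qed.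

Definition c_netapprox : R :=
  (4 * d.+1)%:R * c_class R d * (8 * d.+1)%:R ^+ 2 + d.+1%:R * (4 * d.+1)%:R +
  d.+1%:R * rt R d (4 * d.+1) / Num.sqrt (ln 2).

Lemma c_netapprox_gt0 : 0 < c_netapprox.
Proof.
have h := c_class_gt0 R d.
have h1 : 0 <= d.+1%:R * rt R d (4 * d.+1) / Num.sqrt (ln 2) by rewrite divr_ge0 ?mulr_ge0 ?sqrtr_ge0.
rewrite /c_netapprox ltr_pwDl // addr_gt0 // ?mulr_gt0 ?exprn_gt0 ?ltr0n //.
Qed.

Lemma ap_div q m : (0 < q)%N -> (q <= m)%N -> (m <= 8 * d.+1 * q)%N ->
  ap R d q <= (8 * d.+1)%:R ^+ 2 * ap R d m.
Proof.
move=> q0 qm mq; have m0 : (0 < m)%N by exact: leq_trans qm.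
have rq := rt_gt0 R d q0; have rm := rt_gt0 R d m0.
rewrite /ap mulrCA; apply: ler_pM; rewrite ?sqrtr_ge0 ?invr_ge0 ?(ltW rq) //.
  by rewrite ler_wsqrtr // lgm_le.
rewrite ler_pdivlMr // mulrC ler_pdivrMr //.
apply: le_trans (rt_le R d mq) _; exact: rt_mul.
Qed.

(** Each of the 4 (d+1) classes receives an equal share of the m units. The bounds on individual
    coefficients and directions prepare the quantisation. *)
Theorem net_approx f M m : cost_le f M -> 0 <= M -> (0 < m)%N ->
  exists (a : 'I_m -> R) (w : 'I_m -> 'rV[R]_d.+1),
    [/\ (forall i, norm2 (w i) <= d.+1%:R), (forall i, `|a i| <= M),
      \sum_i `|a i| * norm2 (w i) <= c_netapprox * M &
      forall x, inball x -> `|f x - nn a w x| <= c_netapprox * M * ap R d m].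
Proof.
move=> hf M0 m0.
have cc := ltW (c_class_gt0 R d).
have c1 : 0 <= (4 * d.+1)%:R * c_class R d * (8 * d.+1)%:R ^+ 2 by rewrite !mulr_ge0 // exprn_ge0.
have c2 : 0 <= d.+1%:R * (4 * d.+1)%:R :> R by rewrite mulr_ge0.
have c3 : 0 <= d.+1%:R * rt R d (4 * d.+1) / Num.sqrt (ln 2).
  by rewrite divr_ge0 ?mulr_ge0 ?sqrtr_ge0.
have apm := ap_ge0 R d m.
have [mK|mK] := ltnP m (4 * d.+1).
  exists (fun=> 0), (fun=> 0); split.
  - by move=> _; rewrite /norm2 big1 ?sqrtr0 // => j _; rewrite mxE expr0n.
  - by move=> _; rewrite normr0.
  - by rewrite big1 ?mulr_ge0 ?(ltW c_netapprox_gt0) // => i _; rewrite normr0 mul0r.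
  move=> x hx; rewrite /nn big1 ?subr0; last by move=> i _; rewrite mul0r.
  apply: (le_trans (cost_le_bound hf hx)).
  apply: (@le_trans _ _ (d.+1%:R * rt R d (4 * d.+1) / Num.sqrt (ln 2) * M * ap R d m)); last first.
    by rewrite ler_wpM2r // ler_wpM2r // /c_netapprox; lra.
  have -> : d.+1%:R * rt R d (4 * d.+1) / Num.sqrt (ln 2) * M * ap R d m =
    d.+1%:R * M * (rt R d (4 * d.+1) * ((Num.sqrt (ln 2))^-1 * ap R d m)) by ring.
  rewrite ler_peMr ?mulr_ge0 //.
  apply: (@le_trans _ _ (rt R d (4 * d.+1) * (rt R d m)^-1)).
    by rewrite ler_pdivlMr ?rt_gt0 // mul1r rt_le // ltnW.
  by rewrite ler_wpM2l ?sqrtr_ge0 // inv_rt_le_ap.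
have [I [u [w [u1 w0 wM fE]]]] := chart_decomposition hf M0.
pose q := (m %/ (4 * d.+1))%N.
have q0 : (0 < q)%N by rewrite divn_gt0.
have sg1 b : `|sg b| <= 1 by rewrite norm_sg.
have [w' hw'] := boolp.choice (fun k : K => class_reduce d_gt0 k.1.1 u1 (sg1 k.1.2) (w0 k) (wM k) q0).
pose a (p : K * I) := sg p.1.2 * w' p.1 p.2.
pose v (p : K * I) := pt p.1.1.1 (sg p.1.1.2) (u p.2).
have w'0 k i : 0 <= w' k i by have [h _ _ _] := hw' k; exact: h.
have absa p : `|a p| = w' p.1 p.2 by rewrite /a normrM norm_sg mul1r ger0_norm.
have card : (#|supp a| <= m)%N.
  apply: (@leq_trans (\sum_(k : K) q)%N); last first.
    by rewrite sum_nat_const cardK mulnC leq_trunc_div.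
  apply: (@leq_trans (\sum_(k : K) #|supp (w' k)|)%N); last first.
    by apply: leq_sum => k _; have [] := hw' k.
  rewrite -sum1_card (partition_big (fun p : K * I => p.1) predT) //=; apply: leq_sum => k _.
  rewrite sum1dep_card -(card_imset (supp (w' k)) (_ : injective (pair k))); last by move=> i j [].
  apply: subset_leq_card; apply/fintype.subsetP => -[k' i]; rewrite !inE /= => /andP[ha /eqP kk].
  apply/imsetP; exists i; last by rewrite kk.
  rewrite inE; apply: contraNneq ha => h; rewrite /a /= kk h mulr0 //.
have [a' [v' [hel hav]]] := compress_index v card.
have w'M k i : w' k i <= M.
  have [_ h _ _] := hw' k; apply: le_trans h; rewrite (bigD1 i) //= lerDl sumr_ge0 //.
have nm p : norm2 (v p) <= d.+1%:R by exact: norm2_pt.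
have pairE (F : K * I -> R) : \sum_p F p = \sum_k \sum_i F (k, i).
  by rewrite pair_bigA /=; apply: eq_bigr => -[].
exists a', v'; split.
- move=> i; have [[_ ->]|[j [_ ->]]] := hel i; last exact: nm.
  by rewrite /norm2 big1 ?sqrtr0 // => k _; rewrite mxE expr0n.
- by move=> i; have [[-> _]|[j [-> _]]] := hel i; rewrite ?normr0 // absa.
- rewrite (hav (fun r v0 => `|r| * norm2 v0)); last by move=> v0; rewrite normr0 mul0r.
  apply: (@le_trans _ _ (\sum_p w' p.1 p.2 * d.+1%:R)).
    by apply: ler_sum => p _; rewrite absa ler_wpM2l.
  rewrite pairE /=; apply: (@le_trans _ _ (\sum_(k : K) M * d.+1%:R)).
    by apply: ler_sum => k _; rewrite -mulr_suml ler_wpM2r //; have [] := hw' k.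
  rewrite sumr_const cardK -[_ *+ (4 * _)]mulr_natl.
  have -> : (4 * d.+1)%:R * (M * d.+1%:R) = d.+1%:R * (4 * d.+1)%:R * M :> R by ring.
  by rewrite ler_wpM2r // /c_netapprox; lra.
move=> x hx; rewrite /nn (hav (fun r v0 => r * relu (aff x v0))); last by move=> v0; rewrite mul0r.
rewrite fE // pairE -sumrB /=.
have hxc j : `|x 0 j| <= 1 by exact: inball_coord.
apply: le_trans (ler_norm_sum _ _ _) _.
apply: (@le_trans _ _ (\sum_(k : K) c_class R d * M * ap R d q)).
  apply: ler_sum => k _; have [_ _ _ h] := hw' k; apply: le_trans (h x hxc).
  have -> : sg k.2 * \sum_i w k i * relu (chl k.1.1 (sg k.1.2) x (u i)) -
     \sum_i a (k, i) * relu (aff x (v (k, i))) = - sg k.2 * cerr u k.1.1 (sg k.1.2) (w k) (w' k) x.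
    rewrite /cerr !mulr_sumr -sumrB; apply: eq_bigr => i _; rewrite /a /v aff_pt /=; ring.
  by rewrite normrM normrN norm_sg mul1r.
rewrite sumr_const cardK -[_ *+ (4 * _)]mulr_natl.
have qm : (q <= m)%N by exact: leq_div.
have mq : (m <= 8 * d.+1 * q)%N.
  have := divn_eq m (4 * d.+1); have := @ltn_pmod m (4 * d.+1) isT; rewrite -/q.
  move: q0; clear; move: (m %% _)%N q => r q; nia.
apply: (@le_trans _ _ ((4 * d.+1)%:R * (c_class R d * M * ((8 * d.+1)%:R ^+ 2 * ap R d m)))).
  by apply: ler_wpM2l => //; apply: ler_wpM2l; [exact: mulr_ge0|exact: ap_div].
have -> : (4 * d.+1)%:R * (c_class R d * M * ((8 * d.+1)%:R ^+ 2 * ap R d m)) =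
  (4 * d.+1)%:R * c_class R d * (8 * d.+1)%:R ^+ 2 * M * ap R d m by ring.
by rewrite ler_wpM2r // ler_wpM2r // /c_netapprox; lra.
Qed.

End NetApprox.
End NetApprox.

(** * Finite nets of quantised networks *)

Module FiniteNets.
Import mathcomp.boot.finset.
Import Networks NetApprox.

Section FiniteNets.
Variable R : realType.
Variable d : nat.
Hypothesis d_gt0 : (0 < d)%N.

(** Each unit is coded by one grid coordinate for its coefficient and d + 1 for its direction. Mesh
    m^(-3) turns m rounding errors into a total of order M m^(-2), which is below the approximation
    rate. *)
Definition codes (m : nat) : finType :=
  {ffun 'I_m -> {ffun 'I_1 -> 'I_(2 * m ^ 3).+1} * {ffun 'I_d.+1 -> 'I_(2 * m ^ 3).+1}}.

Definition decode (M : R) m (p : codes m) : 'rV[R]_d -> R :=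
  nn (fun i => M * zpt R (p i).1 0 0) (fun i => d.+1%:R *: zpt R (p i).2).

Lemma card_codes m : (#|codes m|)%:R <= expR (4 * (d.+2%:R * m%:R * lgm R m)).
Proof.
rewrite card_ffun card_prod !card_ffun !card_ord expn1.
have -> : 4 * (d.+2%:R * m%:R * lgm R m) = (4 * (d.+2 * m))%:R * lgm R m by rewrite !natrM; ring.
rewrite expRM_natl lnK ?posrE ?ltr0n // -natrX ler_nat -expnS expnM expnM.
have h : ((2 * m ^ 3).+1 <= m.+1 ^ 4)%N by rewrite !expnS !expn0; clear; nia.
have e2r (a b e : nat) : (a <= b)%N -> (a ^ e <= b ^ e)%N.
  by case: e => // e ab; rewrite leq_exp2r.
by apply: (e2r); apply: (e2r).
Qed.

Lemma affB (x : 'rV[R]_d) v w : aff x (v - w) = aff x v - aff x w.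
Proof. by rewrite !affE -sumrB; apply: eq_bigr => k _; rewrite !mxE mulrBr. Qed.

Lemma norm2_le_max n (v : 'rV[R]_n) e : (forall j, `|v 0 j| <= e) -> norm2 v <= n%:R * e.
Proof.
move=> h; apply: le_trans (norm2_le_sum v) _.
have -> : n%:R * e = \sum_(j < n) e by rewrite sumr_const card_ord mulr_natl.
exact: ler_sum.
Qed.

Definition c_cover : R := c_netapprox R d + 2 * d.+1%:R ^+ 3 / Num.sqrt (ln 2).

Lemma c_cover_gt0 : 0 < c_cover.
Proof.
by rewrite /c_cover ltr_pwDl ?c_netapprox_gt0 // divr_ge0 ?mulr_ge0 ?exprn_ge0 ?sqrtr_ge0.
Qed.

Lemma decode_cover (f : 'rV[R]_d -> R) M m : cost_le f M -> 0 < M -> (0 < m)%N ->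
  exists p : codes m, forall x, inball x -> `|f x - decode M p x| <= c_cover * M * ap R d m.
Proof.
move=> hf M0 m0; have [a [w [hw ha _ happ]]] := net_approx d_gt0 hf (ltW M0) m0.
pose L := (m ^ 3)%N; have L0 : (0 < L)%N by rewrite expn_gt0 m0.
have L0' : 0 < L%:R :> R by rewrite ltr0n.
have d0' : 0 < d.+1%:R :> R by rewrite ltr0n.
have na i : forall j, `|(\row_(_ < 1) (a i / M) : 'rV[R]_1) 0 j| <= 1.
  by move=> j; rewrite mxE normrM normfV (gtr0_norm M0) ler_pdivrMr // mul1r.
have nw i : forall j, `|(d.+1%:R^-1 *: w i) 0 j| <= 1.
  move=> j; rewrite mxE normrM normfV (gtr0_norm d0') mulrC ler_pdivrMr // mul1r.
  by apply: le_trans (norm2_coord _ _) (hw i).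
have [pa hpa] := boolp.choice (fun i => @zpt_near R 1 L _ L0 (na i)).
have [pw hpw] := boolp.choice (fun i => @zpt_near R d.+1 L _ L0 (nw i)).
exists [ffun i => (pa i, pw i)] => x hx.
have h1 := happ x hx.
have h2 : `|nn a w x - decode M [ffun i => (pa i, pw i)] x| <= m%:R * (2 * M * d.+1%:R ^+ 3 / L%:R).
  rewrite /decode /nn -sumrB; apply: le_trans (ler_norm_sum _ _ _) _.
  have -> : m%:R * (2 * M * d.+1%:R ^+ 3 / L%:R) = \sum_(i < m) 2 * M * d.+1%:R ^+ 3 / L%:R.
    by rewrite sumr_const card_ord mulr_natl.
  apply: ler_sum => i _; rewrite ffunE /=.
  set a' := M * _; set w' := d.+1%:R *: _.
  have da : `|a i - a'| <= M / L%:R.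
    have := hpa i 0; rewrite /a'; move: (zpt R (pa i)) => z; rewrite mxE => hh.
    have -> : a i - M * z 0 0 = M * (a i / M - z 0 0) by field; rewrite gt_eqF.
    by rewrite normrM (gtr0_norm M0) ler_pM2l.
  have dw : norm2 (w i - w') <= d.+1%:R * (d.+1%:R / L%:R).
    apply: norm2_le_max => j; have := hpw i j; rewrite /w'; move: (zpt R (pw i)) => z.
    rewrite !mxE => hh.
    have -> : w i 0 j - d.+1%:R * z 0 j = d.+1%:R * (d.+1%:R^-1 * w i 0 j - z 0 j).
      by field; rewrite gt_eqF.
    by rewrite normrM (gtr0_norm d0') ler_pM2l.
  have ra : `|relu (aff x (w i))| <= d.+1%:R ^+ 2.
    apply: le_trans (relu_norm _) _; apply: le_trans (aff_le _ hx) _.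
    by rewrite expr2 ler_pM2l.
  have rw : `|relu (aff x (w i)) - relu (aff x w')| <= d.+1%:R ^+ 3 / L%:R.
    apply: le_trans (relu_lip _ _) _; rewrite -affB; apply: le_trans (aff_le _ hx) _.
    have -> : d.+1%:R ^+ 3 / L%:R = d.+1%:R * (d.+1%:R * (d.+1%:R / L%:R)) :> R by ring.
    by rewrite ler_pM2l.
  have a'M : `|a'| <= M.
    by rewrite /a' normrM (gtr0_norm M0) ler_piMr ?(ltW M0) // zpt_le1.
  have -> : a i * relu (aff x (w i)) - a' * relu (aff x w') =
    (a i - a') * relu (aff x (w i)) + a' * (relu (aff x (w i)) - relu (aff x w')) by ring.
  apply: le_trans (ler_normD _ _) _.
  have t1 : `|(a i - a') * relu (aff x (w i))| <= M / L%:R * d.+1%:R ^+ 2.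
    by rewrite normrM; apply: ler_pM.
  have t2 : `|a' * (relu (aff x (w i)) - relu (aff x w'))| <= M * (d.+1%:R ^+ 3 / L%:R).
    by rewrite normrM; apply: ler_pM.
  apply: (le_trans (lerD t1 t2)).
  have -> : 2 * M * d.+1%:R ^+ 3 / L%:R = M / L%:R * d.+1%:R ^+ 3 + M * (d.+1%:R ^+ 3 / L%:R) by ring.
  rewrite lerD2r; apply: ler_wpM2l; first by rewrite divr_ge0 // ltW.
  by rewrite -natrX -natrX ler_nat leq_pexp2l.
have h3 : m%:R * (2 * M * d.+1%:R ^+ 3 / L%:R) <= 2 * d.+1%:R ^+ 3 / Num.sqrt (ln 2) * M * ap R d m.
  have m0' : 0 < m%:R :> R by rewrite ltr0n.
  have -> : m%:R * (2 * M * d.+1%:R ^+ 3 / L%:R) = 2 * d.+1%:R ^+ 3 * M * (m%:R ^+ 2)^-1.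
    by rewrite /L natrX; field; rewrite gt_eqF.
  have -> : 2 * d.+1%:R ^+ 3 / Num.sqrt (ln 2) * M * ap R d m =
     2 * d.+1%:R ^+ 3 * M * ((Num.sqrt (ln 2))^-1 * ap R d m) by ring.
  apply: ler_wpM2l; first by rewrite !mulr_ge0 ?exprn_ge0 // ltW.
  apply: le_trans (inv_rt_le_ap R d m0).
  by rewrite lef_pV2 ?posrE ?exprn_gt0 ?rt_gt0 // rt_le_sqr.
have -> : f x - decode M [ffun i => (pa i, pw i)] x =
   (f x - nn a w x) + (nn a w x - decode M [ffun i => (pa i, pw i)] x) by ring.
apply: le_trans (ler_normD _ _) _; apply: le_trans (lerD h1 (le_trans h2 h3)) _.
by rewrite /c_cover; lra.
Qed.

End FiniteNets.
End FiniteNets.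

(** * Discrete heat semigroup on the lattice *)

Module Heat.

Section Heat.
Variable R : realType.
Variable d : nat.
Notation V := 'rV[int]_d.
Implicit Types (F H : V -> R) (n : V) (j : 'I_d).

Definition ev j : V := delta_mx 0 j.
Definition co j n : R := (n 0 j)%:~R.

Lemma co_ev j i n (z : int) : co i (n + z *: ev j) = co i n + z%:~R * (i == j)%:R.
Proof.
by rewrite /co !mxE !intrD eqxx /= intrM; case: (i == j).
Qed.

Lemma coD j i n : co i (n + ev j) = co i n + (i == j)%:R.
Proof. by have := co_ev j i n 1; rewrite scale1r mul1r. Qed.

Lemma coB j i n : co i (n - ev j) = co i n - (i == j)%:R.
Proof. by have := co_ev j i n (-1); rewrite scaleN1r mulrN1z mulN1r. Qed.

(** The weights 1/4, 1/2, 1/4 fix affine functions and have the nonnegative symbol cos^2(a/2) on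
    waves of frequency a. *)
Definition G1 j F n : R := 4^-1 * F (n - ev j) + 2^-1 * F n + 4^-1 * F (n + ev j).
Definition Gl (l : seq 'I_d) F : V -> R := foldr G1 F l.
Definition G F := Gl (enum 'I_d) F.
Definition GN (N : nat) F := iter N G F.

Lemma G1_lin j (a b : R) F H n : G1 j (fun n => a * F n + b * H n) n = a * G1 j F n + b * G1 j H n.
Proof. by rewrite /G1; ring. Qed.

Lemma Gl_cons j l F : Gl (j :: l) F = G1 j (Gl l F). Proof. by []. Qed.

Lemma Gl_lin l (a b : R) F H n : Gl l (fun n => a * F n + b * H n) n = a * Gl l F n + b * Gl l H n.
Proof.
elim: l n => [//|j l IH] n; rewrite !Gl_cons.
have -> : Gl l (fun n => a * F n + b * H n) = (fun n => a * Gl l F n + b * Gl l H n).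
  by apply/funext => k; exact: IH.
exact: G1_lin.
Qed.

Lemma GN_lin N (a b : R) F H n : GN N (fun n => a * F n + b * H n) n = a * GN N F n + b * GN N H n.
Proof.
elim: N n => [//|N IH] n; rewrite /GN !iterS -/(GN N _) -/(GN N F) -/(GN N H).
have -> : GN N (fun n => a * F n + b * H n) = (fun n => a * GN N F n + b * GN N H n).
  by apply/funext => k; exact: IH.
exact: Gl_lin.
Qed.

Lemma GN_scale N (c : R) F n : GN N (fun n => c * F n) n = c * GN N F n.
Proof.
have -> : (fun n => c * F n) = (fun n => c * F n + 0 * F n).
  by apply/funext => k; rewrite mul0r addr0.
by rewrite GN_lin mul0r addr0.
Qed.

Lemma Gl_le l F H : (forall n, F n <= H n) -> forall n, Gl l F n <= Gl l H n.
Proof.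
move=> h; elim: l => [//|j l IH] n; rewrite !Gl_cons.
have := IH (n - ev j); have := IH n; have := IH (n + ev j); rewrite /G1; lra.
Qed.

Lemma GN_le N F H : (forall n, F n <= H n) -> forall n, GN N F n <= GN N H n.
Proof. by move=> h; elim: N => [//|N IH] n; rewrite /GN !iterS; exact: Gl_le. Qed.

Lemma Gl_cst l (c : R) : Gl l (fun=> c) = (fun=> c).
Proof. by apply/funext; elim: l => [//|j l IH] n; rewrite Gl_cons /G1 !IH; lra. Qed.

Lemma GN_cst N (c : R) : GN N (fun=> c) = (fun=> c).
Proof. by elim: N => [//|N IH]; rewrite /GN iterS -/(GN N _) IH /G Gl_cst. Qed.

Lemma GN_add N M F : GN (N + M) F = GN N (GN M F).
Proof. by rewrite /GN iterD. Qed.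

Lemma GN_norm N F H : (forall n, `|F n| <= H n) -> forall n, `|GN N F n| <= GN N H n.
Proof.
move=> h n; rewrite ler_norml; apply/andP; split.
  have -> : - GN N H n = GN N (fun n => (-1) * H n) n by rewrite GN_scale mulN1r.
  by apply: GN_le => k; have := h k; rewrite ler_norml => /andP[]; lra.
by apply: GN_le => k; have := h k; rewrite ler_norml => /andP[].
Qed.

(* Polynomials in the lattice coordinates; [Pol k] has total degree less than [k]. *)
Inductive Pol : nat -> (V -> R) -> Prop :=
| Pol_0 k : Pol k (fun=> 0)
| Pol_C k c : Pol k.+1 (fun=> c)
| Pol_X k j F : Pol k F -> Pol k.+1 (fun n => co j n * F n)
| Pol_D k F H : Pol k F -> Pol k H -> Pol k (fun n => F n + H n)
| Pol_Z k c F : Pol k F -> Pol k (fun n => c * F n).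

Lemma Pol0_eq k F : Pol k F -> k = 0%N -> forall n, F n = 0.
Proof.
elim=> // {k F} [k F H _ IF _ IH k0 n|k c F _ IF k0 n]; first by rewrite IF // IH // addr0.
by rewrite IF // mulr0.
Qed.

Lemma Pol_weak k k' F : Pol k F -> (k <= k')%N -> Pol k' F.
Proof.
move=> hF; elim: hF k' => {k F}.
- by move=> k k' _; exact: Pol_0.
- by move=> k c [//|k'] _; exact: Pol_C.
- by move=> k j F _ IH [//|k'] h; apply: Pol_X; exact: IH.
- by move=> k F H _ IF _ IH k' h; apply: Pol_D; [exact: IF|exact: IH].
- by move=> k c F _ IF k' h; apply: Pol_Z; exact: IF.
Qed.

Lemma Pol_eq k F H : F =1 H -> Pol k F -> Pol k H.
Proof. by move=> /funext ->. Qed.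

Lemma Pol_Xsub k c j F : Pol (k - c) F -> Pol (k.+1 - c) (fun n => co j n * F n).
Proof.
move=> hF; have [ck|kc] := leqP c k; first by rewrite subSn //; exact: Pol_X.
have F0 := Pol0_eq hF; apply: (@Pol_eq _ (fun=> 0)); last exact: Pol_0.
by move=> n; rewrite F0 ?mulr0 //; apply/eqP; rewrite subn_eq0 ltnW.
Qed.

Definition dif2 j F n := F (n + ev j) + F (n - ev j) - 2 * F n.
Definition dif1 j F n := F (n + ev j) - F (n - ev j).

(** Both differences are handled together because the product rule for multiplication by a
    coordinate mixes them. *)
Lemma Pol_dif j k F : Pol k F -> Pol (k - 2) (dif2 j F) /\ Pol (k - 1) (dif1 j F).
Proof.
elim=> {k F}.
- move=> k; split; (apply: (@Pol_eq _ (fun=> 0)); last exact: Pol_0) => n;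
    rewrite /dif2 /dif1; ring.
- move=> k c; split; (apply: (@Pol_eq _ (fun=> 0)); last exact: Pol_0) => n;
    rewrite /dif2 /dif1; ring.
- move=> k i F hF [h2 h1]; split.
    have h : Pol (k.+1 - 2) (fun n => co i n * dif2 j F n + (i == j)%:R * dif1 j F n).
      apply: Pol_D; first exact: Pol_Xsub.
      by apply: Pol_Z; rewrite subSS.
    by apply: Pol_eq h => n; rewrite /dif2 /dif1 coD coB; ring.
  have h : Pol (k.+1 - 1) (fun n => co i n * dif1 j F n + (i == j)%:R * (dif2 j F n + 2 * F n)).
    apply: Pol_D; first exact: Pol_Xsub.
    apply: Pol_Z; rewrite subn1 /=; apply: Pol_D; last exact: Pol_Z.
    by apply: Pol_weak h2 _; exact: leq_subr.
  by apply: Pol_eq h => n; rewrite /dif2 /dif1 coD coB; ring.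
- move=> k F H _ [F2 F1] _ [H2 H1]; split.
    by apply: Pol_eq (Pol_D F2 H2) => n; rewrite /dif2; ring.
  by apply: Pol_eq (Pol_D F1 H1) => n; rewrite /dif1; ring.
- move=> k c F _ [F2 F1]; split.
    by apply: Pol_eq (Pol_Z c F2) => n; rewrite /dif2; ring.
  by apply: Pol_eq (Pol_Z c F1) => n; rewrite /dif1; ring.
Qed.

(** The average differs from the identity by a quarter of a second difference in each direction,
    which costs two degrees. *)
Lemma Pol_Gl l k F : Pol k F -> Pol (k - 2) (fun n => F n - Gl l F n).
Proof.
move=> hF; elim: l => [|j l IH] /=.
  by apply: Pol_eq (Pol_0 _) => n; rewrite subrr.
have hG : Pol k (Gl l F).
  apply: Pol_eq (Pol_D hF (Pol_Z (-1) (Pol_weak IH (leq_subr _ _)))) => n /=; ring.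
have [h2 _] := Pol_dif j hG.
by apply: Pol_eq (Pol_D IH (Pol_Z (- 4^-1) h2)) => n; rewrite /dif2 /G1 /Gl /=; field.
Qed.

Lemma Pol_GN N k F : Pol k F -> Pol (k - 2) (fun n => F n - GN N F n).
Proof.
move=> hF; elim: N => [|N IH].
  by apply: Pol_eq (Pol_0 _) => n; rewrite subrr.
have hG : Pol k (GN N F).
  apply: Pol_eq (Pol_D hF (Pol_Z (-1) (Pol_weak IH (leq_subr _ _)))) => n /=; ring.
have h := Pol_Gl (enum 'I_d) hG.
by apply: Pol_eq (Pol_D IH h) => n; rewrite /GN iterS /G /=; ring.
Qed.

Definition res N F n := F n - GN N F n.

Lemma res_iter_Pol N m k F : Pol k F -> (k <= 2 * m)%N -> forall n, iter m (res N) F n = 0.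
Proof.
elim: m k F => [|m IH] k F hF km n; first by apply: (Pol0_eq hF); lia.
by rewrite iterSr; apply: (IH (k - 2)%N); [exact: Pol_GN|lia].
Qed.

Lemma res_lin N (a b : R) F H n : res N (fun n => a * F n + b * H n) n = a * res N F n + b * res N H n.
Proof. by rewrite /res GN_lin; ring. Qed.

Lemma res_iter_lin N m (a b : R) F H n :
  iter m (res N) (fun n => a * F n + b * H n) n = a * iter m (res N) F n + b * iter m (res N) H n.
Proof.
elim: m n => [//|m IH] n; rewrite !iterS.
have -> : iter m (res N) (fun n => a * F n + b * H n) =
   (fun n => a * iter m (res N) F n + b * iter m (res N) H n) by apply/funext => k; exact: IH.
exact: res_lin.
Qed.

(** Comparison with a positive function that the semigroup enlarges by at most [rho]. This admits
    functions of unbounded growth, as Taylor remainders are. *)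
Lemma res_iter_bound N m F H (rho : R) : 0 <= rho -> (forall n, `|F n| <= H n) ->
  (forall n, GN N H n <= rho * H n) -> forall n, `|iter m (res N) F n| <= (1 + rho) ^+ m * H n.
Proof.
move=> rho0 hF hH; elim: m => [|m IH] n; first by rewrite expr0 mul1r.
rewrite iterS /res; apply: le_trans (ler_normB _ _) _.
have h1 := IH n.
have h2 : `|GN N (iter m (res N) F) n| <= (1 + rho) ^+ m * (rho * H n).
  apply: le_trans (GN_norm N IH n) _.
  by rewrite GN_scale ler_wpM2l // exprn_ge0 // addr_ge0.
apply: (le_trans (lerD h1 h2)); rewrite exprS le_eqVlt; apply/orP; left; apply/eqP; ring.
Qed.

(** Eigenvalue of [G1] on real exponentials, that is, its symbol at an imaginary frequency. *)
Definition ecf (t : R) : R := (2 + expR t + expR (- t)) / 4.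

Lemma ecf_ge1 t : 1 <= ecf t.
Proof. have := expR_ge1Dx t; have := expR_ge1Dx (- t); rewrite /ecf; lra. Qed.

Lemma ecf_le t : `|t| <= 4^-1 -> ecf t <= expR (t ^+ 2 / 2).
Proof.
rewrite ler_norml => /andP[t1 t2]; apply: le_trans (expR_ge1Dx _).
have h1 := OneStep.expR_le_quadratic t2.
have h2 : expR (- t) <= 1 + - t + (- t) ^+ 2 by apply: OneStep.expR_le_quadratic; lra.
by move: h2; rewrite sqrrN /ecf; lra.
Qed.

Lemma Gl_exp l i (t a : R) n : uniq l ->
  Gl l (fun n => expR (t * (co i n - a))) n =
  (if i \in l then ecf t else 1) * expR (t * (co i n - a)).
Proof.
elim: l n => [|j l IH] n; first by rewrite mul1r.
rewrite cons_uniq => /andP[jl ul]; rewrite Gl_cons /G1 !IH // coB coD inE.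
have e1 : expR (t * (co i n - (i == j)%:R - a)) = expR (t * (co i n - a)) * expR (- t * (i == j)%:R).
  by rewrite -expRD; congr expR; ring.
have e2 : expR (t * (co i n + (i == j)%:R - a)) = expR (t * (co i n - a)) * expR (t * (i == j)%:R).
  by rewrite -expRD; congr expR; ring.
rewrite e1 e2 /ecf; have [->|ij] /= := eqVneq i j.
  by rewrite (negbTE jl) !mulr1; field.
by rewrite !mulr0 expR0; field.
Qed.

Lemma GN_exp N i (t a : R) n :
  GN N (fun n => expR (t * (co i n - a))) n = ecf t ^+ N * expR (t * (co i n - a)).
Proof.
elim: N n => [|N IH] n; first by rewrite expr0 mul1r.
rewrite /GN iterS -/(GN N _).
have -> : GN N (fun n => expR (t * (co i n - a))) =
  (fun n => ecf t ^+ N * expR (t * (co i n - a)) + 0 * expR (t * (co i n - a))).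
  by apply/funext => k; rewrite IH; ring.
by rewrite /G Gl_lin Gl_exp ?enum_uniq // mem_enum /= mul0r addr0 exprSr; ring.
Qed.

(** An eigenfunction that grows exponentially along all axes: up to constants it dominates every
    power of the distance, and its value at the centre is only 2 d. *)
Definition env (t : R) n0 n : R :=
  \sum_j (expR (t * (co j n - co j n0)) + expR (- t * (co j n - co j n0))).

Lemma GN_sum N (I : Type) (r : seq I) (F : I -> V -> R) n :
  GN N (fun n => \sum_(i <- r) F i n) n = \sum_(i <- r) GN N (F i) n.
Proof.
elim: r => [|i r IH].
  rewrite big_nil; have -> : (fun n => \sum_(i <- [::]) F i n) = (fun=> 0) by apply/funext => k; rewrite big_nil.
  by rewrite GN_cst.
rewrite big_cons -IH.
have := GN_lin N 1 1 (F i) (fun n => \sum_(j <- r) F j n) n; rewrite !mul1r => <-.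
by congr (GN N _ n); apply/funext => k; rewrite big_cons !mul1r.
Qed.

Lemma GN_env N t n0 n : GN N (env t n0) n = ecf t ^+ N * env t n0 n.
Proof.
rewrite /env GN_sum mulr_sumr; apply: eq_bigr => j _.
have := GN_lin N 1 1 (fun n => expR (t * (co j n - co j n0))) (fun n => expR (- t * (co j n - co j n0))) n.
rewrite !mul1r !GN_exp => h.
have eN : ecf (- t) = ecf t by rewrite /ecf opprK; ring.
transitivity (GN N (fun n => 1 * expR (t * (co j n - co j n0)) + 1 * expR (- t * (co j n - co j n0))) n).
  by congr (GN N _ n); apply/funext => k; rewrite !mul1r.
by rewrite h eN; ring.
Qed.

Lemma env0 t n0 : env t n0 n0 = 2 * d%:R.
Proof.
rewrite /env; under eq_bigr do rewrite subrr !mulr0 expR0.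
by rewrite sumr_const card_ord -[_ *+ d]mulr_natr; ring.
Qed.

End Heat.
End Heat.

(** * Telescoping over dyadic times *)

Module Telescope.
Import Heat.

Section Telescope.
Variable R : realType.
Variable d : nat.
Notation V := 'rV[int]_d.
Notation co := (Heat.co R).
Implicit Types (F H E : V -> R) (n : V) (j : 'I_d).

Lemma powR_le_exp (a y : R) (k : nat) : 0 <= a -> a <= k.+1%:R ->
  `|y| `^ a <= (1 + k.+1`!%:R) * (expR y + expR (- y)).
Proof.
move=> a0 ak.
have f0 : 0 < k.+1`!%:R :> R by rewrite ltr0n fact_gt0.
have key (z : R) : 0 <= z -> z `^ a <= (1 + k.+1`!%:R) * expR z.
  move=> z0; have e1 : 1 <= expR z by rewrite -expR0 ler_expR.
  have h2 : z ^+ k.+1 <= k.+1`!%:R * expR z.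
    have := expR_ge1Dxn k z0; rewrite -(ler_pM2l f0) mulrDr mulr1 mulrCA divff ?gt_eqF // mulr1; lra.
  have p0 : 0 <= k.+1`!%:R * expR z by rewrite mulr_ge0 // ?expR_ge0 // ltW.
  rewrite mulrDl mul1r; have [z1|z1] := lerP z 1.
    apply: (@le_trans _ _ 1); last by lra.
    rewrite (_ : 1 = 1 `^ a); last by rewrite powR1.
    by apply: ge0_ler_powR; rewrite ?nnegrE.
  apply: (@le_trans _ _ (z ^+ k.+1)); last by have := expR_ge0 z; lra.
  by rewrite -powR_mulrn // ler_powR // ltW.
have c0 : 0 <= 1 + k.+1`!%:R :> R by rewrite addr_ge0 // ltW.
apply: (le_trans (key _ (normr_ge0 y))); apply: ler_wpM2l => //.
by case: (ger0P y) => _; [rewrite lerDl expR_ge0|rewrite lerDr expR_ge0].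
Qed.

Definition taylor_at (k : nat) (A al h : R) F n0 := exists2 P, Pol k P &
  forall n, `|F n - P n| <= A * \sum_j `|h * (co j n - co j n0)| `^ al.

(** The residual powers annihilate the polynomial, and the remainder is at most s^al times a
    constant multiple of the envelope of rate h/s. With s = h sqrt N the eigenvalue of this envelope
    stays bounded, so that the order s^al results. *)
Lemma res_taylor N m k (kk : nat) (A al h s : R) F n0 : (k <= 2 * m)%N -> 0 <= A ->
  0 <= al -> al <= kk.+1%:R -> 0 < s -> 0 < h ->
  taylor_at k A al h F n0 ->
  `|iter m (res N) F n0| <=
    (1 + ecf (h / s) ^+ N) ^+ m * (A * s `^ al * (1 + kk.+1`!%:R) * (2 * d%:R)).
Proof.
move=> km A0 al0 alk s0 h0 [P hP hF].
have -> : iter m (res N) F n0 = iter m (res N) (fun n => F n - P n) n0.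
  have := res_iter_lin N m 1 (-1) F P n0; rewrite (res_iter_Pol N hP km) mulr0 addr0 mul1r => <-.
  by congr (iter m (res N) _ n0); apply/funext => n; rewrite mul1r mulN1r.
pose c := A * s `^ al * (1 + kk.+1`!%:R).
have c0 : 0 <= c by rewrite /c !mulr_ge0 ?powR_ge0 ?addr_ge0.
have e1 := ecf_ge1 (h / s).
have := @res_iter_bound R d N m (fun n => F n - P n) (fun n => c * env (h / s) n0 n)
   (ecf (h / s) ^+ N) _ _ _ n0; rewrite env0; apply.
- by rewrite exprn_ge0 // (le_trans _ e1).
- move=> n; apply: (le_trans (hF n)); rewrite /c /env -!mulrA; apply: ler_wpM2l => //.
  rewrite mulrA mulr_sumr; apply: ler_sum => j _.
  have -> : h * (co j n - co j n0) = s * (h / s * (co j n - co j n0)) by field; rewrite gt_eqF.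
  rewrite normrM (gtr0_norm s0) powRM ?(ltW s0) // -[leRHS]mulrA; apply: ler_wpM2l; first exact: powR_ge0.
  by rewrite mulNr; exact: powR_le_exp.
by move=> n; rewrite GN_scale GN_env; lra.
Qed.

(** The factor in I - G^2 = (I + G)(I - G), by which residuals at the doubled time are computed from
    those at time N. *)
Definition plus N F n := F n + GN N F n.

Lemma GN_sub N F H n : GN N (fun n => F n - H n) n = GN N F n - GN N H n.
Proof.
have := GN_lin N 1 (-1) F H n; rewrite !mul1r mulN1r => <-.
by congr (GN N _ n); apply/funext => k; rewrite mul1r mulN1r.
Qed.

Lemma GN_addf N F H n : GN N (fun n => F n + H n) n = GN N F n + GN N H n.
Proof.
have := GN_lin N 1 1 F H n; rewrite !mul1r => <-.
by congr (GN N _ n); apply/funext => k; rewrite !mul1r.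
Qed.

Lemma res_plus N F : res N (plus N F) = res (2 * N) F.
Proof.
apply/funext => n; rewrite /res /plus GN_addf mul2n -addnn GN_add; ring.
Qed.

Lemma plus_res N F : plus N (res N F) = res (2 * N) F.
Proof.
apply/funext => n; rewrite /res /plus GN_sub mul2n -addnn GN_add; ring.
Qed.

Lemma iter_plus_res N m F : iter m (plus N) (res N F) = res N (iter m (plus N) F).
Proof. by elim: m => [//|m IH]; rewrite !iterS IH plus_res -res_plus. Qed.

Lemma iter_res2 N m F : iter m (res (2 * N)) F = iter m (plus N) (iter m (res N) F).
Proof.
elim: m F => [//|m IH] F.
by rewrite iterS IH -plus_res -iter_plus_res -!iterS.
Qed.

Lemma iter_plus_sub N m H n :
  iter m (plus N) H n - H n = GN N (fun n => \sum_(i <- iota 0 m) iter i (plus N) H n) n.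
Proof.
rewrite GN_sum; elim: m => [|m IH]; first by rewrite big_nil subrr.
by rewrite -[m.+1]addn1 iotaD big_cat /= big_cons big_nil addr0 -IH addn1 iterS {1}/plus; ring.
Qed.

Lemma iter_res_sub N m F n :
  F n - iter m (res N) F n = GN N (fun n => \sum_(i <- iota 0 m) iter i (res N) F n) n.
Proof.
rewrite GN_sum; elim: m => [|m IH]; first by rewrite big_nil subrr.
by rewrite -[m.+1]addn1 iotaD big_cat /= big_cons big_nil addr0 -IH addn1 iterS {1}/res; ring.
Qed.

Lemma GN_bound N F (A : R) : (forall n, `|F n| <= A) -> forall n, `|GN N F n| <= A.
Proof. by move=> h n; apply: (le_trans (GN_norm N h n)); rewrite GN_cst. Qed.

Lemma iter_bound (op : (V -> R) -> V -> R) m F (A : R) :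
  (forall F A, (forall n, `|F n| <= A) -> forall n, `|op F n| <= 2 * A) ->
  (forall n, `|F n| <= A) -> forall n, `|iter m op F n| <= 2 ^+ m * A.
Proof.
move=> hop h; elim: m => [|m IH] n; first by rewrite expr0 mul1r.
by rewrite iterS exprS -mulrA; apply: hop.
Qed.

Lemma sum_iter_bound (op : (V -> R) -> V -> R) m F (A : R) :
  (forall F A, (forall n, `|F n| <= A) -> forall n, `|op F n| <= 2 * A) ->
  (forall n, `|F n| <= A) -> forall n, `|\sum_(i <- iota 0 m) iter i op F n| <= 2 ^+ m * A.
Proof.
move=> hop h n; have A0 : 0 <= A by apply: le_trans (h n).
suff : `|\sum_(i <- iota 0 m) iter i op F n| <= (2 ^+ m - 1) * A.
  by move=> /le_trans; apply; rewrite ler_wpM2r // gerBl.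
elim: m => [|m IH]; first by rewrite big_nil normr0 expr0 subrr mul0r.
rewrite -[m.+1]addn1 iotaD big_cat /= big_cons big_nil addr0 addn1 add0n.
apply: le_trans (ler_normD _ _) _; apply: le_trans (lerD IH (iter_bound m hop h n)) _.
by rewrite exprS; lra.
Qed.

Lemma plus_bound N F A : (forall n, `|F n| <= A) -> forall n, `|plus N F n| <= 2 * A.
Proof.
move=> h n; apply: le_trans (ler_normD _ _) _.
have := h n; have := GN_bound N h n; lra.
Qed.

Lemma res_bound N F A : (forall n, `|F n| <= A) -> forall n, `|res N F n| <= 2 * A.
Proof.
move=> h n; apply: le_trans (ler_normB _ _) _.
have := h n; have := GN_bound N h n; lra.
Qed.

(** With G the semigroup at time 2^k N, the residual powers at two consecutive times differ by ((I +
    G)^m - I)(I - G)^m F. The difference contains a factor G, and this is what remains without it;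
    the last index treats F - (I - G)^m F in the same way. *)
Definition detail N m (K k : nat) F n : R :=
  if (k < K)%N then \sum_(i <- iota 0 m) iter i (plus (2 ^ k * N)) (iter m (res (2 ^ k * N)) F) n
  else \sum_(i <- iota 0 m) iter i (res (2 ^ k * N)) F n.

Lemma detail_sum N m K F n :
  F n = iter m (res N) F n + \sum_(k < K.+1) GN (2 ^ k * N) (detail N m K k F) n.
Proof.
have h k : (k <= K)%N -> iter m (res (2 ^ k * N)) F n =
    iter m (res N) F n + \sum_(i < k) GN (2 ^ i * N) (detail N m K i F) n.
  elim: k => [|k IH] kK; first by rewrite big_ord0 addr0 expn0 mul1n.
  rewrite big_ord_recr /= addrA -IH ?(ltnW kK) // expnS -mulnA iter_res2.
  rewrite [X in _ + GN _ X n](_ : _ = (fun n => \sum_(i <- iota 0 m) iter i (plus (2 ^ k * N)) (iter m (res (2 ^ k * N)) F) n)); last first.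
    by apply/funext => n'; rewrite /detail kK.
  by rewrite -iter_plus_sub; ring.
rewrite big_ord_recr /= addrA -h //.
rewrite [X in _ + GN _ X n](_ : _ = (fun n => \sum_(i <- iota 0 m) iter i (res (2 ^ K * N)) F n)); last first.
  by apply/funext => n'; rewrite /detail ltnn.
by rewrite -iter_res_sub; ring.
Qed.

Lemma detail_bound N m K k F (A T : R) : (forall n, `|F n| <= A) ->
  (forall n, `|iter m (res (2 ^ k * N)) F n| <= T) ->
  forall n, `|detail N m K k F n| <= 2 ^+ m * (if (k < K)%N then T else A).
Proof.
move=> hA hT n; rewrite /detail; case: ifP => _.
  by apply: sum_iter_bound => //; exact: plus_bound.
by apply: sum_iter_bound => //; exact: res_bound.
Qed.

Definition inbox (Rb : nat) n : bool := [forall j, (`|n 0 j| <= Rb%:Z)%R].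
Definition cut (Rb : nat) E n : R := if inbox Rb n then E n else 0.

(** Outside the box the envelope centred at the origin exceeds expR (t Rb), while the semigroup only
    multiplies this envelope by its eigenvalue. *)
Lemma cut_tail N Rb E (A t B : R) n : (forall n, `|E n| <= A) -> 0 <= t ->
  (forall j, `|co j n| <= B) ->
  `|GN N E n - GN N (cut Rb E) n| <= A * (ecf t ^+ N * (2 * d%:R * expR (t * (B - Rb%:R)))).
Proof.
move=> hE t0 hB; have A0 : 0 <= A by apply: le_trans (hE 0).
rewrite -GN_sub.
have hh n' : `|E n' - cut Rb E n'| <= A * expR (- (t * Rb%:R)) * env t 0 n'.
  have env_ge0 : 0 <= env t 0 n' by apply: sumr_ge0 => j _; rewrite addr_ge0 ?expR_ge0.
  rewrite /cut; case: ifP => [_|/negbT]; first by rewrite subrr normr0 !mulr_ge0 ?expR_ge0.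
  rewrite negb_forall => /existsP[j hj]; rewrite subr0; apply: (le_trans (hE n')).
  rewrite -mulrA ler_peMr // /env (bigD1 j) //= mulrDr.
  rewrite ler_wpDr //; first by rewrite mulr_ge0 ?expR_ge0 // sumr_ge0 // => i _; rewrite addr_ge0 ?expR_ge0.
  have hj' : Rb%:R <= `|co j n'|.
    rewrite /co -intr_norm -[Rb%:R]/(Rb%:Z%:~R) ler_int ltW // ltNge //.
  have -> : co j 0 = 0 by rewrite /co mxE.
  rewrite subr0 mulrDr -!expRD.
  have e1 : 0 <= t * (`|co j n'| - Rb%:R) by rewrite mulr_ge0 // subr_ge0.
  case: (ger0P (co j n')) e1 => _ e1.
    rewrite ler_wpDr ?expR_ge0 // -[leLHS]expR0 ler_expR; lra.
  rewrite ler_wpDl ?expR_ge0 // -[leLHS]expR0 ler_expR; lra.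
apply: (le_trans (GN_norm N hh n)).
rewrite GN_scale GN_env -mulrA; apply: ler_wpM2l => //.
rewrite mulrCA; apply: ler_wpM2l.
  by rewrite exprn_ge0 // (le_trans _ (ecf_ge1 t)).
rewrite /env mulr_sumr.
have -> : 2 * d%:R * expR (t * (B - Rb%:R)) = \sum_(j < d) 2 * expR (t * (B - Rb%:R)).
  by rewrite sumr_const card_ord -[_ *+ d]mulr_natr; ring.
apply: ler_sum => j _; have -> : co j 0 = 0 by rewrite /co mxE.
rewrite subr0 mulrDr -!expRD mulr2n mulrDl !mul1r.
have := hB j; rewrite ler_norml => /andP[h1 h2].
apply: lerD; rewrite ler_expR.
  have : t * co j n <= t * B by rewrite ler_wpM2l. lra.
have : t * - co j n <= t * B by rewrite ler_wpM2l //; lra. lra.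
Qed.

End Telescope.
End Telescope.

(** * Plane waves and orthogonality of characters *)

Module PlaneWaves.
Import Heat Telescope.

Section Trig.
Variable R : realType.

(** Multiplication by 2 sin(w/2) makes the sum telescope to zero over a full period, and that factor
    is nonzero because 0 < |m| < P. *)
Lemma sum_cos_period (P : nat) (m : int) (phi : R) : (0 < P)%N -> m != 0 -> (`|m| < P%:Z)%R ->
  \sum_(t < P) cos (2 * pi * m%:~R / P%:R * t%:R + phi) = 0.
Proof.
move=> P0 m0 mP; have P0' : 0 < P%:R :> R by rewrite ltr0n.
set w := 2 * pi * m%:~R / P%:R.
have tele (n : nat) : 2 * sin (w / 2) * \sum_(t < n) cos (w * t%:R + phi) =
    sin (w * n%:R - w / 2 + phi) - sin (phi - w / 2).
  elim: n => [|n IH]; first by rewrite big_ord0 !mulr0 sub0r [- _ + _]addrC subrr.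
  rewrite big_ord_recr mulrDr IH -[n.+1%:R]natr1.
  have -> : w * (n%:R + 1) - w / 2 + phi = (w * n%:R + phi) + w / 2 by field.
  have -> : w * n%:R - w / 2 + phi = (w * n%:R + phi) - w / 2 by ring.
  by rewrite (sinB (w * n%:R + phi) (w / 2)) (sinD (w * n%:R + phi) (w / 2)); ring.
have wP : w * P%:R = 2 * pi * m%:~R by rewrite /w divfK // gt_eqF.
have per (k : int) (x : R) : sin (x + 2 * pi * k%:~R) = sin x.
  have nat_case (n : nat) (y : R) : sin (y + 2 * pi * n%:R) = sin y.
    elim: n y => [|n IH] y; first by rewrite mulr0 addr0.
    rewrite -[n.+1%:R]natr1 mulrDr mulr1 addrA.
    have -> : y + 2 * pi * n%:R + 2 * pi = (y + 2 * pi * n%:R) + pi *+ 2 by rewrite mulr2n; ring.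
    by rewrite sinD2pi IH.
  case: k => n; first exact: nat_case.
  rewrite NegzE mulrNz mulrN -[LHS](nat_case n.+1) -addrA [- _ + _]addrC subrr addr0 //.
have s0 : sin (w / 2) != 0.
  have -> : w / 2 = pi * m%:~R / P%:R by rewrite /w; field; rewrite gt_eqF.
  have key (k : nat) : (0 < k)%N -> (k < P)%N -> 0 < sin (pi * k%:R / P%:R : R).
    move=> k0 kP; apply: sin_gt0_pi; rewrite divr_gt0 ?mulr_gt0 ?pi_gt0 ?ltr0n //=.
    by rewrite ltr_pdivrMr // ltr_pM2l ?pi_gt0 // ltr_nat.
  case: m m0 mP {w tele wP} => n n0 nP.
    by rewrite gt_eqF // key //; lia.
  by rewrite NegzE mulrNz mulrN mulNr sinN oppr_eq0 gt_eqF // key //; lia.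
have := tele P; rewrite wP.
have -> : 2 * pi * m%:~R - w / 2 + phi = (phi - w / 2) + 2 * pi * m%:~R by ring.
rewrite per subrr => /eqP; rewrite mulf_eq0 mulf_eq0 (negbTE s0) orbF.
by rewrite pnatr_eq0 /= => /eqP.
Qed.

Lemma sin_ge_xcos (y : R) : 0 <= y -> y <= pi / 2 -> y * cos y <= sin y.
Proof.
rewrite le_eqVlt => /orP[/eqP <- _|y0 yp]; first by rewrite mul0r sin0.
pose f (x : R) := sin x - x * cos x.
have df (x : R) : is_derive x 1 f (x * sin x).
  rewrite /f; apply: is_derive_eq.
  rewrite /GRing.scale /=; ring.
have [|c] := @MVT R f (fun x => x * sin x) 0 y y0 (fun x _ => df x).
  by apply: derivable_within_continuous => x _; have [] := df x.
rewrite in_itv /= => /andP[c0 cy].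
rewrite /f sin0 mul0r !subr0 => h.
have : 0 <= c * sin c * y.
  rewrite !mulr_ge0 ?(ltW c0) ?(ltW y0) // sin_ge0_pi // (ltW c0) /=.
  have := pi_gt0 R; lra.
rewrite -h; lra.
Qed.

(** For y = |x|/2 <= 1, y cos y <= sin y implies y^2 <= 2 sin^2 y; hence cos x = 1 - 2 sin^2 y <= 1
    - x^2/4. *)
Lemma cos_le_exp (x : R) : `|x| <= pi / 2 -> 0 <= cos x /\ cos x <= expR (- (x ^+ 2 / 4)).
Proof.
move=> hx; have [/andP[p1 p2] _] := @pihalf_02_cos_pihalf R.
split; first by apply: cos_ge0_pihalf; move: hx; rewrite ler_norml.
apply: le_trans (expR_ge1Dx _).
pose y := `|x| / 2.
have y0 : 0 <= y by rewrite divr_ge0.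
have yp : y <= pi / 2 by rewrite /y; have := normr_ge0 x; lra.
have y1 : y <= 1 by rewrite /y; lra.
have -> : cos x = 1 - 2 * sin y ^+ 2.
  have -> : cos x = cos (y + y).
    have -> : y + y = `|x| by rewrite /y; field.
    by case: (ger0P x) => _ //; rewrite cosN.
  by rewrite cosD -!expr2; have := cos2Dsin2 y; lra.
have h := sin_ge_xcos y0 yp.
have cy : 0 <= cos y by apply: cos_ge0_pihalf; rewrite yp andbT; lra.
have h2 : (y * cos y) ^+ 2 <= sin y ^+ 2.
  by apply: lerXn2r => //; rewrite nnegrE ?mulr_ge0 // (le_trans _ h) // mulr_ge0.
have yx : y ^+ 2 = x ^+ 2 / 4 by rewrite /y expr_div_n real_normK ?num_real //; field.
rewrite -yx.
have y2 : y ^+ 2 <= 1 by rewrite expr_le1.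
have := cos2Dsin2 y; rewrite exprMn in h2 => cs.
have : y ^+ 2 * (1 - sin y ^+ 2) <= sin y ^+ 2 by have -> : 1 - sin y ^+ 2 = cos y ^+ 2 by lra.
have s1 : sin y ^+ 2 <= 1 by have := sqr_ge0 (cos y); lra.
have : y ^+ 2 * sin y ^+ 2 <= sin y ^+ 2 by rewrite ler_piMl // sqr_ge0.
lra.
Qed.

End Trig.

Section Waves.
Variable R : realType.
Variable d : nat.
Notation V := 'rV[int]_d.
Notation co := (Heat.co R).
Implicit Types (F H : V -> R) (n : V) (j : 'I_d).

Lemma Gl_local l (B : nat) F H : uniq l -> (forall n, inbox B.+1 n -> F n = H n) ->
  forall n, (forall j, (`|n 0 j| <= (B + (j \notin l))%N%:Z)%R) -> Gl l F n = Gl l H n.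
Proof.
elim: l => [|j l IH] ul hFH n hn.
  by apply: hFH; apply/forallP => j; have := hn j; rewrite in_nil addn1.
move: ul; rewrite cons_uniq => /andP[jl ul]; rewrite !Gl_cons /G1.
have aux (z : int) : (`|z| <= 1)%R -> Gl l F (n + z *: ev j) = Gl l H (n + z *: ev j).
  move=> hz; apply: IH => // i; have := hn i; rewrite inE !mxE eqxx /=.
  case: (eqVneq i j) => [->|ij] /=; last by rewrite mulr0 addr0.
  by rewrite jl mulr1; lia.
have := aux (-1) isT; have := aux 0 isT; have := aux 1 isT.
by rewrite scale1r scale0r scaleN1r addr0 => -> -> ->.
Qed.

(** One step reaches nearest neighbours only, so a function may be replaced by a periodised one that
    agrees with it on a box enlarged by the time. *)
Lemma GN_local N (B : nat) F H : (forall n, inbox (B + N) n -> F n = H n) ->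
  forall n, inbox B n -> GN N F n = GN N H n.
Proof.
elim: N B => [|N IH] B hFH n hn; first by apply: hFH; rewrite addn0.
rewrite /GN !iterS -/(GN N _) -/(GN N H); apply: (@Gl_local _ B) => //; first exact: enum_uniq.
  by apply: IH => n' hn'; apply: hFH; rewrite addnS -addSn.
by move=> j; rewrite mem_enum /= addn0; exact: (forallP hn).
Qed.

Definition dot (a : 'I_d -> R) n : R := \sum_j a j * co j n.

Lemma dotD a n j (z : int) : dot a (n + z *: ev j) = dot a n + z%:~R * a j.
Proof.
rewrite /dot; under eq_bigr do rewrite co_ev mulrDr.
rewrite big_split /=; congr (_ + _); rewrite (bigD1 j) //= eqxx mulr1 big1 ?addr0; first by rewrite mulrC.
by move=> i /negbTE ->; rewrite !mulr0.
Qed.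

Lemma Gl_cos l a (phi : R) n : uniq l ->
  Gl l (fun n => cos (dot a n + phi)) n = (\prod_(j <- l) cos (a j / 2) ^+ 2) * cos (dot a n + phi).
Proof.
elim: l n => [|j l IH] n; first by rewrite big_nil mul1r.
rewrite cons_uniq => /andP[jl ul]; rewrite Gl_cons /G1 !IH // big_cons.
have := dotD a n j 1; rewrite scale1r mul1r => ->.
have := dotD a n j (-1); rewrite scaleN1r mulrN1z mulN1r => ->.
have -> : dot a n - a j + phi = (dot a n + phi) - a j by ring.
have -> : dot a n + a j + phi = (dot a n + phi) + a j by ring.
rewrite (cosB (dot a n + phi) (a j)) (cosD (dot a n + phi) (a j)).
have -> : cos (a j) = 2 * cos (a j / 2) ^+ 2 - 1.
  have -> : cos (a j) = cos (a j / 2 + a j / 2) by congr cos; field.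
  by rewrite cosD -!expr2 [sin _ ^+ 2]sin2cos2; ring.
by field.
Qed.

Lemma GN_cos N a (phi : R) n :
  GN N (fun n => cos (dot a n + phi)) n = (\prod_j cos (a j / 2) ^+ (2 * N)) * cos (dot a n + phi).
Proof.
elim: N n => [|N IH] n.
  by rewrite /= (eq_bigr (fun=> 1)) ?big1_eq ?mul1r // => j _; rewrite muln0 expr0.
rewrite /GN iterS -/(GN N _).
set c := \prod_j cos (a j / 2) ^+ (2 * N) in IH.
have -> : GN N (fun n => cos (dot a n + phi)) =
  (fun n => c * cos (dot a n + phi) + 0 * cos (dot a n + phi)) by apply/funext => k; rewrite IH; ring.
rewrite /G Gl_lin Gl_cos ?enum_uniq // mul0r addr0 mulrA; congr (_ * _).
rewrite /c big_enum /= -big_split /=; apply: eq_bigr => j _.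
by rewrite -exprD; congr (_ ^+ _); lia.
Qed.

Section Lattice.
Variables (Q P : nat).
Hypothesis P_gt0 : (0 < P)%N.
Hypothesis PQ : (P <= Q)%N.
Notation K := 'I_(2 * Q).+1.

Definition klo : nat := (Q - P./2)%N.
(** Uniform weights on P consecutive integers around Q. Windows of all periods P are placed in one
    index type of size 2 Q + 1, so that different periods share their integer directions. *)
Definition kw (a : K) : R := if (klo <= a < klo + P)%N then P%:R^-1 else 0.
Definition kz (k : {ffun 'I_d -> K}) (j : 'I_d) : R := (k j : nat)%:R - Q%:R.

Lemma sum_kw (f : nat -> R) : \sum_(a : K) kw a * f a = P%:R^-1 * \sum_(t < P) f (klo + t)%N.
Proof.
rewrite /kw mulr_sumr.
transitivity (\sum_(0 <= a < (2 * Q).+1) (if (klo <= a < klo + P)%N then P%:R^-1 * f a else 0)).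
  by rewrite big_mkord; apply: eq_bigr => a _; case: ifP; rewrite ?mul0r.
have h2 : (P./2 <= P)%N by rewrite -[leqRHS]odd_double_half -addnn; lia.
have hP : (P <= P./2.*2.+1)%N by rewrite -{1}[P]odd_double_half; case: (odd P); lia.
rewrite (@big_cat_nat _ _ _ klo) //=; last by rewrite /klo; lia.
rewrite [X in X + _]big_nat_cond [X in X + _]big1 ?add0r; last first.
  by move=> a; rewrite andbT => /andP[_ h]; rewrite leqNgt h.
rewrite (@big_cat_nat _ _ _ (klo + P)) //=; last by rewrite /klo; lia.
  rewrite [X in _ + X]big_nat_cond [X in _ + X]big1 ?addr0; last first.
    by move=> a; rewrite andbT => /andP[h _]; rewrite ltnNge h andbF.
  rewrite -[X in \sum_(X <= _ < _) _]add0n big_addn addKn big_mkord; apply: eq_bigr => t _.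
  by rewrite addnC leq_addr ltn_add2l ltn_ord.
by rewrite leq_addr.
Qed.

Lemma sum_kw1 : \sum_(a : K) kw a = 1.
Proof.
transitivity (\sum_(a : K) kw a * 1); first by apply: eq_bigr => a _; rewrite mulr1.
by rewrite (sum_kw (fun=> 1)) sumr_const card_ord mulVf // pnatr_eq0 -lt0n.
Qed.

Notation kwt := (@Packing.wt R K kw d).

(** Redrawing a single coordinate j with [m j] nonzero already averages the wave over full periods
    and gives zero. *)
Lemma char_sum (m : 'I_d -> int) (phi : R) : (forall j, (`|m j| < P%:Z)%R) ->
  \sum_(k : {ffun 'I_d -> K}) kwt k * cos (2 * pi / P%:R * (\sum_j kz k j * (m j)%:~R) + phi) =
  if [forall j, m j == 0] then cos phi else 0.
Proof.
move=> hm; have P0' : 0 < P%:R :> R by rewrite ltr0n.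
case: ifP => [/forallP m0|/negbT].
  transitivity (\sum_(k : {ffun 'I_d -> K}) kwt k * cos phi).
    apply: eq_bigr => k _; rewrite big1 ?mulr0 ?add0r // => j _.
    by rewrite (eqP (m0 j)) mulr0.
  by rewrite -mulr_suml (Packing.sum_wt sum_kw1) mul1r.
rewrite negb_forall => /existsP[j mj].
rewrite (Packing.resample sum_kw1 j) big1 // => k _.
set S := (X in _ * X); suff -> : S = 0 by rewrite mulr0.
pose rest := \sum_(i | i != j) kz k i * (m i)%:~R.
pose f (a : nat) := cos (2 * pi * (m j)%:~R / P%:R * a%:R +
   (2 * pi / P%:R * (rest - Q%:R * (m j)%:~R) + phi)).
have -> : S = \sum_(a : K) kw a * f a.
  apply: eq_bigr => a _; congr (_ * cos _).
  rewrite (bigD1 j) //= (eq_bigr (fun i => kz k i * (m i)%:~R)); last first.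
    by move=> i ij; rewrite /kz ffunE (negbTE ij).
  by rewrite -/rest /kz ffunE eqxx; field; rewrite gt_eqF.
rewrite sum_kw /f.
under eq_bigr => t _ do rewrite natrD mulrDr -addrA addrCA.
rewrite sum_cos_period // ?mulr0 //.
Qed.

End Lattice.
End Waves.
End PlaneWaves.

(** * One-dimensional ridge profiles *)

Module RidgeProfile.
Import PlaneWaves.

Section Profile.
Variable R : realType.

Lemma cauchy_schwarz (I : finType) (a b : I -> R) :
  (\sum_i a i * b i) ^+ 2 <= (\sum_i a i ^+ 2) * (\sum_i b i ^+ 2).
Proof.
have h : 0 <= \sum_i \sum_j (a i * b j - a j * b i) ^+ 2.
  by apply: sumr_ge0 => i _; apply: sumr_ge0 => j _; exact: sqr_ge0.
have E : \sum_i \sum_j (a i * b j - a j * b i) ^+ 2 =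
   2 * ((\sum_i a i ^+ 2) * (\sum_i b i ^+ 2)) - 2 * (\sum_i a i * b i) ^+ 2.
  have -> : (\sum_i a i * b i) ^+ 2 = \sum_i \sum_j (a i * b i) * (a j * b j).
    by rewrite expr2 mulr_suml; apply: eq_bigr => i _; rewrite mulr_sumr.
  have -> : 2 * ((\sum_i a i ^+ 2) * (\sum_i b i ^+ 2)) =
     \sum_i \sum_j a i ^+ 2 * b j ^+ 2 + \sum_i \sum_j a j ^+ 2 * b i ^+ 2.
    rewrite mulr2n mulrDl mul1r [X in _ = _ + X]exchange_big /=.
    by rewrite mulr_suml; congr (_ + _); apply: eq_bigr => i _; rewrite mulr_sumr.
  rewrite mulr_sumr -!big_split /= -sumrB; apply: eq_bigr => i _.
  rewrite mulr_sumr -!big_split /= -sumrB; apply: eq_bigr => j _; ring.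
by move: h; rewrite E; lra.
Qed.

Lemma cs_sqrt (I : finType) (a b : I -> R) : (forall i, 0 <= a i) -> (forall i, 0 <= b i) ->
  \sum_i a i * b i <= Num.sqrt (\sum_i a i ^+ 2) * Num.sqrt (\sum_i b i ^+ 2).
Proof.
move=> a0 b0; have p0 : 0 <= \sum_i a i * b i by apply: sumr_ge0 => i _; exact: mulr_ge0.
rewrite -sqrtrM; last by apply: sumr_ge0 => i _; exact: sqr_ge0.
by rewrite -[leLHS]ger0_norm // -sqrtr_sqr ler_wsqrtr // cauchy_schwarz.
Qed.

Lemma sum_le_sqrt n (a : 'I_n -> R) : (forall i, 0 <= a i) ->
  \sum_i a i <= Num.sqrt n%:R * Num.sqrt (\sum_i a i ^+ 2).
Proof.
move=> a0; have := @cs_sqrt _ (fun=> 1) a (fun=> ler01) a0.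
have -> : \sum_(i < n) (fun=> 1) i * a i = \sum_i a i by apply: eq_bigr => i _; rewrite mul1r.
have -> // : \sum_(i < n) ((fun=> 1) i : R) ^+ 2 = n%:R.
by under eq_bigr do rewrite expr1n; rewrite sumr_const card_ord.
Qed.

Lemma abs_sin_le (x : R) : `|sin x| <= `|x|.
Proof.
have key (y : R) : 0 < y -> sin y <= y.
  move=> y0; have [|c _] := @MVT R sin cos 0 y y0 (fun x _ => is_derive_sin x).
    by apply: derivable_within_continuous => z _; have [] := is_derive_sin z.
  rewrite sin0 !subr0 => ->; rewrite ler_piMl ?(ltW y0) //; exact: cos_le1.
have keyN (y : R) : 0 < y -> - y <= sin y.
  move=> y0; have [|c _] := @MVT R sin cos 0 y y0 (fun x _ => is_derive_sin x).
    by apply: derivable_within_continuous => z _; have [] := is_derive_sin z.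
  rewrite sin0 !subr0 => ->; rewrite -mulN1r ler_wpM2r ?(ltW y0) //; exact: cos_geN1.
have key2 (y : R) : 0 < y -> `|sin y| <= y by move=> y0; rewrite ler_norml key ?keyN.
have [x0|x0|->] := ltrgt0P x; last by rewrite sin0 normr0.
  exact: key2.
by rewrite -normrN -sinN; apply: key2; rewrite oppr_gt0.
Qed.

Lemma one_sub_cos (x : R) : 0 <= 2 - 2 * cos x /\ 2 - 2 * cos x <= x ^+ 2.
Proof.
split; first by have := cos_le1 x; lra.
have -> : cos x = 1 - 2 * sin (x / 2) ^+ 2.
  have -> : cos x = cos (x / 2 + x / 2) by congr cos; field.
  by rewrite cosD -!expr2; have := cos2Dsin2 (x / 2); lra.
have : `|sin (x / 2)| ^+ 2 <= `|x / 2| ^+ 2 by rewrite lerXn2r ?nnegrE // abs_sin_le.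
by rewrite !real_normK ?num_real // expr_div_n; lra.
Qed.

(** Discrete Taylor formula: second differences are the masses of the kinks. Index 0 has no left
    neighbour and is accounted for by the initial slope. *)
Lemma second_difference_rep (f : nat -> R) (T : nat) n : (n <= T)%N ->
  f n = f 0%N + (f 1%N - f 0%N) * relu (n%:R : R) +
    \sum_(k < T) (if (k : nat) == 0%N then 0 else f k.+1 - 2 * f k + f k.-1) * relu (n%:R - k%:R).
Proof.
have reluN (a b : nat) : relu (a%:R - b%:R : R) = (a - b)%N%:R.
  rewrite /relu; have [ab|ab] := leqP b a; first by rewrite natrB // max_l // subr_ge0 ler_nat.
  have -> : (a - b = 0)%N by apply/eqP; rewrite subn_eq0 ltnW.
  by rewrite max_r // subr_le0 ler_nat ltnW.
have relu0 (a : nat) : relu (a%:R : R) = a%:R by rewrite /relu max_l.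
move=> nT; rewrite relu0.
have -> : \sum_(k < T) (if (k : nat) == 0%N then 0 else f k.+1 - 2 * f k + f k.-1) * relu (n%:R - k%:R) =
  \sum_(k < n) (if (k : nat) == 0%N then 0 else f k.+1 - 2 * f k + f k.-1) * (n%:R - k%:R).
  rewrite -(subnKC nT) big_split_ord /= [X in _ + X]big1 ?addr0.
    by apply: eq_bigr => k _; rewrite reluN natrB // ltnW.
  move=> k _; rewrite reluN; have -> : (n - (n + k) = 0)%N by lia. by rewrite mulr0.
have dif m : \sum_(k < m.+1) (if (k : nat) == 0%N then 0 else f k.+1 - 2 * f k + f k.-1) =
   f m.+1 - f m - (f 1%N - f 0%N).
  elim: m => [|m IH]; first by rewrite big_ord1 /= subrr.
  by rewrite big_ord_recr IH /=; ring.
elim: n {nT} => [|n IH]; first by rewrite big_ord0 mulr0 !addr0.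
have -> : \sum_(k < n.+1) (if (k : nat) == 0%N then 0 else f k.+1 - 2 * f k + f k.-1) * (n.+1%:R - k%:R) =
  \sum_(k < n) (if (k : nat) == 0%N then 0 else f k.+1 - 2 * f k + f k.-1) * (n%:R - k%:R) +
  \sum_(k < n.+1) (if (k : nat) == 0%N then 0 else f k.+1 - 2 * f k + f k.-1).
  transitivity (\sum_(k < n.+1) ((if (k : nat) == 0%N then 0 else f k.+1 - 2 * f k + f k.-1) * (n%:R - k%:R) +
     (if (k : nat) == 0%N then 0 else f k.+1 - 2 * f k + f k.-1))).
    by apply: eq_bigr => k _; rewrite -[n.+1%:R]natr1; ring.
  by rewrite big_split /= big_ord_recr /= subrr mulr0 addr0.
have -> : f n.+1 = f n + (f n.+1 - f n) by ring.
by rewrite dif {1}IH -[n.+1%:R]natr1; ring.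
Qed.

Variables (L Q : nat).
Hypothesis L_gt0 : (0 < L)%N.
Hypothesis LQ : (4 * L < Q)%N.

(** Frequencies L to 2 L - 1 in units of 2 pi/Q. Because 4 L < Q, their sums and their nonzero
    differences are not multiples of the period, which gives orthogonality over Q consecutive
    integers. *)
Definition fr (i : 'I_L) : R := 2 * pi * (L + i)%:R / Q%:R.
Definition prof (A B : 'I_L -> R) (t : R) : R := \sum_i (A i * cos (fr i * t) + B i * sin (fr i * t)).
Definition energy (A B : 'I_L -> R) : R := \sum_i (A i ^+ 2 + B i ^+ 2).

Let Q_gt0 : (0 < Q)%N. Proof. by apply: leq_ltn_trans LQ. Qed.
Let Q0 : 0 < Q%:R :> R. Proof. by rewrite ltr0n. Qed.

Lemma energy_ge0 A B : 0 <= energy A B.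
Proof. by apply: sumr_ge0 => i _; rewrite addr_ge0 ?sqr_ge0. Qed.

Definition wm : R := 4 * pi * L%:R / Q%:R.

Lemma fr_bound i : 0 <= fr i <= wm.
Proof.
rewrite /fr /wm; apply/andP; split.
  by rewrite !mulr_ge0 ?invr_ge0 // pi_ge0.
rewrite ler_pM2r ?invr_gt0 //.
have -> : 4 * pi * L%:R = 2 * pi * (2 * L)%:R :> R by rewrite natrM; ring.
rewrite ler_pM2l ?mulr_gt0 ?pi_gt0 // ler_nat; have := ltn_ord i; lia.
Qed.

Lemma trig_comb_le (a b x : R) : `|a * cos x + b * sin x| <= Num.sqrt (a ^+ 2 + b ^+ 2).
Proof.
rewrite -sqrtr_sqr ler_wsqrtr //.
have := cos2Dsin2 x; have : 0 <= (a * sin x - b * cos x) ^+ 2 by exact: sqr_ge0.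
move=> h cs; have -> : a ^+ 2 + b ^+ 2 = (a ^+ 2 + b ^+ 2) * (cos x ^+ 2 + sin x ^+ 2) by rewrite cs mulr1.
by lra.
Qed.

Lemma sum_sqrt_energy A B : \sum_i Num.sqrt (A i ^+ 2 + B i ^+ 2) <= Num.sqrt L%:R * Num.sqrt (energy A B).
Proof.
apply: le_trans (sum_le_sqrt _) _; first by move=> i; exact: sqrtr_ge0.
apply: ler_wpM2l; first exact: sqrtr_ge0.
rewrite ler_wsqrtr // /energy; apply: ler_sum => i _.
by rewrite sqr_sqrtr // addr_ge0 ?sqr_ge0.
Qed.

Lemma prof_le A B t : `|prof A B t| <= Num.sqrt L%:R * Num.sqrt (energy A B).
Proof.
apply: le_trans (sum_sqrt_energy A B); apply: le_trans (ler_norm_sum _ _ _) _.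
by apply: ler_sum => i _; exact: trig_comb_le.
Qed.

Lemma prof_dif_le A B t : `|prof A B (t + 1) - prof A B t| <= wm * (Num.sqrt L%:R * Num.sqrt (energy A B)).
Proof.
rewrite /prof -sumrB; apply: le_trans (ler_norm_sum _ _ _) _.
apply: le_trans (ler_wpM2l _ (sum_sqrt_energy A B)); last first.
  by have /andP[a b] := fr_bound (Ordinal L_gt0); exact: le_trans b.
rewrite mulr_sumr; apply: ler_sum => i _.
pose x := fr i * t + fr i / 2; pose y := fr i / 2.
have -> : fr i * (t + 1) = x + y by rewrite /x /y; field.
have -> : fr i * t = x - y by rewrite /x /y; ring.
rewrite (cosB x y) (sinB x y) (cosD x y) (sinD x y).
have -> : A i * (cos x * cos y - sin x * sin y) + B i * (sin x * cos y + cos x * sin y) -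
   (A i * (cos x * cos y + sin x * sin y) + B i * (sin x * cos y - cos x * sin y)) =
   2 * sin y * (B i * cos x + (- A i) * sin x) by ring.
rewrite normrM; apply: ler_pM => //.
  have /andP[f0 f1] := fr_bound i.
  rewrite normrM ger0_norm //; have := abs_sin_le y; rewrite /y (ger0_norm (divr_ge0 f0 _)) //; lra.
by apply: le_trans (trig_comb_le _ _ _) _; rewrite sqrrN addrC.
Qed.

Lemma prof_dif2 A B t : prof A B (t + 1) - 2 * prof A B t + prof A B (t - 1) =
  prof (fun i => - (2 - 2 * cos (fr i)) * A i) (fun i => - (2 - 2 * cos (fr i)) * B i) t.
Proof.
rewrite /prof mulr_sumr -sumrB -big_split /=; apply: eq_bigr => i _.
have -> : fr i * (t + 1) = fr i * t + fr i by ring.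
have -> : fr i * (t - 1) = fr i * t - fr i by ring.
by rewrite (cosB (fr i * t)) (sinB (fr i * t)) (cosD (fr i * t)) (sinD (fr i * t)); ring.
Qed.

Lemma sum_cos_shift (m : int) (a phi : R) : m != 0 -> (`|m| < Q%:Z)%R ->
  \sum_(t < Q) cos (2 * pi * m%:~R / Q%:R * (t%:R + a) + phi) = 0.
Proof.
move=> m0 mQ; rewrite -[RHS](sum_cos_period (2 * pi * m%:~R / Q%:R * a + phi) Q_gt0 m0 mQ).
by apply: eq_bigr => t _; rewrite mulrDr addrA.
Qed.

Lemma sum_sin_shift (m : int) (a : R) : m != 0 -> (`|m| < Q%:Z)%R ->
  \sum_(t < Q) sin (2 * pi * m%:~R / Q%:R * (t%:R + a)) = 0.
Proof.
move=> m0 mQ; rewrite -[RHS](sum_cos_shift a (- (pi / 2)) m0 mQ).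
by apply: eq_bigr => t _; rewrite cosB cos_pihalf sin_pihalf mulr0 mulr1 add0r.
Qed.

(** By orthogonality the sum equals Q/2 times the energy, for any shift a. *)
Lemma sum_prof_sqr A B a : \sum_(t < Q) prof A B (t%:R + a) ^+ 2 <= Q%:R * energy A B.
Proof.
have expand t : prof A B t ^+ 2 = \sum_i \sum_k 2^-1 *
   ((A i * A k + B i * B k) * cos (2 * pi * (Posz i - Posz k)%:~R / Q%:R * t) +
    (B i * A k - A i * B k) * sin (2 * pi * (Posz i - Posz k)%:~R / Q%:R * t) +
    (A i * A k - B i * B k) * cos (2 * pi * (Posz (L + i) + Posz (L + k))%:~R / Q%:R * t) +
    (A i * B k + B i * A k) * sin (2 * pi * (Posz (L + i) + Posz (L + k))%:~R / Q%:R * t)).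
  rewrite expr2 {1}/prof mulr_suml; apply: eq_bigr => i _; rewrite mulr_sumr; apply: eq_bigr => k _.
  have -> : 2 * pi * (Posz i - Posz k)%:~R / Q%:R * t = fr i * t - fr k * t.
    by rewrite /fr intrB !natrD -!pmulrn; field; rewrite gt_eqF.
  have -> : 2 * pi * (Posz (L + i) + Posz (L + k))%:~R / Q%:R * t = fr i * t + fr k * t.
    by rewrite /fr intrD -!pmulrn; field; rewrite gt_eqF.
  by rewrite (cosB (fr i * t)) (sinB (fr i * t)) (cosD (fr i * t)) (sinD (fr i * t)); field.
under eq_bigr => t _ do rewrite expand.
rewrite exchange_big /= mulr_sumr; apply: ler_sum => i _.
have hsum (k : 'I_L) : (`|Posz (L + i) + Posz (L + k)| < Q%:Z)%R /\ Posz (L + i) + Posz (L + k) != 0.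
  have := ltn_ord i; have := ltn_ord k; move: LQ L_gt0; clear; lia.
have inner (k : 'I_L) : \sum_(t < Q) 2^-1 *
   ((A i * A k + B i * B k) * cos (2 * pi * (Posz i - Posz k)%:~R / Q%:R * (t%:R + a)) +
    (B i * A k - A i * B k) * sin (2 * pi * (Posz i - Posz k)%:~R / Q%:R * (t%:R + a)) +
    (A i * A k - B i * B k) * cos (2 * pi * (Posz (L + i) + Posz (L + k))%:~R / Q%:R * (t%:R + a)) +
    (A i * B k + B i * A k) * sin (2 * pi * (Posz (L + i) + Posz (L + k))%:~R / Q%:R * (t%:R + a))) =
   if k == i then 2^-1 * Q%:R * (A i ^+ 2 + B i ^+ 2) else 0.
  rewrite -mulr_sumr !big_split /= -!mulr_sumr.
  have [h1 h2] := hsum k.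
  have -> : \sum_(t < Q) cos (2 * pi * (Posz (L + i) + Posz (L + k))%:~R / Q%:R * (t%:R + a)) = 0.
    by have := sum_cos_shift a 0 h2 h1; under eq_bigr do rewrite addr0.
  rewrite (sum_sin_shift a h2 h1) !mulr0 !addr0.
  have [->|ki] := eqVneq k i.
    have -> : B i * A i - A i * B i = 0 by ring.
    rewrite mul0r addr0 subrr; under eq_bigr do rewrite mulr0 !mul0r cos0.
    by rewrite sumr_const card_ord; ring.
  have d0 : Posz i - Posz k != 0 by rewrite subr_eq0 eqz_nat eq_sym.
  have d1 : (`|Posz i - Posz k| < Q%:Z)%R.
    by have := ltn_ord i; have := ltn_ord k; move: LQ; clear; lia.
  rewrite (sum_sin_shift a d0 d1) mulr0 addr0.
  have := sum_cos_shift a 0 d0 d1; under eq_bigr do rewrite addr0.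
  by move=> ->; rewrite !mulr0.
rewrite exchange_big /=; under eq_bigr => k _ do rewrite inner.
rewrite (bigD1 i) //= eqxx big1 ?addr0; last by move=> k /negbTE ->.
have e0 : 0 <= Q%:R * (A i ^+ 2 + B i ^+ 2) by rewrite mulr_ge0 // ?addr_ge0 ?sqr_ge0 // ltW.
lra.
Qed.

Lemma sum_prof_sqr_long A B a (n : nat) :
  \sum_(t < n) prof A B (t%:R + a) ^+ 2 <= (n + Q)%:R * energy A B.
Proof.
have win (W : nat) : \sum_(t < W * Q) prof A B (t%:R + a) ^+ 2 <= (W * Q)%:R * energy A B.
  elim: W => [|W IH]; first by rewrite mul0n big_ord0 mul0r.
  rewrite mulSn addnC big_split_ord /= natrD mulrDl; apply: lerD => //.
  apply: le_trans (sum_prof_sqr A B ((W * Q)%:R + a)).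
  apply: ler_sum => t _ /=.
  by have -> : (W * Q + t)%:R + a = t%:R + ((W * Q)%:R + a) by rewrite natrD; ring.
have nW : (n <= (n %/ Q).+1 * Q)%N by rewrite ltnW // ltn_ceil.
apply: (@le_trans _ _ (\sum_(t < (n %/ Q).+1 * Q) prof A B (t%:R + a) ^+ 2)).
  rewrite -(subnKC nW) big_split_ord /= lerDl sumr_ge0 // => t _; exact: sqr_ge0.
apply: (le_trans (win _)); apply: ler_wpM2r; first exact: energy_ge0.
by rewrite ler_nat mulSn addnC leq_add2r leq_trunc_div.
Qed.

(** The l1 norm of the second differences is estimated through the l2 norm, where orthogonality
    avoids the factor sqrt L that the termwise bounds on values and slopes contain. *)
Lemma sum_dif2_le A B a (n : nat) :
  \sum_(t < n) `|prof A B (t%:R + a + 1) - 2 * prof A B (t%:R + a) + prof A B (t%:R + a - 1)| <=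
  Num.sqrt n%:R * (Num.sqrt (n + Q)%:R * (wm ^+ 2 * Num.sqrt (energy A B))).
Proof.
apply: le_trans (sum_le_sqrt _) _ => //; apply: ler_wpM2l; first exact: sqrtr_ge0.
under eq_bigr => t _ do rewrite real_normK ?num_real // prof_dif2.
pose A' i := - (2 - 2 * cos (fr i)) * A i; pose B' i := - (2 - 2 * cos (fr i)) * B i.
rewrite -/A' -/B'.
have wm0 : 0 <= wm by have /andP[x y] := fr_bound (Ordinal L_gt0); exact: le_trans y.
have en : energy A' B' <= wm ^+ 4 * energy A B.
  rewrite /energy mulr_sumr; apply: ler_sum => i _.
  have -> : A' i ^+ 2 + B' i ^+ 2 = (2 - 2 * cos (fr i)) ^+ 2 * (A i ^+ 2 + B i ^+ 2) by rewrite /A' /B'; ring.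
  apply: ler_wpM2r; first by rewrite addr_ge0 ?sqr_ge0.
  have [c0 c1] := one_sub_cos (fr i); have /andP[f0 f1] := fr_bound i.
  have -> : wm ^+ 4 = (wm ^+ 2) ^+ 2 by rewrite -exprM.
  rewrite ler_sqr ?nnegrE ?exprn_ge0 //; apply: (le_trans c1).
  by rewrite ler_sqr ?nnegrE.
rewrite [wm ^+ 2 * _](_ : _ = Num.sqrt (wm ^+ 4 * energy A B)); last first.
  have -> : wm ^+ 4 = (wm ^+ 2) ^+ 2 by rewrite -exprM.
  by rewrite sqrtrM ?exprn_ge0 // sqrtr_sqr ger0_norm // exprn_ge0.
rewrite -sqrtrM // ler_wsqrtr //; apply: (le_trans (sum_prof_sqr_long _ _ _ _)).
exact: ler_wpM2l.
Qed.

End Profile.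
End RidgeProfile.

(** * Networks reproducing the heat semigroup on the lattice *)

Module Representation.
Import Heat Telescope PlaneWaves RidgeProfile Networks NetApprox.

Section CostLe.
Variables (R : realType) (d : nat).

Lemma cost_le_add (f g : 'rV[R]_d -> R) M M' : cost_le f M -> cost_le g M' ->
  cost_le (fun x => f x + g x) (M + M').
Proof.
move=> [I [c [v [h1 h2]]]] [J [c' [v' [h1' h2']]]].
exists (I + J)%type, (fun s => match s with inl i => c i | inr j => c' j end),
  (fun s => match s with inl i => v i | inr j => v' j end); split.
  by rewrite big_sumType /=; exact: lerD.
by move=> x hx; rewrite big_sumType /= h2 // h2'.
Qed.

Lemma cost_le_single (c : R) (v : 'rV[R]_d.+1) :
  cost_le (fun x => c * relu (aff x v)) (`|c| * norm2 v).
Proof.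
exists 'I_1, (fun=> c), (fun=> v); split; first by rewrite big_ord1.
by move=> x _; rewrite big_ord1.
Qed.

Lemma cost_le0 : cost_le (fun _ : 'rV[R]_d => 0 : R) 0.
Proof.
exists 'I_0, (fun=> 0), (fun=> 0); split; first by rewrite big_ord0.
by move=> x _; rewrite big_ord0.
Qed.

Lemma cost_le_weak (f : 'rV[R]_d -> R) M M' : M <= M' -> cost_le f M -> cost_le f M'.
Proof. by move=> MM [I [c [v [h1 h2]]]]; exists I, c, v; split=> //; exact: le_trans MM. Qed.

Lemma cost_le_sum (J : Type) (r : seq J) (f : J -> 'rV[R]_d -> R) (M : J -> R) :
  (forall j, cost_le (f j) (M j)) ->
  cost_le (fun x => \sum_(j <- r) f j x) (\sum_(j <- r) M j).
Proof.
move=> h; elim: r => [|j r IH].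
  rewrite big_nil; have -> : (fun x => \sum_(j <- [::]) f j x) = (fun=> 0 : R) by apply/funext => x; rewrite big_nil.
  exact: cost_le0.
rewrite big_cons; have -> : (fun x => \sum_(j <- j :: r) f j x) = (fun x => f j x + \sum_(i <- r) f i x).
  by apply/funext => x; rewrite big_cons.
exact: cost_le_add.
Qed.

End CostLe.

Section Rep.
Variables (R : realType) (d : nat).
Notation V := 'rV[int]_d.
Notation co := (Heat.co R).
Variables (N B0 Rb L Q : nat) (Pf : 'I_L -> nat) (c : V -> R).
Hypothesis L_gt0 : (0 < L)%N.
Hypothesis B0_gt0 : (0 < B0)%N.
Hypothesis LQ : (4 * L < Q)%N.
Hypothesis PfQ : forall i : 'I_L, ((L + i) * Pf i = Q)%N.
Hypothesis Pf_big : forall i, (B0 + N + Rb < Pf i)%N.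
Hypothesis Pf_big2 : forall i, (2 * Rb < Pf i)%N.
Hypothesis c_supp : forall n, ~~ inbox Rb n -> c n = 0.

Let Q_gt0 : (0 < Q)%N. Proof. exact: leq_ltn_trans LQ. Qed.
Let Pf_gt0 i : (0 < Pf i)%N. Proof. exact: leq_ltn_trans (Pf_big i). Qed.
Let Pf_le i : (Pf i <= Q)%N.
Proof. by rewrite -(PfQ i) leq_pmull // addn_gt0 L_gt0. Qed.

Notation Y := {ffun 'I_d -> 'I_(2 * Rb).+1}.
Notation K := {ffun 'I_d -> 'I_(2 * Q).+1}.

Definition yv (y : Y) : V := \row_j (Posz (y j) - Posz Rb).
Notation dz k n := (dot (kz R k) n).
Notation kwt i k := (@Packing.wt R _ (kw R (Q := Q) (Pf i)) d k).
Definition damp (i : 'I_L) (k : K) : R := \prod_j cos (fr R Q i * kz R k j / 2) ^+ (2 * N).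

Lemma yv_inj : injective yv.
Proof.
move=> y y' /rowP h; apply/ffunP => j; have := h j; rewrite !mxE => /addIr [].
by move=> /val_inj.
Qed.

Lemma yv_le y j : (`|yv y 0 j| <= Rb%:Z)%R.
Proof. by rewrite mxE; have := ltn_ord (y j); lia. Qed.

Lemma box_sum n : \sum_y c (yv y) * (yv y == n)%:R = c n.
Proof.
have [nb|nb] := boolP (inbox Rb n).
  have [y yn] : exists y, yv y = n.
    exists [ffun j => inord (absz (n 0 j + Posz Rb))]; apply/rowP => j; rewrite mxE ffunE.
    have /= hj := forallP nb j; rewrite inordK; last by move: hj; clear; lia.
    by move: hj; clear; lia.
  rewrite (bigD1 y) //= yn eqxx mulr1 big1 ?addr0 // => y' yy.
  by rewrite -yn (inj_eq yv_inj) (negbTE yy) mulr0.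
rewrite c_supp // big1 // => y _; case: eqP => [E|]; last by rewrite mulr0.
by move: nb; rewrite -E; case/negP; apply/forallP => j; exact: yv_le.
Qed.

Lemma frE i : fr R Q i = 2 * pi / (Pf i)%:R.
Proof.
have a0 : (L + i)%:R != 0 :> R by rewrite pnatr_eq0 -lt0n addn_gt0 L_gt0.
have b0 : (Pf i)%:R != 0 :> R by rewrite pnatr_eq0 -lt0n.
rewrite /fr -{1}(PfQ i) natrM; move: ((L + i)%:R) ((Pf i)%:R) a0 b0 => a b a0 b0.
by field; rewrite a0 b0.
Qed.

Lemma char_sum_diff i (n n' : V) (phi : R) : (forall j, (`|n 0 j - n' 0 j| < (Pf i)%:Z)%R) ->
  \sum_(k : K) kwt i k * cos (fr R Q i * (dz k n - dz k n') + phi) = (n' == n)%:R * cos phi.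
Proof.
move=> h.
have := @char_sum R d Q (Pf i) (Pf_gt0 i) (Pf_le i) (fun j => n 0 j - n' 0 j) phi h.
have -> : [forall j, n 0 j - n' 0 j == 0] = (n' == n).
  apply/forallP/eqP => [hh|-> j]; last by rewrite subrr.
  by apply/rowP => j; have := hh j; rewrite subr_eq0 => /eqP.
move=> E; transitivity (if n' == n then cos phi else 0); last by case: (_ == _); rewrite ?mul1r ?mul0r.
rewrite -E; apply: eq_bigr => k _; congr (_ * cos (_ + _)); rewrite frE; congr (_ * _).
rewrite /dot -sumrB; apply: eq_bigr => j _; rewrite /Heat.co intrB; ring.
Qed.

(** A period larger than the boxes involved makes the periodised function indistinguishable from [c]
    on the box; each wave is then multiplied by its eigenvalue [damp]. *)
Lemma gn_rep i n : inbox B0 n -> GN N c n =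
  \sum_(k : K) \sum_y kwt i k * damp i k * (c (yv y) * cos (fr R Q i * (dz k n - dz k (yv y)))).
Proof.
move=> nB.
pose a (k : K) j := fr R Q i * kz R k j.
have dotE k n' : dot (a k) n' = fr R Q i * dz k n' by rewrite /dot mulr_sumr; apply: eq_bigr => j _; rewrite /a mulrA.
pose term (k : K) (y : Y) n' := kwt i k * c (yv y) * cos (dot (a k) n' - fr R Q i * dz k (yv y)).
have perE n' : inbox (B0 + N) n' -> c n' = \sum_(p <- index_enum (K * Y)%type) term p.1 p.2 n'.
  move=> n'b.
  have -> : \sum_(p <- index_enum (K * Y)%type) term p.1 p.2 n' = \sum_y \sum_k term k y n'.
    by rewrite exchange_big /= pair_bigA /=.
  rewrite -box_sum; apply: eq_bigr => y _.
  have := @char_sum_diff i n' (yv y) 0 _; rewrite cos0 mulr1 => <-; last first.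
    by move=> j; have /= := forallP n'b j; have := yv_le y j; have := Pf_big i; clear; lia.
  rewrite mulr_sumr; apply: eq_bigr => k _; rewrite /term dotE addr0 -mulrBr; ring.
rewrite (GN_local perE nB) GN_sum.
transitivity (\sum_(p : K * Y) kwt i p.1 * damp i p.1 * (c (yv p.2) * cos (fr R Q i * (dz p.1 n - dz p.1 (yv p.2))))).
  apply: eq_bigr => -[k y] _ /=; rewrite /term GN_scale GN_cos dotE -mulrBr /damp /a; ring.
by rewrite [RHS]pair_bigA /=.
Qed.

Definition coA (k : K) (i : 'I_L) : R :=
  L%:R^-1 * (kwt i k * damp i k * \sum_y c (yv y) * cos (fr R Q i * dz k (yv y))).
Definition coB (k : K) (i : 'I_L) : R :=
  L%:R^-1 * (kwt i k * damp i k * \sum_y c (yv y) * sin (fr R Q i * dz k (yv y))).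

(** Averaging over the L periods Q/(L+i) collects, for each integer direction k, the waves of all
    these periods into one profile with L frequencies. *)
Lemma rep n : inbox B0 n -> GN N c n = \sum_(k : K) prof Q (coA k) (coB k) (dz k n).
Proof.
move=> nB.
have -> : GN N c n = \sum_(i < L) L%:R^-1 * GN N c n.
  by rewrite sumr_const card_ord -[_ *+ L]mulr_natl mulrA divff ?mul1r // pnatr_eq0 -lt0n.
under eq_bigr => i _ do rewrite (gn_rep i nB) mulr_sumr.
rewrite exchange_big /=; apply: eq_bigr => k _; rewrite /prof; apply: eq_bigr => i _.
rewrite -mulr_sumr.
have -> : \sum_y c (yv y) * cos (fr R Q i * (dz k n - dz k (yv y))) =
  (\sum_y c (yv y) * cos (fr R Q i * dz k (yv y))) * cos (fr R Q i * dz k n) +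
  (\sum_y c (yv y) * sin (fr R Q i * dz k (yv y))) * sin (fr R Q i * dz k n).
  rewrite !mulr_suml -big_split /=; apply: eq_bigr => y _.
  by rewrite mulrBr cosB; ring.
by rewrite /coA /coB; ring.
Qed.

(** Bounds |k.n| on the box, so the profile has to be resolved on an interval of twice this
    length. *)
Definition tlen (k : K) : nat := (B0 * \sum_j absz (Posz (k j) - Posz Q)%R)%N.

Definition latpt n : 'rV[R]_d := \row_j (co j n / B0%:R).

Lemma kz_norm (k : K) j : `|kz R k j| = (absz (Posz (k j) - Posz Q))%:R.
Proof. by rewrite /kz natr_absz intr_norm intrB -!pmulrn. Qed.

Lemma tlenE (k : K) : (tlen k)%:R = B0%:R * \sum_j `|kz R k j|.
Proof. by rewrite /tlen natrM natr_sum; congr (_ * _); apply: eq_bigr => j _; rewrite kz_norm. Qed.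

(** Costs of the constant, the initial slope and the kinks; the last two use directions of norm at
    most 2 [tlen k]. *)
Definition ridge_bound (k : K) (E : R) : R :=
  Num.sqrt L%:R * E + 2 * (tlen k)%:R * (wm R L Q * (Num.sqrt L%:R * E) +
   Num.sqrt (2 * tlen k)%:R * (Num.sqrt (2 * tlen k + Q)%:R * (wm R L Q ^+ 2 * E))).

Lemma ridge_net (A B : 'I_L -> R) (k : K) : exists f,
  cost_le f (ridge_bound k (Num.sqrt (energy A B))) /\
  forall n, inbox B0 n -> f (latpt n) = prof Q A B (dz k n).
Proof.
set T := tlen k; set p := prof Q A B.
have B0' : B0%:R != 0 :> R by rewrite pnatr_eq0 -lt0n.
(* After a shift by [T] the values of k.n are integers from 0 to 2 T. At the lattice points n/B0 the
   kinks sit exactly at integers, so the resolution into units is exact there. *)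
pose vv (t : nat) : 'rV[R]_d.+1 := pt ord_max (T%:R - t%:R) (fun j => B0%:R * kz R k j).
have affv t n : aff (latpt n) (vv t) = dz k n + T%:R - t%:R.
  rewrite aff_pt /chl /ext unlift_none mulr1 -addrA; congr (_ + _).
  apply: eq_bigr => j _; rewrite liftK mxE; field; exact: B0'.
have nvv t : (t <= 2 * T)%N -> norm2 (vv t) <= 2 * T%:R.
  move=> tT; apply: le_trans (norm2_le_sum _) _; rewrite (bigD1_ord ord_max) //= mxE unlift_none.
  have -> : \sum_(j < d) `|vv t 0 (lift ord_max j)| = T%:R.
    rewrite /T tlenE mulr_sumr; apply: eq_bigr => j _; rewrite mxE liftK normrM ger0_norm //.
  have : `|T%:R - t%:R : R| <= T%:R; last by lra.
  rewrite ler_norml; have : t%:R <= 2 * T%:R :> R by rewrite -natrM ler_nat. 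
  by have : 0 <= t%:R :> R by []; lra.
pose one : 'rV[R]_d.+1 := pt ord_max 1 (fun=> 0).
have affone x : aff x one = 1.
  rewrite aff_pt /chl /ext unlift_none mulr1 big1 ?add0r // => j _; by rewrite mulr0.
have none : norm2 one <= 1.
  apply: le_trans (norm2_le_sum _) _; rewrite (bigD1_ord ord_max) //= mxE unlift_none normr1.
  by rewrite big1 ?addr0 // => j _; rewrite mxE liftK normr0.
pose f0 (t : nat) := p (t%:R - T%:R).
pose D (t : nat) := if t == 0%N then 0 else f0 t.+1 - 2 * f0 t + f0 t.-1.
pose f x := f0 0%N * relu (aff x one) + (f0 1%N - f0 0%N) * relu (aff x (vv 0%N)) +
   \sum_(t <- index_enum 'I_(2 * T)) D t * relu (aff x (vv t)).
exists f; split.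
  have h : cost_le f (`|f0 0%N| * norm2 one + `|f0 1%N - f0 0%N| * norm2 (vv 0%N) +
     \sum_(t <- index_enum 'I_(2 * T)) `|D t| * norm2 (vv t)).
    apply: cost_le_add; first by apply: cost_le_add; exact: cost_le_single.
    by apply: cost_le_sum => t; exact: cost_le_single.
  apply: cost_le_weak h; rewrite /ridge_bound -/T -addrA mulrDr; apply: lerD.
    rewrite -[leRHS]mulr1; apply: ler_pM => //; first exact: norm2_ge0.
    exact: prof_le.
  apply: lerD.
    rewrite [leRHS]mulrC; apply: ler_pM => //; first exact: norm2_ge0.
      have := @prof_dif_le R L Q L_gt0 LQ A B (0%:R - T%:R); rewrite /f0 -/p.
      by have -> : 0%:R - T%:R + 1 = 1%:R - T%:R :> R by ring.
    exact: nvv.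
  have := @sum_dif2_le R L Q L_gt0 LQ A B (- T%:R) (2 * T)%N => hs.
  rewrite [leRHS]mulrC; apply: le_trans (ler_wpM2r _ hs); last by rewrite mulr_ge0.
  rewrite mulr_suml; apply: ler_sum => t _; apply: ler_pM => //; first exact: norm2_ge0.
    rewrite /D; case: eqP => [_|/eqP t0]; first by rewrite normr0.
    have tp : (t : nat).-1.+1 = t by rewrite prednK // lt0n.
    rewrite /f0 -/p.
    have -> : t.+1%:R - T%:R = t%:R - T%:R + 1 :> R by rewrite -[t.+1%:R]natr1; ring.
    have -> // : t.-1%:R - T%:R = t%:R - T%:R - 1 :> R by rewrite -{2}tp -[t.-1.+1%:R]natr1; ring.
  by apply: nvv; exact: ltnW.
move=> n nB; rewrite /f affone affv subr0.
pose tz : int := \sum_j (Posz (k j) - Posz Q) * n 0 j.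
have tzE : dz k n = tz%:~R.
  rewrite /dot /tz rmorph_sum /=; apply: eq_bigr => j _.
  by rewrite intrM intrB /kz /Heat.co -!pmulrn.
have tzT : (`|tz| <= T%:Z)%R.
  apply: le_trans (ler_norm_sum _ _ _) _.
  have -> : T%:Z = (\sum_j `|Posz (k j) - Posz Q| * B0%:Z)%R.
    rewrite -mulr_suml mulrC /T /tlen PoszM; congr (_ * _).
    by rewrite (raddf_sum Posz) /=; apply: eq_bigr => j _; rewrite abszE.
  by apply: ler_sum => j _; rewrite normrM ler_wpM2l // (forallP nB).
pose m := absz (tz + T%:Z).
have mE : m%:R = dz k n + T%:R :> R.
  rewrite tzE /m natr_absz ger0_norm; last by move: tzT; lia.
  by rewrite intrD -pmulrn.
have m2T : (m <= 2 * T)%N by rewrite /m; move: tzT; lia.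
have relu1 : relu (1 : R) = 1 by rewrite /relu max_l.
have -> : p (dz k n) = f0 m by rewrite /f0 mE addrK.
rewrite (second_difference_rep f0 m2T) relu1 mulr1 -mE; congr (_ + _).
by apply: eq_bigr => t _; rewrite affv -mE.
Qed.

(** The window is centred, so its members are at most half a period and the phases in [damp] stay
    within pi/2, as [cos_le_exp] requires. *)
Lemma half_window_le (P' Q' k : nat) : (P' <= Q')%N -> (klo Q' P' <= k < klo Q' P' + P')%N ->
  (absz (Posz k - Posz Q')%R * 2 <= P')%N.
Proof.
rewrite /klo; have := odd_double_half P'; rewrite -addnn; move: (P'./2) => m.
by case: (odd P') => /= <-; clear; lia.
Qed.

Section Sum.
Hypothesis N_gt0 : (0 < N)%N.
Hypothesis H1 : B0%:R <= Num.sqrt N%:R * L%:R :> R.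
Hypothesis H2 : Num.sqrt N%:R * L%:R <= Q%:R :> R.

Let Q0 : 0 < Q%:R :> R. Proof. by rewrite ltr0n. Qed.
Let L0 : 0 < L%:R :> R. Proof. by rewrite ltr0n. Qed.
Let sN0 : 0 < Num.sqrt N%:R :> R. Proof. by rewrite sqrtr_gt0 ltr0n. Qed.

(** Frequency in the unit in which the damping is Gaussian of width of order one. [om] is a summable
    weight for Cauchy-Schwarz over the directions, and [rk] the ridge length relative to the common
    period Q. *)
Definition xk (k : K) j : R := Num.sqrt N%:R * L%:R * `|kz R k j| / Q%:R.
Definition om (k : K) : R := \prod_j (1 + xk k j ^+ 2)^-1.
Definition rk (k : K) : R := (tlen k)%:R / Q%:R.

Lemma xk_ge0 k j : 0 <= xk k j.
Proof. by rewrite /xk !mulr_ge0 ?invr_ge0 ?sqrtr_ge0. Qed.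

Lemma om_gt0 k : 0 < om k.
Proof. by apply: prodr_gt0 => j _; rewrite invr_gt0 ltr_pwDl // sqr_ge0. Qed.

Lemma rk_ge0 k : 0 <= rk k. Proof. by rewrite divr_ge0. Qed.

Lemma kwt_sqr i k : kwt i k ^+ 2 <= (Pf i)%:R^-1 ^+ d * kwt i k.
Proof.
rewrite /Packing.wt -prodrXl.
have -> : (Pf i)%:R^-1 ^+ d = \prod_(j < d) (Pf i)%:R^-1 :> R by rewrite prodr_const card_ord.
rewrite -big_split /=; apply: ler_prod => j _; rewrite sqr_ge0 /= /kw.
by case: ifP => _; rewrite ?mulr0 ?expr0n // expr2.
Qed.

Lemma prod_ge_sum (I : finType) (x : I -> R) : (forall i, 0 <= x i) ->
  1 + \sum_i x i <= \prod_i (1 + x i).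
Proof.
move=> x0; suff /andP[] : (1 + \sum_i x i <= \prod_i (1 + x i)) && (0 <= \sum_i x i) by [].
elim/big_rec2: _ => [|i y z _ /andP[h hz]]; first by rewrite addr0 !lexx.
rewrite addr_ge0 ?x0 // andbT.
apply: (@le_trans _ _ ((1 + x i) * (1 + y))); last by rewrite ler_wpM2l // addr_ge0.
have : 0 <= x i * y by rewrite mulr_ge0 ?x0.
lra.
Qed.

Lemma rk_le k : 1 + rk k <= \prod_j (1 + xk k j).
Proof.
apply: le_trans (prod_ge_sum (xk_ge0 k)); rewrite lerD2l /rk tlenE mulr_sumr mulr_suml.
apply: ler_sum => j _; rewrite /xk; apply: ler_wpM2r; first by rewrite invr_ge0.
exact: ler_wpM2r.
Qed.

Lemma exp_poly_bound (x : R) : 0 <= x -> expR (- x ^+ 2) * (1 + x) ^+ 4 <= 216 * (1 + x ^+ 2)^-1.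
Proof.
move=> x0; have y0 : 0 <= x ^+ 2 by exact: sqr_ge0.
have p0 : 0 < 1 + x ^+ 2 by rewrite ltr_pwDl.
rewrite ler_pdivlMr // expRN -mulrA mulrC ler_pdivrMr ?expR_gt0 //.
have h1 : (1 + x) ^+ 2 <= 2 * (1 + x ^+ 2) by have := sqr_ge0 (1 - x); lra.
have h2 : (1 + x) ^+ 4 <= 4 * (1 + x ^+ 2) ^+ 2.
  have -> : (1 + x) ^+ 4 = ((1 + x) ^+ 2) ^+ 2 by rewrite -exprM.
  have -> : 4 * (1 + x ^+ 2) ^+ 2 = (2 * (1 + x ^+ 2)) ^+ 2 by ring.
  by apply: lerXn2r; rewrite ?nnegrE ?sqr_ge0 ?mulr_ge0 // ltW.
have h3 : (1 + x ^+ 2) ^+ 3 <= 27 * expR (x ^+ 2).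
  have -> : expR (x ^+ 2) = expR (x ^+ 2 / 3) ^+ 3.
    by rewrite -expRM_natl; congr expR; field.
  have -> : 27 * expR (x ^+ 2 / 3) ^+ 3 = (3 * expR (x ^+ 2 / 3)) ^+ 3 by ring.
  apply: lerXn2r; rewrite ?nnegrE ?mulr_ge0 ?expR_ge0 // ?(ltW p0) //.
  by have := expR_ge1Dx (x ^+ 2 / 3); lra.
apply: (@le_trans _ _ (4 * (1 + x ^+ 2) ^+ 2 * (1 + x ^+ 2))).
  by rewrite ler_pM2r.
have -> : 4 * (1 + x ^+ 2) ^+ 2 * (1 + x ^+ 2) = 4 * (1 + x ^+ 2) ^+ 3 by ring.
by have := expR_ge0 (x ^+ 2); lra.
Qed.

(** The Gaussian decay pays at once for the fourth power of the ridge length and for the reciprocal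
    of the summation weight. *)
Lemma damp_bound i k : kwt i k != 0 -> damp i k ^+ 2 * (1 + rk k) ^+ 4 <= 216 ^+ d * om k.
Proof.
move=> hk.
have kwj j : kw R (Q := Q) (Pf i) (k j) != 0.
  by apply: contraNneq hk => h; rewrite /Packing.wt (bigD1 j) //= h mul0r.
have kzj j : `|kz R k j| <= (Pf i)%:R / 2.
  have := kwj j; rewrite /kw; case: ifP => [hr _|_]; last by rewrite eqxx.
  rewrite ler_pdivlMr // kz_norm -natrM ler_nat.
  exact: (half_window_le (Pf_le i) hr).
have pi1 : 1 <= pi :> R by have := pihalf_ge1 R; lra.
apply: (@le_trans _ _ (damp i k ^+ 2 * (\prod_j (1 + xk k j)) ^+ 4)).
  apply: ler_wpM2l; first exact: sqr_ge0.
  apply: lerXn2r; rewrite ?nnegrE ?rk_le //; first by rewrite addr_ge0 // rk_ge0.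
  by apply: prodr_ge0 => j _; rewrite addr_ge0 // xk_ge0.
have -> : 216 ^+ d = \prod_(j < d) 216 :> R by rewrite prodr_const card_ord.
rewrite /damp /om -!prodrXl -!big_split /=; apply: ler_prod => j _.
set y := fr R Q i * kz R k j / 2.
have yE : y = pi * kz R k j / (Pf i)%:R.
  by rewrite /y frE; field; rewrite pnatr_eq0 -lt0n.
have yb : `|y| <= pi / 2.
  rewrite yE !normrM normfV (ger0_norm (pi_ge0 R)) normr_nat.
  rewrite ler_pdivrMr ?ltr0n // -mulrA; apply: ler_wpM2l; first exact: pi_ge0.
  by rewrite mulrC.
have [c0 c1] := cos_le_exp yb.
rewrite mulr_ge0 ?exprn_ge0 ?addr_ge0 ?xk_ge0 //=.
apply: le_trans (exp_poly_bound (xk_ge0 k j)); apply: ler_wpM2r.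
  by rewrite exprn_ge0 // addr_ge0 // xk_ge0.
apply: (@le_trans _ _ ((expR (- (y ^+ 2 / 4)) ^+ (2 * N)) ^+ 2)).
  by apply: lerXn2r; rewrite ?nnegrE ?exprn_ge0 ?expR_ge0 // lerXn2r ?nnegrE ?expR_ge0.
rewrite -exprM -expRM_natl ler_expR.
have -> : (2 * N * 2)%:R * - (y ^+ 2 / 4) = - (N%:R * y ^+ 2) by rewrite !natrM; field.
rewrite lerN2.
have -> : xk k j ^+ 2 = N%:R * (L%:R * kz R k j / Q%:R) ^+ 2.
  rewrite /xk !exprMn sqr_sqrtr // real_normK ?num_real //; ring.
apply: ler_wpM2l => //.
have -> : y = (pi * (L + i)%:R / L%:R) * (L%:R * kz R k j / Q%:R).
  rewrite /y /fr; move: ((L + i)%:R) => z; field; by rewrite !gt_eqF.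
rewrite [leRHS]exprMn ler_peMl ?sqr_ge0 // expr_ge1 //; last by rewrite !mulr_ge0 ?invr_ge0 ?pi_ge0.
rewrite ler_pdivlMr // mul1r; apply: (@le_trans _ _ (1 * (L + i)%:R)).
  by rewrite mul1r ler_nat leq_addr.
exact: ler_wpM2r.
Qed.

Definition chat2 (i : 'I_L) (k : K) : R :=
  (\sum_y c (yv y) * cos (fr R Q i * dz k (yv y))) ^+ 2 +
  (\sum_y c (yv y) * sin (fr R Q i * dz k (yv y))) ^+ 2.

(** Plancherel for the finite character sum; the condition 2 Rb < [Pf i] prevents aliasing between
    points of the support. *)
Lemma parseval i : \sum_k kwt i k * chat2 i k = \sum_y c (yv y) ^+ 2.
Proof.
have e k : chat2 i k = \sum_y \sum_y' c (yv y) * c (yv y') * cos (fr R Q i * (dz k (yv y) - dz k (yv y')) + 0).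
  rewrite /chat2 !expr2 !big_distrlr /= -big_split /=; apply: eq_bigr => y _.
  rewrite -big_split /=; apply: eq_bigr => y' _.
  by rewrite addr0 mulrBr cosB; ring.
under eq_bigr => k _ do rewrite e mulr_sumr.
rewrite exchange_big /=; apply: eq_bigr => y _.
under eq_bigr => k _ do rewrite mulr_sumr.
rewrite exchange_big /= (bigD1 y) //= [X in _ + X]big1 ?addr0.
  under eq_bigr => k _ do rewrite mulrCA.
  rewrite -mulr_sumr char_sum_diff ?eqxx ?cos0; first by rewrite !mulr1 expr2.
  by move=> j; rewrite subrr normr0; have := Pf_gt0 i; clear; lia.
move=> y' yy'; under eq_bigr => k _ do rewrite mulrCA.
rewrite -mulr_sumr char_sum_diff; first by rewrite (inj_eq yv_inj) (negbTE yy') mul0r mulr0.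
by move=> j; have := yv_le y j; have := yv_le y' j; have := Pf_big2 i; clear; lia.
Qed.

Lemma energy_co k : energy (coA k) (coB k) =
  \sum_i L%:R^-1 ^+ 2 * (kwt i k ^+ 2 * damp i k ^+ 2 * chat2 i k).
Proof. by apply: eq_bigr => i _; rewrite /coA /coB /chat2; ring. Qed.

Definition cnorm2 : R := \sum_y c (yv y) ^+ 2.

(** Each of the L periods enters with the squared averaging weight L^(-2), so their sum carries 1/L:
    this is the gain from averaging. The factor (2 L/Q)^d comes from squaring the window weights. *)
Lemma weighted_energy : \sum_k (1 + rk k) ^+ 4 / om k * energy (coA k) (coB k) <=
  216 ^+ d * (L%:R^-1 * (2 * L%:R / Q%:R) ^+ d * cnorm2).
Proof.
have S0 : 0 <= cnorm2 by apply: sumr_ge0 => y _; exact: sqr_ge0.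
apply: (@le_trans _ _ (\sum_(i < L) \sum_k 216 ^+ d * (L%:R^-1 ^+ 2 * ((Pf i)%:R^-1 ^+ d * (kwt i k * chat2 i k))))).
  rewrite [leRHS]exchange_big /=; apply: ler_sum => k _; rewrite energy_co mulr_sumr; apply: ler_sum => i _.
  have ch0 : 0 <= chat2 i k by rewrite /chat2 addr_ge0 ?sqr_ge0.
  have [k0|k0] := eqVneq (kwt i k) 0; first by rewrite k0 expr0n /= !(mul0r, mulr0).
  have h := damp_bound k0; have hq := kwt_sqr i k.
  have -> : (1 + rk k) ^+ 4 / om k * (L%:R^-1 ^+ 2 * (kwt i k ^+ 2 * damp i k ^+ 2 * chat2 i k)) =
    (damp i k ^+ 2 * (1 + rk k) ^+ 4 / om k) * (L%:R^-1 ^+ 2 * (kwt i k ^+ 2 * chat2 i k)) by ring.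
  apply: ler_pM.
  - apply: divr_ge0; last exact: ltW (om_gt0 k).
    by rewrite mulr_ge0 ?sqr_ge0 // exprn_ge0 // addr_ge0 // rk_ge0.
  - by apply: mulr_ge0; [exact: sqr_ge0|apply: mulr_ge0 => //; exact: sqr_ge0].
  - by rewrite ler_pdivrMr // om_gt0.
  apply: ler_wpM2l; first exact: sqr_ge0.
  by rewrite mulrA; apply: ler_wpM2r.
under eq_bigr => i _ do rewrite -!mulr_sumr parseval.
rewrite -mulr_sumr; apply: ler_wpM2l; first exact: exprn_ge0.
apply: (@le_trans _ _ (\sum_(i < L) L%:R^-1 ^+ 2 * ((2 * L%:R / Q%:R) ^+ d * cnorm2))).
  apply: ler_sum => i _; apply: ler_wpM2l; first exact: sqr_ge0.
  apply: ler_wpM2r => //; apply: lerXn2r; rewrite ?nnegrE ?invr_ge0 ?divr_ge0 ?mulr_ge0 //.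
  have -> : (Pf i)%:R^-1 = (L + i)%:R / Q%:R :> R.
    rewrite -(PfQ i) natrM invfM mulrA divff ?mul1r // pnatr_eq0 -lt0n addn_gt0 L_gt0 //.
  apply: ler_wpM2r; first by rewrite invr_ge0.
  by rewrite -natrM ler_nat; have := ltn_ord i; clear; lia.
rewrite sumr_const card_ord -[_ *+ L]mulr_natl le_eqVlt; apply/orP; left; apply/eqP.
by rewrite expr2 !mulrA divff ?gt_eqF // mul1r.
Qed.

Lemma sum_om : \sum_k om k <= (5 * Q%:R / (Num.sqrt N%:R * L%:R)) ^+ d.
Proof.
pose al : R := Num.sqrt N%:R * L%:R / Q%:R.
have al0 : 0 < al by rewrite divr_gt0 // mulr_gt0.
have al1 : al <= 1 by rewrite ler_pdivrMr // mul1r.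
pose g (a : nat) : R := (1 + (al * `|a%:R - Q%:R|) ^+ 2)^-1.
have -> : \sum_k om k = \sum_(k : K) \prod_j g (k j).
  apply: eq_bigr => k _; apply: eq_bigr => j _; rewrite /g /xk /kz /al; congr (1 + _ ^+ 2)^-1; ring.
rewrite -(bigA_distr_bigA (fun (j : 'I_d) (a : 'I_(2 * Q).+1) => g a)) prodr_const card_ord.
have gs : \sum_(a < (2 * Q).+1) g a <= 5 / al.
  have tele (n : nat) : \sum_(t < n) (1 + (al * t.+1%:R) ^+ 2)^-1 <= 2 / al.
    apply: (@le_trans _ _ (2 / al * (1 - (1 + al * n%:R)^-1))); last first.
      rewrite ler_piMr ?divr_ge0 ?(ltW al0) // gerBl invr_ge0 addr_ge0 // mulr_ge0 //; exact: ltW.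
    elim: n => [|n IH]; first by rewrite big_ord0 mulr0 addr0 invr1 subrr mulr0.
    rewrite big_ord_recr /=; apply: (le_trans (lerD IH (lexx _))).
    rewrite -[n.+1%:R]natr1; set z := n%:R; have z0 : 0 <= z by rewrite /z.
    have p1 : 0 < 1 + al * z by rewrite ltr_pwDl // mulr_ge0 // ltW.
    have p2 : 0 < 1 + al * (z + 1) by rewrite ltr_pwDl // mulr_ge0 ?addr_ge0 // ltW.
    have p3 : 0 < 1 + (al * (z + 1)) ^+ 2 by rewrite ltr_pwDl // sqr_ge0.
    have E : 2 / al * (1 - (1 + al * (z + 1))^-1) - 2 / al * (1 - (1 + al * z)^-1) =
      2 / ((1 + al * z) * (1 + al * (z + 1))) by field; rewrite !gt_eqF.
    suff : (1 + (al * (z + 1)) ^+ 2)^-1 <= 2 / ((1 + al * z) * (1 + al * (z + 1))) by rewrite -E; lra.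
    rewrite -[leLHS]mul1r ler_pdivrMr // mulrAC ler_pdivlMr ?mulr_gt0 // mul1r.
    have q1 : (1 + al * z) * (1 + al * (z + 1)) <= (1 + al * (z + 1)) ^+ 2.
      by rewrite expr2 ler_pM2r //; lra.
    by have := sqr_ge0 (1 - al * (z + 1)); move: q1; lra.
  have -> : ((2 * Q).+1 = Q + Q.+1)%N by clear; lia.
  rewrite big_split_ord /= big_ord_recl /=.
  have -> : \sum_(a < Q) g a = \sum_(t < Q) (1 + (al * t.+1%:R) ^+ 2)^-1.
    rewrite (reindex_inj rev_ord_inj) /=; apply: eq_bigr => t _; rewrite /g.
    have tQ : (t.+1 <= Q)%N by exact: ltn_ord.
    by rewrite natrB // addrAC subrr add0r normrN normr_nat.
  have -> : \sum_(a < Q) g (Q + bump 0 a)%N = \sum_(t < Q) (1 + (al * t.+1%:R) ^+ 2)^-1.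
    apply: eq_bigr => t _; rewrite /g /bump leq0n add1n natrD addrAC subrr add0r ger0_norm //.
  have -> : g (Q + 0)%N = 1 by rewrite /g addn0 subrr normr0 mulr0 expr0n addr0 invr1.
  have := tele Q; have : 1 <= al^-1 by rewrite invf_ge1.
  lra.
have -> : 5 * Q%:R / (Num.sqrt N%:R * L%:R) = 5 / al by rewrite /al; field; rewrite !gt_eqF.
apply: lerXn2r => //; rewrite nnegrE.
  by apply: sumr_ge0 => a _; rewrite invr_ge0 addr_ge0 // sqr_ge0.
by rewrite divr_ge0 // ltW.
Qed.

(** With pi <= 4 the sum is at most 1 + 544 r + 1024 r^2 times L^2 E. The kinks are responsible for
    L^2; the other terms carry at most L^(3/2). *)
Lemma ridge_bound_le k (E : R) : 0 <= E -> ridge_bound k E <= 1100 * L%:R ^+ 2 * ((1 + rk k) ^+ 2 * E).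
Proof.
move=> E0; rewrite /ridge_bound; set T := (tlen k)%:R : R; set r := rk k.
have r0 : 0 <= r by exact: rk_ge0.
have TE : T = r * Q%:R by rewrite /r /rk divfK // gt_eqF.
have T0 : 0 <= T by rewrite /T.
have [/andP[_ p2] _] := @pihalf_02_cos_pihalf R.
have p0 := pi_ge0 R.
have p4 : pi <= 4 :> R by lra.
have L1 : 1 <= L%:R :> R by rewrite ler1n.
have sL : Num.sqrt L%:R <= L%:R :> R.
  by rewrite -[leRHS]ger0_norm // -sqrtr_sqr ler_wsqrtr // expr2 ler_peMr.
have LL : L%:R <= L%:R ^+ 2 :> R by rewrite expr2 ler_peMr.
have s2 : Num.sqrt (2 * tlen k)%:R * Num.sqrt (2 * tlen k + Q)%:R <= 2 * T + Q%:R.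
  rewrite -sqrtrM // -[leRHS]ger0_norm; last by rewrite addr_ge0 // mulr_ge0.
  rewrite -sqrtr_sqr ler_wsqrtr // natrD natrM -/T expr2; apply: ler_wpM2r; first by rewrite addr_ge0 // mulr_ge0.
  by rewrite lerDl.
have wE : wm R L Q = 4 * pi * L%:R / Q%:R by [].
have w0 : 0 <= wm R L Q by rewrite wE !mulr_ge0 ?invr_ge0.
have t1 : Num.sqrt L%:R * E <= L%:R ^+ 2 * E by rewrite ler_wpM2r // (le_trans sL).
have t2 : 2 * T * (wm R L Q * (Num.sqrt L%:R * E)) <= 32 * r * (L%:R ^+ 2 * E).
  have -> : 2 * T * (wm R L Q * (Num.sqrt L%:R * E)) = 8 * pi * r * (L%:R * Num.sqrt L%:R * E).
    by rewrite TE wE; field; rewrite gt_eqF.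
  apply: ler_pM; rewrite ?mulr_ge0 ?sqrtr_ge0 //; first by rewrite ler_wpM2r //; lra.
  by rewrite ler_wpM2r // expr2 ler_wpM2l.
have t3 : 2 * T * (Num.sqrt (2 * tlen k)%:R * (Num.sqrt (2 * tlen k + Q)%:R * (wm R L Q ^+ 2 * E))) <=
   512 * (r * (2 * r + 1)) * (L%:R ^+ 2 * E).
  apply: (@le_trans _ _ (2 * T * ((2 * T + Q%:R) * (wm R L Q ^+ 2 * E)))).
    by apply: ler_wpM2l; [rewrite mulr_ge0|rewrite mulrA ler_wpM2r // mulr_ge0 // sqr_ge0].
  have -> : 2 * T * ((2 * T + Q%:R) * (wm R L Q ^+ 2 * E)) = 32 * pi ^+ 2 * (r * (2 * r + 1)) * (L%:R ^+ 2 * E).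
    by rewrite TE wE; field; rewrite gt_eqF.
  apply: ler_wpM2r; first by rewrite mulr_ge0 // sqr_ge0.
  apply: ler_wpM2r; first by rewrite mulr_ge0 // addr_ge0 // mulr_ge0.
  have : pi ^+ 2 <= 4 ^+ 2 :> R by apply: lerXn2r; rewrite ?nnegrE.
  lra.
rewrite mulrDr; apply: (le_trans (lerD t1 (lerD t2 t3))).
have -> : L%:R ^+ 2 * E + (32 * r * (L%:R ^+ 2 * E) + 512 * (r * (2 * r + 1)) * (L%:R ^+ 2 * E)) =
  (1 + 544 * r + 1024 * r ^+ 2) * (L%:R ^+ 2 * E) by ring.
have -> : 1100 * L%:R ^+ 2 * ((1 + r) ^+ 2 * E) = (1100 * (1 + r) ^+ 2) * (L%:R ^+ 2 * E) by ring.
apply: ler_wpM2r; first by rewrite mulr_ge0 // sqr_ge0.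
have := sqr_ge0 r; lra.
Qed.

(** Cauchy-Schwarz over the directions with weight [om]. The effective number of directions, of
    order (Q/(sqrt N L))^d, cancels the factor (L/Q)^d of the energy, so Q disappears; 2160 is 5
    times 216 times 2. *)
Theorem heat_network : exists f,
  cost_le f (1100 * L%:R ^+ 2 * Num.sqrt ((2160 / Num.sqrt N%:R) ^+ d * (L%:R^-1 * cnorm2))) /\
  forall n, inbox B0 n -> f (latpt n) = GN N c n.
Proof.
have [f hf] := boolp.choice (fun k => ridge_net (coA k) (coB k) k).
exists (fun x => \sum_(k <- index_enum K) f k x); split; last first.
  by move=> n nB; rewrite (rep nB); apply: eq_bigr => k _; have [_ h] := hf k; exact: h.
apply: (@cost_le_weak _ _ _ (\sum_(k <- index_enum K) ridge_bound k (Num.sqrt (energy (coA k) (coB k))))); last first.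
  by apply: cost_le_sum => k; have [] := hf k.
have gen (C : R) : 0 <= C -> (forall k E, 0 <= E -> ridge_bound k E <= C * ((1 + rk k) ^+ 2 * E)) ->
    \sum_k (1 + rk k) ^+ 2 * Num.sqrt (energy (coA k) (coB k)) <=
      Num.sqrt ((2160 / Num.sqrt N%:R) ^+ d * (L%:R^-1 * cnorm2)) ->
    \sum_k ridge_bound k (Num.sqrt (energy (coA k) (coB k))) <=
      C * Num.sqrt ((2160 / Num.sqrt N%:R) ^+ d * (L%:R^-1 * cnorm2)).
  move=> C0 hC hs; apply: le_trans (ler_wpM2l C0 hs); rewrite mulr_sumr.
  by apply: ler_sum => k _; apply: hC; exact: sqrtr_ge0.
apply: (gen (1100 * L%:R ^+ 2)); first by apply: mulr_ge0; [exact: ler0n|exact: sqr_ge0].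
  exact: ridge_bound_le.
clear gen.
pose bb k := (1 + rk k) ^+ 2 * Num.sqrt (energy (coA k) (coB k)) / Num.sqrt (om k).
have so k : 0 < Num.sqrt (om k) by rewrite sqrtr_gt0 om_gt0.
have -> : \sum_k (1 + rk k) ^+ 2 * Num.sqrt (energy (coA k) (coB k)) = \sum_k Num.sqrt (om k) * bb k.
  by apply: eq_bigr => k _; rewrite /bb mulrCA divff ?mulr1 // gt_eqF.
apply: le_trans (cs_sqrt _ _) _.
- by move=> k; exact: sqrtr_ge0.
- by move=> k; apply: divr_ge0; [apply: mulr_ge0; [exact: sqr_ge0|exact: sqrtr_ge0]|exact: sqrtr_ge0].
have -> : \sum_k Num.sqrt (om k) ^+ 2 = \sum_k om k.
  by apply: eq_bigr => k _; rewrite sqr_sqrtr // ltW // om_gt0.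
have -> : \sum_k bb k ^+ 2 = \sum_k (1 + rk k) ^+ 4 / om k * energy (coA k) (coB k).
  apply: eq_bigr => k _; rewrite /bb expr_div_n exprMn !sqr_sqrtr ?energy_ge0 ?(ltW (om_gt0 k)) //.
  by rewrite -exprM mulrAC.
have s0 : 0 <= \sum_k om k by apply: sumr_ge0 => k _; rewrite ltW // om_gt0.
rewrite -sqrtrM // ler_wsqrtr //.
apply: le_trans (ler_pM s0 _ sum_om weighted_energy) _.
  apply: sumr_ge0 => k _; apply: mulr_ge0; last exact: energy_ge0.
  by rewrite divr_ge0 ?exprn_ge0 ?addr_ge0 ?rk_ge0 // ltW // om_gt0.
have -> : 2160 / Num.sqrt N%:R = (5 * Q%:R / (Num.sqrt N%:R * L%:R)) * 216 * (2 * L%:R / Q%:R) :> R.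
  by field; rewrite !gt_eqF.
by rewrite !exprMn le_eqVlt; apply/orP; left; apply/eqP; ring.
Qed.

End Sum.

End Rep.
End Representation.

(** * Multiscale approximation on the lattice *)

Module MultiScale.
Import Heat Telescope NetApprox Representation.

Section MultiScale.
Variables (R : realType) (d : nat).
Hypothesis d_gt0 : (0 < d)%N.
Notation V := 'rV[int]_d.
Notation lat B0 n := (latpt R B0 n).

Definition cw : R := 2160.
Definition ch : R := 1100.

Lemma cw_ge1 : 1 <= cw. Proof. by rewrite ler1n. Qed.
Lemma ch_ge0 : 0 <= ch. Proof. exact: ler0n. Qed.

Lemma powR_exprn (a x : R) k : 0 <= a -> (a ^+ k) `^ x = (a `^ x) ^+ k.
Proof.
move=> a0; elim: k => [|k IH]; first by rewrite !expr0 powR1.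
by rewrite !exprS powRM ?exprn_ge0 // IH.
Qed.

Lemma scale_net (N B0 Rb L : nat) (E : V -> R) (A : R) : (0 < N)%N -> (0 < L)%N -> (0 < B0)%N ->
  B0%:R <= Num.sqrt N%:R * L%:R :> R -> (forall n, `|E n| <= A) ->
  exists f, cost_le f (ch * L%:R ^+ 2 * (A * Num.sqrt (L%:R^-1 * (cw * (2 * Rb).+1%:R / Num.sqrt N%:R) ^+ d))) /\
    forall n, inbox B0 n -> f (lat B0 n) = GN N (cut Rb E) n.
Proof.
move=> N0 L0 B0p hB hE.
have A0 : 0 <= A by apply: le_trans (hE 0).
pose W := (4 * L * (B0 + N + 2 * Rb + 1))%N.
(* The factorial makes Q divisible by every L + i, and [W] makes all periods larger than the boxes.
   Such a huge Q is harmless because the cost does not depend on it. *)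
pose Q := ((2 * L)`! * W)%N.
pose Pf (i : 'I_L) := ((2 * L)`! %/ (L + i) * W)%N.
have W1 : (B0 + N + 2 * Rb < W)%N by rewrite /W; nia.
have dv (i : 'I_L) : (L + i %| (2 * L)`!)%N.
  by apply: dvdn_fact; have := ltn_ord i; move: L0; clear; lia.
have PW i : (W <= Pf i)%N.
  rewrite leq_pmull // divn_gt0; last by move: L0; clear; lia.
  by apply: dvdn_leq (dv i); rewrite fact_gt0.
have WQ : (W <= Q)%N by rewrite leq_pmull // fact_gt0.
have LQ : (4 * L < Q)%N by apply: leq_trans WQ; rewrite /W; nia.
have PfQ (i : 'I_L) : ((L + i) * Pf i = Q)%N.
  by rewrite /Pf /Q mulnA [((L + i) * _)%N]mulnC divnK // dv.
have Pb1 i : (B0 + N + Rb < Pf i)%N by apply: leq_trans (PW i); move: W1; clear; lia.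
have Pb2 i : (2 * Rb < Pf i)%N by apply: leq_trans (PW i); move: W1; clear; lia.
have cs n : ~~ inbox Rb n -> cut Rb E n = 0 by rewrite /cut => /negbTE ->.
have N1 : 1 <= N%:R :> R by rewrite ler1n.
have sN : Num.sqrt N%:R <= N%:R :> R.
  by rewrite -[leRHS]ger0_norm // -sqrtr_sqr ler_wsqrtr // expr2 ler_peMr.
have H2 : Num.sqrt N%:R * L%:R <= Q%:R :> R.
  apply: (@le_trans _ _ (N%:R * L%:R)); first by rewrite ler_wpM2r.
  by rewrite -natrM ler_nat; apply: leq_trans WQ; rewrite /W; nia.
have [f [hf1 hf2]] := heat_network L0 B0p LQ PfQ Pb1 Pb2 cs N0 hB H2.
exists f; split=> //; apply: cost_le_weak hf1.
rewrite -/cw -/ch; apply: ler_wpM2l; first by apply: mulr_ge0; [exact: ch_ge0|exact: sqr_ge0].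
have sN0 : 0 < Num.sqrt N%:R :> R by rewrite sqrtr_gt0 ltr0n.
have cn : cnorm2 Rb (cut Rb E) <= A ^+ 2 * (2 * Rb).+1%:R ^+ d.
  apply: (@le_trans _ _ (\sum_(y : {ffun 'I_d -> 'I_(2 * Rb).+1}) A ^+ 2)).
    apply: ler_sum => y _; rewrite -[leLHS]real_normK ?num_real //; apply: lerXn2r; rewrite ?nnegrE //.
    by rewrite /cut; case: ifP => // _; rewrite normr0.
  by rewrite sumr_const card_ffun !card_ord -[_ *+ _]mulr_natr natrX.
have cw0 := le_trans ler01 cw_ge1.
have -> : A * Num.sqrt (L%:R^-1 * (cw * (2 * Rb).+1%:R / Num.sqrt N%:R) ^+ d) =
    Num.sqrt ((cw / Num.sqrt N%:R) ^+ d * (L%:R^-1 * (A ^+ 2 * (2 * Rb).+1%:R ^+ d))).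
  rewrite -{1}[A]ger0_norm // -sqrtr_sqr -sqrtrM ?sqr_ge0 //; congr Num.sqrt.
  rewrite [cw * _ / _]mulrAC [(_ * (2 * Rb).+1%:R) ^+ d]exprMn.
  move: ((2 * Rb).+1%:R ^+ d) ((cw / Num.sqrt N%:R) ^+ d) => a b; ring.
rewrite ler_wsqrtr //; apply: ler_wpM2l; first by rewrite exprn_ge0 // divr_ge0 // ltW.
by apply: ler_wpM2l; rewrite ?invr_ge0.
Qed.

Opaque cw ch.

Notation q := (Num.sqrt 2 : R).

Lemma q_bounds : 1 <= q /\ q <= 3 / 2.
Proof.
split; first by rewrite -[leLHS]sqrtr1 ler_wsqrtr // ler1n.
have h : 0 <= 3 / 2 :> R by rewrite divr_ge0.
by rewrite -[leRHS]ger0_norm // -sqrtr_sqr ler_wsqrtr // expr2; lra.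
Qed.

Lemma qk_bounds k : (2 ^ k./2)%:R <= q ^+ k /\ q ^+ k <= 2 * (2 ^ k./2)%:R.
Proof.
have [q1 q2] := q_bounds.
have qE : q ^+ k = q ^+ (odd k) * (2 ^ k./2)%:R.
  rewrite -{1}(odd_double_half k) exprD -mul2n exprM sqr_sqrtr // natrX //.
rewrite qE; have : 0 <= (2 ^ k./2)%:R :> R by [].
move: ((2 ^ k./2)%:R : R) => z z0; case: (odd k); rewrite ?expr1 ?expr0.
  by split; [rewrite ler_peMl|rewrite ler_wpM2r //; lra].
by split; lra.
Qed.

Lemma sqrtNk p k : Num.sqrt (2 ^ k * 4 ^ p)%:R = q ^+ k * 2 ^+ p :> R.
Proof.
have -> : (2 ^ k * 4 ^ p)%:R = (q ^+ k * 2 ^+ p) ^+ 2 :> R.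
  by rewrite natrM !natrX exprMn -!exprM ![(_ * 2)%N]mulnC !exprM sqr_sqrtr //; congr (_ * _ ^+ p); ring.
by rewrite sqrtr_sqr ger0_norm // mulr_ge0 ?exprn_ge0 ?sqrtr_ge0.
Qed.

Lemma expR1_ge2 : 2 <= expR 1 :> R.
Proof. by have := expR_ge1Dx (1 : R); lra. Qed.

Lemma expR_half_le2 : expR (2^-1) <= 2 :> R.
Proof.
have e0 := expR_gt0 (- 2^-1 : R).
have -> : (2^-1 : R) = - - 2^-1 by rewrite opprK.
rewrite expRN -[leLHS]mul1r ler_pdivrMr //; have := expR_ge1Dx (- 2^-1 : R); lra.
Qed.

(** The bound expR (t^2 N/2) with t^2 N = 1. The condition p >= 2 gives time at least 16, hence t <=
    1/4 as [ecf_le] requires. *)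
Lemma ecf_pow_le (p k : nat) : (2 <= p)%N ->
  ecf (Num.sqrt (2 ^ k * 4 ^ p)%:R)^-1 ^+ (2 ^ k * 4 ^ p) <= 2 :> R.
Proof.
move=> p2; set N := (2 ^ k * 4 ^ p)%N.
have N16 : (16 <= N)%N.
  by rewrite /N; apply: (@leq_trans (4 ^ p)); [rewrite (@leq_pexp2l 4 2 p)|rewrite leq_pmull // expn_gt0].
have sN4 : 4 <= Num.sqrt N%:R :> R.
  have -> : 4 = Num.sqrt (4 ^+ 2) :> R by rewrite sqrtr_sqr ger0_norm.
  by rewrite ler_wsqrtr // -natrX ler_nat.
have N0 : 0 < N%:R :> R by rewrite ltr0n; apply: leq_trans N16.
have t0 : 0 <= (Num.sqrt N%:R)^-1 :> R by rewrite invr_ge0 sqrtr_ge0.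
have t4 : `|(Num.sqrt N%:R)^-1| <= 4^-1 :> R.
  by rewrite ger0_norm // lef_pV2 ?posrE // (lt_le_trans _ sN4).
apply: le_trans expR_half_le2.
have -> : (2^-1 : R) = N%:R * ((Num.sqrt N%:R)^-1 ^+ 2 / 2).
  by rewrite exprVn sqr_sqrtr //; field; rewrite gt_eqF.
rewrite expRM_natl; apply: lerXn2r; rewrite ?nnegrE ?expR_ge0 //; last exact: ecf_le.
by apply: le_trans (ecf_ge1 _).
Qed.

Lemma geo_bound (x : R) (n : nat) : 0 <= x -> x < 1 -> \sum_(k < n) x ^+ k <= (1 - x)^-1.
Proof.
move=> x0 x1; have p : 0 < 1 - x by rewrite subr_gt0.
rewrite -[leRHS]mul1r ler_pdivlMr // mulrC.
have -> : (1 - x) * (\sum_(k < n) x ^+ k) = 1 - x ^+ n.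
  by rewrite -[X in _ = X - _](expr1n R n) subrXX; congr (_ * _); apply: eq_bigr => i _; rewrite expr1n mul1r.
by rewrite gerBl exprn_ge0.
Qed.

(** Half of the exponential decay is spent on the polynomial: with e half the decay rate, 1 + c k <=
    (1 + c d/e) expR (e k/d). *)
Lemma poly_geo_bound (c x : R) (k : nat) : 0 <= c -> 0 < x -> x < 1 ->
  (1 + c * k%:R) ^+ d * x ^+ k <= (1 + c * d%:R * 2 / (- ln x)) ^+ d * expR (ln x / 2) ^+ k.
Proof.
move=> c0 x0 x1.
pose e := - ln x / 2; have e0 : 0 < e by rewrite /e divr_gt0 // oppr_gt0 ln_lt0 // x0.
have d0 : 0 < d%:R :> R by rewrite ltr0n.
have xE : x ^+ k = expR (ln x / 2) ^+ k * expR (- (e * k%:R / d%:R)) ^+ d.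
  rewrite -!expRM_natl -expRD -{1}(lnK (x := x)) ?posrE // -expRM_natl; congr expR.
  by rewrite /e; field; rewrite gt_eqF.
rewrite xE mulrCA [leRHS]mulrC; apply: ler_wpM2l; first by rewrite exprn_ge0 // expR_ge0.
rewrite -exprMn; apply: lerXn2r; rewrite ?nnegrE.
- by rewrite mulr_ge0 ?expR_ge0 // addr_ge0 // mulr_ge0.
- by rewrite addr_ge0 // divr_ge0 ?mulr_ge0 // oppr_ge0 ltW // ln_lt0 // x0.
rewrite expRN ler_pdivrMr ?expR_gt0 //.
have -> : c * d%:R * 2 / - ln x = c * d%:R / e.
  by rewrite /e; field; rewrite lt_eqF // ln_lt0 // x0.
apply: (@le_trans _ _ ((1 + c * d%:R / e) * (1 + e * k%:R / d%:R))); last first.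
  apply: ler_wpM2l; last exact: expR_ge1Dx.
  by rewrite addr_ge0 // mulr_ge0 ?mulr_ge0 // invr_ge0 ltW.
have -> : (1 + c * d%:R / e) * (1 + e * k%:R / d%:R) = 1 + c * k%:R + (c * d%:R / e + e * k%:R / d%:R).
  by field; rewrite !gt_eqF.
rewrite lerDl addr_ge0 //; first by rewrite mulr_ge0 ?mulr_ge0 // invr_ge0 ltW.
by rewrite mulr_ge0 ?invr_ge0 // mulr_ge0 // ltW.
Qed.

Section Fixed.
Variables (r J p : nat) (al A : R) (F : V -> R).
Notation u := r.+1.
Notation B0 := (2 ^ (J + p))%N.
Notation Nk k := (2 ^ k * 4 ^ p)%N.
Notation h := (B0%:R^-1 : R).
Notation K := (2 * J)%N.
Hypothesis p2 : (2 <= p)%N.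
Hypothesis al_gt0 : 0 < al.
Hypothesis al_le : al <= u%:R.
Hypothesis A_ge0 : 0 <= A.
Hypothesis F_le : forall n, `|F n| <= A.
Hypothesis F_taylor : forall n0, taylor_at u A al h F n0.

(** Spatial width of the semigroup at time 2^k 4^p on the mesh 2^(-J-p); it grows from 2^(-J) to 1
    and is independent of [p]. [Rbk] exceeds the unit box by a multiple of k widths, which makes the
    tails exponentially small in k, and [Lk] is comparable to 1/[sk]. *)
Definition sk k : R := q ^+ k / 2 ^+ J.
Definition Rbk k := (B0 + u * k * 2 ^ (p + k./2 + 1))%N.
Definition cdet : R := 2 ^+ u * (3 ^+ u * ((1 + u`!%:R) * (2 * d%:R))).
Definition Lk k := (2 ^ (J - k./2))%N.

Let q0 : 0 < q. Proof. by rewrite sqrtr_gt0. Qed.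
Let J0 : 0 < 2 ^+ J :> R. Proof. exact: exprn_gt0. Qed.
Let P0 : 0 < 2 ^+ p :> R. Proof. exact: exprn_gt0. Qed.
Let sk0 k : 0 < sk k. Proof. by rewrite divr_gt0 // exprn_gt0. Qed.

Lemma sk_le1 k : (k <= K)%N -> sk k <= 1.
Proof.
move=> kK; rewrite ler_pdivrMr // mul1r.
have [q1 _] := q_bounds; apply: (@le_trans _ _ (q ^+ K)); first exact: ler_weXn2l.
by rewrite exprM sqr_sqrtr.
Qed.

Lemma h_sk k : h / sk k = (Num.sqrt (Nk k)%:R)^-1.
Proof.
rewrite sqrtNk /sk natrX exprD invfM; field; rewrite ?gt_eqF ?exprn_gt0 //.
Qed.

Lemma detail_le k n : (k <= K)%N -> `|detail (4 ^ p) u K k F n| <= cdet * (A * sk k `^ al).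
Proof.
move=> kK.
pose T := (1 + (2 : R)) ^+ u * (A * sk k `^ al * (1 + u`!%:R) * (2 * d%:R)).
have s0 : 0 <= A * sk k `^ al by rewrite mulr_ge0 ?powR_ge0.
have hT n' : `|iter u (res (Nk k)) F n'| <= T.
  have h0 : 0 < h by rewrite invr_gt0.
  apply: le_trans (@res_taylor R d (Nk k) u u r A al h (sk k) F n' _ A_ge0 (ltW al_gt0) al_le (sk0 k) h0 (F_taylor n')) _.
    by rewrite mul2n -addnn leq_addr.
  rewrite /T; apply: ler_wpM2r; first by rewrite !mulr_ge0 ?powR_ge0 ?addr_ge0.
  apply: lerXn2r; rewrite ?nnegrE ?addr_ge0 ?exprn_ge0 //.
    by apply: le_trans (ecf_ge1 _).
  by rewrite lerD2l h_sk ecf_pow_le.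
apply: (le_trans (detail_bound _ F_le hT n)).
rewrite /cdet -mulrA; apply: ler_wpM2l; first exact: exprn_ge0.
have c1 : 1 <= (1 + u`!%:R) * (2 * d%:R) :> R.
  have d1 : 1 <= d%:R :> R by rewrite ler1n.
  have f0 : 0 <= u`!%:R :> R by [].
  by apply: mulr_ege1; lra.
have t3 : 1 <= 3 ^+ u :> R by rewrite expr_ge1 // ler1n.
case: ifP => kK'.
  rewrite /T; have -> : (1 + 2 : R) = 3 by ring.
  by rewrite le_eqVlt; apply/orP; left; apply/eqP; ring.
have kE : k = K by apply/eqP; rewrite eqn_leq kK leqNgt kK'.
have -> : sk k = 1 by rewrite /sk kE exprM sqr_sqrtr // divff // gt_eqF.
by rewrite powR1 mulr1 ler_peMl // mulr_ege1.
Qed.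

Lemma Rbk_tail k : expR ((Num.sqrt (Nk k)%:R)^-1 * (B0%:R - (Rbk k)%:R)) <= expR (- 1) ^+ (u * k) :> R.
Proof.
rewrite -expRM_natl ler_expR mulrN1 /Rbk natrD opprD addrA subrr add0r mulrN lerN2.
rewrite sqrtNk mulrC [(u * k * _)%:R]natrM -mulrA ler_peMr // ler_pdivlMr ?mulr_gt0 ?exprn_gt0 // mul1r.
have [_ h2] := qk_bounds k.
rewrite !expnD expn1 !natrM natrX mulrC -mulrA; apply: ler_wpM2l; first exact: exprn_ge0.
by rewrite mulrC.
Qed.

(** The width factor grows like (q^al)^k. Since al <= u and the tail decays like expR (- u k), at
    most (q/e)^(u k) <= (3/4)^k is left, using q <= 3/2 and e >= 2. *)
Lemma tail_le k n : (k <= K)%N -> inbox B0 n ->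
  `|GN (Nk k) (detail (4 ^ p) u K k F) n - GN (Nk k) (cut (Rbk k) (detail (4 ^ p) u K k F)) n| <=
  cdet * A * (4 * d%:R) * ((2 ^+ J) `^ (- al)) * (3 / 4) ^+ k.
Proof.
move=> kK nb.
have hE n' := @detail_le k n' kK.
have t0 : 0 <= (Num.sqrt (Nk k)%:R)^-1 :> R by rewrite invr_ge0 sqrtr_ge0.
have hB j : `|Heat.co R j n| <= B0%:R.
  by rewrite /Heat.co -intr_norm -[B0%:R]/(B0%:Z%:~R) ler_int (forallP nb).
apply: le_trans (cut_tail _ _ hE t0 hB) _.
have cd0 : 0 <= cdet by rewrite /cdet !mulr_ge0 ?exprn_ge0 ?addr_ge0.
have -> : cdet * A * (4 * d%:R) * ((2 ^+ J) `^ (- al)) * (3 / 4) ^+ k =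
  cdet * (A * ((2 ^+ J) `^ (- al)) * (3 / 4) ^+ k * (2 * (2 * d%:R))) by ring.
rewrite -mulrA; apply: ler_wpM2l => //; rewrite -!mulrA; apply: ler_wpM2l => //.
apply: (@le_trans _ _ (sk k `^ al * (2 * (2 * (d%:R * expR (- 1) ^+ (u * k)))))).
  apply: ler_wpM2l; first exact: powR_ge0.
  apply: ler_pM; [|by rewrite !mulr_ge0 ?expR_ge0|exact: ecf_pow_le|].
    by rewrite exprn_ge0 // (le_trans _ (ecf_ge1 _)).
  apply: ler_wpM2l => //; apply: ler_wpM2l => //; exact: Rbk_tail.
have -> : sk k `^ al = (2 ^+ J) `^ (- al) * (q `^ al) ^+ k.
  rewrite /sk powRM ?exprn_ge0 ?invr_ge0 ?exprn_ge0 ?(ltW q0) // mulrC; congr (_ * _).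
    by rewrite -powR_inv1 ?(ltW J0) // -powRrM mulN1r.
  exact: powR_exprn (ltW q0).
rewrite -!mulrA; apply: ler_wpM2l; first exact: powR_ge0.
have -> : (q `^ al) ^+ k * (2 * (2 * (d%:R * expR (- 1) ^+ (u * k)))) =
  (q `^ al * expR (-1) ^+ u) ^+ k * (2 * (2 * d%:R)) by rewrite exprMn -exprM; ring.
apply: ler_wpM2r; first by rewrite !mulr_ge0.
apply: lerXn2r; rewrite ?nnegrE ?mulr_ge0 ?powR_ge0 ?exprn_ge0 ?expR_ge0 ?divr_ge0 //.
have [q1 q2] := q_bounds.
have e1 : expR (-1) <= 2^-1 :> R by rewrite expRN lef_pV2 ?posrE ?expR_gt0 // expR1_ge2.
apply: (@le_trans _ _ ((q * expR (-1)) ^+ u)).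
  rewrite exprMn; apply: ler_wpM2r; first by rewrite exprn_ge0 // expR_ge0.
  by rewrite -powR_mulrn ?(ltW q0) //; apply: ler_powR.
have b1 : q * expR (-1) <= 3 / 4.
  by apply: le_trans (ler_pM (ltW q0) (expR_ge0 _) q2 e1) _; lra.
have b0 : 0 <= q * expR (-1) by rewrite mulr_ge0 ?expR_ge0 // ltW.
apply: (@le_trans _ _ ((3 / 4) ^+ u)); first by apply: lerXn2r; rewrite ?nnegrE // divr_ge0.
by rewrite exprS ler_piMr ?divr_ge0 // exprn_ile1 ?divr_ge0 //; lra.
Qed.

Notation tau := ((d%:R + 3) / 2 - al).

Definition ccost : R := 4 * ch * cdet * (cw * 6) ^+ d.

(** With w = 1/[sk], the factors w^2 from L^2, w^(-al) from the amplitude and w^((d-1)/2) from the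
    square root multiply to w^tau. The polynomial in k is the price of the enlarged box. *)
Lemma scale_cost k : (k <= K)%N ->
  ch * (Lk k)%:R ^+ 2 * (cdet * (A * sk k `^ al) *
    Num.sqrt ((Lk k)%:R^-1 * (cw * (2 * Rbk k).+1%:R / Num.sqrt (Nk k)%:R) ^+ d)) <=
  ccost * A * ((2 ^+ J) `^ tau * ((1 + (2 * u)%:R * k%:R) ^+ d * (q `^ (- tau)) ^+ k)).
Proof.
move=> kK.
have [b1 b2] := qk_bounds k; have c1 := cw_ge1; have c0 := le_trans ler01 c1; have ch0 := ch_ge0.
have s0 := sk0 k; have s1 := sk_le1 kK.
have kJ : (k./2 <= J)%N by rewrite -leq_double -!mul2n; apply: leq_trans kK; rewrite mul2n -[X in (_ <= X)%N](odd_double_half k) leq_addl.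
have z0 : 0 < (2 ^ k./2)%:R :> R by rewrite ltr0n expn_gt0.
have LE : (Lk k)%:R = 2 ^+ J / (2 ^ k./2)%:R :> R.
  by rewrite /Lk natrX natrX -expfB_cond ?pnatr_eq0 // .
have qk0 : 0 < q ^+ k by exact: exprn_gt0.
have L1 : (sk k)^-1 <= (Lk k)%:R by rewrite LE /sk invf_div ler_pM2l // lef_pV2 ?posrE.
have L2 : (Lk k)%:R <= 2 * (sk k)^-1.
  rewrite LE /sk invf_div mulrCA ler_pM2l // -[leLHS]mul1r ler_pdivrMr // mulrAC ler_pdivlMr // mul1r.
  done.
have L0 : 0 < (Lk k)%:R :> R by rewrite ltr0n expn_gt0.
set w := (sk k)^-1 in L1 L2.
have w1 : 1 <= w by rewrite invf_ge1.
have w0 : 0 < w by exact: lt_le_trans w1.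
have cd0 : 0 <= cdet by rewrite /cdet !mulr_ge0 ?exprn_ge0 ?addr_ge0.
have sw : sk k `^ al = w `^ (- al) by rewrite /w -powR_inv1 ?(ltW s0) // -powRrM mulN1r opprK.
have rb : cw * (2 * Rbk k).+1%:R / Num.sqrt (Nk k)%:R <= w * (cw * 6 * (1 + (2 * u)%:R * k%:R)).
  have sN0 : 0 < Num.sqrt (Nk k)%:R :> R by rewrite sqrtNk mulr_gt0 ?exprn_gt0.
  have r1 : (2 * Rbk k).+1%:R <= 3 * (Rbk k)%:R :> R.
    rewrite -natrM ler_nat; have : (0 < Rbk k)%N by rewrite /Rbk addn_gt0 expn_gt0.
    by clear; lia.
  have r2 : (Rbk k)%:R / Num.sqrt (Nk k)%:R <= w + 2 * (u%:R * k%:R).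
    rewrite /Rbk natrD mulrDl; apply: lerD.
      by rewrite -h_sk mulrA divff ?gt_eqF // mul1r.
    rewrite [(u * k * _)%:R]natrM -mulrA [leRHS]mulrC natrM; apply: ler_wpM2l; first by rewrite mulr_ge0.
    rewrite ler_pdivrMr // sqrtNk !expnD expn1 !natrM natrX.
    by have : 2 ^+ p * (2 ^ k./2)%:R <= 2 ^+ p * q ^+ k by [rewrite ler_pM2l]; lra.
  apply: (@le_trans _ _ (cw * 3 * ((Rbk k)%:R / Num.sqrt (Nk k)%:R))).
    rewrite -[leLHS]mulrA -[leRHS]mulrA; apply: ler_wpM2l => //.
    by rewrite mulrA ler_wpM2r // invr_ge0 ltW.
  apply: (@le_trans _ _ (cw * 3 * (w + 2 * (u%:R * k%:R)))); first by apply: ler_wpM2l r2; rewrite mulr_ge0.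
  have uk : 0 <= u%:R * k%:R :> R by rewrite mulr_ge0.
  have wk : u%:R * k%:R <= w * (u%:R * k%:R) by rewrite ler_peMl.
  have -> : w * (cw * 6 * (1 + (2 * u)%:R * k%:R)) = cw * 3 * (2 * w + 4 * (w * (u%:R * k%:R))) by rewrite natrM; ring.
  by apply: ler_wpM2l; [rewrite mulr_ge0|lra].
have D1 : 1 <= cw * 6 * (1 + (2 * u)%:R * k%:R) :> R.
  have : 0 <= (2 * u)%:R * k%:R :> R by rewrite mulr_ge0.
  by move=> ?; apply: mulr_ege1; lra.
set D := cw * 6 * (1 + (2 * u)%:R * k%:R) in rb D1.
have sq : Num.sqrt ((Lk k)%:R^-1 * (cw * (2 * Rbk k).+1%:R / Num.sqrt (Nk k)%:R) ^+ d) <=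
    w `^ ((d%:R - 1) / 2) * D ^+ d.
  apply: (@le_trans _ _ (Num.sqrt (w^-1 * w ^+ d * (D ^+ d) ^+ 2))).
    rewrite ler_wsqrtr // -[leRHS]mulrA; apply: ler_pM; rewrite ?invr_ge0 ?exprn_ge0 ?divr_ge0 ?mulr_ge0 ?sqrtr_ge0 //.
      by rewrite lef_pV2 ?posrE.
    apply: (@le_trans _ _ ((w * D) ^+ d)).
      by apply: lerXn2r; rewrite ?nnegrE ?divr_ge0 ?mulr_ge0 ?sqrtr_ge0 // ltW // (lt_le_trans _ D1).
    rewrite exprMn; apply: ler_wpM2l; first by rewrite exprn_ge0 // ltW.
    by rewrite expr2 ler_peMr ?exprn_ge0 ?expr_ge1 // ?(le_trans _ D1).
  have hw : 0 <= w^-1 * w ^+ d by rewrite mulr_ge0 ?invr_ge0 ?exprn_ge0 // ltW.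
  rewrite (sqrtrM _ hw) sqrtr_sqr ger0_norm; last by rewrite exprn_ge0 // (le_trans _ D1).
  apply: ler_wpM2r; first by rewrite exprn_ge0 // (le_trans _ D1).
  rewrite -(powR12_sqrt hw).
  rewrite -(powR_inv1 (ltW w0)) -(powR_mulrn d (ltW w0)) -powRD; last by rewrite (gt_eqF w0) implybT.
  by rewrite -powRrM (_ : (-1 + d%:R) * 2^-1 = (d%:R - 1) / 2) //; ring.
apply: (@le_trans _ _ (ch * (2 * w) ^+ 2 * (cdet * (A * w `^ (- al)) * (w `^ ((d%:R - 1) / 2) * D ^+ d)))).
  rewrite sw; apply: ler_pM; rewrite ?mulr_ge0 ?sqr_ge0 ?powR_ge0 ?sqrtr_ge0 //.
    apply: ler_wpM2l => //; apply: lerXn2r; rewrite ?nnegrE //.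
    by rewrite mulr_ge0 // ltW.
  by apply: ler_wpM2l; rewrite ?mulr_ge0 ?powR_ge0.
have wt : w ^+ 2 * w `^ (- al) * w `^ ((d%:R - 1) / 2) = (2 ^+ J) `^ tau * (q `^ (- tau)) ^+ k.
  have wn : w != 0 by rewrite gt_eqF.
  rewrite -(powR_mulrn 2 (ltW w0)) -powRD ?wn ?implybT // -powRD ?wn ?implybT //.
  have -> : 2 - al + (d%:R - 1) / 2 = tau by field.
  rewrite /w /sk invf_div powRM ?invr_ge0 ?exprn_ge0 ?(ltW q0) //; congr (_ * _).
  have -> : (q ^+ k)^-1 = (q ^+ k) `^ (-1) by rewrite powR_inv1 // ltW.
  rewrite -powRrM mulN1r.
  exact: powR_exprn (ltW q0).
have -> : ch * (2 * w) ^+ 2 * (cdet * (A * w `^ (- al)) * (w `^ ((d%:R - 1) / 2) * D ^+ d)) =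
   4 * ch * cdet * A * (w ^+ 2 * w `^ (- al) * w `^ ((d%:R - 1) / 2)) * D ^+ d by ring.
rewrite wt /D /ccost exprMn le_eqVlt; apply/orP; left; apply/eqP.
move: ((2 ^+ J) `^ tau) ((q `^ (- tau)) ^+ k) ((1 + (2 * u)%:R * k%:R) ^+ d) ((cw * 6) ^+ d) => a1 a2 a3 a4.
ring.
Qed.

Hypothesis tau_gt0 : 0 < tau.

(** The sum over all scales of a polynomial times powers of q^(-tau); it stays bounded in the number
    of scales because tau > 0. *)
Definition cgeo : R := (1 + (2 * u)%:R * d%:R * 2 / (- ln (q `^ (- tau)))) ^+ d * (1 - expR (ln (q `^ (- tau)) / 2))^-1.
Definition cres : R := 3 ^+ u * ((1 + u`!%:R) * (2 * d%:R)).

(** Two errors remain, the residual at the finest time and the cut tails of all scales. Neither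
    these nor the cost depend on [p]. *)
Lemma lattice_approx : exists f, cost_le f (ccost * cgeo * A * (2 ^+ J) `^ tau) /\
  forall n, inbox B0 n -> `|f (lat B0 n) - F n| <= (cres + cdet * (16 * d%:R)) * A * (2 ^+ J) `^ (- al).
Proof.
have [q1 q2] := q_bounds.
have s0 k : 0 < Num.sqrt (Nk k)%:R :> R by rewrite sqrtNk mulr_gt0 ?exprn_gt0.
have step (k : 'I_K.+1) : exists f,
    cost_le f (ccost * A * ((2 ^+ J) `^ tau * ((1 + (2 * u)%:R * k%:R) ^+ d * (q `^ (- tau)) ^+ k))) /\
    forall n, inbox B0 n -> f (lat B0 n) = GN (Nk k) (cut (Rbk k) (detail (4 ^ p) u K k F)) n.
  have kK : (k <= K)%N by rewrite -ltnS.
  have hL : B0%:R <= Num.sqrt (Nk k)%:R * (Lk k)%:R :> R.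
    have [b1 _] := qk_bounds k.
    have kJ : (k./2 <= J)%N by rewrite -leq_double -!mul2n; apply: leq_trans kK; rewrite mul2n -[X in (_ <= X)%N](odd_double_half k) leq_addl.
    rewrite sqrtNk /Lk.
    have -> : B0%:R = (2 ^ k./2)%:R * 2 ^+ p * (2 ^ (J - k./2))%:R :> R.
      by rewrite !natrX -!exprD; congr (_ ^+ _); move: kJ; clear; lia.
    by rewrite ler_pM2r ?ltr0n ?expn_gt0 // ler_pM2r.
  have Nk0 : (0 < Nk k)%N by rewrite muln_gt0 !expn_gt0.
  have Lk0 : (0 < Lk k)%N by rewrite expn_gt0.
  have Bk0 : (0 < B0)%N by rewrite expn_gt0.
  have [f [h1 h2]] := scale_net (Rbk k) Nk0 Lk0 Bk0 hL (fun n => detail_le n kK).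
  by exists f; split=> //; apply: cost_le_weak h1; exact: scale_cost.
have [f hf] := boolp.choice step.
exists (fun x => \sum_(k <- index_enum 'I_K.+1) f k x); split.
  apply: cost_le_weak (cost_le_sum (index_enum 'I_K.+1) (fun k => (hf k).1)).
  set x := q `^ (- tau).
  have x0 : 0 < x by exact: powR_gt0.
  have q1' : 1 < q.
    by rewrite -[ltLHS]sqrtr1 ltr_sqrt // ltr1n.
  have x1 : x < 1.
    rewrite /x powRN invf_lt1 ?powR_gt0 //.
    have : 1 `^ tau < q `^ tau by apply: gt0_ltr_powR; rewrite ?nnegrE // ltW.
    by rewrite powR1.
  have y0 : 0 <= expR (ln x / 2) by exact: expR_ge0.
  have y1 : expR (ln x / 2) < 1 by rewrite expR_lt1 ltr_pdivrMr // mul0r ln_lt0 // x0.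
  rewrite -mulr_sumr -mulr_sumr.
  have -> : ccost * cgeo * A * (2 ^+ J) `^ tau = ccost * A * ((2 ^+ J) `^ tau * cgeo) by ring.
  have cd0 : 0 <= cdet by rewrite /cdet !mulr_ge0 ?exprn_ge0 ?addr_ge0.
  apply: ler_wpM2l; first by rewrite /ccost !mulr_ge0 ?ch_ge0 ?exprn_ge0 // mulr_ge0 // (le_trans ler01 cw_ge1).
  apply: ler_wpM2l; first exact: powR_ge0.
  apply: (@le_trans _ _ (\sum_(k < K.+1) (1 + (2 * u)%:R * d%:R * 2 / (- ln x)) ^+ d * expR (ln x / 2) ^+ k)).
    by apply: ler_sum => k _; apply: poly_geo_bound.
  rewrite -mulr_sumr; apply: ler_wpM2l; last exact: geo_bound.
  by rewrite exprn_ge0 // addr_ge0 // divr_ge0 ?mulr_ge0 // oppr_ge0 ltW // ln_lt0 // x0.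
move=> n nb.
rewrite [in X in _ - X](detail_sum (4 ^ p) u K F n).
under eq_bigr => k _ do rewrite ((hf k).2 n nb).
set S1 := \sum_(k < K.+1) _; set S2 := \sum_(k < K.+1) _.
have -> : S1 - (iter u (res (4 ^ p)) F n + S2) = - iter u (res (4 ^ p)) F n - (S2 - S1) by ring.
apply: le_trans (ler_normB _ _) _; rewrite normrN mulrDl mulrDl; apply: lerD.
  have h0 : 0 < h by rewrite invr_gt0.
  apply: le_trans (@res_taylor R d (4 ^ p) u u r A al h (sk 0) F n _ A_ge0 (ltW al_gt0) al_le (sk0 0%N) h0 (F_taylor n)) _.
    by rewrite mul2n -addnn leq_addr.
  have -> : sk 0%N `^ al = (2 ^+ J) `^ (- al).
    by rewrite /sk expr0 mul1r -powR_inv1 ?(ltW J0) // -powRrM mulN1r.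
  have -> : cres * A * (2 ^+ J) `^ (- al) = 3 ^+ u * (A * (2 ^+ J) `^ (- al) * (1 + u`!%:R) * (2 * d%:R)).
    by rewrite /cres; ring.
  apply: ler_wpM2r; first by rewrite !mulr_ge0 ?powR_ge0 ?addr_ge0.
  apply: lerXn2r; rewrite ?nnegrE ?addr_ge0 ?exprn_ge0 //.
    by apply: le_trans (ecf_ge1 _).
  by have := ecf_pow_le 0%N p2; rewrite -h_sk expn0 mul1n; lra.
rewrite /S2 /S1 -sumrB; apply: le_trans (ler_norm_sum _ _ _) _.
apply: (@le_trans _ _ (\sum_(k < K.+1) cdet * A * (4 * d%:R) * ((2 ^+ J) `^ (- al)) * (3 / 4) ^+ k)).
  by apply: ler_sum => k _; apply: tail_le => //; rewrite -ltnS.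
rewrite -mulr_sumr.
have cd0 : 0 <= cdet by rewrite /cdet !mulr_ge0 ?exprn_ge0 ?addr_ge0.
have g4 : \sum_(k < K.+1) (3 / 4 : R) ^+ k <= 4.
  apply: le_trans (geo_bound _ _ _) _; first by rewrite divr_ge0.
    by lra.
  by have -> : 1 - 3 / 4 = 4^-1 :> R by [field]; rewrite invrK.
apply: le_trans (ler_wpM2l _ g4) _; first by rewrite !mulr_ge0 ?powR_ge0.
by rewrite le_eqVlt; apply/orP; left; apply/eqP; ring.
Qed.

End Fixed.
End MultiScale.
End MultiScale.

(** * Taylor expansion on the lattice *)

Module Taylor.
Import Heat.

Section OneDim.
Variable R : realType.

Definition tay (rho : nat) (c : nat -> R) (t : R) : R := \sum_(a < rho.+1) c a / a`!%:R * t ^+ a.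

Lemma tay_derive rho c (t : R) : is_derive t 1 (tay rho.+1 c) (tay rho (fun a => c a.+1) t).
Proof.
elim: rho => [|rho IH].
  have -> : tay 1 c = cst (c 0%N) + (c 1%N \*: (@id R)).
    by apply/funext => s; rewrite /tay big_ord_recl big_ord1 /= !fctE /= fact0 divr1 mulr1 factS fact0 divr1 expr1.
  have -> : tay 0 (fun a => c a.+1) t = 0 + c 1%N *: (1 : R).
    by rewrite /tay big_ord1 /= fact0 divr1 expr0 add0r.
  by apply: is_deriveD; apply: is_deriveZ.
have -> : tay rho.+2 c = tay rho.+1 c + (c rho.+2 / (rho.+2)`!%:R) \*: ((@id R) ^+ rho.+2).
  by apply/funext => s; rewrite /tay big_ord_recr /= !fctE.
have -> : tay rho.+1 (fun a => c a.+1) t =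
   tay rho (fun a => c a.+1) t + (c rho.+2 / (rho.+2)`!%:R) *: ((rho.+2%:R * t ^+ rho.+1) *: (1 : R)).
  rewrite {1}/tay big_ord_recr /=; congr (_ + _); rewrite /GRing.scale /= mulr1 [(rho.+2)`!]factS natrM.
  have f0 : (rho.+1)`!%:R != 0 :> R by rewrite pnatr_eq0 -lt0n fact_gt0.
  have r0 : rho.+2%:R != 0 :> R by rewrite pnatr_eq0.
  move: ((rho.+1)`!%:R) (rho.+2%:R) f0 r0 => x y x0 y0; field; by rewrite x0 y0.
by apply: is_deriveD; apply: is_deriveZ; exact: is_deriveX.
Qed.

Lemma mvt_bound (f df : R -> R) (M t : R) : (forall s : R, is_derive s 1 f (df s)) ->
  (forall s, `|s| <= `|t| -> `|df s| <= M) -> `|f t - f 0| <= M * `|t|.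
Proof.
move=> hf hM.
have cf (i : interval R) : {within [set` i], continuous f}%classic.
  by apply: derivable_within_continuous => x _; exact: (ex_derive (is_derive := hf x)).
have [t0|t0] := lerP 0 t.
  have [c] := @MVT_segment R f df 0 t t0 (fun x _ => hf x) (cf _).
  rewrite in_itv /= => /andP[c0 ct] ->; rewrite subr0 normrM; apply: ler_wpM2r => //.
  by apply: hM; rewrite !ger0_norm.
have [c] := @MVT_segment R f df t 0 (ltW t0) (fun x _ => hf x) (cf _).
rewrite in_itv /= => /andP[c0 ct] E; rewrite -normrN opprB E sub0r normrM normrN; apply: ler_wpM2r => //.
by apply: hM; rewrite !ler0_norm ?lerN2 // ltW.
Qed.

(** The derivative of the remainder is the remainder of the derivative, and the mean value bound
    adds one power of |t| per order. *)
Lemma taylor1 (rho : nat) (phi : nat -> R -> R) (A beta : R) : 0 <= A -> 0 <= beta ->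
  (forall a, (a < rho)%N -> forall t : R, is_derive t 1 (phi a) (phi a.+1 t)) ->
  (forall t, `|phi rho t - phi rho 0| <= A * `|t| `^ beta) ->
  forall t, `|phi 0%N t - tay rho (fun a => phi a 0) t| <= A * `|t| `^ (rho%:R + beta).
Proof.
move=> A0 b0; elim: rho phi => [|rho IH] phi hd hh t.
  by rewrite /tay big_ord1 fact0 divr1 expr0 mulr1 add0r; exact: hh.
pose psi s := phi 0%N s - tay rho.+1 (fun a => phi a 0) s.
pose dpsi s := phi 1%N s - tay rho (fun a => phi a.+1 0) s.
have psi0 : psi 0 = 0.
  rewrite /psi /tay big_ord_recl big1 ?addr0 => [|i _]; last by rewrite /= exprS mul0r mulr0.
  by rewrite /= fact0 divr1 expr0 mulr1 subrr.
have dp (s : R) : is_derive s 1 psi (dpsi s).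
  by apply: is_deriveB; [exact: hd|exact: tay_derive].
have hdp s : `|s| <= `|t| -> `|dpsi s| <= A * `|t| `^ (rho%:R + beta).
  move=> st; apply: (le_trans (IH (fun a => phi a.+1) _ _ s)).
  - by move=> a ar; apply: hd.
  - exact: hh.
  by apply: ler_wpM2l => //; apply: ge0_ler_powR; rewrite ?nnegrE ?addr_ge0.
have := mvt_bound dp hdp; rewrite psi0 subr0 => /le_trans; apply.
rewrite -mulrA; apply: ler_wpM2l => //.
have [->|t0] := eqVneq t 0; first by rewrite normr0 mulr0 powR_ge0.
have n0 : `|t| != 0 by rewrite normr_eq0.
rewrite -{2}[`|t|]powRr1 // -powRD; last by rewrite n0 implybT.
by rewrite -[rho.+1%:R]natr1 (_ : rho%:R + beta + 1 = rho%:R + 1 + beta) //; ring.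
Qed.

End OneDim.

Section Multi.
Variables (R : realType) (d : nat).
Notation V := 'rV[int]_d.
Notation E := 'rV[R]_d.
Notation co := (Heat.co R).
Notation e j := (delta_mx 0 j : E).

Lemma line_derive (G : E -> R) (y v : E) (t : R) : (forall x, differentiable G x) ->
  is_derive t 1 (fun s : R => G (y + s *: v)) ('D_v G (y + t *: v)).
Proof.
move=> dG.
have e1 : (fun h : R => h^-1 *: (((fun s : R => G (y + s *: v)) \o shift t) (h *: 1) - G (y + t *: v))) =
   (fun h : R => h^-1 *: ((G \o shift (y + t *: v)) (h *: v) - G (y + t *: v))).
  apply/funext => h /=; congr (_ *: (G _ - _)).
  by rewrite [h *: 1]mulr1 scalerDl addrCA.
split; first by rewrite /derivable e1; exact: diff_derivable.
by rewrite /derive e1.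
Qed.

Definition dl (l : seq 'I_d) (s : 'I_d -> nat) (F : E -> R) : E -> R :=
  foldr (fun j G => iter (s j) (partial j) G) F l.

Lemma Ck_iter a k j (F : E -> R) : Ck (a + k) F -> Ck k (iter a (partial j) F).
Proof.
elim: a F => [//|a IH] F; rewrite addSn => -[_ h]; rewrite iterSr; apply: IH; exact: h.
Qed.

Lemma Ck_diff k (F : E -> R) : Ck k.+1 F -> forall x, differentiable F x.
Proof. by case. Qed.

Lemma norm2_e (t : R) j : norm2 (t *: e j) = `|t|.
Proof.
rewrite /norm2 (bigD1 j) //= big1 ?addr0 => [|i ij].
  by rewrite !mxE !eqxx mulr1 sqrtr_sqr.
by rewrite !mxE (negbTE ij) andbF mulr0 expr0n.
Qed.

(** Expanding one coordinate after another produces products of powers of different coordinates;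
    they are dominated by pure powers of the full order. *)
Lemma pow_mix (x y : R) (a : nat) (b : R) : 0 <= x -> 0 <= y -> 0 < b ->
  x ^+ a * y `^ b <= x `^ (a%:R + b) + y `^ (a%:R + b).
Proof.
move=> x0 y0 b0.
have ab0 : 0 <= a%:R + b by rewrite addr_ge0 // ltW.
have [xy|yx] := lerP x y.
  apply: (@le_trans _ _ (y `^ (a%:R + b))); last by rewrite lerDr powR_ge0.
  have [y00|yn] := eqVneq y 0.
    by rewrite y00 !powR0 ?mulr0 // gt_eqF // ltr_wpDl.
  rewrite powRD ?yn ?implybT // powR_mulrn //; apply: ler_wpM2r; first exact: powR_ge0.
  exact: lerXn2r.
apply: (@le_trans _ _ (x `^ (a%:R + b))); last by rewrite lerDl powR_ge0.
have xn : x != 0 by rewrite gt_eqF // (le_lt_trans y0).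
rewrite powRD ?xn ?implybT // powR_mulrn //; apply: ler_wpM2l; first exact: exprn_ge0.
by apply: ge0_ler_powR; rewrite ?nnegrE // ltW.
Qed.

Variables (h : R) (n0 : V).
Definition zc j (n : V) : R := h * (co j n - co j n0).
Definition zpt (l : seq 'I_d) (n : V) : E := \sum_(j <- l) zc j n *: e j.

Lemma Pol_zc k j (F : V -> R) a : Pol k F -> Pol (a + k) (fun n => zc j n ^+ a * F n).
Proof.
move=> hF; elim: a => [|a IH]; first by apply: Pol_eq hF => n; rewrite expr0 mul1r.
have h1 := Pol_Z h (Pol_X j IH).
have h2 := Pol_Z (- (h * co j n0)) (Pol_weak IH (leqnSn _)).
by apply: Pol_eq (Pol_D h1 h2) => n; rewrite /zc exprS; ring.
Qed.

Lemma Pol_sum k (I : Type) (s : seq I) (F : I -> V -> R) : (forall i, Pol k (F i)) ->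
  Pol k (fun n => \sum_(i <- s) F i n).
Proof.
move=> hF; elim: s => [|i s IH]; first by apply: Pol_eq (Pol_0 R d k) => n; rewrite big_nil.
by apply: Pol_eq (Pol_D (hF i) IH) => n; rewrite big_cons.
Qed.

Lemma dl_rcons l j s (F : E -> R) : dl (rcons l j) s F = dl l s (iter (s j) (partial j) F).
Proof. by rewrite /dl foldr_rcons. Qed.

Lemma eq_dl l s s' (F : E -> R) : {in l, s =1 s'} -> dl l s F = dl l s' F.
Proof.
elim: l => [//|j l IH] ss /=; rewrite IH ?(ss j) ?mem_head //.
by move=> i il; apply: ss; rewrite inE il orbT.
Qed.

End Multi.

Section TaylorList.
Variables (R : realType) (d : nat).
Notation V := 'rV[int]_d.
Notation E := 'rV[R]_d.
Notation e j := (delta_mx 0 j : E).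

(** Expansion in the last coordinate has as coefficients partial derivatives of F, to which
    induction applies with a lower order; adding coordinates at the end fits [dl_rcons], where the
    last one is differentiated first. [C] is chosen before F and the mesh, hence uniform over these
    derivatives and all lattices. *)
Lemma taylor_list (l : seq 'I_d) (r : nat) : uniq l -> exists2 C : R, 0 <= C &
  forall (h : R) (n0 : V) (rho : nat) (F : E -> R) (A beta : R) (x : E), (rho <= r)%N -> 0 <= A -> 0 < beta ->
    Ck rho F ->
    (forall s x y, (\sum_(j <- l) s j)%N = rho ->
       `|dl l s F x - dl l s F y| <= A * norm2 (x - y) `^ beta) ->
    exists2 P, Pol rho.+1 P & forall n, `|F (x + zpt h n0 l n) - P n| <= C * A * \sum_(j <- l) `|zc h n0 j n| `^ (rho%:R + beta).
Proof.
elim/last_ind: l => [|l j IH] ul.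
  exists 0 => // h n0 rho F A beta x rr A0 b0 cF hF; exists (fun=> F x); first exact: Pol_C.
  by move=> n; rewrite /zpt big_nil addr0 subrr normr0 big_nil mulr0.
move: ul; rewrite rcons_uniq => /andP[jl ul]; have [C C0 hC] := IH ul.
exists (1 + r.+1%:R * C * (size l).+1%:R); first by rewrite addr_ge0 // !mulr_ge0.
move=> h n0 rho F A beta x rr A0 b0 cF hF.
have st a (ar : (a <= rho)%N) : exists2 P, Pol (rho - a).+1 P & forall n,
    `|iter a (partial j) F (x + zpt h n0 l n) - P n| <= C * A * \sum_(i <- l) `|zc h n0 i n| `^ ((rho - a)%:R + beta).
  apply: hC => //; first exact: leq_trans (leq_subr _ _) rr.
    by apply: Ck_iter; rewrite subnKC.
  move=> s y y' hs.
  pose s' i := if i == j then a else s i.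
  have ss : {in l, s =1 s'} by move=> i il; rewrite /s'; case: eqP => // ij; rewrite -ij il in jl.
  have s'j : s' j = a by rewrite /s' eqxx.
  have := hF s' y y'; rewrite !dl_rcons s'j -!(eq_dl _ ss); apply.
  rewrite big_rcons /= s'j (eq_big_seq s) ?hs ?subnK // => i il; by rewrite ss.
pose Q a n := if @idP (a <= rho)%N is ReflectT ar then sval (cid2 (st a ar)) n else 0.
have hQ1 a : (a <= rho)%N -> Pol (rho - a).+1 (Q a).
  by rewrite /Q; case: {-}_ / idP => // ar _; case: cid2.
have hQ2 a : (a <= rho)%N -> forall n,
    `|iter a (partial j) F (x + zpt h n0 l n) - Q a n| <= C * A * \sum_(i <- l) `|zc h n0 i n| `^ ((rho - a)%:R + beta).
  by rewrite /Q; case: {-}_ / idP => // ar _; case: cid2.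
exists (fun n => \sum_(a <- index_enum 'I_rho.+1) a`!%:R^-1 * (zc h n0 j n ^+ a * Q a n)).
  apply: Pol_sum => a; apply: Pol_Z.
  have ar : (a <= rho)%N by rewrite -ltnS.
  by have := Pol_zc h n0 j a (hQ1 a ar); rewrite addnS subnKC.
move=> n; set z := zc h n0 j n; set y := x + zpt h n0 l n.
have -> : x + zpt h n0 (rcons l j) n = y + z *: e j by rewrite /zpt big_rcons /= addrA.
pose phi a (t : R) := iter a (partial j) F (y + t *: e j).
have t1 := @taylor1 R rho phi A beta A0 (ltW b0).
have /= {t1} := t1 _ _ z.
have d1 a : (a < rho)%N -> forall t : R, is_derive t 1 (phi a) (phi a.+1 t).
  move=> ar t; apply: line_derive; apply: (@Ck_diff R d (rho - a).-1); apply: Ck_iter.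
  by rewrite prednK ?subn_gt0 // subnKC // ltnW.
have d2 t : `|phi rho t - phi rho 0| <= A * `|t| `^ beta.
  pose s i := if i == j then rho else 0%N.
  have sj : s j = rho by rewrite /s eqxx.
  have s0 : {in l, s =1 (fun=> 0%N)} by move=> i il; rewrite /s; case: eqP => // ij; rewrite -ij il in jl.
  have := hF s (y + t *: e j) (y + 0 *: e j); rewrite !dl_rcons sj !(eq_dl _ s0).
  have z0 G : dl l (fun=> 0%N) G = G by elim: (l) => //= i l' ->.
  rewrite !z0 /phi -(norm2_e t j) opprD addrACA subrr add0r scale0r subr0; apply.
  by rewrite big_rcons /= sj big_seq big1 // => i il; rewrite s0.
move=> /(_ d1 d2); rewrite /tay /phi /= => h1.
pose T := \sum_(a < rho.+1) iter a (partial j) F y / a`!%:R * z ^+ a.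
have h2 : `|T - \sum_(a < rho.+1) a`!%:R^-1 * (z ^+ a * Q a n)| <=
    \sum_(a < rho.+1) `|z| ^+ a * (C * A * \sum_(i <- l) `|zc h n0 i n| `^ ((rho - a)%:R + beta)).
  rewrite /T -sumrB; apply: le_trans (ler_norm_sum _ _ _) _; apply: ler_sum => a _.
  have ar : (a <= rho)%N by rewrite -ltnS.
  have -> : iter a (partial j) F y / a`!%:R * z ^+ a - a`!%:R^-1 * (z ^+ a * Q a n) =
    a`!%:R^-1 * (z ^+ a * (iter a (partial j) F y - Q a n)) by ring.
  rewrite normrM (ger0_norm (x := _^-1)) ?invr_ge0 // normrM normrX.
  apply: (@le_trans _ _ (1 * (`|z| ^+ a * `|iter a (partial j) F y - Q a n|))).
    apply: ler_wpM2r; first by rewrite mulr_ge0 // exprn_ge0.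
    by rewrite invf_le1 ?ltr0n ?fact_gt0 // ler1n fact_gt0.
  rewrite mul1r; apply: ler_wpM2l; first exact: exprn_ge0.
  exact: hQ2.
set Sl := \sum_(i <- l) `|zc h n0 i n| `^ (rho%:R + beta).
have Sl0 : 0 <= Sl by apply: sumr_ge0 => i _; exact: powR_ge0.
have zp : 0 <= `|z| `^ (rho%:R + beta) by exact: powR_ge0.
have h3 : \sum_(a < rho.+1) `|z| ^+ a * (C * A * \sum_(i <- l) `|zc h n0 i n| `^ ((rho - a)%:R + beta)) <=
    rho.+1%:R * (C * A * (Sl + (size l)%:R * `|z| `^ (rho%:R + beta))).
  rewrite -[rho.+1 in leRHS]card_ord mulr_natl -sumr_const; apply: ler_sum => a _.
  have ar : (a <= rho)%N by rewrite -ltnS.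
  rewrite mulrCA; apply: ler_wpM2l; first by rewrite mulr_ge0.
  rewrite mulr_sumr.
  have -> : (size l)%:R * `|z| `^ (rho%:R + beta) = \sum_(i <- l) `|z| `^ (rho%:R + beta).
    by rewrite big_const_seq count_predT iter_addr_0 mulr_natl.
  rewrite /Sl -big_split /=; apply: ler_sum => i _.
  have b1 : 0 < (rho - a)%:R + beta by rewrite ltr_wpDl.
  apply: le_trans (pow_mix a (normr_ge0 _) (normr_ge0 _) b1) _.
  have -> : a%:R + ((rho - a)%:R + beta) = rho%:R + beta by rewrite addrA -natrD subnKC.
  by rewrite addrC.
rewrite -/T in h1.
have -> : F (y + z *: e j) - \sum_(a <- index_enum 'I_rho.+1) a`!%:R^-1 * (z ^+ a * Q a n) =
   (F (y + z *: e j) - T) + (T - \sum_(a < rho.+1) a`!%:R^-1 * (z ^+ a * Q a n)) by rewrite addrA subrK.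
apply: le_trans (ler_normD _ _) _.
have h1' : `|F (y + z *: e j) - T| <= A * `|z| `^ (rho%:R + beta).
  by move: h1; under [X in `|_ - X|]eq_bigr => a _ do rewrite scale0r addr0.
apply: le_trans (lerD h1' (le_trans h2 h3)) _.
rewrite big_rcons /= -/z -/Sl.
have rr' : rho.+1%:R <= r.+1%:R :> R by rewrite ler_nat ltnS.
have CA : 0 <= C * A by rewrite mulr_ge0.
set zz := `|z| `^ (rho%:R + beta) in h1' zp *.
apply: (@le_trans _ _ (A * zz + r.+1%:R * (C * A * (Sl + (size l)%:R * zz)))).
  by rewrite lerD2l; apply: ler_wpM2r => //; rewrite mulr_ge0 // addr_ge0 // mulr_ge0.
rewrite mulrDl mul1r mulrDl; apply: lerD.
  by rewrite ler_wpM2l // lerDr.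
rewrite -[(size l).+1%:R]natr1.
have -> : r.+1%:R * C * ((size l)%:R + 1) * A * (Sl + zz) =
   r.+1%:R * (C * A * (Sl + (size l)%:R * zz)) + r.+1%:R * (C * A * ((size l)%:R * Sl + zz)) by ring.
by rewrite lerDl !mulr_ge0 // addr_ge0 // mulr_ge0.
Qed.

End TaylorList.
End Taylor.

(** * Approximation of Hoelder functions on the ball *)

Module Holder.
Import Heat Telescope Networks NetApprox Representation MultiScale Taylor.

Section Holder.
Variables (R : realType) (d : nat).
Hypothesis d_gt0 : (0 < d)%N.
Notation V := 'rV[int]_d.
Notation E := 'rV[R]_d.
Notation co := (Heat.co R).

(** The cost bounds the Lipschitz constant, which carries estimates from lattice points to the whole
    ball. *)
Lemma cost_le_lip (f : E -> R) M x y : cost_le f M -> inball x -> inball y ->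
  `|f x - f y| <= M * \sum_j `|x 0 j - y 0 j|.
Proof.
move=> [I [c [v [hM hf]]]] hx hy; rewrite !hf // -sumrB.
have S0 : 0 <= \sum_j `|x 0 j - y 0 j| by apply: sumr_ge0.
apply: le_trans (ler_norm_sum _ _ _) _; apply: le_trans (ler_wpM2r S0 hM).
rewrite mulr_suml; apply: ler_sum => i _; rewrite -mulrBr normrM -mulrA; apply: ler_wpM2l => //.
apply: le_trans (relu_lip _ _) _.
have -> : aff x (v i) - aff y (v i) = \sum_(j < d) (x 0 j - y 0 j) * v i 0 (widen_ord (leqnSn d) j).
  by rewrite /aff opprD addrACA subrr addr0 -sumrB; apply: eq_bigr => j _; rewrite mulrBl.
apply: le_trans (ler_norm_sum _ _ _) _; rewrite mulr_sumr; apply: ler_sum => j _.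
by rewrite normrM mulrC; apply: ler_wpM2r => //; exact: norm2_coord.
Qed.

(** Rounding towards zero keeps the lattice point inside the ball. *)
Definition truncz (B0 : nat) (x : E) : V :=
  \row_j (if 0 <= x 0 j then Num.floor (B0%:R * x 0 j) else - Num.floor (- (B0%:R * x 0 j))).

Lemma truncz_spec (B0 : nat) (x : E) j : (0 < B0)%N ->
  `|co j (truncz B0 x) / B0%:R| <= `|x 0 j| /\ `|x 0 j - co j (truncz B0 x) / B0%:R| <= B0%:R^-1.
Proof.
move=> B0p; have b0 : 0 < B0%:R :> R by rewrite ltr0n.
have key (t : R) : 0 <= t -> [/\ 0 <= (Num.floor (B0%:R * t))%:~R / B0%:R :> R,
    (Num.floor (B0%:R * t))%:~R / B0%:R <= t &
    t - (Num.floor (B0%:R * t))%:~R / B0%:R <= B0%:R^-1].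
  move=> t0; have bt : 0 <= B0%:R * t by rewrite mulr_ge0 // ltW.
  have f0 : 0 <= (Num.floor (B0%:R * t))%:~R :> R by rewrite ler0z floor_ge0.
  have f1 : (Num.floor (B0%:R * t))%:~R <= B0%:R * t by exact: floor_le_tmp.
  have f2 : B0%:R * t < (Num.floor (B0%:R * t) + 1)%:~R by exact: floorD1_gt.
  split; [by apply: divr_ge0 => //; exact: ltW|by rewrite ler_pdivrMr // [t * _]mulrC|].
  rewrite lerBlDr -[X in X + _]mul1r -mulrDl ler_pdivlMr // [t * _]mulrC ltW //.
  by move: f2; rewrite intrD addrC.
rewrite /Heat.co mxE; case: ifP => [x0|/negbT]; last rewrite -ltNge => x0.
  have [h1 h2 h3] := key _ x0; rewrite !ger0_norm //; last by rewrite subr_ge0.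
have nx : 0 <= - x 0 j by rewrite oppr_ge0 ltW.
have [h1 h2 h3] := key _ nx; rewrite mulrN in h1 h2 h3.
rewrite intrN mulNr normrN (ger0_norm h1) (ltr0_norm x0) opprK; split=> //.
by rewrite -normrN opprD ger0_norm // subr_ge0.
Qed.

Lemma inball_le (x y : E) : inball x -> (forall j, `|y 0 j| <= `|x 0 j|) -> inball y.
Proof.
move=> hx h; apply: le_trans hx; rewrite /norm2 ler_wsqrtr //; apply: ler_sum => j _.
rewrite -[leLHS]real_normK ?num_real // -[leRHS]real_normK ?num_real //.
by apply: lerXn2r; rewrite ?nnegrE.
Qed.

Definition unif_cont (F : E -> R) := forall eps : R, 0 < eps -> exists2 del : R, 0 < del &
  forall x y : E, (forall j, `|x 0 j - y 0 j| <= del) -> `|F x - F y| <= eps.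

(** For fixed J the cost is bounded uniformly in the mesh exponent [p]. So [p] can be chosen last,
    with the Lipschitz error of the network and the modulus of continuity of F both below 2^(-J al)
    on one mesh cell. *)
Lemma smooth_approx (r : nat) (al A : R) (F : E -> R) : 0 < al -> al <= r.+1%:R ->
  al < (d%:R + 3) / 2 -> 0 <= A -> (forall x, `|F x| <= A) -> unif_cont F ->
  (forall (B0 : nat) n0, (0 < B0)%N ->
     taylor_at r.+1 A al B0%:R^-1 (fun n => F (latpt R B0 n)) n0) ->
  exists2 C : R, 0 < C & forall J : nat, exists g : E -> R,
    cost_le g (C * (2 ^+ J) `^ ((d%:R + 3) / 2 - al)) /\
    forall x, inball x -> `|g x - F x| <= C * (2 ^+ J) `^ (- al).
Proof.
move=> al0 alr ald A0 FA Fu FT.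
pose C1 := ccost R d r * cgeo d r al * A.
pose C2 := (cres R d r + cdet R d r * (16 * d%:R)) * A.
exists (1 + `|C1| + `|C2| + 2).
  by rewrite ltr_wpDl // addr_ge0 // addr_ge0.
move=> J; set W := (2 ^+ J) `^ _; set e := (2 ^+ J) `^ (- al).
have e0 : 0 < e by apply: powR_gt0; exact: exprn_gt0.
have W0 : 0 < W by apply: powR_gt0; exact: exprn_gt0.
have [del del0 hdel] := Fu e e0.
pose M := `|C1| * W; have M0 : 0 <= M by rewrite mulr_ge0 // ltW.
pose X := del^-1 + M * d%:R / e.
have X0 : 0 <= X by rewrite addr_ge0 ?invr_ge0 ?(ltW del0) // divr_ge0 ?mulr_ge0 // ltW.
pose p := (Num.truncn X).+2.
have p2 : (2 <= p)%N by [].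
have pX : X <= (2 ^ (J + p))%:R.
  have h1 : X <= (Num.truncn X).+1%:R by apply: ltW; exact: truncnS_gt.
  apply: le_trans h1 _; rewrite ler_nat.
  apply: (@leq_trans p); first by rewrite leqnSn.
  apply: (@leq_trans (2 ^ p)); first by rewrite ltnW // ltn_expl.
  by rewrite leq_exp2l // leq_addl.
set B0 := (2 ^ (J + p))%N in pX.
have B0p : (0 < B0)%N by rewrite expn_gt0.
have b0 : 0 < B0%:R :> R by rewrite ltr0n.
have tau0 : 0 < (d%:R + 3) / 2 - al by rewrite subr_gt0.
have [f [hf1 hf2]] := lattice_approx d_gt0 p2 al0 alr A0 (fun n => FA _) (fun n0 => FT B0 n0 B0p) tau0.
have hfM : cost_le f M.
  by apply: cost_le_weak hf1; rewrite /M -/W -/C1; apply: ler_wpM2r; [exact: ltW|exact: ler_norm].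
exists f; split.
  apply: cost_le_weak hfM; rewrite /M; apply: ler_wpM2r; first exact: ltW.
  have := normr_ge0 C2; lra.
move=> x hx.
pose n := truncz B0 x; pose y := latpt R B0 n.
have yj j : y 0 j = co j n / B0%:R by rewrite mxE.
have hy1 j : `|y 0 j| <= `|x 0 j| by rewrite yj; have [] := truncz_spec x j B0p.
have hy2 j : `|x 0 j - y 0 j| <= B0%:R^-1 by rewrite yj; have [] := truncz_spec x j B0p.
have yb : inball y by apply: inball_le hx hy1.
have nb : inbox B0 n.
  apply/forallP => j; have := le_trans (hy1 j) (inball_coord j hx).
  rewrite yj normrM normfV [X in _ / X]ger0_norm ?(ltW b0) // ler_pdivrMr // mul1r /Heat.co.
  by rewrite -intr_norm -[B0%:R]/(B0%:Z%:~R) ler_int.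
have t1 : `|f x - f y| <= e.
  apply: le_trans (cost_le_lip hfM hx yb) _.
  apply: (@le_trans _ _ (M * (d%:R * B0%:R^-1))).
    apply: ler_wpM2l => //; apply: (@le_trans _ _ (\sum_(j < d) B0%:R^-1)); first exact: ler_sum.
    by rewrite sumr_const card_ord mulr_natl.
  rewrite [M * _]mulrA ler_pdivrMr // [e * _]mulrC -ler_pdivrMr //; apply: le_trans pX; rewrite /X lerDr invr_ge0; exact: ltW.
have t2 : `|F x - F y| <= e.
  apply: hdel => j; apply: (le_trans (hy2 j)).
  rewrite -[leRHS]invrK lef_pV2 ?posrE ?invr_gt0 //; apply: le_trans pX; rewrite /X lerDl.
  by rewrite divr_ge0 ?mulr_ge0 // ltW.
have t3 := hf2 n nb; rewrite -/y -/C2 in t3.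
have t3' : `|f y - F y| <= `|C2| * e.
  by apply: le_trans t3 _; apply: ler_wpM2r; [exact: ltW|exact: ler_norm].
have -> : f x - F x = (f x - f y) + (f y - F y) + (F y - F x) by ring.
apply: le_trans (ler_normD _ _) _; rewrite [`|F y - F x|]distrC.
have := ler_normD (f x - f y) (f y - F y).
have c1 : 0 <= `|C1| * e by rewrite mulr_ge0 // ltW.
rewrite !mulrDl mul1r; lra.
Qed.

Lemma holder_Taylor (r : nat) (beta : R) (F : E -> R) : 0 < beta -> beta <= 1 ->
  (holder_norm_Rd r beta F < 2%:E)%E ->
  exists2 A : R, 0 <= A & (forall x, `|F x| <= A) /\
  forall (B0 : nat) n0, (0 < B0)%N ->
     taylor_at r.+1 A (r%:R + beta) B0%:R^-1 (fun n => F (latpt R B0 n)) n0.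
Proof.
move=> b0 b1; rewrite /holder_norm_Rd; case: asboolP => // cF; rewrite gt_max => /andP[h1 h2].
have F2 x : `|F x| <= 2.
  have -> : F x = dmulti (fun=> 0%N) F x.
    by rewrite /dmulti; elim: (enum _) => //= j l ->.
  rewrite -lee_fin; apply: ltW; apply: le_lt_trans h1; apply: ereal_sup_ubound.
  by exists (fun=> 0%N), x; split=> //; rewrite /mi_norm big1.
have [C C0 hC] := @taylor_list R d (enum 'I_d) r (enum_uniq _).
exists (C * 2 + 2); first by rewrite addr_ge0 // mulr_ge0.
split=> [x|B0 n0 B0p]; first by apply: le_trans (F2 x) _; rewrite lerDr mulr_ge0.
have [|P hP1 hP2] := hC B0%:R^-1 n0 r F 2 beta (latpt R B0 n0) (leqnn _) (ler0n _ _) b0 cF.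
  move=> s x y hs; have [->|xy] := eqVneq x y.
    by rewrite subrr normr0 mulr_ge0 ?powR_ge0.
  have n0' : 0 < norm2 (x - y) `^ beta.
    apply: powR_gt0; rewrite lt_neqAle norm2_ge0 andbT eq_sym; apply: contraNneq xy => nz.
    apply/eqP/rowP => j; apply/eqP; rewrite -subr_eq0 -normr_le0.
    by have := norm2_coord (x - y) j; rewrite nz !mxE.
  rewrite -ler_pdivrMr // -lee_fin; apply: ltW; apply: le_lt_trans h2; apply: ereal_sup_ubound.
  by exists s, x, y; split=> //; rewrite /mi_norm -hs big_enum.
exists P => // n; have := hP2 n.
have -> : latpt R B0 n0 + zpt B0%:R^-1 n0 (enum 'I_d) n = latpt R B0 n.
  apply/rowP => j; rewrite /zpt mxE summxE big_enum /= (bigD1 j) //= big1 ?addr0 => [|i ij].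
    by rewrite !mxE !eqxx /= /zc; ring.
  by rewrite !mxE eq_sym (negbTE ij) andbF mulr0.
rewrite big_enum => /le_trans; apply; apply: ler_wpM2r; last by rewrite lerDl.
by apply: sumr_ge0 => j _; exact: powR_ge0.
Qed.

(** For r = 0 this comes from the Hoelder quotient, otherwise from the bounded first partial
    derivatives. *)
Lemma holder_unif (r : nat) (beta : R) (F : E -> R) : 0 < beta -> beta <= 1 ->
  (holder_norm_Rd r beta F < 2%:E)%E -> unif_cont F.
Proof.
move=> b0 b1; rewrite /holder_norm_Rd; case: asboolP => // cF; rewrite gt_max => /andP[h1 h2].
have d0 : 0 < d%:R :> R by rewrite ltr0n.
have dz (G : E -> R) : dmulti (fun=> 0%N) G = G by rewrite /dmulti; elim: (enum _) => //= j l ->.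
move=> eps e0; case: r cF h1 h2 => [|r] cF h1 h2.
  exists ((eps / 2) `^ (beta^-1) / d%:R); first by rewrite divr_gt0 // powR_gt0 // divr_gt0.
  move=> x y hxy; have [->|xy] := eqVneq x y; first by rewrite subrr normr0 ltW.
  have n0' : 0 < norm2 (x - y) `^ beta.
    apply: powR_gt0; rewrite lt_neqAle norm2_ge0 andbT eq_sym; apply: contraNneq xy => nz.
    apply/eqP/rowP => j; apply/eqP; rewrite -subr_eq0 -normr_le0.
    by have := norm2_coord (x - y) j; rewrite nz !mxE.
  have hh : `|F x - F y| <= 2 * norm2 (x - y) `^ beta.
    rewrite -ler_pdivrMr // -lee_fin; apply: ltW; apply: le_lt_trans h2; apply: ereal_sup_ubound.
    by exists (fun=> 0%N), x, y; rewrite !dz; split=> //; rewrite /mi_norm big1.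
  apply: (le_trans hh); rewrite mulrC -ler_pdivlMr //.
  have nn : norm2 (x - y) <= (eps / 2) `^ (beta^-1).
    apply: le_trans (norm2_le_sum _) _.
    apply: (@le_trans _ _ (\sum_(j < d) (eps / 2) `^ (beta^-1) / d%:R)).
      by apply: ler_sum => j _; rewrite !mxE.
    by rewrite sumr_const card_ord -[_ *+ d]mulr_natr divfK // gt_eqF.
  have -> : eps / 2 = ((eps / 2) `^ (beta^-1)) `^ beta.
    by rewrite -powRrM mulVf ?powRr1 ?gt_eqF // divr_ge0 // ltW.
  by apply: ge0_ler_powR; rewrite ?nnegrE ?powR_ge0 ?norm2_ge0 // ltW.
have pb j x : `|partial j F x| <= 2.
  pose s i := (i == j) : nat.
  have -> : partial j F x = dmulti s F x.
    have : j \in enum 'I_d by rewrite mem_enum.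
    rewrite /dmulti; elim: (enum 'I_d) (enum_uniq 'I_d) => //= i l IH /andP[il ul].
    rewrite inE => /predU1P[ji|jl].
      rewrite {1}/s -ji eqxx /=; congr (partial j _ x).
      have : j \notin l by rewrite ji.
      elim: (l) => //= k l' IH'; rewrite inE negb_or => /andP[jk /IH' <-].
      by rewrite /s eq_sym (negbTE jk).
    have ij : (i == j) = false by apply/eqP => E'; rewrite E' jl in il.
    by rewrite {1}/s ij /= -IH.
  rewrite -lee_fin; apply: ltW; apply: le_lt_trans h1; apply: ereal_sup_ubound.
  exists s, x; split=> //; rewrite /mi_norm (bigD1 j) //= /s eqxx big1 // => i /negbTE ->//.
have dF : forall x, differentiable F x by case: cF.
exists (eps / (2 * d%:R)); first by rewrite divr_gt0 // mulr_gt0.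
move=> x y hxy; pose v := x - y.
have := @mvt_bound R (fun s => F (y + s *: v)) (fun s => 'D_v F (y + s *: v)) eps 1 (fun s => line_derive y v s dF).
rewrite scale1r scale0r addr0 normr1 mulr1 [y + v]addrC subrK; apply => s _.
rewrite deriveE //.
have -> : v = \sum_(j < d) v 0 j *: delta_mx 0 j.
  apply/rowP => i; rewrite summxE (bigD1 i) //= big1 ?addr0 => [|k ki]; first by rewrite !mxE !eqxx mulr1.
  by rewrite !mxE eq_sym (negbTE ki) andbF mulr0.
rewrite linear_sum; apply: le_trans (ler_norm_sum _ _ _) _.
apply: (@le_trans _ _ (\sum_(j < d) eps / (2 * d%:R) * 2)); last first.
  rewrite sumr_const card_ord -[_ *+ d]mulr_natr le_eqVlt; apply/orP; left; apply/eqP.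
  by field; rewrite gt_eqF.
apply: ler_sum => j _; rewrite linearZ /= normrM; apply: ler_pM => //; first by rewrite !mxE.
by rewrite -deriveE //; exact: pb.
Qed.

Theorem holder_approx (al : R) (h : E -> R) : 0 < al -> al < (d%:R + 3) / 2 -> holder_ball al h ->
  exists2 C : R, 0 < C & forall J : nat, exists g : E -> R,
    cost_le g (C * (2 ^+ J) `^ ((d%:R + 3) / 2 - al)) /\
    forall x, inball x -> `|g x - h x| <= C * (2 ^+ J) `^ (- al).
Proof.
move=> al0 ald [r [beta [alE b0 b1 hn]]].
(* The infimum over extensions need not be attained, so an extension of norm below 2 is used. *)
have : (holder_norm r beta h < 2%:E)%E by apply: le_lt_trans hn _; rewrite lte_fin ltr1n.
rewrite /holder_norm => /ereal_inf_lt [_ [F Fh <-] hF].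
have [A A0 [FA FT]] := holder_Taylor b0 b1 hF.
have alr : al <= r.+1%:R by rewrite alE -[r.+1%:R]natr1 lerD2l.
rewrite -alE in FT.
have [C C0 hC] := smooth_approx al0 alr ald A0 FA (holder_unif b0 b1 hF) FT.
exists C => // J; have [g [g1 g2]] := hC J; exists g; split=> // x hx.
by rewrite -Fh // g2.
Qed.

End Holder.
End Holder.

(** * Deviation inequalities for i.i.d. samples *)

Module Concentration.
Import OneStep.
Local Open Scope classical_set_scope.

Section Bounded.
Variables (R : realType) (dT : measure_display) (T : measurableType dT).
Implicit Types f g : T -> R.

Definition bm f := measurable_fun setT f /\ exists b : R, forall z, `|f z| <= b.

Lemma bm_cst (a : R) : bm (fun=> a).
Proof. by split=> //; exists `|a|. Qed.

Lemma bm_D f g : bm f -> bm g -> bm (fun z => f z + g z).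
Proof.
move=> [mf [b hb]] [mg [b' hb']]; split; first exact: measurable_funD.
by exists (b + b') => z; apply: le_trans (ler_normD _ _) _; exact: lerD.
Qed.

Lemma bm_M f g : bm f -> bm g -> bm (fun z => f z * g z).
Proof.
move=> [mf [b hb]] [mg [b' hb']]; split; first exact: measurable_funM.
by exists (b * b') => z; rewrite normrM; exact: ler_pM.
Qed.

Lemma bm_N f : bm f -> bm (fun z => - f z).
Proof.
move=> hf; have := bm_M (bm_cst (-1)) hf.
by congr bm; apply/funext => z; rewrite mulN1r.
Qed.

Lemma bm_B f g : bm f -> bm g -> bm (fun z => f z - g z).
Proof. by move=> hf hg; apply: bm_D => //; exact: bm_N. Qed.

Lemma bm_sqr f : bm f -> bm (fun z => f z ^+ 2).
Proof. by move=> hf; have := bm_M hf hf; congr bm; apply/funext => z; rewrite expr2. Qed.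

Lemma bm_sum (I : Type) (s : seq I) (f : I -> T -> R) : (forall i, bm (f i)) ->
  bm (fun z => \sum_(i <- s) f i z).
Proof.
move=> h; elim: s => [|i s IH].
  by have := bm_cst 0; congr bm; apply/funext => z; rewrite big_nil.
by have := bm_D (h i) IH; congr bm; apply/funext => z; rewrite big_cons.
Qed.

Lemma bm_ind (A : set T) : measurable A -> bm (\1_A : T -> R).
Proof.
move=> mA; split; first exact: measurable_indic.
by exists 1 => z; rewrite indicE; case: (_ \in _); rewrite ?normr1 ?normr0.
Qed.

(** Cells are preimages of half-open intervals of length [eps]. They reduce bounded functions to
    finitely many events, the form in which independence and conditioning are given. *)
Lemma discretize f (b eps : R) : measurable_fun setT f -> (forall z, `|f z| <= b) -> 0 < eps ->
  exists (K : nat) (c : 'I_K -> R) (q : T -> 'I_K),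
    [/\ (forall k, measurable (q @^-1` [set k])),
        (forall z, c (q z) <= f z /\ f z <= c (q z) + eps) & forall k, `|c k| <= b].
Proof.
move=> mf hb e0.
pose K := (Num.truncn (2 * b / eps)).+1.
have fb z : 0 <= (f z + b) / eps <= 2 * b / eps.
  have := hb z; rewrite ler_norml => /andP[h1 h2].
  rewrite divr_ge0 ?(ltW e0) //=; last by lra.
  by rewrite ler_pM2r ?invr_gt0 //; lra.
have b0 : 0 <= 2 * b / eps by have /andP[h1 h2] := fb point; apply: le_trans h2.
have qK z : (Num.truncn ((f z + b) / eps) < K)%N.
  by rewrite ltnS; have /andP[h1 h2] := fb z; exact: le_truncn.
pose q z : 'I_K := Ordinal (qK z).
pose c (k : 'I_K) : R := - b + k%:R * eps.
have qP z : c (q z) <= f z < c (q z) + eps.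
  have /andP[h1 h2] := fb z; have /andP[t1 t2] := truncn_itv h1.
  rewrite /c /=; move: t1 t2; rewrite ler_pdivlMr // ltr_pdivrMr // -[_.+1%:R]natr1 (mulrDl _ 1) mul1r => t1 t2.
  by apply/andP; split; lra.
exists K, c, q; split.
- move=> k; have -> : q @^-1` [set k] = f @^-1` `[c k, c k + eps[%classic.
    apply/seteqP; split=> z /=; first by move=> <-; rewrite in_itv /=; exact: qP.
    rewrite in_itv /= => /andP[h1 h2]; have /andP[h3 h4] := qP z.
    apply: val_inj; apply/eqP; rewrite eqn_leq; move: h1 h2 h3 h4; rewrite /c => h1 h2 h3 h4.
    have k1 : (q z)%:R < k.+1%:R :> R by rewrite -(ltr_pM2r e0) -[k.+1%:R]natr1 mulrDl mul1r; lra.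
    have k2 : k%:R < (q z).+1%:R :> R by rewrite -(ltr_pM2r e0) -[(q z).+1%:R]natr1 mulrDl mul1r; lra.
    by move: k1 k2; rewrite !ltr_nat !ltnS => -> ->.
  by rewrite -[X in measurable X]setTI; apply: mf => //; exact: measurable_itv.
- by move=> z; have /andP[h1 h2] := qP z; split=> //; exact: ltW.
move=> k; have k0 : 0 <= k%:R * eps by rewrite mulr_ge0 // ltW.
have : k%:R * eps <= 2 * b.
  rewrite -ler_pdivlMr //; have /andP[tl _] := truncn_itv b0; apply: le_trans tl; rewrite ler_nat -ltnS; exact: ltn_ord.
by rewrite /c ler_norml => h; apply/andP; split; lra.
Qed.

End Bounded.

Lemma bm_comp (R : realType) (dT dU : measure_display) (T : measurableType dT) (U : measurableType dU)
  (f : U -> R) (g : T -> U) : bm f -> measurable_fun setT g -> bm (fun z => f (g z)).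
Proof. by move=> [mf [b hb]] mg; split; [exact: measurableT_comp|exists b]. Qed.

Section Integral.
Variables (R : realType) (dT : measure_display) (T : measurableType dT).
Variable mu : {finite_measure set T -> \bar R}.
Implicit Types f g : T -> R.

Definition Iv f : R := Rintegral mu setT f.

Lemma bm_integrable f : bm f -> mu.-integrable setT (EFin \o f).
Proof.
move=> [mf [b hb]]; apply: measurable_bounded_integrable => //; first exact: fin_num_fun_lty.
exists b; split; first exact: num_real.
by move=> M bM z _; apply: le_trans (hb z) (ltW bM).
Qed.

Lemma Iv_D f g : bm f -> bm g -> Iv (fun z => f z + g z) = Iv f + Iv g.
Proof. by move=> hf hg; apply: RintegralD => //; exact: bm_integrable. Qed.

Lemma Iv_B f g : bm f -> bm g -> Iv (fun z => f z - g z) = Iv f - Iv g.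
Proof. by move=> hf hg; apply: RintegralB => //; exact: bm_integrable. Qed.

Lemma Iv_Z a f : bm f -> Iv (fun z => a * f z) = a * Iv f.
Proof. by move=> hf; apply: RintegralZl => //; exact: bm_integrable. Qed.

Lemma Iv_le f g : bm f -> bm g -> (forall z, f z <= g z) -> Iv f <= Iv g.
Proof. by move=> hf hg h; apply: le_Rintegral => //; exact: bm_integrable. Qed.

Lemma Iv_cst a : Iv (fun=> a) = a * fine (mu setT).
Proof. exact: Rintegral_cst. Qed.

Lemma Iv_ge0 f : (forall z, 0 <= f z) -> 0 <= Iv f.
Proof. by move=> h; apply: Rintegral_ge0. Qed.

Lemma Iv_ind (A : set T) : measurable A -> Iv (\1_A) = fine (mu A).
Proof. by move=> mA; rewrite /Iv /Rintegral integral_indic // setIT. Qed.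

Lemma Iv_sum (I : Type) (s : seq I) (f : I -> T -> R) : (forall i, bm (f i)) ->
  Iv (fun z => \sum_(i <- s) f i z) = \sum_(i <- s) Iv (f i).
Proof.
move=> h; elim: s => [|i s IH].
  have -> : (fun z => \sum_(i <- [::]) f i z) = (fun=> 0) by apply/funext => z; rewrite big_nil.
  by rewrite big_nil Iv_cst mul0r.
rewrite big_cons -IH -Iv_D //; last exact: bm_sum.
by congr Iv; apply/funext => z; rewrite big_cons.
Qed.

Lemma Iv_norm f (b : R) : bm f -> (forall z, `|f z| <= b) -> `|Iv f| <= b * fine (mu setT).
Proof.
move=> hf hb; rewrite ler_norml -Iv_cst; apply/andP; split; last first.
  by apply: Iv_le => // [|z]; [exact: bm_cst|have := hb z; rewrite ler_norml => /andP[]].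
have -> : - Iv (fun=> b) = Iv (fun=> - b) by rewrite !Iv_cst mulNr.
by apply: Iv_le => // [|z]; [exact: bm_cst|have := hb z; rewrite ler_norml => /andP[]].
Qed.

Lemma Iv_ae f g (N : set T) : bm f -> bm g -> measurable N -> mu N = 0%E ->
  (forall z, ~ N z -> f z = g z) -> Iv f = Iv g.
Proof.
move=> [mf _] [mg _] mN N0 h; rewrite /Iv /Rintegral; congr fine; apply: ae_eq_integral => //.
- exact/measurable_EFinP.
- exact/measurable_EFinP.
by exists N; split=> // z /= hz; apply: contrapT => nz; apply: hz => _; rewrite h.
Qed.

Lemma Iv_cells (K : nat) (c : 'I_K -> R) (q : T -> 'I_K) : (forall k, measurable (q @^-1` [set k])) ->
  bm (fun z => c (q z)) /\ Iv (fun z => c (q z)) = \sum_k c k * fine (mu (q @^-1` [set k])).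
Proof.
move=> mq.
have E : (fun z => c (q z)) = (fun z => \sum_k c k * \1_(q @^-1` [set k]) z).
  apply/funext => z; rewrite (bigD1 (q z)) //= big1 ?addr0.
    by rewrite indicE mem_set ?mulr1.
  by move=> k kq; rewrite indicE memNset ?mulr0 //= => qk; rewrite qk eqxx in kq.
have hb k : bm (fun z => c k * \1_(q @^-1` [set k]) z).
  by apply: bm_M; [exact: bm_cst|exact: bm_ind].
rewrite E; split; first exact: bm_sum.
by rewrite Iv_sum //; apply: eq_bigr => k _; rewrite Iv_Z ?Iv_ind //; exact: bm_ind.
Qed.

End Integral.

Section Likely.
Variables (R : realType) (dO : measure_display) (O : measurableType dO) (P : probability O R).

(** The set itself may fail to be measurable, for instance as an intersection over all networks;
    only a measurable subset of large probability is asked for. *)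
Definition likely (p : R) (Q : set O) := exists2 E, measurable E & E `<=` Q /\ (P (~` E) <= p%:E)%E.

Lemma likely_weak p p' Q Q' : p <= p' -> Q `<=` Q' -> likely p Q -> likely p' Q'.
Proof.
move=> pp QQ [E mE [h1 h2]]; exists E => //; split; first exact: subset_trans QQ.
by apply: le_trans h2 _; rewrite lee_fin.
Qed.

Lemma likely_and p p' Q Q' : likely p Q -> likely p' Q' -> likely (p + p') (Q `&` Q').
Proof.
move=> [E mE [h1 h2]] [E' mE' [h1' h2']]; exists (E `&` E'); first exact: measurableI.
split; first exact: setISS.
rewrite setCI EFinD; apply: le_trans (measureU2 _ _ _) _; try exact: measurableC.
exact: leeD.
Qed.

Lemma likelyT Q : (forall w, Q w) -> likely 0 Q.
Proof. by move=> h; exists setT => //; split=> //; rewrite setCT measure0. Qed.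

Lemma likely_seq (I : eqType) (s : seq I) (p : I -> R) (Q : I -> set O) :
  (forall i, likely (p i) (Q i)) ->
  likely (\sum_(i <- s) p i) [set w | forall i, i \in s -> Q i w].
Proof.
move=> h; elim: s => [|i s IH].
  by rewrite big_nil; apply: likelyT => w j; rewrite in_nil.
rewrite big_cons; apply: likely_weak (lexx _) _ (likely_and (h i) IH) => w [/= h1 h2] j.
by rewrite inE => /predU1P[->|/h2].
Qed.

Lemma likely_fin (I : finType) (p : R) (Q : I -> set O) : (forall i, likely p (Q i)) ->
  likely (#|I|%:R * p) [set w | forall i, Q i w].
Proof.
move=> h; have := likely_seq (index_enum I) h.
rewrite big_const_seq count_predT iter_addr_0 cardE enumT mulr_natl.
by apply: likely_weak => // w hw i; apply: hw; rewrite mem_index_enum.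
Qed.

Lemma likely_null (N : set O) : measurable N -> P N = 0%E -> likely 0 (~` N).
Proof. by move=> mN N0; exists (~` N); [exact: measurableC|split=> //; rewrite setCK N0]. Qed.

Lemma likely_prob p Q : likely p Q -> exists E, [/\ measurable E, E `<=` Q & ((1 - p)%:E <= P E)%E].
Proof.
move=> [E mE [h1 h2]]; exists E; split=> //.
have := probability_setC P mE => hE.
have fE : P E \is a fin_num by exact: fin_num_measure.
have fC : P (~` E) \is a fin_num by apply: fin_num_measure; exact: measurableC.
move: h2; rewrite hE -(fineK fE) -EFinB !lee_fin; lra.
Qed.

End Likely.

Section Bernstein.
Variables (R : realType) (dO : measure_display) (O : measurableType dO) (P : probability O R).
Variables (dT : measure_display) (T : measurableType dT) (Z : nat -> O -> T).
Hypothesis iid : iid_seq P Z.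

Let mZ i : measurable_fun setT (Z i). Proof. by case: iid. Qed.

Lemma Iv_cstP (a : R) : Iv P (fun=> a) = a.
Proof. by rewrite Iv_cst [X in fine X](_ : _ = 1%E) ?mulr1 //; exact: probability_setT. Qed.

Definition Ev (f : T -> R) : R := Iv P (fun w => f (Z 0%N w)).

Lemma measure_big_le (I : finType) (S : pred I) (A : I -> set O) (p : I -> R) :
  (forall i, measurable (A i)) -> (forall i, P (A i) = (p i)%:E) ->
  (P (\big[setU/set0]_(i | S i) A i) <= (\sum_(i | S i) p i)%:E)%E.
Proof.
move=> mA hA.
suff : measurable (\big[setU/set0]_(i | S i) A i) /\ (P (\big[setU/set0]_(i | S i) A i) <= (\sum_(i | S i) p i)%:E)%E by case.
apply: (big_ind2 (fun (X : set O) (x : R) => measurable X /\ (P X <= x%:E)%E)).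
- by split=> //; rewrite measure0.
- move=> X x Y y [mX hX] [mY hY]; split; first exact: measurableU.
  by rewrite EFinD; apply: le_trans (measureU2 _ mX mY) _; exact: leeD.
by move=> i _; rewrite hA.
Qed.

Lemma cells_measurable (K : nat) (c : 'I_K -> R) (q : T -> 'I_K) (n : nat) (t : R) :
  (forall k, measurable (q @^-1` [set k])) ->
  measurable [set w | (t < \sum_(i < n) c (q (Z i w)))%R].
Proof.
move=> mq.
have mc i : measurable_fun setT (fun w => c (q (Z i w))).
  have mqZ k : measurable ((q \o Z i) @^-1` [set k]) by have := mZ i measurableT (mq k); rewrite setTI.
  by have [[]] := Iv_cells P c mqZ.
have -> : [set w | (t < \sum_(i < n) c (q (Z i w)))%R] = (fun w => \sum_(i < n) c (q (Z i w))) @^-1` `]t, +oo[%classic.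
  by apply/seteqP; split=> w /=; rewrite in_itv /= andbT.
by rewrite -[X in measurable X]setTI; apply: measurable_sum => //; exact: measurable_itv.
Qed.

(** Independence is available as a product rule for events, so the exponential moment is computed by
    summing over all n-tuples of cells that the sample can visit. *)
Lemma chernoff_cells (K : nat) (c : 'I_K -> R) (q : T -> 'I_K) (n : nat) (lam t : R) :
  (forall k, measurable (q @^-1` [set k])) -> 0 <= lam ->
  (P [set w | (t < \sum_(i < n) c (q (Z i w)))%R] <=
   (expR (- (lam * t)) * (\sum_k fine (P (Z 0%N @^-1` (q @^-1` [set k]))) * expR (lam * c k)) ^+ n)%:E)%E.
Proof.
move=> mq l0; have [_ ind idd] := iid.
pose p k := fine (P (Z 0%N @^-1` (q @^-1` [set k]))).
have mA i k : measurable (Z i @^-1` (q @^-1` [set k])) by rewrite -[X in measurable X]setTI; exact: mZ.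
have pE i k : P (Z i @^-1` (q @^-1` [set k])) = (p k)%:E.
  by rewrite idd // /p fineK //; exact: fin_num_measure.
have p0 k : 0 <= p k by exact: fine_ge0.
pose A (ka : {ffun 'I_n -> 'I_K}) (i : nat) : set T :=
  if insub i is Some i' then q @^-1` [set ka i'] else setT.
have mAA ka i : measurable (A ka i) by rewrite /A; case: insub.
pose W ka := [set w | forall i, i \in iota 0 n -> A ka i (Z i w)].
have WE ka : P (W ka) = (\prod_(i < n) p (ka i))%:E.
  rewrite /W ind ?iota_uniq //.
  have -> : iota 0 n = index_iota 0 n by rewrite /index_iota subn0.
  rewrite big_mkord (big_morph EFin (@EFinM R) (erefl _)); apply: eq_bigr => i _.
  by rewrite /A valK pE.
have mW ka : measurable (W ka).
  have -> : W ka = \bigcap_(i in [set i | i \in iota 0 n]) (Z i @^-1` A ka i) by [].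
  apply: fin_bigcap_measurable; first exact: finite_seq.
  by move=> i _; rewrite -[X in measurable X]setTI; exact: mZ.
pose S (ka : {ffun 'I_n -> 'I_K}) := t < \sum_(i < n) c (ka i).
have sub : [set w | (t < \sum_(i < n) c (q (Z i w)))%R] `<=` \big[setU/set0]_(ka | S ka) W ka.
  move=> w /= hw; pose k0 := [ffun i : 'I_n => q (Z i w)].
  have Sk : S k0 by rewrite /S; under eq_bigr do rewrite ffunE.
  rewrite (bigD1 k0) //=; left => i; rewrite mem_iota add0n => /andP[_ ilt].
  by rewrite /A insubT /= ffunE.
have mS : measurable (\big[setU/set0]_(ka | S ka) W ka) by apply: bigsetU_measurable.
have mL := cells_measurable c n t mq.
apply: le_trans (le_measure P _ _ sub) _; rewrite ?inE //.
apply: le_trans (measure_big_le S mW WE) _; rewrite lee_fin.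
apply: (@le_trans _ _ (\sum_(ka : {ffun 'I_n -> 'I_K}) expR (- (lam * t)) * \prod_(i < n) (p (ka i) * expR (lam * c (ka i))))).
  rewrite [leRHS](bigID S) /= -[leLHS]addr0; apply: lerD; last first.
    by apply: sumr_ge0 => ka _; rewrite mulr_ge0 ?expR_ge0 // prodr_ge0 // => i _; rewrite mulr_ge0 ?expR_ge0.
  apply: ler_sum => ka Ska; rewrite big_split /= -expR_sum mulrCA -expRD.
  rewrite ler_peMr ?prodr_ge0 // -[leLHS]expR0 ler_expR -mulr_sumr addrC -mulrBr mulr_ge0 // subr_ge0; exact: ltW.
by rewrite -mulr_sumr -(bigA_distr_bigA (fun (i : 'I_n) k => p k * expR (lam * c k))) prodr_const card_ord.
Qed.

(** The summand 1 in the exponent pays for discretising: [eps] is so small that each of its two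
    contributions is at most 1/4. *)
Lemma bernstein (f : T -> R) (b lam s : R) (n : nat) : measurable_fun setT f -> (forall z, `|f z| <= b) ->
  0 <= lam -> lam * b <= 4^-1 ->
  likely P (expR (1 + n%:R * lam ^+ 2 * Ev (fun z => f z ^+ 2) - lam * s))
    [set w | \sum_(i < n) f (Z i w) <= n%:R * Ev f + s].
Proof.
move=> mf hb l0 lb.
have bf : bm f by split=> //; exists b.
have bfZ : bm (fun w => f (Z 0%N w)) by exact: bm_comp.
have b0 : 0 <= b by apply: le_trans (normr_ge0 _) (hb point).
pose eps := (1 + 4 * n%:R * lam + 4 * n%:R * lam ^+ 2 * (2 * b + 1))^-1.
have x1 : 0 <= 4 * n%:R * lam by rewrite !mulr_ge0.
have x2 : 0 <= 4 * n%:R * lam ^+ 2 * (2 * b + 1) by rewrite !mulr_ge0 ?sqr_ge0 // addr_ge0 // mulr_ge0.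
have e0 : 0 < eps by rewrite invr_gt0; lra.
have eE : eps * (1 + 4 * n%:R * lam + 4 * n%:R * lam ^+ 2 * (2 * b + 1)) = 1 by rewrite mulVf // gt_eqF //; lra.
have [K [c [q [mq hq hc]]]] := discretize mf hb e0.
pose p k := fine (P (Z 0%N @^-1` (q @^-1` [set k]))).
have p0 k : 0 <= p k by exact: fine_ge0.
have mqZ k : measurable ((q \o Z 0%N) @^-1` [set k]) by have := mZ 0%N measurableT (mq k); rewrite setTI.
have [bc1 c1] := Iv_cells P c mqZ.
have [bc2 c2] := Iv_cells P (fun k => c k ^+ 2) mqZ.
have [bc3 c3] := Iv_cells P (fun=> 1) mqZ.
have S0 : \sum_k p k = 1.
  have <- : Iv P (fun=> 1) = 1 by exact: Iv_cstP.
  by rewrite c3; apply: eq_bigr => k _; rewrite mul1r.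
have S1 : \sum_k p k * c k <= Ev f.
  apply: (@le_trans _ _ (Iv P (fun w => c (q (Z 0%N w))))).
    by rewrite c1 le_eqVlt; apply/orP; left; apply/eqP; apply: eq_bigr => k _; rewrite mulrC.
  by apply: Iv_le => // w; have [] := hq (Z 0%N w).
have S2 : \sum_k p k * c k ^+ 2 <= Ev (fun z => f z ^+ 2) + eps * (2 * b + 1).
  apply: (@le_trans _ _ (Iv P (fun w => c (q (Z 0%N w)) ^+ 2))).
    by rewrite c2 le_eqVlt; apply/orP; left; apply/eqP; apply: eq_bigr => k _; rewrite mulrC.
  have -> : Ev (fun z => f z ^+ 2) + eps * (2 * b + 1) = Iv P (fun w => f (Z 0%N w) ^+ 2 + eps * (2 * b + 1)).
    by rewrite (Iv_D P (bm_sqr bfZ) (bm_cst _ _)) Iv_cstP.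
  apply: Iv_le => // [|w]; first by apply: bm_D; [exact: (bm_sqr bfZ)|exact: bm_cst].
  have [h1 h2] := hq (Z 0%N w); have := hc (q (Z 0%N w)); have := hb (Z 0%N w).
  rewrite !ler_norml => /andP[h3 h4] /andP[h5 h6].
  move: (f (Z 0%N w)) (c (q (Z 0%N w))) h1 h2 h3 h4 h5 h6 => x y h1 h2 h3 h4 h5 h6.
  have : (y - x) * (x + y) <= eps * (2 * b).
    have -> : (y - x) * (x + y) = (x - y) * - (x + y) by ring.
    apply: (@le_trans _ _ ((x - y) * (2 * b))); first by apply: ler_wpM2l; lra.
    by apply: ler_wpM2r; [rewrite mulr_ge0|lra].
  have -> : (y - x) * (x + y) = y ^+ 2 - x ^+ 2 by ring.
  rewrite mulrDr mulr1; lra.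
have mgf : \sum_k p k * expR (lam * c k) <= expR (lam * Ev f + lam ^+ 2 * (Ev (fun z => f z ^+ 2) + eps * (2 * b + 1))).
  apply: le_trans (expR_ge1Dx _).
  apply: (@le_trans _ _ (\sum_k (p k + lam * (p k * c k) + lam ^+ 2 * (p k * c k ^+ 2)))).
    apply: ler_sum => k _.
    have -> : p k + lam * (p k * c k) + lam ^+ 2 * (p k * c k ^+ 2) = p k * (1 + lam * c k + (lam * c k) ^+ 2) by ring.
    apply: ler_wpM2l => //; apply: expR_le_quadratic; apply: le_trans lb; apply: ler_wpM2l => //.
    exact: le_trans (ler_norm _) (hc k).
  rewrite !big_split /= S0 -!mulr_sumr -addrA lerD2l; apply: lerD; first exact: ler_wpM2l.
  by apply: ler_wpM2l => //; exact: sqr_ge0.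
have mE : measurable [set w | \sum_(i < n) f (Z i w) <= n%:R * Ev f + s].
  have -> : [set w | \sum_(i < n) f (Z i w) <= n%:R * Ev f + s] =
      (fun w => \sum_(i < n) f (Z i w)) @^-1` `]-oo, n%:R * Ev f + s]%classic.
    by apply/seteqP; split=> w /=; rewrite in_itv.
  have ms : measurable_fun setT (fun w => \sum_(i < n) f (Z i w)).
    by apply: measurable_sum => i; exact: measurableT_comp.
  by rewrite -[X in measurable X]setTI; apply: ms => //; exact: measurable_itv.
exists [set w | \sum_(i < n) f (Z i w) <= n%:R * Ev f + s] => //; split=> //.
have sub : ~` [set w | \sum_(i < n) f (Z i w) <= n%:R * Ev f + s] `<=`
    [set w | (n%:R * Ev f + s - n%:R * eps < \sum_(i < n) c (q (Z i w)))%R].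
  move=> w /= /negP; rewrite -ltNge => h.
  have : \sum_(i < n) f (Z i w) <= \sum_(i < n) (c (q (Z i w)) + eps).
    by apply: ler_sum => i _; have [] := hq (Z i w).
  rewrite big_split /= sumr_const card_ord -[eps *+ n]mulr_natl; lra.
have mC := measurableC mE; have mL := cells_measurable c n (n%:R * Ev f + s - n%:R * eps) mq.
apply: le_trans (le_measure P _ _ sub) _; rewrite ?inE //.
apply: le_trans (chernoff_cells _ _ _ mq l0) _; rewrite lee_fin.
apply: (@le_trans _ _ (expR (- (lam * (n%:R * Ev f + s - n%:R * eps))) *
    expR (lam * Ev f + lam ^+ 2 * (Ev (fun z => f z ^+ 2) + eps * (2 * b + 1))) ^+ n)).
  apply: ler_wpM2l; first exact: expR_ge0.
  apply: lerXn2r mgf; rewrite nnegrE ?expR_ge0 //.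
  by apply: sumr_ge0 => k _; rewrite mulr_ge0 ?expR_ge0.
rewrite -expRM_natl -expRD ler_expR.
have u1 : n%:R * lam * eps <= 4^-1 by move: eE; have := mulr_ge0 (ltW e0) x2; lra.
have u2 : n%:R * lam ^+ 2 * (eps * (2 * b + 1)) <= 4^-1 by move: eE; have := mulr_ge0 (ltW e0) x1; lra.
lra.
Qed.

(** Here [lam] is unrestricted: if lam b > 1/4, then either the claimed probability is at least 1,
    or s > 2 n b and the event is certain. *)
Lemma hoeffding (f : T -> R) (b lam s : R) (n : nat) : measurable_fun setT f -> (forall z, `|f z| <= b) ->
  0 <= lam ->
  likely P (expR (1 + 8 * n%:R * (lam * b) ^+ 2 - lam * s))
    [set w | \sum_(i < n) f (Z i w) <= n%:R * Ev f + s].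
Proof.
move=> mf hb l0.
have bf : bm f by split=> //; exists b.
have bfZ : bm (fun w => f (Z 0%N w)) by exact: bm_comp.
have b0 : 0 <= b by apply: le_trans (normr_ge0 _) (hb point).
have [lb|lb] := lerP (lam * b) 4^-1.
  apply: likely_weak _ (fun _ h => h) (@bernstein f b lam s n mf hb l0 lb).
  rewrite ler_expR.
  have : Ev (fun z => f z ^+ 2) <= b ^+ 2.
    have <- : Iv P (fun=> b ^+ 2) = b ^+ 2 by exact: Iv_cstP.
    apply: Iv_le; [exact: (bm_sqr bfZ)|exact: bm_cst|move=> w].
    by rewrite -[leLHS]real_normK ?num_real //; apply: lerXn2r; rewrite ?nnegrE.
  move=> hE; have : n%:R * lam ^+ 2 * Ev (fun z => f z ^+ 2) <= n%:R * lam ^+ 2 * b ^+ 2.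
    by apply: ler_wpM2l hE; rewrite mulr_ge0 // sqr_ge0.
  have : 0 <= n%:R * lam ^+ 2 * b ^+ 2 by rewrite !mulr_ge0 // sqr_ge0.
  rewrite exprMn; lra.
have [s2|s2] := lerP s (2 * n%:R * b).
  apply: (@likely_weak _ _ _ P 1 _ set0); last first.
  - exists set0 => //; split=> //; rewrite setC0 probability_setT //.
  - by [].
  rewrite -[leLHS]expR0 ler_expR.
  have h1 : lam * s <= lam * (2 * n%:R * b) by rewrite ler_wpM2l.
  have h2 : n%:R * (lam * b * 4^-1) <= n%:R * (lam * b) ^+ 2.
    by rewrite ler_wpM2l // expr2 ler_wpM2l ?mulr_ge0 // ltW.
  lra.
apply: (@likely_weak _ _ _ P 0 _ setT); first exact: expR_ge0.
  move=> w _ /=.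
  have h1 : \sum_(i < n) f (Z i w) <= n%:R * b.
    rewrite -[n in leRHS]card_ord mulr_natl -sumr_const; apply: ler_sum => i _.
    exact: le_trans (ler_norm _) (hb _).
  have : `|Ev f| <= b by have := Iv_norm P bfZ (fun w => hb (Z 0%N w)); rewrite -Iv_cst Iv_cstP.
  rewrite ler_norml => /andP[h2 _].
  have : n%:R * - b <= n%:R * Ev f by rewrite ler_wpM2l.
  lra.
exact: likelyT.
Qed.

End Bernstein.
End Concentration.

(** * Excess risk and uniform concentration *)

Module Regression.
Import Networks NetApprox FiniteNets Concentration.
Local Open Scope classical_set_scope.

Section Measurability.
Variables (R : realType) (d : nat).
Notation BV := (borel_rV R d).

Lemma coord_measurable (j : 'I_d) : measurable_fun setT (fun x : BV => (x : 'rV[R]_d) 0 j).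
Proof.
apply: (measurability (@RGenOInfty.G R)); first exact: RGenOInfty.measurableE.
move=> _ [_ [a ->] <-]; rewrite setTI; apply: sub_sigma_algebra.
have := @open_comp _ _ (fun x : 'rV[R]_d => x 0 j) [set t | a < t].
have -> : (fun x : BV => (x : 'rV[R]_d) 0 j) @^-1` `]a, +oo[ = (fun x : 'rV[R]_d => x 0 j) @^-1` [set t | a < t].
  by apply/seteqP; split=> x /=; rewrite in_itv /= andbT.
by apply; [move=> x _; exact: coord_continuous|exact: open_gt].
Qed.

Lemma nn_measurable N (a : 'I_N -> R) (w : 'I_N -> 'rV[R]_d.+1) :
  measurable_fun setT (nn a w : BV -> R).
Proof.
apply: measurable_sum => i; apply: measurable_funM => //.
apply: measurable_maxr => //; apply: measurable_funD => //.
apply: measurable_sum => j; apply: measurable_funM => //; exact: coord_measurable.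
Qed.

Lemma ball_measurable : measurable ([set x | inball x] : set BV).
Proof.
have ms : measurable_fun setT (fun x : BV => \sum_(j < d) ((x : 'rV[R]_d) 0 j) ^+ 2).
  by apply: measurable_sum => j; apply: measurable_funX; exact: coord_measurable.
have -> : [set x | inball x] = (fun x : BV => \sum_(j < d) ((x : 'rV[R]_d) 0 j) ^+ 2) @^-1` `]-oo, 1].
  apply/seteqP; split=> x /=; rewrite in_itv /= /inball /norm2.
    by rewrite -[X in _ <= X]sqrtr1 ler_sqrt.
  by rewrite -[X in _ -> _ <= X]sqrtr1 => h; rewrite ler_wsqrtr.
by rewrite -[X in measurable X]setTI; apply: ms => //; exact: measurable_itv.
Qed.

End Measurability.

Section Clip.
Variables (R : realType) (B : R).
Hypothesis B_gt0 : 0 < B.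

(** Projection onto [-B, B], which agrees with [truncB] and shows at once that truncation is
    measurable and 1-Lipschitz. *)
Definition clp (t : R) : R := Num.min B (Num.max (- B) t).

Lemma clp_cases (t : R) : [\/ t < - B /\ clp t = - B, [/\ - B <= t, t <= B & clp t = t] | B < t /\ clp t = B].
Proof.
have B0 := B_gt0; rewrite /clp; have [h1|h1] := leP (- B) t; last first.
  by constructor 1; split=> //; rewrite min_r //; lra.
by have [h2|h2] := leP t B; [constructor 2|constructor 3].
Qed.

Lemma clp_norm t : `|clp t| <= B.
Proof.
have B0 := B_gt0; rewrite ler_norml; case: (clp_cases t) => [[h ->]|[h h' ->]|[h ->]]; apply/andP; split; lra.
Qed.

Lemma clp_lip (a b : R) : `|clp a - clp b| <= `|a - b|.
Proof.
have B0 := B_gt0; have := ler_norm (a - b); have := ler_norm (- (a - b)); rewrite normrN => n1 n2.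
rewrite ler_norml; case: (clp_cases a) => [[h ->]|[h h1 ->]|[h ->]];
  case: (clp_cases b) => [[h' ->]|[h' h1' ->]|[h' ->]]; apply/andP; split; lra.
Qed.

Lemma clp_id (t : R) : `|t| <= B -> clp t = t.
Proof. have B0 := B_gt0; rewrite ler_norml => /andP[h1 h2]; case: (clp_cases t) => [[h ->]|[h h' ->]|[h ->]]; lra. Qed.

Lemma clp_sqr_le (t y : R) : `|y| <= B -> (clp t - y) ^+ 2 <= (t - y) ^+ 2.
Proof.
move=> hy; rewrite -{1}(clp_id hy) -[leLHS]real_normK ?num_real // -[leRHS]real_normK ?num_real //.
by apply: lerXn2r; rewrite ?nnegrE // clp_lip.
Qed.

Lemma truncB_clp d (f : 'rV[R]_d -> R) x : truncB B f x = clp (f x).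
Proof.
have B0 := B_gt0; rewrite /truncB; case: ifP => [/clp_id -> //|/negbT]; rewrite -ltNge lter_normr => /orP[h|h].
  case: (clp_cases (f x)) => [[h' ->]|[h' h1 ->]|[h' ->]]; rewrite ?gtr0_sg ?mul1r //; lra.
case: (clp_cases (f x)) => [[h' ->]|[h' h1 ->]|[h' ->]]; rewrite ?ltr0_sg ?mulN1r //; lra.
Qed.

Lemma clp_measurable (dT : measure_display) (T : measurableType dT) (f : T -> R) :
  measurable_fun setT f -> bm (fun z => clp (f z)).
Proof.
move=> mf; split; last by exists B => z; exact: clp_norm.
by apply: measurable_minr => //; exact: measurable_maxr.
Qed.

End Clip.

Section Model.
Variables (R : realType) (d : nat) (B : R).
Variables (dO : measure_display) (O : measurableType dO) (P : probability O R).
Variables (X : nat -> O -> 'rV[R]_d) (Y : nat -> O -> R) (h : 'rV[R]_d -> R) (H : R).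
Notation BV := (borel_rV R d).
Notation T := (BV * R)%type.
Notation Z := (fun i w => ((X i w : BV), Y i w)).
Hypothesis B_gt0 : 0 < B.
Hypothesis iid : iid_seq P Z.
Hypothesis X_ball : P [set w | ~ inball (X 0%N w)] = 0%E.
Hypothesis Y_bound : P [set w | B < `|Y 0%N w|] = 0%E.
Hypothesis h_cond : cond_exp_version P (X 0%N) (Y 0%N) h.
Hypothesis h_bound : forall x, inball x -> `|h x| <= H.

Notation E := (@Ev R dO O P _ T Z).
Notation clpB := (clp B).

(** The regression function is bounded on the ball only, so it is set to zero outside. *)
Definition hb (x : BV) : R := \1_[set x | inball x] x * h x.

Lemma H_ge0 : 0 <= H.
Proof.
apply: le_trans (normr_ge0 _) (h_bound (x := 0) _).
by rewrite /inball /norm2 big1 ?sqrtr0 // => j _; rewrite mxE expr0n.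
Qed.

Lemma hbE (x : 'rV[R]_d) : inball x -> hb x = h x.
Proof. by move=> hx; rewrite /hb indicE mem_set // mul1r. Qed.

Lemma hb_norm x : `|hb x| <= H.
Proof.
rewrite /hb indicE; case: (boolP (x \in _)) => hx; last by rewrite mul0r normr0 H_ge0.
by rewrite mul1r; apply: h_bound; move: hx; rewrite inE.
Qed.

Lemma hb_bm : bm hb.
Proof.
split; last by exists H => x; exact: hb_norm.
by apply: measurable_funM; [apply: measurable_indic; exact: ball_measurable|case: h_cond].
Qed.

Let mZ i : measurable_fun setT (Z i). Proof. by case: iid. Qed.
Let mX : measurable_fun setT (X 0%N : O -> BV).
Proof. by have := measurableT_comp (@measurable_fst _ _ BV R) (mZ 0%N). Qed.
Let mY : measurable_fun setT (Y 0%N).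
Proof. by have := measurableT_comp (@measurable_snd _ _ BV R) (mZ 0%N). Qed.

Lemma bm1 (f : BV -> R) : bm f -> bm (fun z : T => f z.1).
Proof. by move=> hf; apply: bm_comp hf _; exact: measurable_fst. Qed.

Lemma bm_y : bm (fun z : T => clpB z.2).
Proof. by apply: clp_measurable => //; exact: measurable_snd. Qed.

Lemma bmZ (f : T -> R) : bm f -> bm (fun w => f (Z 0%N w)).
Proof. by move=> hf; apply: bm_comp hf _; exact: mZ. Qed.

Lemma EvD f g : bm f -> bm g -> E (fun z => f z + g z) = E f + E g.
Proof. by move=> hf hg; apply: Iv_D; exact: bmZ. Qed.
Lemma EvB f g : bm f -> bm g -> E (fun z => f z - g z) = E f - E g.
Proof. by move=> hf hg; apply: Iv_B; exact: bmZ. Qed.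
Lemma EvZ a f : bm f -> E (fun z => a * f z) = a * E f.
Proof. by move=> hf; apply: Iv_Z; exact: bmZ. Qed.
Lemma Ev_le f g : bm f -> bm g -> (forall z, f z <= g z) -> E f <= E g.
Proof. by move=> hf hg hh; apply: Iv_le => //; exact: bmZ. Qed.
Lemma Ev_sum (I : Type) (s : seq I) (f : I -> T -> R) : (forall i, bm (f i)) ->
  E (fun z => \sum_(i <- s) f i z) = \sum_(i <- s) E (f i).
Proof. by move=> hf; apply: Iv_sum => i; exact: bmZ. Qed.
Lemma Ev_cst a : E (fun=> a) = a.
Proof. exact: Iv_cstP. Qed.
Lemma Ev_norm f b : bm f -> (forall z, `|f z| <= b) -> `|E f| <= b.
Proof.
move=> hf hb'; have := Iv_norm P (bmZ hf) (fun w => hb' (Z 0%N w)).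
by rewrite -Iv_cst Iv_cstP.
Qed.

Lemma null_X : measurable [set w | ~ inball (X 0%N w)].
Proof.
have -> : [set w | ~ inball (X 0%N w)] = (X 0%N : O -> BV) @^-1` (~` [set x | inball x]) by [].
rewrite -[X in measurable X]setTI; apply: mX => //; apply: measurableC; exact: ball_measurable.
Qed.

Lemma null_Y : measurable [set w | B < `|Y 0%N w|].
Proof.
have -> : [set w | B < `|Y 0%N w|] = (fun w => `|Y 0%N w|) @^-1` `]B, +oo[%classic.
  by apply/seteqP; split=> w /=; rewrite in_itv /= andbT.
have mn : measurable_fun setT (fun w => `|Y 0%N w|) by apply: measurableT_comp mY; exact: normr_measurable.
by rewrite -[X in measurable X]setTI; apply: mn => //; exact: measurable_itv.
Qed.

Lemma orth_ind (A : set BV) : measurable A ->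
  E (fun z => \1_A z.1 * hb z.1) = E (fun z => \1_A z.1 * clpB z.2).
Proof.
move=> mA; have [mh hc] := h_cond.
have mXA : measurable ((X 0%N : O -> BV) @^-1` A) by rewrite -[X in measurable X]setTI; exact: mX.
have conv (f : O -> R) : Iv P (fun w => \1_A (X 0%N w : BV) * f w) = fine (\int[P]_(w in (X 0%N : O -> BV) @^-1` A) (f w)%:E)%E.
  rewrite /Iv /Rintegral [in RHS]integral_mkcond; congr fine; apply: eq_integral => w _.
  rewrite /patch indicE; case: (boolP (w \in _)) => hw.
    by rewrite mem_set ?mul1r //; move: hw; rewrite inE.
  by rewrite memNset ?mul0r //; move: hw; rewrite notin_setE.
have e1 : (\int[P]_(w in (X 0%N : O -> BV) @^-1` A) (hb (X 0%N w))%:E = \int[P]_(w in (X 0%N : O -> BV) @^-1` A) (h (X 0%N w))%:E)%E.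
  apply: ae_eq_integral => //.
  - apply/measurable_EFinP; apply: measurable_funTS; apply: measurableT_comp mX; by case: hb_bm.
  - by apply/measurable_EFinP; apply: measurable_funTS; exact: measurableT_comp mX.
  exists [set w | ~ inball (X 0%N w)]; split; [exact: null_X|exact: X_ball|].
  by move=> w /= hw; apply: contra_not hw => hx _; rewrite hbE.
have e2 : (\int[P]_(w in (X 0%N : O -> BV) @^-1` A) (clpB (Y 0%N w))%:E = \int[P]_(w in (X 0%N : O -> BV) @^-1` A) (Y 0%N w)%:E)%E.
  apply: ae_eq_integral => //.
  - by apply/measurable_EFinP; apply: measurable_funTS; case: (clp_measurable B_gt0 mY).
  - by apply/measurable_EFinP; apply: measurable_funTS.
  exists [set w | B < `|Y 0%N w|]; split; [exact: null_Y|exact: Y_bound|].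
  by move=> w /= hw; apply: contra_not_lt hw => hx _; rewrite clp_id.
by rewrite /Ev /= (conv (fun w => hb (X 0%N w))) (conv (fun w => clpB (Y 0%N w))) e1 e2 hc.
Qed.

(** Conditional expectation gives the identity for indicators. A bounded f is replaced by a
    discretised one, at an arbitrarily small price since the residual is bounded by H + B. *)
Lemma orth (f : BV -> R) : bm f -> E (fun z => f z.1 * (hb z.1 - clpB z.2)) = 0.
Proof.
move=> bf; have [mf [b hf]] := bf.
pose r (z : T) := hb z.1 - clpB z.2.
have br : bm r by apply: bm_B; [exact: bm1 hb_bm|exact: bm_y].
have rn z : `|r z| <= H + B by apply: le_trans (ler_normB _ _) _; apply: lerD; [exact: hb_norm|exact: clp_norm].
have HB : 0 < H + B by rewrite ltr_wpDl // H_ge0.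
apply/eqP; rewrite -normr_le0; apply/ler_addgt0Pr => eps e0; rewrite add0r.
have e1 : 0 < eps / (H + B) by rewrite divr_gt0.
have [K [c [q [mq hq hc]]]] := discretize mf hf e1.
have bq : bm (fun x => c (q x)).
  split; last by exists b.
  have mq' : measurable_fun setT (fun x => \sum_k c k * \1_(q @^-1` [set k]) x).
    by apply: measurable_sum => k; apply: measurable_funM => //; exact: measurable_indic.
  move: mq'; congr (measurable_fun setT _); apply/funext => x; rewrite (bigD1 (q x)) //= big1 ?addr0.
    by rewrite indicE mem_set ?mulr1.
  by move=> k kq; rewrite indicE memNset ?mulr0 //= => qk; rewrite qk eqxx in kq.
have z0 : E (fun z => c (q z.1) * r z) = 0.
  have bk k : bm (fun z : T => \1_(q @^-1` [set k]) z.1 * r z) by apply: bm_M => //; apply: bm1; exact: bm_ind.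
  transitivity (E (fun z => \sum_k c k * (\1_(q @^-1` [set k]) z.1 * r z))).
    congr E; apply/funext => z; rewrite (bigD1 (q z.1)) //= big1 ?addr0.
      by rewrite indicE mem_set ?mul1r.
    by move=> k kq; rewrite indicE memNset ?mul0r ?mulr0 //= => qk; rewrite qk eqxx in kq.
  rewrite Ev_sum; last by move=> k; apply: bm_M => //; exact: bm_cst.
  apply: big1 => k _; rewrite (EvZ (c k) (bk k)).
  have -> : E (fun z => \1_(q @^-1` [set k]) z.1 * r z) =
    E (fun z => \1_(q @^-1` [set k]) z.1 * hb z.1 - \1_(q @^-1` [set k]) z.1 * clpB z.2).
    by congr E; apply/funext => z; rewrite /r mulrBr.
  rewrite EvB ?orth_ind ?subrr ?mulr0 //.
    by apply: bm_M; apply: bm1; [exact: bm_ind|exact: hb_bm].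
  by apply: bm_M; [apply: bm1; exact: bm_ind|exact: bm_y].
have -> : E (fun z => f z.1 * r z) = E (fun z => (f z.1 - c (q z.1)) * r z).
  rewrite -[LHS]subr0 -z0 -EvB; first by congr E; apply/funext => z; rewrite mulrBl.
    by apply: bm_M => //; exact: bm1.
  by apply: bm_M => //; exact: (bm1 bq).
apply: Ev_norm.
  by apply: bm_M => //; apply: bm_B; [exact: bm1|exact: (bm1 bq)].
move=> z; rewrite normrM; have [h1 h2] := hq z.1.
apply: (@le_trans _ _ (eps / (H + B) * (H + B))); last by rewrite divfK // gt_eqF.
by apply: ler_pM => //; rewrite ger0_norm ?subr_ge0 //; lra.
Qed.

Definition Vr (g : BV -> R) : R := E (fun z => (clpB (g z.1) - hb z.1) ^+ 2).
(** Excess loss over the regression function. By orthogonality its mean is [Vr], which also bounds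
    its second moment up to a constant; the Bernstein step rests on this. *)
Definition Dl (g : BV -> R) (z : T) : R := (clpB (g z.1) - clpB z.2) ^+ 2 - (hb z.1 - clpB z.2) ^+ 2.

Lemma bm_clp1 (g : BV -> R) : measurable_fun setT g -> bm (fun z : T => clpB (g z.1)).
Proof. by move=> mg; apply: (@bm1 (fun x => clpB (g x))); exact: clp_measurable. Qed.

Lemma bm_D g : measurable_fun setT g -> bm (Dl g).
Proof.
move=> mg; apply: bm_B; apply: bm_sqr; apply: bm_B; [exact: bm_clp1|exact: bm_y|exact: (bm1 hb_bm)|exact: bm_y].
Qed.

Lemma Ev_Dl g : measurable_fun setT g -> E (Dl g) = Vr g.
Proof.
move=> mg; pose f (x : BV) := 2 * (clpB (g x) - hb x).
have bf : bm f.
  by apply: bm_M; [exact: bm_cst|apply: bm_B; [exact: clp_measurable|exact: hb_bm]].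
have -> : E (Dl g) = E (fun z => (clpB (g z.1) - hb z.1) ^+ 2 + f z.1 * (hb z.1 - clpB z.2)).
  by congr E; apply/funext => z; rewrite /Dl /f; ring.
rewrite EvD ?orth ?addr0 //.
  by apply: bm_sqr; apply: bm_B; [exact: bm_clp1|exact: (bm1 hb_bm)].
by apply: bm_M; [exact: (bm1 bf)|apply: bm_B; [exact: (bm1 hb_bm)|exact: bm_y]].
Qed.

Lemma Dl_lip g g' z : `|Dl g z - Dl g' z| <= 4 * B * `|clpB (g z.1) - clpB (g' z.1)|.
Proof.
have -> : Dl g z - Dl g' z = (clpB (g z.1) - clpB (g' z.1)) * (clpB (g z.1) + clpB (g' z.1) - 2 * clpB z.2) by rewrite /Dl; ring.
rewrite normrM mulrC; apply: ler_wpM2r => //.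
have B0 := B_gt0; have := clp_norm B_gt0 (g z.1); have := clp_norm B_gt0 (g' z.1); have := clp_norm B_gt0 z.2.
rewrite !ler_norml => /andP[h1 h2] /andP[h3 h4] /andP[h5 h6]; apply/andP; split; lra.
Qed.

Lemma Dl_le g z : `|Dl g z| <= (3 * B + H) * `|clpB (g z.1) - hb z.1|.
Proof.
have -> : Dl g z = (clpB (g z.1) - hb z.1) * (clpB (g z.1) + hb z.1 - 2 * clpB z.2) by rewrite /Dl; ring.
rewrite normrM mulrC; apply: ler_wpM2r => //.
have B0 := B_gt0; have := clp_norm B_gt0 (g z.1); have := hb_norm z.1; have := clp_norm B_gt0 z.2.
rewrite !ler_norml => /andP[h1 h2] /andP[h3 h4] /andP[h5 h6]; apply/andP; split; lra.
Qed.

Lemma Dl_norm g z : `|Dl g z| <= (3 * B + H) * (B + H).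
Proof.
apply: le_trans (Dl_le g z) _; apply: ler_wpM2l; first by rewrite addr_ge0 ?mulr_ge0 ?H_ge0 // ltW.
by apply: le_trans (ler_normB _ _) _; apply: lerD; [exact: clp_norm|exact: hb_norm].
Qed.


Section Chaining.
Hypothesis d_gt0 : (0 < d)%N.

Lemma Iball (f g : T -> R) : bm f -> bm g -> (forall z, inball (z.1 : 'rV[R]_d) -> f z = g z) -> E f = E g.
Proof.
move=> hf hg hfg; apply: (Iv_ae (N := [set w | ~ inball (X 0%N w)])); [exact: bmZ|exact: bmZ|exact: null_X|exact: X_ball|].
by move=> w /contrapT hw; apply: hfg.
Qed.

Definition ib (z : T) : R := \1_[set x | inball x] z.1.

Lemma ibE z : inball (z.1 : 'rV[R]_d) -> ib z = 1.
Proof. by move=> hz; rewrite /ib indicE mem_set. Qed.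

Lemma ib_cases z : ib z = 0 \/ (inball (z.1 : 'rV[R]_d) /\ ib z = 1).
Proof.
have [hz|hz] := boolP (z.1 \in [set x | inball x]); last by left; rewrite /ib indicE (negbTE hz).
by right; split; [move: hz; rewrite inE|rewrite ibE //; move: hz; rewrite inE].
Qed.

Lemma bm_ib : bm ib.
Proof. apply: bm1; apply: bm_ind; exact: ball_measurable. Qed.

(** Networks are compared on the ball only; the indicator makes the increment bounded everywhere
    without changing its mean. *)
Definition Dd (g g' : BV -> R) (z : T) : R := ib z * (Dl g z - Dl g' z).

Lemma Dd_bm g g' : measurable_fun setT g -> measurable_fun setT g' -> bm (Dd g g').
Proof. by move=> mg mg'; apply: bm_M; [exact: bm_ib|apply: bm_B; exact: bm_D]. Qed.

Lemma Ev_Dd g g' : measurable_fun setT g -> measurable_fun setT g' -> E (Dd g g') = Vr g - Vr g'.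
Proof.
move=> mg mg'; rewrite -!Ev_Dl // -EvB; try exact: bm_D.
apply: Iball; [exact: Dd_bm|by apply: bm_B; exact: bm_D|].
by move=> z hz; rewrite /Dd ibE ?mul1r.
Qed.

Lemma Dd_norm g g' e z : 0 <= e -> (forall x : 'rV[R]_d, inball x -> `|g x - g' x| <= e) ->
  `|Dd g g' z| <= 4 * B * e.
Proof.
move=> e0 hg; have B4 : 0 <= 4 * B by rewrite mulr_ge0 // ltW.
rewrite /Dd; case: (ib_cases z) => [->|[hz ->]]; first by rewrite mul0r normr0 mulr_ge0.
rewrite mul1r; apply: le_trans (Dl_lip _ _ _) _; apply: ler_wpM2l => //.
by apply: le_trans (clp_lip B_gt0 _ _) _; exact: hg.
Qed.

Definition b1 : R := 3 * B + H.
(** Small enough for the range of Bernstein's inequality and for the variance term to cost at most a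
    quarter of n [Vr]. *)
Definition lam0 : R := (4 * (b1 ^+ 2 + b1 * (B + H) + 1))^-1.

Let b1_ge0 : 0 <= b1. Proof. by rewrite addr_ge0 ?H_ge0 // mulr_ge0 // ltW. Qed.
Let BH_ge0 : 0 <= B + H. Proof. by rewrite addr_ge0 ?H_ge0 // ltW. Qed.
Let lam0_gt0 : 0 < lam0.
Proof. by rewrite invr_gt0 mulr_gt0 // ltr_wpDl // addr_ge0 ?sqr_ge0 // mulr_ge0. Qed.

Lemma lam0_le : lam0 * b1 ^+ 2 <= 4^-1 /\ lam0 * (b1 * (B + H)) <= 4^-1.
Proof.
have u := sqr_ge0 b1; have v : 0 <= b1 * (B + H) by exact: mulr_ge0.
have D0 : 0 < 4 * (b1 ^+ 2 + b1 * (B + H) + 1) by lra.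
by rewrite /lam0; split; rewrite mulrC ler_pdivrMr //; lra.
Qed.

Lemma Vr_ge0 g : 0 <= Vr g.
Proof. by apply: Iv_ge0 => w; exact: sqr_ge0. Qed.

Lemma Ev_Dl2 g : measurable_fun setT g -> E (fun z => Dl g z ^+ 2) <= b1 ^+ 2 * Vr g.
Proof.
move=> mg; have bd : bm (fun z : T => (clpB (g z.1) - hb z.1) ^+ 2).
  by apply: bm_sqr; apply: bm_B; [exact: bm_clp1|exact: (bm1 hb_bm)].
rewrite /Vr -EvZ //; apply: Ev_le; [by apply: bm_sqr; exact: bm_D|by apply: bm_M => //; exact: bm_cst|].
move=> z; rewrite -[leLHS]real_normK ?num_real // -[X in _ * X]real_normK ?num_real // -exprMn.
by apply: lerXn2r; rewrite ?nnegrE ?mulr_ge0 //; exact: Dl_le.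
Qed.

Lemma base_likely g n s : measurable_fun setT g ->
  likely P (expR (1 - lam0 * s))
    [set w | n%:R * Vr g - \sum_(i < n) Dl g (Z i w) <= n%:R * Vr g / 4 + s].
Proof.
move=> mg; have [l1 l2] := lam0_le.
have bD := bm_D mg; have [mN _] := bm_N bD.
have nb z : `|- Dl g z| <= b1 * (B + H) by rewrite normrN; exact: Dl_norm.
have := @bernstein R dO O P _ T Z iid (fun z => - Dl g z) _ lam0 (n%:R * Vr g / 4 + s) n mN nb (ltW lam0_gt0) l2.
have EN : E (fun z => - Dl g z) = - Vr g.
  have -> : (fun z => - Dl g z) = (fun z => -1 * Dl g z) by apply/funext => z; rewrite mulN1r.
  by rewrite EvZ // Ev_Dl // mulN1r.
have E2 : E (fun z => (- Dl g z) ^+ 2) <= b1 ^+ 2 * Vr g.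
  apply: le_trans (Ev_Dl2 mg); rewrite le_eqVlt; apply/orP; left; apply/eqP.
  by congr E; apply/funext => z; rewrite sqrrN.
apply: likely_weak.
  rewrite ler_expR.
  have h1 : n%:R * lam0 ^+ 2 * E (fun z => (- Dl g z) ^+ 2) <= n%:R * lam0 ^+ 2 * (b1 ^+ 2 * Vr g).
    by apply: ler_wpM2l E2; rewrite mulr_ge0 ?sqr_ge0.
  have h2 : n%:R * lam0 * Vr g * (lam0 * b1 ^+ 2) <= n%:R * lam0 * Vr g * 4^-1.
    by apply: ler_wpM2l => //; rewrite !mulr_ge0 ?Vr_ge0 // ltW.
  have : n%:R * lam0 ^+ 2 * (b1 ^+ 2 * Vr g) = n%:R * lam0 * Vr g * (lam0 * b1 ^+ 2) by ring.
  lra.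
by move=> w /=; rewrite EN sumrN; lra.
Qed.

Lemma pair_likely (g g' : BV -> R) (n : nat) (e kap s : R) : measurable_fun setT g -> measurable_fun setT g' ->
  (0 < n)%N -> 0 < e -> 0 <= s ->
  (forall x : 'rV[R]_d, inball x -> `|g x - g' x| <= e) ->
  32 * n%:R * (4 * B * e) ^+ 2 * kap <= s ^+ 2 ->
  likely P (expR (1 - kap))
    [set w | n%:R * (Vr g - Vr g') - \sum_(i < n) Dd g g' (Z i w) <= s].
Proof.
move=> mg mg' n0 e0 s0 hg hk.
have bD := Dd_bm mg mg'; have [mN _] := bm_N bD.
have nb z : `|- Dd g g' z| <= 4 * B * e by rewrite normrN; apply: Dd_norm => //; exact: ltW.
have b0 : 0 < 4 * B * e by rewrite !mulr_gt0.
have n0' : 0 < n%:R :> R by rewrite ltr0n.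
set b := 4 * B * e in nb b0 hk.
(* Minimiser of the exponent 8 n (lam b)^2 - lam s. *)
pose lam := s / (16 * n%:R * b ^+ 2).
have l0 : 0 <= lam by apply: divr_ge0 => //; apply: mulr_ge0; [rewrite mulr_ge0|exact: sqr_ge0].
have := @hoeffding R dO O P _ T Z iid (fun z => - Dd g g' z) b lam s n mN nb l0.
have EN : E (fun z => - Dd g g' z) = - (Vr g - Vr g').
  have -> : (fun z => - Dd g g' z) = (fun z => -1 * Dd g g' z) by apply/funext => z; rewrite mulN1r.
  by rewrite EvZ // Ev_Dd // mulN1r.
apply: likely_weak; last by move=> w /=; rewrite EN sumrN; lra.
rewrite ler_expR.
have -> : 1 + 8 * n%:R * (lam * b) ^+ 2 - lam * s = 1 - s ^+ 2 / (32 * n%:R * b ^+ 2).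
  by rewrite /lam; field; rewrite !gt_eqF.
rewrite lerD2l lerN2 ler_pdivlMr; last by rewrite !mulr_gt0 // exprn_gt0.
by rewrite mulrC.
Qed.

Notation c0 := (c_cover R d).
Notation kd := (Reduction.kd R d).

(** Equal to 2^(-3/(2 d)). Per chaining level the accuracy improves by 2^(1/2+3/(2 d)) while the
    square root of the entropy grows by 2^(1/2), so the deviations decrease with this ratio. *)
Definition rho : R := (Num.sqrt (kd 2 ^+ 3))^-1.

Lemma kd2_gt1 : 1 < kd 2.
Proof.
rewrite /Reduction.kd; have : (1 : R) `^ (d%:R^-1) < 2%:R `^ (d%:R^-1).
  by apply: gt0_ltr_powR; rewrite ?nnegrE ?invr_gt0 ?ltr0n // ltr1n.
by rewrite powR1.
Qed.

Lemma rho_bounds : 0 < rho /\ rho < 1.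
Proof.
have k1 := kd2_gt1; have k3 : 1 < kd 2 ^+ 3 by rewrite exprn_egt1.
have s1 : 1 < Num.sqrt (kd 2 ^+ 3) by rewrite -[ltLHS]sqrtr1 ltr_sqrt // (lt_trans _ k3).
by split; rewrite /rho ?invr_gt0 ?invf_lt1 // (lt_trans _ s1).
Qed.

Lemma rho_kd j m : (0 < m)%N -> (kd (2 ^ j * m) ^+ 3)^-1 = (rho ^+ j) ^+ 2 * (kd m ^+ 3)^-1.
Proof.
move=> m0; have -> : kd (2 ^ j * m) = kd 2 ^+ j * kd m.
  rewrite kdM; congr (_ * _); elim: j => [|j IH]; first by rewrite expn0 expr0 /Reduction.kd powR1.
  by rewrite expnS kdM IH exprS.
have k3 : 0 <= kd 2 ^+ 3 by rewrite exprn_ge0 // kd_ge0.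
rewrite exprMn invfM; congr (_ * _); rewrite -exprM mulnC exprM /rho exprVn sqr_sqrtr //.
by rewrite -[in LHS]exprM mulnC exprM exprVn.
Qed.

Lemma rt_sqr m : rt R d m ^+ 2 = m%:R * kd m ^+ 3.
Proof. by rewrite sqr_sqrtr // mulr_ge0 // exprn_ge0 // kd_ge0. Qed.

Lemma pow2_bracket n : (2 <= n)%N -> exists J, [/\ (n <= 2 ^ J)%N, (2 ^ J <= 2 * n)%N & (J <= n)%N].
Proof.
move=> n2; have n0 : (0 < n)%N by apply: leq_trans n2.
have /andP[h1 h2] := trunc_log_bounds (isT : (1 < 2)%N) n0.
exists (trunc_log 2 n).+1; split; [exact: ltnW|by rewrite expnS leq_mul2l|].
by apply: leq_trans h1; rewrite ltn_expl.
Qed.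

Lemma lgm_bound (n m : nat) : (2 <= n)%N -> (m <= 2 * n * n)%N -> lgm R m <= 4 * ln n%:R.
Proof.
move=> n2 mn; have n0 : 0 < n%:R :> R by rewrite ltr0n; apply: leq_trans n2.
have -> : 4 * ln n%:R = ln (n%:R ^+ 4) :> R by rewrite lnXn // mulr_natl.
rewrite ler_ln ?posrE ?ltr0n ?exprn_gt0 // -natrX ler_nat.
by apply: leq_ltn_trans mn _; rewrite !expnS expn0; move: n2; clear; nia.
Qed.

(** With m_j = 2^j m, pairs of codes at levels j and j + 1 have log-cardinality at most 48 (d+2) m_j
    log n, and the 4 is left for the probability. [C1] likewise covers the coarsest net, and 2^13 in
    [C2] is 32 times 8^2 times 4. *)
Definition kapc : R := 48 * d.+2%:R + 4.
Definition C1 : R := (32 * d.+2%:R + 3) / lam0.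
Definition C2 : R := Num.sqrt (2 ^+ 13 * kapc) * B * c0.
Definition Ckey : R := 4 * c0 ^+ 2 + 2 * C1 + 2 * C2 / (1 - rho) + 48 * B * c0.

(** The condition on [M] says that the accuracy e_0 of the coarsest net satisfies n e_0^2 <= C m log
    n. Bernstein leaves a quarter of n [Vr] of the code, at most half of n [Vr g] up to that error,
    and this half is absorbed on the left; hence the factor 2 before the empirical sum. *)
Lemma key_bound (n m : nat) (M : R) : (2 <= n)%N -> (0 < m)%N -> (m <= n)%N -> 0 < M ->
  M ^+ 2 * n%:R <= m%:R ^+ 2 * kd m ^+ 3 ->
  likely P (2 * expR 1 * expR (- (3 * (m%:R * ln n%:R))))
    [set w | forall g : BV -> R, measurable_fun setT g -> cost_le g M ->
      (forall i, (i < n)%N -> inball (X i w)) ->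
      n%:R * Vr g <= 2 * \sum_(i < n) Dl g (Z i w) + Ckey * (m%:R * ln n%:R)].
Proof.
move=> n2 m0 mn M0 hM.
have n0 : (0 < n)%N by apply: leq_trans n2.
have n0' : 0 < n%:R :> R by rewrite ltr0n.
have m0' : 0 < m%:R :> R by rewrite ltr0n.
have c00 := c_cover_gt0 R d.
have B0 := B_gt0.
have [J [J1 J2 J3]] := pow2_bracket n2.
set Lm := ln n%:R.
have Lm12 : 2^-1 <= Lm.
  have l2 : 2^-1 <= ln 2 :> R.
    rewrite -[leLHS]expRK ler_ln ?posrE ?expR_gt0 //; exact: MultiScale.expR_half_le2.
  by apply: le_trans l2 _; rewrite ler_ln ?posrE // ler_nat.
have Lm0 : 0 < Lm by apply: lt_le_trans Lm12.
pose mj j := (2 ^ j * m)%N.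
have mj0 j : (0 < mj j)%N by rewrite muln_gt0 expn_gt0 m0.
have lgj j : (j <= J)%N -> lgm R (mj j) <= 4 * Lm.
  move=> jJ; apply: lgm_bound => //; rewrite /mj; apply: leq_mul => //.
  by apply: leq_trans J2; rewrite leq_exp2l.
pose ej j := c0 * M * Num.sqrt (4 * Lm) / rt R d (mj j).
have rtj j : 0 < rt R d (mj j) by exact: rt_gt0.
have s4 : 0 < Num.sqrt (4 * Lm) by rewrite sqrtr_gt0 mulr_gt0.
have ej0 j : 0 < ej j by rewrite !mulr_gt0 // invr_gt0.
have ejS j : ej j.+1 <= ej j.
  apply: ler_wpM2l; first by rewrite ltW // !mulr_gt0.
  by rewrite lef_pV2 ?posrE // rt_le // /mj leq_mul2r leq_exp2l // leqnSn orbT.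
have ej2 j : ej j ^+ 2 = 4 * c0 ^+ 2 * M ^+ 2 * Lm * ((mj j)%:R * kd (mj j) ^+ 3)^-1.
  rewrite /ej !exprMn exprVn rt_sqr sqr_sqrtr; last by rewrite mulr_ge0 // ltW.
  move: ((mj j)%:R * kd (mj j) ^+ 3) => q; ring.
have kd3 k : (0 < k)%N -> 0 < kd k ^+ 3 by move=> k0; rewrite exprn_gt0 // Reduction.kd_gt0.
have cov g j : (j <= J)%N -> cost_le g M -> exists p : codes d (mj j), forall x, inball x -> `|g x - decode M p x| <= ej j.
  move=> jJ hg; have [p hp] := decode_cover d_gt0 hg M0 (mj0 j); exists p => x hx.
  apply: le_trans (hp x hx) _; rewrite /ej /ap -[leRHS]mulrA; apply: ler_wpM2l; first by rewrite mulr_ge0 // ltW.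
  by apply: ler_wpM2r; [rewrite invr_ge0 ltW|rewrite ler_wsqrtr // lgj].
have mdec j (p : codes d (mj j)) : measurable_fun setT (decode M p : BV -> R) by exact: nn_measurable.
have mL1 : 1 <= 2 * (m%:R * Lm).
  have : 1 * 2^-1 <= m%:R * Lm by apply: ler_pM => //; rewrite ler1n.
  lra.
have hcod j : (j <= J)%N -> #|codes d (mj j)|%:R <= expR (16 * d.+2%:R * (mj j)%:R * Lm).
  move=> jJ; apply: le_trans (card_codes R d (mj j)) _; rewrite ler_expR.
  have : d.+2%:R * (mj j)%:R * lgm R (mj j) <= d.+2%:R * (mj j)%:R * (4 * Lm) by rewrite ler_wpM2l // lgj.
  lra.
have mjm j : m%:R <= (mj j)%:R :> R by rewrite ler_nat leq_pmull // expn_gt0.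
have LB : likely P (expR 1 * expR (- (3 * (m%:R * Lm)))) [set w | forall p : codes d (mj 0), n%:R * Vr (decode M p) -
    \sum_(i < n) Dl (decode M p) (Z i w) <= n%:R * Vr (decode M p) / 4 + C1 * (m%:R * Lm)].
  have := likely_fin (fun p : codes d (mj 0) => @base_likely _ n (C1 * (m%:R * Lm)) (mdec 0%N p)).
  apply: likely_weak => //.
  apply: le_trans (ler_wpM2r (expR_ge0 _) (hcod 0%N (leq0n _))) _.
  rewrite -!expRD ler_expR /C1 /mj expn0 mul1n.
  have -> : lam0 * ((32 * d.+2%:R + 3) / lam0 * (m%:R * Lm)) = (32 * d.+2%:R + 3) * (m%:R * Lm).
    by field; rewrite gt_eqF.
  have : 0 <= d.+2%:R * (m%:R * Lm) by rewrite !mulr_ge0 // ltW.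
  lra.
pose sj j := C2 * rho ^+ j * (m%:R * Lm).
have [r0 r1] := rho_bounds.
have kap0 : 0 < kapc by rewrite ltr_wpDl // mulr_ge0.
have C20 : 0 < C2 by apply: mulr_gt0 => //; apply: mulr_gt0 => //; rewrite sqrtr_gt0; apply: mulr_gt0 => //; exact: exprn_gt0.
have sj0 j : 0 <= sj j by rewrite !mulr_ge0 ?exprn_ge0 // ltW.
have LJ : forall j : 'I_J, likely P (expR 1 * expR (- (4 * (m%:R * Lm)))) [set w | forall pp : codes d (mj j) * codes d (mj j.+1),
    (forall x, inball x -> `|decode M pp.2 x - decode M pp.1 x| <= 2 * ej j) ->
    n%:R * (Vr (decode M pp.2) - Vr (decode M pp.1)) - \sum_(i < n) Dd (decode M pp.2) (decode M pp.1) (Z i w) <= sj j].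
  move=> j; have jJ : (j <= J)%N by apply: ltnW.
  have one (pp : codes d (mj j) * codes d (mj j.+1)) : likely P (expR (1 - kapc * ((mj j)%:R * Lm))) [set w |
      (forall x, inball x -> `|decode M pp.2 x - decode M pp.1 x| <= 2 * ej j) ->
      n%:R * (Vr (decode M pp.2) - Vr (decode M pp.1)) - \sum_(i < n) Dd (decode M pp.2) (decode M pp.1) (Z i w) <= sj j].
    have [hx|hx] := pselect (forall x, inball x -> `|decode M pp.2 x - decode M pp.1 x| <= 2 * ej j); last first.
      by apply: (@likely_weak _ _ _ P 0 _ setT); [exact: expR_ge0|move=> w _ /hx|exact: likelyT].
    apply: likely_weak (lexx _) _ (@pair_likely (decode M pp.2) (decode M pp.1) n (2 * ej j) _ (sj j) (mdec _ _) (mdec _ _) n0 _ (sj0 _) hx _).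
    - by move=> w hw _.
    - by rewrite mulr_gt0.
    have -> : 32 * n%:R * (4 * B * (2 * ej j)) ^+ 2 * (kapc * ((mj j)%:R * Lm)) =
      2 ^+ 13 * kapc * B ^+ 2 * c0 ^+ 2 * Lm ^+ 2 * (M ^+ 2 * n%:R) * (kd (mj j) ^+ 3)^-1.
      have -> : (4 * B * (2 * ej j)) ^+ 2 = 64 * B ^+ 2 * ej j ^+ 2 by ring.
      rewrite ej2 invfM; have mz : (mj j)%:R != 0 :> R by rewrite pnatr_eq0 -lt0n.
      move: ((kd (mj j) ^+ 3)^-1) ((mj j)%:R) mz => q z mz; by field.
    rewrite rho_kd //.
    have -> : sj j ^+ 2 = 2 ^+ 13 * kapc * B ^+ 2 * c0 ^+ 2 * Lm ^+ 2 * m%:R ^+ 2 * (rho ^+ j) ^+ 2.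
      rewrite /sj /C2 !exprMn sqr_sqrtr; last by apply: mulr_ge0; [exact: exprn_ge0|exact: ltW].
      ring.
    have q0 : 0 <= 2 ^+ 13 * kapc * B ^+ 2 * c0 ^+ 2 * Lm ^+ 2.
      by do 3 (apply: mulr_ge0; last exact: sqr_ge0); apply: mulr_ge0; [exact: exprn_ge0|exact: ltW].
    move: (2 ^+ 13 * kapc * B ^+ 2 * c0 ^+ 2 * Lm ^+ 2) q0 => q q0.
    have -> : q * (M ^+ 2 * n%:R) * ((rho ^+ j) ^+ 2 * (kd m ^+ 3)^-1) = q * (rho ^+ j) ^+ 2 * (M ^+ 2 * n%:R / kd m ^+ 3) by ring.
    have -> : q * m%:R ^+ 2 * (rho ^+ j) ^+ 2 = q * (rho ^+ j) ^+ 2 * m%:R ^+ 2 by ring.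
    apply: ler_wpM2l; first by rewrite mulr_ge0 // sqr_ge0.
    by rewrite ler_pdivrMr // kd3.
  have := likely_fin one; apply: likely_weak => //.
  rewrite card_prod natrM.
  have := ler_pM (ler0n _ _) (ler0n _ _) (hcod j jJ) (hcod j.+1 (ltn_ord j)) => hc.
  apply: le_trans (ler_wpM2r (expR_ge0 _) hc) _; rewrite -!expRD ler_expR.
  have -> : (mj j.+1)%:R = 2 * (mj j)%:R :> R by rewrite /mj expnS -mulnA natrM.
  rewrite /kapc; have : m%:R * Lm <= (mj j)%:R * Lm by rewrite ler_pM2r.
  lra.
have LC := likely_fin LJ.
apply: likely_weak _ _ (likely_and LB LC); first last.
  move=> w [/= hB hC] g mg hg hX.
  have chs j : exists p : codes d (mj j), (j <= J)%N -> forall x, inball x -> `|g x - decode M p x| <= ej j.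
    have [jJ|jJ] := leqP j J; first by have [p hp] := cov g j jJ hg; exists p.
    by have [p _] := decode_cover d_gt0 hg M0 (mj0 j); exists p.
  pose p j : codes d (mj j) := sval (cid (chs j)).
  have hp j : (j <= J)%N -> forall x, inball x -> `|g x - decode M (p j) x| <= ej j by rewrite /p; case: cid.
  pose Pj j : BV -> R := decode M (p j).
  have mP j : measurable_fun setT (Pj j) by exact: mdec.
  pose Phi (f : BV -> R) := n%:R * Vr f - \sum_(i < n) Dl f (Z i w).
  have DdE f f' : \sum_(i < n) Dd f f' (Z i w) = \sum_(i < n) Dl f (Z i w) - \sum_(i < n) Dl f' (Z i w).
    by rewrite -sumrB; apply: eq_bigr => i _; rewrite /Dd ibE ?mul1r //; exact: hX.
  have tele j : (j <= J)%N -> Phi (Pj j) <= Phi (Pj 0%N) + \sum_(k < j) sj k.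
    elim: j => [|j IH] jJ; first by rewrite big_ord0 addr0.
    rewrite big_ord_recr /= addrA; apply: le_trans (lerD (IH (ltnW jJ)) (lexx _)); rewrite -lerBlDl.
    have := hC (Ordinal jJ) (p j, p j.+1); rewrite /= => /(_ _).
    have hd x : inball x -> `|decode M (p j.+1) x - decode M (p j) x| <= 2 * ej j.
      move=> hx; have h1 := hp j.+1 jJ x hx; have h2 := hp j (ltnW jJ) x hx; have h3 := ejS j.
      have -> : decode M (p j.+1) x - decode M (p j) x = (g x - decode M (p j) x) - (g x - decode M (p j.+1) x) by ring.
      apply: le_trans (ler_normB _ _) _; lra.
    move=> /(_ hd); rewrite DdE /Phi -/(Pj j) -/(Pj j.+1); lra.
  have last_step : Phi g <= Phi (Pj J) + 8 * B * (n%:R * ej J).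
    have hb' z : `|Dd g (Pj J) z| <= 4 * B * ej J by apply: Dd_norm; [exact: ltW|exact: (hp J (leqnn _))].
    have h1 : Vr g - Vr (Pj J) <= 4 * B * ej J.
      by rewrite -Ev_Dd //; apply: le_trans (ler_norm _) _; apply: Ev_norm; [exact: Dd_bm|].
    have h2 : - \sum_(i < n) Dd g (Pj J) (Z i w) <= n%:R * (4 * B * ej J).
      rewrite -sumrN -[n in leRHS]card_ord mulr_natl -sumr_const; apply: ler_sum => i _.
      by apply: le_trans (ler_norm _) _; rewrite normrN.
    have h3 : n%:R * (Vr g - Vr (Pj J)) <= n%:R * (4 * B * ej J) by rewrite ler_wpM2l.
    by move: h2; rewrite DdE /Phi; lra.
  have V0 : Vr (Pj 0%N) <= 2 * Vr g + 2 * ej 0%N ^+ 2.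
    have bg f : measurable_fun setT f -> bm (fun z : T => (clpB (f z.1) - hb z.1) ^+ 2).
      by move=> mf; apply: bm_sqr; apply: bm_B; [exact: bm_clp1|exact: (bm1 hb_bm)].
    have -> : Vr (Pj 0%N) = E (fun z => ib z * (clpB (Pj 0%N z.1) - hb z.1) ^+ 2).
      apply: Iball; [exact: bg|by apply: bm_M; [exact: bm_ib|exact: bg]|].
      by move=> z hz; rewrite ibE ?mul1r.
    have -> : 2 * Vr g + 2 * ej 0%N ^+ 2 = E (fun z => 2 * (clpB (g z.1) - hb z.1) ^+ 2 + 2 * ej 0%N ^+ 2).
      by rewrite EvD ?Ev_cst ?EvZ //; [exact: bg|apply: bm_M; [exact: bm_cst|exact: bg]|exact: bm_cst].
    apply: Ev_le.
    - by apply: bm_M; [exact: bm_ib|exact: bg].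
    - by apply: Concentration.bm_D; [apply: bm_M; [exact: bm_cst|exact: bg]|exact: bm_cst].
    move=> z; case: (ib_cases z) => [->|[hz ->]].
      by rewrite mul0r addr_ge0 // mulr_ge0 // sqr_ge0.
    rewrite mul1r.
    have h1 : (clpB (g z.1) - clpB (Pj 0%N z.1)) ^+ 2 <= ej 0%N ^+ 2.
      rewrite -[leLHS]real_normK ?num_real //; apply: lerXn2r; rewrite ?nnegrE //; first exact: ltW.
      by apply: le_trans (clp_lip B_gt0 _ _) _; exact: hp.
    move: (clpB (g z.1)) (clpB (Pj 0%N z.1)) (hb z.1) (ej 0%N ^+ 2) h1 => a b c e2 h1.
    have := sqr_ge0 (a - b + (a - c)); have -> : (a - b + (a - c)) ^+ 2 = 2 * (a - b) ^+ 2 + 2 * (a - c) ^+ 2 - (b - c) ^+ 2 by ring.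
    lra.
  have hb0 := hB (p 0%N); rewrite -/(Pj 0%N) in hb0.
  have sums : \sum_(k < J) sj k <= C2 / (1 - rho) * (m%:R * Lm).
    rewrite /sj -mulr_suml -mulr_sumr; apply: ler_wpM2r; first by rewrite mulr_ge0 // ltW.
    by apply: ler_wpM2l; [exact: ltW|apply: MultiScale.geo_bound => //; exact: ltW].
  have e0b : n%:R * ej 0%N ^+ 2 <= 4 * c0 ^+ 2 * (m%:R * Lm).
    rewrite ej2 /mj expn0 mul1n.
    have -> : n%:R * (4 * c0 ^+ 2 * M ^+ 2 * Lm * (m%:R * kd m ^+ 3)^-1) = 4 * c0 ^+ 2 * Lm * (M ^+ 2 * n%:R / (m%:R * kd m ^+ 3)) by ring.
    have -> : 4 * c0 ^+ 2 * (m%:R * Lm) = 4 * c0 ^+ 2 * Lm * m%:R by ring.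
    apply: ler_wpM2l; first by rewrite !mulr_ge0 ?sqr_ge0 // ltW.
    rewrite ler_pdivrMr; last by rewrite mulr_gt0 // kd3.
    by apply: le_trans hM _; rewrite expr2 -mulrA.
  have eJb : n%:R * ej J <= 3 * c0 * (m%:R * Lm).
    rewrite -(ler_pXn2r (n := 2)) ?nnegrE //; last 2 first.
    - by rewrite mulr_ge0 // ltW.
    - by rewrite !mulr_ge0 // ltW.
    rewrite exprMn ej2.
    have kJ : n%:R * (m%:R * kd m ^+ 3) <= (mj J)%:R * kd (mj J) ^+ 3.
      rewrite mulrA; apply: ler_pM; rewrite ?mulr_ge0 ?exprn_ge0 ?kd_ge0 //.
        by rewrite /mj natrM ler_wpM2r // ler_nat.
      apply: lerXn2r; rewrite ?nnegrE ?kd_ge0 //; apply: Reduction.kd_le; by rewrite leq_pmull // expn_gt0.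
    have k0 : 0 < m%:R * kd m ^+ 3 by rewrite mulr_gt0 // kd3.
    apply: (@le_trans _ _ (n%:R ^+ 2 * (4 * c0 ^+ 2 * M ^+ 2 * Lm * (n%:R * (m%:R * kd m ^+ 3))^-1))).
      apply: ler_wpM2l; first exact: sqr_ge0.
      apply: ler_wpM2l; first by rewrite !mulr_ge0 ?sqr_ge0 // ltW.
      have k1 : 0 < n%:R * (m%:R * kd m ^+ 3) by rewrite mulr_gt0.
      by rewrite lef_pV2 // posrE //; exact: lt_le_trans kJ.
    have -> : n%:R ^+ 2 * (4 * c0 ^+ 2 * M ^+ 2 * Lm * (n%:R * (m%:R * kd m ^+ 3))^-1) =
       4 * c0 ^+ 2 * Lm * (M ^+ 2 * n%:R / (m%:R * kd m ^+ 3)).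
      move: (m%:R * kd m ^+ 3) k0 => q q0; by field; rewrite !gt_eqF.
    apply: (@le_trans _ _ (4 * c0 ^+ 2 * Lm * m%:R)).
      apply: ler_wpM2l; first by rewrite !mulr_ge0 ?sqr_ge0 // ltW.
      rewrite ler_pdivrMr //; by apply: le_trans hM _; rewrite expr2 -mulrA.
    have -> : 4 * c0 ^+ 2 * Lm * m%:R = 4 * c0 ^+ 2 * (m%:R * Lm) by ring.
    have -> : (3 * c0 * (m%:R * Lm)) ^+ 2 = 9 * c0 ^+ 2 * ((m%:R * Lm) * (m%:R * Lm)) by ring.
    have x0 : 0 <= m%:R * Lm by rewrite mulr_ge0 // ltW.
    move: (m%:R * Lm) x0 mL1 => x x0 mL1.
    have h1 : x * 1 <= x * (2 * x) by rewrite ler_wpM2l.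
    have h2 := mulr_ge0 (sqr_ge0 c0) (sqr_ge0 x).
    have : c0 ^+ 2 * x <= c0 ^+ 2 * (2 * (x * x)) by rewrite ler_wpM2l ?sqr_ge0 //; lra.
    move: h2; rewrite (expr2 x); lra.
  have tJ := tele J (leqnn _).
  have e16 : 16 * B * (n%:R * ej J) <= 16 * B * (3 * c0 * (m%:R * Lm)) by rewrite ler_wpM2l // mulr_ge0 // ltW.
  have nV : n%:R * Vr (Pj 0%N) <= n%:R * (2 * Vr g + 2 * ej 0%N ^+ 2) by rewrite ler_wpM2l.
  have CkE : Ckey * (m%:R * Lm) = 4 * c0 ^+ 2 * (m%:R * Lm) + 2 * (C1 * (m%:R * Lm)) +
     2 * (C2 / (1 - rho) * (m%:R * Lm)) + 16 * B * (3 * c0 * (m%:R * Lm)) by rewrite /Ckey; ring.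
  move: tJ last_step hb0; rewrite /Phi CkE => tJ last_step hb0.
  move: (C2 / (1 - rho) * (m%:R * Lm)) (C1 * (m%:R * Lm)) (4 * c0 ^+ 2 * (m%:R * Lm)) (B * (3 * c0 * (m%:R * Lm))) sums e0b e16 hb0 => x1 x2 x3 x4 sums e0b e16 hb0.
  lra.
rewrite card_ord.
(* The number of levels is at most n <= expR (m log n), which lowers the exponent from 4 to 3. *)
have Jx : J%:R <= expR (m%:R * Lm).
  apply: (@le_trans _ _ n%:R); first by rewrite ler_nat.
  rewrite -[leLHS]lnK ?posrE // ler_expR -/Lm ler_peMl ?(ltW Lm0) // ler1n //.
have hh : J%:R * expR (- (4 * (m%:R * Lm))) <= expR (- (3 * (m%:R * Lm))).
  apply: le_trans (ler_wpM2r (expR_ge0 _) Jx) _; rewrite -expRD ler_expR; lra.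
have := ler_wpM2l (expR_ge0 (1 : R)) hh; lra.
Qed.

End Chaining.

End Model.
End Regression.

(** * The penalty and a sparse competitor *)

Module Comparator.
Import Networks NetApprox Representation.

Section Kappa.
Variables (R : realType) (d : nat).
Local Open Scope classical_set_scope.
Implicit Types f : 'rV[R]_d -> R.

Lemma kappa_ge0 f : (0 <= kappa f)%E.
Proof. by apply: le_ereal_inf_tmp => _ [k [c [v [_ _ _ ->]]]]; rewrite lee_fin sumr_ge0. Qed.

Lemma kappa_lt_cost f M : (kappa f < M%:E)%E -> cost_le f M.
Proof.
move=> /ereal_inf_lt [_ [k [c [v [_ sv hf ->]]]]]; rewrite lte_fin => hM.
exists 'I_k, c, v; split=> //; apply: le_trans (ltW hM).
by apply: ler_sum => j _; rewrite sv mulr1.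
Qed.

Lemma relu_scale (x : 'rV[R]_d) (t : R) v : 0 <= t -> relu (aff x (t *: v)) = t * relu (aff x v).
Proof.
move=> t0; have -> : aff x (t *: v) = t * aff x v.
  by rewrite !affE mulr_sumr; apply: eq_bigr => k _; rewrite !mxE mulrCA.
by rewrite relu_pM.
Qed.

Lemma norm2Z n (t : R) (v : 'rV[R]_n) : 0 <= t -> norm2 (t *: v) = t * norm2 v.
Proof.
move=> t0; rewrite /norm2 -{2}[t]ger0_norm // -sqrtr_sqr -sqrtrM ?sqr_ge0 //; congr Num.sqrt.
by rewrite mulr_sumr; apply: eq_bigr => j _; rewrite mxE exprMn.
Qed.

(** [kappa] asks for distinct unit directions: zero directions are dropped, the others normalised,
    and atoms with equal direction merged, which by the triangle inequality cannot raise the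
    mass. *)
Lemma cost_kappa f M : cost_le f M -> (kappa f <= M%:E)%E.
Proof.
move=> [I [c [v [hM hf]]]].
pose u i := (norm2 (v i))^-1 *: v i.
pose s := undup [seq u i | i <- index_enum I & norm2 (v i) != 0].
have us : uniq s by exact: undup_uniq.
pose vv (j : 'I_(size s)) := nth 0 s j.
pose cc (j : 'I_(size s)) := \sum_(i | (norm2 (v i) != 0) && (u i == vv j)) c i * norm2 (v i).
have su j : sphere (vv j).
  have : vv j \in s by exact: mem_nth.
  rewrite mem_undup => /mapP[i]; rewrite mem_filter => /andP[ni _] ->.
  by rewrite /sphere norm2Z ?invr_ge0 ?norm2_ge0 // mulVf.
have split_sum (F : I -> R) : \sum_(j < size s) \sum_(i | (norm2 (v i) != 0) && (u i == vv j)) F i =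
    \sum_(i | norm2 (v i) != 0) F i.
  rewrite (exchange_big_dep (fun i => norm2 (v i) != 0)) /=; last by move=> j i _ /andP[].
  apply: eq_bigr => i ni.
  have iu : u i \in s by rewrite mem_undup; apply: map_f; rewrite mem_filter ni mem_index_enum.
  have ju : (index (u i) s < size s)%N by rewrite index_mem.
  rewrite (big_pred1 (Ordinal ju)) // => j; rewrite ni /=; apply/eqP/eqP => [E|->].
    by apply: val_inj; rewrite /= E /vv index_uniq.
  by rewrite /vv /= nth_index.
apply: le_trans (ereal_inf_lbound _) _.
  exists (size s), cc, vv; split; [|exact: su| |reflexivity].
    by move=> j j' /eqP; rewrite nth_uniq // => /eqP /val_inj.
  move=> x hx; rewrite hf //.
  transitivity (\sum_(i | norm2 (v i) != 0) c i * norm2 (v i) * relu (aff x (u i))).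
    rewrite [LHS](bigID (fun i => norm2 (v i) != 0)) /= [X in _ + X]big1 ?addr0.
      apply: eq_bigr => i ni; rewrite -mulrA; congr (_ * _).
      by rewrite -relu_scale ?norm2_ge0 // /u scalerA divff // scale1r.
    move=> i /negPn/eqP n0.
    have -> : v i = 0 *: v i.
      rewrite scale0r; apply/rowP => j; rewrite mxE; apply/eqP; rewrite -normr_le0 -n0; exact: norm2_coord.
    by rewrite relu_scale // mul0r mulr0.
  rewrite -split_sum; apply: eq_bigr => j _; rewrite /cc mulr_suml; apply: eq_bigr => i /andP[_ /eqP ->].
  by [].
rewrite lee_fin; apply: le_trans hM.
apply: (@le_trans _ _ (\sum_(j < size s) \sum_(i | (norm2 (v i) != 0) && (u i == vv j)) `|c i| * norm2 (v i))).
  apply: ler_sum => j _; apply: le_trans (ler_norm_sum _ _ _) _; apply: ler_sum => i _.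
  by rewrite normrM (ger0_norm (norm2_ge0 _)).
rewrite split_sum [leRHS](bigID (fun i => norm2 (v i) != 0)) /= lerDl.
by apply: sumr_ge0 => i _; rewrite mulr_ge0 // norm2_ge0.
Qed.

Lemma inNN_le m N (a : 'I_m -> R) (w : 'I_m -> 'rV[R]_d.+1) : (m <= N)%N -> inNN N (nn a w).
Proof.
move=> mN; rewrite -(subnKC mN).
exists (fun i => if fintype.split i is inl j then a j else 0), (fun i => if fintype.split i is inl j then w j else 0) => x _.
rewrite /nn big_split_ord /= [X in _ + X]big1 ?addr0.
  by apply: eq_bigr => j _; rewrite (unsplitK (inl j)).
by move=> j _; rewrite (unsplitK (inr j)) mul0r.
Qed.

Lemma cost_nn m (a : 'I_m -> R) (w : 'I_m -> 'rV[R]_d.+1) M :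
  \sum_i `|a i| * norm2 (w i) <= M -> cost_le (nn a w) M.
Proof. by move=> h; exists 'I_m, a, w. Qed.

End Kappa.

Section Comparator.
Variables (R : realType) (d : nat).
Hypothesis d_gt0 : (0 < d)%N.
Variables (al Cap : R) (h : 'rV[R]_d -> R).
Notation tau := ((d%:R + 3) / 2 - al).
Hypothesis al_gt0 : 0 < al.
Hypothesis tau_ge0 : 0 <= tau.
Hypothesis Cap_gt0 : 0 < Cap.
Hypothesis approx : forall J : nat, exists g : 'rV[R]_d -> R,
    cost_le g (Cap * (2 ^+ J) `^ tau) /\
    forall x, inball x -> `|g x - h x| <= Cap * (2 ^+ J) `^ (- al).
Notation kd := (Reduction.kd R d).

Lemma ln_nat_ge n : (2 <= n)%N -> 2^-1 <= ln n%:R :> R.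
Proof.
move=> n2; have l2 : 2^-1 <= ln 2 :> R.
  rewrite -[leLHS]expRK ler_ln ?posrE ?expR_gt0 //; exact: MultiScale.expR_half_le2.
by apply: le_trans l2 _; rewrite ler_ln ?posrE ?ltr0n ?(leq_trans _ n2) // ler_nat.
Qed.

Lemma powR_sq (t x : R) : (t `^ x) ^+ 2 = t `^ (2 * x).
Proof. by rewrite -powR_mulrn ?powR_ge0 // -powRrM mulrC. Qed.

Lemma mkd3 m : m%:R * kd m ^+ 3 = m%:R `^ (1 + 3 / d%:R).
Proof.
have [->|m0] := posnP m.
  by rewrite mul0r powR0 // gt_eqF // ltr_wpDr // divr_ge0.
have mz : m%:R != 0 :> R by rewrite pnatr_eq0 -lt0n.
rewrite powRD ?mz ?implybT // powRr1 //; congr (_ * _).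
by rewrite /Reduction.kd -powR_mulrn ?powR_ge0 // -powRrM mulrC.
Qed.

(** Scale 2^J of order t gives error t^(-al) at cost t^tau. With about t^d units the squared
    sparsification error is t^(2 tau - d - 3) log n, which is again t^(-2 al) log n. *)
Lemma comparator (c : R) : 0 < c -> exists2 Cc : R, 0 < Cc & forall (n N : nat) (t : R),
  (2 <= n)%N -> 1 <= t -> n%:R = t `^ (d%:R + 2 * al) -> c * t `^ d%:R <= N%:R ->
  exists m (a : 'I_m -> R) (w : 'I_m -> 'rV[R]_d.+1), [/\ (m <= N)%N,
    cost_le (nn a w) (Cc * t `^ tau) &
    forall x, inball x -> (nn a w x - h x) ^+ 2 <= Cc * (t `^ (- (2 * al)) * ln n%:R)].
Proof.
move=> c_gt0; have al0 := al_gt0; have tau0 := tau_ge0; have Cap0 := Cap_gt0.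
have d0 : 0 < d%:R :> R by rewrite ltr0n.
(* Capping at 1 yields m >= c' t^d both when the width N is the binding limit and when t^d is. *)
pose c' := Num.min c 1; have c'0 : 0 < c' by rewrite lt_min c_gt0 ltr01.
have c'c : c' <= c by rewrite ge_min lexx.
have c'1 : c' <= 1 by rewrite ge_min lexx orbT.
pose E3 : R := 1 + 3 / d%:R; have E30 : 0 < E3 by rewrite ltr_wpDr // divr_ge0.
(* The power of two found below lies between t and 6 t. *)
pose K1 := Cap * 6 `^ tau; have K10 : 0 < K1 by rewrite mulr_gt0 // powR_gt0.
have cn0 := c_netapprox_gt0 R d.
set cn := c_netapprox R d in cn0 *.
pose K2 := 4 * Cap ^+ 2 + 8 * (cn * K1) ^+ 2 / c' `^ E3.
have K20 : 0 < K2.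
  apply: ltr_wpDr; last by rewrite mulr_gt0 // exprn_gt0.
  by rewrite divr_ge0 ?powR_ge0 // mulr_ge0 // sqr_ge0.
exists (cn * K1 + K2); first by rewrite addr_gt0 // mulr_gt0.
move=> n N t n2 t1 nt hN.
have t0 : 0 < t by exact: lt_le_trans t1.
have tn : t != 0 by rewrite gt_eqF.
have Ln := ln_nat_ge n2.
pose n' := (Num.truncn t).+2.
have tt : t < (Num.truncn t).+1%:R by exact: truncnS_gt.
have tt' : (Num.truncn t)%:R <= t by have /andP[] := truncn_itv (ltW t0).
have [J [J1 J2 _]] := @Regression.pow2_bracket n' isT.
have tJ : t <= 2 ^+ J.
  by rewrite -natrX; apply: le_trans (ltW tt) _; rewrite ler_nat; apply: leq_trans J1; rewrite leqnSn.
have J6 : 2 ^+ J <= 6 * t.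
  rewrite -natrX; apply: (@le_trans _ _ (2 * n')%:R); first by rewrite ler_nat.
  by rewrite natrM /n' -addn2 natrD; lra.
have [g [g1 g2]] := approx J.
have Jp : 0 < 2 ^+ J :> R by exact: exprn_gt0.
have g1' : cost_le g (K1 * t `^ tau).
  apply: cost_le_weak g1; rewrite /K1 -mulrA; apply: ler_wpM2l; first exact: ltW.
  rewrite -powRM ?(ltW t0) //; apply: ge0_ler_powR => //; rewrite nnegrE; first exact: ltW.
  by rewrite mulr_ge0 // ltW.
pose mu := t `^ d%:R.
have mu1 : 1 <= mu by rewrite -(powRr0 t) /mu ler_powR.
pose m := minn N (Num.truncn mu).+1.
have N0 : (0 < N)%N.
  by rewrite -(ltr0n R); apply: lt_le_trans hN; rewrite mulr_gt0 // (lt_le_trans _ mu1).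
have m0 : (0 < m)%N by rewrite leq_min N0.
have mc : c' * mu <= m%:R.
  rewrite /m /minn; case: ifP => _.
    by apply: le_trans hN; rewrite ler_wpM2r // (le_trans _ mu1).
  apply: (@le_trans _ _ (1 * mu)); first by rewrite ler_wpM2r // (le_trans _ mu1).
  by rewrite mul1r ltW // truncnS_gt.
have mun : mu <= n%:R by rewrite nt /mu ler_powR // lerDl mulr_ge0 // ltW.
have mle : (m <= 2 * n * n)%N.
  apply: (@leq_trans n.+1).
    apply: leq_trans (geq_minr _ _) _; rewrite ltnS -(ler_nat R).
    by apply: le_trans mun; have /andP[] := truncn_itv (le_trans ler01 mu1).
  apply: (@leq_trans (2 * n)); last by rewrite leq_pmulr // (leq_trans _ n2).
  by move: n2; clear; lia.
have [a [w [_ _ haw happ]]] := net_approx d_gt0 g1' (mulr_ge0 (ltW K10) (powR_ge0 _ _)) m0.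
exists m, a, w; split; first exact: geq_minl.
  apply: cost_le_weak (cost_nn haw); rewrite -/cn mulrA; apply: ler_wpM2r; first exact: powR_ge0.
  by rewrite lerDl ltW.
move=> x hx.
set T := t `^ (- (2 * al)); have T0 : 0 < T by exact: powR_gt0.
have e1 : (g x - h x) ^+ 2 <= Cap ^+ 2 * T.
  apply: (@le_trans _ _ ((Cap * t `^ (- al)) ^+ 2)).
    rewrite -[leLHS]real_normK ?num_real //; apply: lerXn2r; rewrite ?nnegrE ?mulr_ge0 ?powR_ge0 ?(ltW Cap0) //.
    apply: le_trans (g2 x hx) _; apply: ler_wpM2l; first exact: ltW.
    by rewrite !powRN lef_pV2 ?posrE ?powR_gt0 //; apply: ge0_ler_powR; rewrite ?nnegrE // ltW.
  by rewrite exprMn /T powR_sq mulrN.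
have e2 : (g x - nn a w x) ^+ 2 <= 4 * (cn * K1) ^+ 2 / c' `^ E3 * (T * ln n%:R).
  apply: (@le_trans _ _ ((cn * (K1 * t `^ tau) * ap R d m) ^+ 2)).
    rewrite -[leLHS]real_normK ?num_real //; apply: lerXn2r; rewrite ?nnegrE //; last exact: happ.
    apply: mulr_ge0; last exact: ap_ge0.
    by apply: mulr_ge0; [exact: ltW|apply: mulr_ge0; [exact: ltW|exact: powR_ge0]].
  have lg0 : 0 <= lgm R m by rewrite ltW // lgm_gt0.
  have -> : (cn * (K1 * t `^ tau) * ap R d m) ^+ 2 = (cn * K1) ^+ 2 * (t `^ tau ^+ 2 * (lgm R m / m%:R `^ E3)).
    rewrite /ap !exprMn exprVn Regression.rt_sqr sqr_sqrtr // mkd3; ring.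
  have -> : 4 * (cn * K1) ^+ 2 / c' `^ E3 * (T * ln n%:R) = (cn * K1) ^+ 2 * (4 * ln n%:R * (T / c' `^ E3)) by ring.
  apply: ler_wpM2l; first exact: sqr_ge0.
  have h1 : t `^ tau ^+ 2 / m%:R `^ E3 <= T / c' `^ E3.
    have cm : c' `^ E3 * t `^ (d%:R + 3) <= m%:R `^ E3.
      have -> : t `^ (d%:R + 3) = mu `^ E3.
        by rewrite /mu -powRrM /E3; congr (_ `^ _); field; rewrite gt_eqF.
      rewrite -powRM ?(ltW c'0) ?(le_trans _ mu1) //; apply: ge0_ler_powR; rewrite ?nnegrE ?(ltW E30) //.
      by rewrite mulr_ge0 ?(ltW c'0) // (le_trans _ mu1).
    have q0 : 0 < c' `^ E3 * t `^ (d%:R + 3) by rewrite mulr_gt0 ?powR_gt0.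
    apply: (@le_trans _ _ (t `^ tau ^+ 2 / (c' `^ E3 * t `^ (d%:R + 3)))).
      apply: ler_wpM2l; first exact: sqr_ge0.
      by rewrite lef_pV2 // posrE //; exact: lt_le_trans cm.
    have -> : t `^ tau ^+ 2 = T * t `^ (d%:R + 3).
      rewrite powR_sq /T -powRD ?tn ?implybT //; congr (_ `^ _); by field.
    rewrite invfM mulrACA divff ?mulr1 //.
    by rewrite gt_eqF // powR_gt0.
  have lg : lgm R m <= 4 * ln n%:R by exact: (@Regression.lgm_bound R n m n2 mle).
  have -> : t `^ tau ^+ 2 * (lgm R m / m%:R `^ E3) = lgm R m * (t `^ tau ^+ 2 / m%:R `^ E3) by ring.
  by apply: ler_pM => //; rewrite divr_ge0 ?sqr_ge0 ?powR_ge0.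
have TL : T <= 2 * (T * ln n%:R).
  have : T * 1 <= T * (2 * ln n%:R) by rewrite ler_wpM2l ?(ltW T0) //; lra.
  lra.
have TL0 : 0 <= T * ln n%:R by rewrite mulr_ge0 ?(ltW T0) //; lra.
have c20 : Cap ^+ 2 * T <= Cap ^+ 2 * (2 * (T * ln n%:R)) by rewrite ler_wpM2l // sqr_ge0.
have key : (nn a w x - h x) ^+ 2 <= K2 * (T * ln n%:R).
  have := sqr_ge0 ((g x - nn a w x) + (g x - h x)).
  have -> : ((g x - nn a w x) + (g x - h x)) ^+ 2 = 2 * (g x - nn a w x) ^+ 2 + 2 * (g x - h x) ^+ 2 - (nn a w x - h x) ^+ 2 by ring.
  rewrite /K2; lra.
apply: le_trans key _; apply: ler_wpM2r => //; rewrite lerDr ltW // mulr_gt0 //.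
Qed.

End Comparator.
End Comparator.

(** * Events of high probability *)

Module Events.
Import NetApprox Concentration Regression Comparator.
Import HBNNSimple.
Local Open Scope classical_set_scope.

Section Events.
Variables (R : realType) (d : nat) (B : R).
Variables (dO : measure_display) (O : measurableType dO) (P : probability O R).
Variables (X : nat -> O -> 'rV[R]_d) (Y : nat -> O -> R) (h : 'rV[R]_d -> R) (H : R).
Notation BV := (borel_rV R d).
Notation T := (BV * R)%type.
Notation Z := (fun i w => ((X i w : BV), Y i w)).
Hypothesis d_gt0 : (0 < d)%N.
Hypothesis B_gt0 : 0 < B.
Hypothesis iid : iid_seq P Z.
Hypothesis X_ball : P [set w | ~ inball (X 0%N w)] = 0%E.
Hypothesis Y_bound : P [set w | B < `|Y 0%N w|] = 0%E.
Hypothesis h_cond : cond_exp_version P (X 0%N) (Y 0%N) h.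
Hypothesis h_bound : forall x, inball x -> `|h x| <= H.

Notation E := (@Ev R dO O P _ T Z).
Notation clpB := (clp B).
Notation hb := (hb h).
Notation Vr := (Vr B P X Y h).
Notation Dl := (Dl B h).
Notation ib := (@ib R d).
Notation kd := (Reduction.kd R d).

(** The competitor stays unclipped because the estimator minimises the unclipped empirical risk; the
    ball indicator again keeps the variable bounded. *)
Definition Dc (g : BV -> R) (z : T) : R := ib z * ((g z.1 - clpB z.2) ^+ 2 - (hb z.1 - clpB z.2) ^+ 2).

(** For one fixed function Bernstein suffices, with second moment at most a constant times [d2].
    Only the uniform bound [D2] enters the exponent, so it can be kept independent of n. *)
Lemma comparator_likely (g : BV -> R) (d2 D2 s : R) n : measurable_fun setT g ->
  (forall x : 'rV[R]_d, inball x -> (g x - h x) ^+ 2 <= d2) -> 0 <= d2 -> d2 <= D2 ->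
  likely P (expR (1 - (4 * (1 + D2 + 2 * (H + B)) ^+ 2)^-1 * s))
    [set w | \sum_(i < n) Dc g (Z i w) <= 2 * n%:R * d2 + s].
Proof.
move=> mg hg d20 dD.
have H0 := H_ge0 h_bound; have B0 := B_gt0.
pose b2 := 1 + D2 + 2 * (H + B); have b21 : 1 <= b2 by rewrite /b2; lra.
pose lam := (4 * b2 ^+ 2)^-1; have lam0 : 0 < lam by rewrite invr_gt0 mulr_gt0 // exprn_gt0 // (lt_le_trans _ b21).
pose q (x : BV) := \1_[set x | inball x] x * (g x - hb x).
have qib z : q z.1 = ib z * (g z.1 - hb z.1) by [].
have q2 x : q x ^+ 2 <= d2.
  rewrite /q indicE; case: (boolP (x \in _)) => hx; last by rewrite mul0r expr0n.
  have hx' : inball x by move: hx; rewrite inE.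
  by rewrite mul1r (hbE _ hx'); exact: hg.
have qn x : `|q x| <= 1 + D2.
  rewrite -(ler_pXn2r (n := 2)) ?nnegrE //; last by rewrite addr_ge0 // (le_trans d20).
  by rewrite real_normK ?num_real //; apply: le_trans (q2 x) _; rewrite sqrrD expr1n mul1r; have := sqr_ge0 D2; lra.
have bq : bm q.
  split; last by exists (1 + D2).
  apply: measurable_funM; first by apply: measurable_indic; exact: ball_measurable.
  by apply: measurable_funB => //; case: (hb_bm h_cond h_bound).
have bq1 : bm (fun z : T => q z.1) by exact: bm1 bq.
have br : bm (fun z : T => hb z.1 - clpB z.2).
  by apply: bm_B; [exact: (bm1 (hb_bm h_cond h_bound))|exact: bm_y].
have rn z : `|hb z.1 - clpB z.2| <= H + B.
  by apply: le_trans (ler_normB _ _) _; apply: lerD; [exact: hb_norm|exact: clp_norm].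
have DcE z : Dc g z = q z.1 ^+ 2 + 2 * q z.1 * (hb z.1 - clpB z.2).
  rewrite /Dc qib; case: (ib_cases z) => [->|[_ ->]]; ring.
have bD : bm (Dc g).
  have -> : Dc g = (fun z => q z.1 ^+ 2 + 2 * q z.1 * (hb z.1 - clpB z.2)) by apply/funext => z; exact: DcE.
  apply: Concentration.bm_D; first exact: bm_sqr.
  by apply: bm_M => //; apply: bm_M => //; exact: bm_cst.
have Dn z : `|Dc g z| <= b2 * `|q z.1|.
  rewrite DcE (_ : _ + _ = q z.1 * (q z.1 + 2 * (hb z.1 - clpB z.2))); last by ring.
  rewrite normrM mulrC; apply: ler_wpM2r => //; apply: le_trans (ler_normD _ _) _.
  rewrite (normrM 2) (ger0_norm (x := 2)) //; have h1 := qn z.1; have h2 := rn z.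
  by rewrite /b2; lra.
have E1 : E (Dc g) <= d2.
  have -> : E (Dc g) = E (fun z => q z.1 ^+ 2).
    have -> : Dc g = (fun z => q z.1 ^+ 2 + 2 * q z.1 * (hb z.1 - clpB z.2)) by apply/funext => z; exact: DcE.
    rewrite (EvD iid (bm_sqr bq1)); last by apply: bm_M => //; apply: bm_M => //; exact: bm_cst.
    have bq2 : bm (fun x => 2 * q x) by apply: bm_M => //; exact: bm_cst.
    by rewrite (orth B_gt0 iid X_ball Y_bound h_cond h_bound bq2) addr0.
  rewrite -[leRHS](Ev_cst P X Y); apply: (Ev_le iid); [exact: (bm_sqr bq1)|exact: bm_cst|].
  by move=> z; exact: q2.
have E2 : E (fun z => Dc g z ^+ 2) <= b2 ^+ 2 * d2.
  rewrite -[leRHS](Ev_cst P X Y); apply: (Ev_le iid); [exact: bm_sqr|exact: bm_cst|].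
  move=> z; apply: (@le_trans _ _ ((b2 * `|q z.1|) ^+ 2)).
    rewrite -[leLHS]real_normK ?num_real //; apply: lerXn2r; rewrite ?nnegrE //; last exact: Dn.
    by rewrite mulr_ge0 // (le_trans ler01 b21).
  by rewrite exprMn real_normK ?num_real // ler_wpM2l ?sqr_ge0.
have Db z : `|Dc g z| <= b2 ^+ 2.
  apply: le_trans (Dn z) _; rewrite expr2 ler_wpM2l ?(le_trans ler01) //.
  by apply: le_trans (qn _) _; rewrite /b2; lra.
have lb : lam * b2 ^+ 2 <= 4^-1.
  rewrite /lam invfM -mulrA mulVf ?mulr1 // gt_eqF // exprn_gt0 // (lt_le_trans _ b21) //.
have := @bernstein R dO O P _ T Z iid (Dc g) (b2 ^+ 2) lam (n%:R * d2 + s) n (proj1 bD) Db (ltW lam0) lb.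
apply: likely_weak; last first.
  move=> w /= hw; apply: le_trans hw _.
  have : n%:R * E (Dc g) <= n%:R * d2 by rewrite ler_wpM2l.
  lra.
rewrite ler_expR -/b2 -/lam.
have h1 : n%:R * lam ^+ 2 * E (fun z => Dc g z ^+ 2) <= n%:R * lam ^+ 2 * (b2 ^+ 2 * d2).
  by rewrite ler_wpM2l // mulr_ge0 // sqr_ge0.
have h2 : n%:R * lam * d2 * (lam * b2 ^+ 2) <= n%:R * lam * d2 * 4^-1.
  by rewrite ler_wpM2l // !mulr_ge0 // ltW.
have h3 : 0 <= n%:R * lam * d2 by rewrite !mulr_ge0 // ltW.
have h4 : n%:R * lam ^+ 2 * (b2 ^+ 2 * d2) = n%:R * lam * d2 * (lam * b2 ^+ 2) by ring.
lra.
Qed.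

Lemma data_likely n : likely P 0 [set w | forall i, (i < n)%N -> inball (X i w) /\ `|Y i w| <= B].
Proof.
have [mZ _ idd] := iid.
have mb := @ball_measurable R d.
pose A1 : set T := [set z | ~ inball (z.1 : 'rV[R]_d)].
pose A2 : set T := [set z | B < `|z.2|].
have mA1 : measurable A1.
  have -> : A1 = fst @^-1` (~` [set x | inball x]) by [].
  by rewrite -[X in measurable X]setTI; apply: measurable_fst => //; exact: measurableC.
have mA2 : measurable A2.
  have mn : measurable_fun setT (fun z : T => `|z.2|).
    by apply: measurableT_comp (@measurable_snd _ _ BV R); exact: normr_measurable.
  have -> : A2 = (fun z : T => `|z.2|) @^-1` `]B, +oo[%classic.
    by apply/seteqP; split=> z /=; rewrite in_itv /= andbT.
  by rewrite -[X in measurable X]setTI; apply: mn => //; exact: measurable_itv.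
have one i : likely P 0 [set w | inball (X i w) /\ `|Y i w| <= B].
  have l1 := @likely_null R dO O P (Z i @^-1` A1) _ _.
  have l2 := @likely_null R dO O P (Z i @^-1` A2) _ _.
  have m1 : measurable (Z i @^-1` A1) by rewrite -[X in measurable X]setTI; exact: mZ.
  have m2 : measurable (Z i @^-1` A2) by rewrite -[X in measurable X]setTI; exact: mZ.
  have p1 : P (Z i @^-1` A1) = 0%E by rewrite idd.
  have p2 : P (Z i @^-1` A2) = 0%E by rewrite idd.
  apply: likely_weak _ _ (likely_and (l1 m1 p1) (l2 m2 p2)); first by rewrite addr0.
  by move=> w [/= /contrapT h1 /negP]; rewrite -leNgt.
have := likely_seq (iota 0 n) one; rewrite big1 //; apply: likely_weak => // w /= hw i ilt.
by apply: hw; rewrite mem_iota.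
Qed.

(** The estimator is arbitrary off the ball, so its squared error need not be measurable. The
    integral is therefore bounded through the simple functions below it, each compared almost
    everywhere with a measurable integrand. *)
Lemma risk_le (f : 'rV[R]_d -> R) (g : BV -> R) : measurable_fun setT g ->
  (forall x : 'rV[R]_d, inball x -> f x = g x) ->
  (\int[P]_v ((truncB B f (X 0%N v) - h (X 0%N v)) ^+ 2)%:E <= (Vr g)%:E)%E.
Proof.
move=> mg fg; have [mZ _ _] := iid.
have bF : bm (fun w => (clpB (g (X 0%N w : BV)) - hb (X 0%N w)) ^+ 2).
  have bf : bm (fun z : T => (clpB (g z.1) - hb z.1) ^+ 2).
    by apply: bm_sqr; apply: bm_B; [exact: bm_clp1|exact: (bm1 (hb_bm h_cond h_bound))].
  exact: (bm_comp bf (mZ 0%N)).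
have VE : (Vr g)%:E = (\int[P]_w ((clpB (g (X 0%N w : BV)) - hb (X 0%N w)) ^+ 2)%:E)%E.
  rewrite /Regression.Vr /Ev /Iv /Rintegral fineK //.
  by apply: integrable_fin_num => //; exact: bm_integrable bF.
rewrite VE ge0_integralE; last by move=> w _; rewrite lee_fin sqr_ge0.
apply: ge_ereal_sup => _ [s /= hs <-].
have <- : (\int[P]_w (s w)%:E)%E = sintegral P s by rewrite integral_nnsfun // patch_setT.
apply: ae_ge0_le_integral => //.
- by move=> w _; rewrite lee_fin; exact: fun_ge0.
- exact/measurable_EFinP.
- by move=> w _; rewrite lee_fin sqr_ge0.
- by apply/measurable_EFinP; case: bF.
exists [set w | ~ inball (X 0%N w)]; split; [exact: (null_X iid)|exact: X_ball|].
move=> w /= hw; apply: contra_not hw => hx _.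
by have := hs w; rewrite patch_setT /= truncB_clp // fg // (hbE _ hx).
Qed.

Definition Cpeel : R := `|Ckey d B H| + 2 * ((B + H) ^+ 2 + 2 * ((3 * B + H) * (B + H))).

(** For m > n the claim is deterministic: all losses are bounded and n <= 2 m log n. *)
Lemma peel_likely (n m : nat) (M : R) : (2 <= n)%N -> (0 < m)%N -> 0 < M ->
  M ^+ 2 * n%:R <= m%:R ^+ 2 * kd m ^+ 3 ->
  likely P (2 * expR 1 * expR (- (3 * (m%:R * ln n%:R))))
    [set w | forall g : BV -> R, measurable_fun setT g -> cost_le g M ->
      (forall i, (i < n)%N -> inball (X i w)) ->
      n%:R * Vr g <= 2 * \sum_(i < n) Dl g (Z i w) + Cpeel * (m%:R * ln n%:R)].
Proof.
move=> n2 m0 M0 hM; have Ln := ln_nat_ge R n2.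
have H0 := H_ge0 h_bound; have B0 := B_gt0.
have c0 : 0 <= (B + H) ^+ 2 + 2 * ((3 * B + H) * (B + H)).
  by rewrite addr_ge0 ?sqr_ge0 // !mulr_ge0 // !addr_ge0 // ?mulr_ge0 // ltW.
have mL0 : 0 <= m%:R * ln n%:R :> R by rewrite mulr_ge0 //; lra.
have [mn|mn] := leqP m n.
  apply: likely_weak (lexx _) _ (key_bound B_gt0 iid X_ball Y_bound h_cond h_bound d_gt0 n2 m0 mn M0 hM).
  move=> w /= hw g mg hg hX; apply: le_trans (hw g mg hg hX) _; rewrite lerD2l.
  apply: ler_wpM2r => //; apply: le_trans (ler_norm _) _; rewrite /Cpeel lerDl; exact: mulr_ge0.
apply: (@likely_weak _ _ _ P 0 _ setT); [by rewrite !mulr_ge0 ?expR_ge0| |exact: likelyT].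
move=> w _ /= g mg _ _.
have V1 : Vr g <= (B + H) ^+ 2.
  rewrite -[leRHS](Ev_cst P X Y); apply: (Ev_le iid).
  - by apply: bm_sqr; apply: bm_B; [exact: bm_clp1|exact: (bm1 (hb_bm h_cond h_bound))].
  - exact: bm_cst.
  move=> z; rewrite -[leLHS]real_normK ?num_real //; apply: lerXn2r; rewrite ?nnegrE //; first by rewrite addr_ge0 // ltW.
  by apply: le_trans (ler_normB _ _) _; apply: lerD; [exact: clp_norm|exact: hb_norm].
have nV : n%:R * Vr g <= n%:R * (B + H) ^+ 2 by rewrite ler_wpM2l.
have SD : - (n%:R * ((3 * B + H) * (B + H))) <= \sum_(i < n) Dl g (Z i w).
  have -> : - (n%:R * ((3 * B + H) * (B + H))) = \sum_(i < n) - ((3 * B + H) * (B + H)).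
    by rewrite sumrN sumr_const card_ord mulr_natl.
  apply: ler_sum => i _.
  by have := Dl_norm B_gt0 h_bound g (Z i w); rewrite ler_norml => /andP[].
have nm : n%:R <= 2 * (m%:R * ln n%:R) :> R.
  apply: (@le_trans _ _ (m%:R * 1)); first by rewrite mulr1 ler_nat ltnW.
  by rewrite mulrCA ler_wpM2l //; lra.
have := ler_wpM2r c0 nm => hn.
have := mulr_ge0 (normr_ge0 (Ckey d B H)) mL0; rewrite /Cpeel mulrDl.
lra.
Qed.

End Events.
End Events.

(** * Peeling over cost levels and the rate *)

Module Rate.
Import NetApprox Concentration Regression Comparator Events.
Local Open Scope classical_set_scope.

Section Scales.
Variables (R : realType) (d : nat).
Hypothesis d_gt0 : (0 < d)%N.
Notation kd := (Reduction.kd R d).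
Definition theta : R := 2 * d%:R / (2 * d%:R + 3).

Let d0 : 0 < d%:R :> R. Proof. by rewrite ltr0n. Qed.

Lemma theta_bounds : 0 < theta /\ theta < 1.
Proof.
have dd := d0; have e0 : 0 < 2 * d%:R + 3 :> R by lra.
split; first by rewrite divr_gt0 // mulr_gt0.
by rewrite ltr_pdivrMr // mul1r; lra.
Qed.

(** Beyond [y0] the linear term dominates, and below it the left side is at most its value at
    [y0]. *)
Lemma young (a b th : R) : 0 < a -> 0 < b -> 0 < th -> th < 1 ->
  exists2 K : R, 0 <= K & forall y : R, 0 < y -> a * y `^ th <= b * y + K.
Proof.
move=> a0 b0 th0 th1; pose y0 := (a / b) `^ (1 - th)^-1.
have ab : 0 < a / b by rewrite divr_gt0.
have y00 : 0 < y0 by exact: powR_gt0.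
have t1 : 0 < 1 - th by rewrite subr_gt0.
exists (a * y0 `^ th); first by rewrite mulr_ge0 ?powR_ge0 // ltW.
move=> y yp; have [hy|hy] := lerP y y0.
  apply: (@le_trans _ _ (a * y0 `^ th)); last by rewrite lerDr mulr_ge0 // ltW.
  by rewrite ler_wpM2l ?(ltW a0) //; apply: ge0_ler_powR; rewrite ?nnegrE // ltW.
apply: (@le_trans _ _ (b * y)); last by rewrite lerDl mulr_ge0 ?powR_ge0 // ltW.
have e : y = y `^ th * y `^ (1 - th).
  by rewrite -powRD ?(gt_eqF yp) ?implybT // addrC subrK powRr1 // ltW.
rewrite [in leRHS]e mulrCA mulrC; apply: ler_wpM2l; first exact: powR_ge0.
rewrite mulrC -ler_pdivrMr //.
apply: (@le_trans _ _ (y0 `^ (1 - th))).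
  by rewrite /y0 -powRrM mulVf ?gt_eqF // powRr1 // ltW.
by apply: ge0_ler_powR; rewrite ?nnegrE // ltW.
Qed.

(** [theta] solves theta (2 + 3/d) = 2, so m^(2+3/d) matches the factor 4^i of the squared cost; the
    powers of t agree because n = t^(d + 2 al). *)
Lemma peel_scale (al t : R) (n i : nat) : 1 <= t -> n%:R = t `^ (d%:R + 2 * al) ->
  exists m : nat, [/\ (0 < m)%N, t `^ d%:R <= m%:R,
    m%:R <= 2 * (t `^ d%:R * (2 ^+ i) `^ theta) &
    ((2 ^+ i) * t `^ ((d%:R + 3) / 2 - al)) ^+ 2 * n%:R <= m%:R ^+ 2 * kd m ^+ 3].
Proof.
move=> t1 nt; have dd := d0; have [th0 th1] := theta_bounds.
have t0 : 0 < t by exact: lt_le_trans t1.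
have i1 : 1 <= 2 ^+ i :> R by rewrite exprn_ege1 // ler1n.
have i0 : 0 < 2 ^+ i :> R by exact: exprn_gt0.
pose u := t `^ d%:R * (2 ^+ i) `^ theta.
have mu1 : 1 <= t `^ d%:R by have := ler_powR t1 (ler0n R d); rewrite powRr0.
have p1 : 1 <= (2 ^+ i) `^ theta :> R by have := ler_powR i1 (ltW th0); rewrite powRr0.
have u1 : t `^ d%:R <= u by rewrite ler_peMr // powR_ge0.
have uu : 1 <= u by exact: le_trans u1.
have ut := truncn_itv (le_trans ler01 uu); have /andP[ut1 ut2] := ut.
exists (Num.truncn u).+1; split=> //.
- exact: le_trans u1 (ltW ut2).
- by rewrite -/u -natr1; lra.
set m := (Num.truncn u).+1 in ut2 *.
have mz : m%:R != 0 :> R by rewrite pnatr_eq0.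
have -> : m%:R ^+ 2 * kd m ^+ 3 = m%:R `^ (2 + 3 / d%:R) :> R.
  rewrite expr2 -mulrA mkd3 -{1}(powRr1 (ler0n R m)) -powRD ?mz ?implybT // addrA //.
apply: (@le_trans _ _ (u `^ (2 + 3 / d%:R))); last first.
  have e0 : 0 <= 2 + 3 / d%:R :> R by rewrite addr_ge0 // divr_ge0.
  by apply: ge0_ler_powR; rewrite ?nnegrE ?ler0n ?(le_trans ler01 uu) ?(ltW ut2).
rewrite /u powRM ?powR_ge0 // -!powRrM nt exprMn powR_sq mulrAC -mulrA -powRD ?(gt_eqF t0) ?implybT //.
have -> : theta * (2 + 3 / d%:R) = 2%:R.
  by rewrite /theta; field; rewrite !gt_eqF //; lra.
have -> : d%:R * (2 + 3 / d%:R) = 2 * ((d%:R + 3) / 2 - al) + (d%:R + 2 * al).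
  by field; rewrite gt_eqF.
by rewrite powR_mulrn ?(ltW i0) // [leRHS]mulrC mulrC [X in X <= _]mulrC [2 * _ + _]addrC.
Qed.

Lemma scale_log_bound (al t : R) (n : nat) : 0 < al -> 1 <= t -> n%:R = t `^ (d%:R + 2 * al) ->
  t `^ (- (2 * al)) * ln n%:R <= (d%:R + 2 * al) / (2 * al).
Proof.
move=> a0 t1 nt; have dd := d0; have t0 : 0 < t by exact: lt_le_trans t1.
have a2 : 0 < 2 * al by rewrite mulr_gt0.
have l : 2 * al * ln t <= t `^ (2 * al).
  by rewrite -ln_powR; have := le_ln1Dx (x := t `^ (2 * al) - 1); rewrite (addrC 1) subrK => h; apply: le_trans (h _) _; [have := powR_gt0 (2 * al) t0|]; lra.
rewrite nt ln_powR powRN.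
have p0 : 0 < t `^ (2 * al) by exact: powR_gt0.
rewrite ler_pdivrMl // mulrA ler_pdivlMr //.
have : (2 * al * ln t) * (d%:R + 2 * al) <= t `^ (2 * al) * (d%:R + 2 * al) by rewrite ler_wpM2r //; lra.
lra.
Qed.

End Scales.

Section Estimator.
Variables (R : realType) (d : nat) (O : Type).
Variables (X : nat -> O -> 'rV[R]_d) (Y : nat -> O -> R).
Variables (N : nat -> nat) (lam : nat -> R) (fhat : nat -> O -> 'rV[R]_d -> R).
Hypothesis est : is_estimator X Y N lam fhat.

(** Comparison with a competitor of finite cost forces the penalty of the estimator to be finite;
    zero units pad the competitor to the allowed width. *)
Lemma estimator_basic n om m (a : 'I_m -> R) (w : 'I_m -> 'rV[R]_d.+1) M :
  (2 <= n)%N -> 0 < lam n -> (m <= N n)%N -> cost_le (nn a w) M ->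
  exists k : R, [/\ 0 <= k, kappa (fhat n om) = k%:E &
    \sum_(i < n) (fhat n om (X i om) - Y i om) ^+ 2 + n%:R * (lam n * k) <=
    \sum_(i < n) (nn a w (X i om) - Y i om) ^+ 2 + n%:R * (lam n * M)].
Proof.
move=> n2 l0 mN hM; have [_ opt] := est om n2.
have n0 : 0 < n%:R :> R by rewrite ltr0n (leq_trans _ n2).
have := opt _ (inNN_le a w mN); rewrite /pen_risk => h1.
have k0 := kappa_ge0 (fhat n om); have hk := cost_kappa hM.
have h2 : ((n%:R^-1 * \sum_(i < n) (fhat n om (X i om) - Y i om) ^+ 2)%R%:E + (lam n)%:E * kappa (fhat n om) <=
    (n%:R^-1 * \sum_(i < n) (nn a w (X i om) - Y i om) ^+ 2 + lam n * M)%R%:E)%E.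
  apply: le_trans h1 _; rewrite EFinD leeD2l // EFinM; apply: lee_wpmul2l => //.
  by rewrite lee_fin ltW.
move: k0 h2; case: (kappa (fhat n om)) => [k| |] //.
  rewrite lee_fin => k0; rewrite -EFinM -EFinD lee_fin => h2.
  exists k; split=> //.
  have := ler_wpM2l (ltW n0) h2; rewrite !mulrDr !mulrA divff ?gt_eqF // !mul1r; lra.
by move=> _; rewrite gt0_muley ?lte_fin // addey // leye_eq.
Qed.

End Estimator.

Section Main.
Variables (R : realType) (d : nat) (B : R).
Variables (dO : measure_display) (O : measurableType dO) (P : probability O R).
Variables (X : nat -> O -> 'rV[R]_d) (Y : nat -> O -> R) (h : 'rV[R]_d -> R).
Notation BV := (borel_rV R d).
Notation Z := (fun i w => ((X i w : BV), Y i w)).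
Hypothesis d_gt0 : (0 < d)%N.
Hypothesis B_gt0 : 0 < B.
Hypothesis iid : iid_seq P Z.
Hypothesis X_ball : P [set w | ~ inball (X 0%N w)] = 0%E.
Hypothesis Y_bound : P [set w | B < `|Y 0%N w|] = 0%E.
Hypothesis h_cond : cond_exp_version P (X 0%N) (Y 0%N) h.
Variables (al Cap : R).
Notation tau := ((d%:R + 3) / 2 - al).
Hypothesis al_gt0 : 0 < al.
Hypothesis tau_ge0 : 0 <= tau.
Hypothesis Cap_gt0 : 0 < Cap.
Hypothesis approx : forall J : nat, exists g : 'rV[R]_d -> R,
    cost_le g (Cap * (2 ^+ J) `^ tau) /\
    forall x, inball x -> `|g x - h x| <= Cap * (2 ^+ J) `^ (- al).
Notation H := (d.+2%:R * Cap).
Notation Vr := (Vr B P X Y h).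
Notation Dl := (Dl B h).

Lemma target_bound x : inball x -> `|h x| <= H.
Proof.
move=> hx; have [g [g1 g2]] := approx 0; have := g2 x hx.
rewrite !expr0 powR1 mulr1 => h2; move: g1; rewrite expr0 powR1 mulr1 => g1.
have := cost_le_bound g1 hx => h3.
have -> : h x = g x - (g x - h x) by ring.
apply: le_trans (ler_normB _ _) _; rewrite -natr1 mulrDl mul1r; exact: lerD.
Qed.

Section Fixed.
Variables (N : nat -> nat) (lam : nat -> R) (fhat : nat -> O -> 'rV[R]_d -> R).
Hypothesis est : is_estimator X Y N lam fhat.

(** Clipping can only lower the loss since |Y| <= B on the sample, so the left side may be clipped
    while the competitor is not. *)
Lemma empirical_le n om m (a : 'I_m -> R) (w : 'I_m -> 'rV[R]_d.+1) M m' (a' : 'I_m' -> R) w' :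
  (2 <= n)%N -> 0 < lam n -> (m <= N n)%N -> cost_le (nn a w) M ->
  (forall x, inball x -> fhat n om x = nn a' w' x) ->
  (forall i, (i < n)%N -> inball (X i om) /\ `|Y i om| <= B) ->
  exists k : R, [/\ 0 <= k, kappa (fhat n om) = k%:E &
    \sum_(i < n) Dl (nn a' w') (Z i om) + n%:R * (lam n * k) <=
    \sum_(i < n) Dc B h (nn a w) (Z i om) + n%:R * (lam n * M)].
Proof.
move=> n2 l0 mN hM ff dat; have [k [k0 kE hk]] := estimator_basic est om n2 l0 mN hM.
exists k; split=> //; have B0 := B_gt0.
have e1 : \sum_(i < n) Dl (nn a' w') (Z i om) <= \sum_(i < n) (fhat n om (X i om) - Y i om) ^+ 2
   - \sum_(i < n) (h (X i om) - Y i om) ^+ 2.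
  rewrite -sumrB; apply: ler_sum => i _; have [xi yi] := dat i (ltn_ord i).
  rewrite /Regression.Dl /= (hbE _ xi) (clp_id B0 yi) ff // lerD2r.
  exact: clp_sqr_le.
have e2 : \sum_(i < n) Dc B h (nn a w) (Z i om) = \sum_(i < n) (nn a w (X i om) - Y i om) ^+ 2
   - \sum_(i < n) (h (X i om) - Y i om) ^+ 2.
  rewrite -sumrB; apply: eq_bigr => i _; have [xi yi] := dat i (ltn_ord i).
  by rewrite /Dc ibE //= (hbE _ xi) (clp_id B0 yi) mul1r.
lra.
Qed.

Theorem rate (c cl cl' : R) : 0 < c -> 0 < cl -> 0 < cl' ->
  (forall (n : nat) (t : R), (2 <= n)%N -> 1 <= t -> n%:R = t `^ (d%:R + 2 * al) ->
    [/\ c * t `^ d%:R <= (N n)%:R,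
        cl * (t `^ (- (2 * al + tau)) * ln n%:R) <= lam n &
        lam n <= cl' * (t `^ (- (2 * al + tau)) * ln n%:R)]) ->
  exists C c1 : R, [/\ 0 < C, 0 < c1 & forall (n : nat) (t : R),
    (2 <= n)%N -> 1 <= t -> n%:R = t `^ (d%:R + 2 * al) ->
    likely P (c1 * expR (- (2 * (t `^ d%:R * ln n%:R))))
      [set w | (\int[P]_v ((truncB B (fhat n w) (X 0%N v) - h (X 0%N v)) ^+ 2)%:E
          <= (C * (t `^ (- (2 * al)) * ln n%:R))%:E)%E]].
Proof.
move=> c0 cl0 cl0' hyp.
have num1 (a b k : R) : a <= b + 2 -> 1 <= k -> a + 1 <= b + 3 * k by lra.
have num2 (s k u v p1 p2 p3 p4 : R) :
    u <= p1 + p2 -> s + k <= u + v -> p4 <= k -> v <= p3 -> s <= p1 + p2 + p3 - p4 by lra.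
have num3 (l : R) : 2^-1 <= l -> [/\ 0 <= l, 0 < l & 1 <= 2 * l] by split; lra.
have num4 (s a u k a' k' : R) : s <= a - u -> - k <= s -> k <= k' -> a <= a' -> u <= a' + k' by lra.
have num5 (u v : R) : u <= v -> 2 * (u + 2) <= 2 * v + 4 by lra.
(* The final balance: the empirical excess enters twice and contains - b l x, which cancels the 2 b
   l x produced by y <= 2 x + 4. *)
have num6 (v s m q A b l x y k : R) : v <= 2 * s + m -> m <= q -> q <= (b * y + k) * l ->
    b * l * y <= b * l * (2 * x + 4) -> s <= A * l - b * l * x -> v <= (2 * A + 4 * b + k) * l by lra.
have B0 := B_gt0; have Cap0 := Cap_gt0; have al0 := al_gt0; have tau0 := tau_ge0.
have hH := target_bound; have H0 : 0 <= H by rewrite mulr_ge0 // ltW.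
have dd : 0 < d%:R :> R by rewrite ltr0n.
have [th0 th1] := theta_bounds R d_gt0.
have [Cc Cc0 hCc] := comparator d_gt0 al_gt0 tau_ge0 Cap_gt0 approx c0.
pose D2 := Cc * ((d%:R + 2 * al) / (2 * al)).
pose lam1 := (4 * (1 + D2 + 2 * (H + B)) ^+ 2)^-1.
have D20 : 0 <= D2 by rewrite mulr_ge0 ?(ltW Cc0) // divr_ge0 ?addr_ge0 ?mulr_ge0 // ltW.
have lam10 : 0 < lam1.
  by rewrite invr_gt0 mulr_gt0 // exprn_gt0 // -addrA ltr_pwDl // !addr_ge0 // mulr_ge0 // addr_ge0 // ltW.
(* The competitor's mean excess loss, its deviation, and its penalty. *)
pose A1 := 2 * Cc + 3 / lam1 + cl' * Cc.
have A10 : 0 <= A1.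
  have h1 : 0 <= 3 / lam1 by rewrite divr_ge0 // ltW.
  have h2 : 0 <= cl' * Cc by rewrite mulr_ge0 // ltW.
  by rewrite /A1; lra.
pose Kd := (3 * B + H) * (B + H).
have Kd0 : 0 <= Kd by rewrite mulr_ge0 // addr_ge0 ?mulr_ge0 // ltW.
pose C3 := (A1 + 2 * Kd) / cl.
have C30 : 0 <= C3 by rewrite divr_ge0 ?(ltW cl0) // addr_ge0 // mulr_ge0.
pose Cp := `|Cpeel d B H| + 1; have Cp0 : 0 < Cp by rewrite ltr_wpDl.
have [K0 K00 hK0] := young (mulr_gt0 (ltr0n R 2) Cp0) cl0 th0 th1.
pose C := 2 * A1 + 4 * cl + K0.
have C0 : 0 < C by rewrite /C -addrA ltr_wpDl ?mulr_ge0 // ltr_wpDr // mulr_gt0.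
have c10 : 0 < expR 1 + 2 * expR 1 * (C3 + 3) :> R.
  by rewrite ltr_wpDr ?expR_gt0 // !mulr_ge0 ?expR_ge0 // addr_ge0.
exists C, (expR 1 + 2 * expR 1 * (C3 + 3)); split=> // n t n2 t1 nt.
have [hN hl1 hl2] := hyp n t n2 t1 nt.
have Ln := ln_nat_ge R n2; have [ln0 lnp _] := num3 _ Ln.
have t0 : 0 < t by exact: lt_le_trans t1.
have tn : t != 0 by rewrite gt_eqF.
have n0 : 0 < n%:R :> R by rewrite ltr0n (leq_trans _ n2).
have [m [a [w [mN hcost happ]]]] := hCc n (N n) t n2 t1 nt hN.
set L := t `^ d%:R * ln n%:R.
set r := t `^ (- (2 * al)) * ln n%:R.
set Mn := t `^ tau in hcost.
have Mn0 : 0 < Mn by exact: powR_gt0.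
have mu1 : 1 <= t `^ d%:R by have := ler_powR t1 (ler0n R d); rewrite powRr0.
have Lln : ln n%:R <= L by rewrite /L ler_peMl.
have [L0 Lp L2] := num3 _ (le_trans Ln Lln).
have nr : n%:R * r = L.
  rewrite /r mulrA {1}nt -powRD ?tn ?implybT // /L; congr (t `^ _ * _); ring.
have lMn : t `^ (- (2 * al + tau)) * ln n%:R * Mn = r.
  by rewrite mulrAC /Mn -powRD ?tn ?implybT // /r; congr (t `^ _ * _); ring.
have r0 : 0 < r by rewrite mulr_gt0 ?powR_gt0.
have lam0 : 0 < lam n by apply: lt_le_trans hl1; rewrite !mulr_gt0 ?powR_gt0.
have d2D : Cc * r <= D2 by rewrite ler_wpM2l ?(ltW Cc0) //; exact: scale_log_bound.
have ev1 := data_likely iid X_ball Y_bound n.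
have ev2 := comparator_likely B_gt0 iid X_ball Y_bound h_cond hH (3 / lam1 * L) n
  (nn_measurable a w) happ (mulr_ge0 (ltW Cc0) (ltW r0)) d2D.
(* Boundedness of the losses limits the normalised penalty x to [C3] n, so linearly many levels
   suffice; their number is absorbed by n <= expR L when the exponent drops from 3 to 2. *)
pose I := (Num.truncn (C3 * n%:R + 2)).+1.
have [mi hmi] := boolp.choice (fun i => peel_scale d_gt0 i t1 nt).
have pk i : likely P (2 * expR 1 * expR (- (3 * L)))
    [set w | forall g : BV -> R, measurable_fun setT g -> cost_le g (2 ^+ i * Mn) ->
      (forall i, (i < n)%N -> inball (X i w)) ->
      n%:R * Vr g <= 2 * \sum_(i < n) Dl g (Z i w) + Cpeel d B H * ((mi i)%:R * ln n%:R)].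
  have [mi0 mi1 mi2 mi3] := hmi i.
  apply: likely_weak _ _ (peel_likely d_gt0 B_gt0 iid X_ball Y_bound h_cond hH n2 mi0 (mulr_gt0 (exprn_gt0 i (ltr0n R 2)) Mn0) mi3) => //.
  by rewrite ler_wpM2l ?mulr_ge0 ?expR_ge0 // ler_expR lerN2 ler_wpM2l // /L ler_wpM2r.
have ev3 := likely_fin (fun i : 'I_I => pk i).
have {ev1 ev2 ev3} ev := likely_and (likely_and ev1 ev2) ev3.
apply: likely_weak _ _ ev.
  rewrite -/lam1 card_ord add0r.
  have -> : 1 - lam1 * (3 / lam1 * L) = 1 + - (3 * L) by field; rewrite gt_eqF.
  rewrite expRD; set E3 := expR (- (3 * L)); set E2 := expR (- (2 * L)); set e := expR 1.
  have E30 : 0 <= E3 by exact: expR_ge0.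
  have e0 : 0 <= e by exact: expR_ge0.
  have h1 : n%:R * E3 <= E2.
    have -> : E2 = expR L * E3 by rewrite -expRD; congr expR; ring.
    by rewrite ler_wpM2r // -[leLHS]lnK ?posrE // ler_expR.
  have n1 : 1 <= n%:R :> R by rewrite ler1n (leq_trans _ n2).
  have h2 : E3 <= E2 by apply: le_trans h1; rewrite ler_peMl.
  have hI : I%:R <= (C3 + 3) * n%:R.
    have q0 : 0 <= C3 * n%:R + 2 by rewrite addr_ge0 // mulr_ge0.
    have /andP[q1 _] := truncn_itv q0.
    by rewrite /I -natr1 mulrDl; exact: num1.
  have h3 : I%:R * E3 <= (C3 + 3) * E2.
    apply: (@le_trans _ _ ((C3 + 3) * n%:R * E3)); first by rewrite ler_wpM2r.
    by rewrite -mulrA ler_wpM2l // addr_ge0.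
  have h4 : e * E3 <= e * E2 by rewrite ler_wpM2l.
  have h5 : 2 * e * (I%:R * E3) <= 2 * e * ((C3 + 3) * E2) by rewrite ler_wpM2l // mulr_ge0.
  have -> : I%:R * (2 * e * E3) = 2 * e * (I%:R * E3) by ring.
  have -> : (e + 2 * e * (C3 + 3)) * E2 = e * E2 + 2 * e * ((C3 + 3) * E2) by ring.
  exact: lerD.
move=> om [[/= dat cmp] pl].
have [[a' [w' ff]] _] := est om n2.
have [k [k0 kE hk]] := empirical_le n2 lam0 mN hcost ff dat.
set S := \sum_(i < n) Dl (nn a' w') (Z i om) in hk.
pose x := k / Mn; have x0 : 0 <= x by rewrite divr_ge0 // ltW.
have kx : k = x * Mn by rewrite /x divfK // gt_eqF.
set tt := t `^ (- (2 * al + tau)) * ln n%:R in hl1 hl2 lMn.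
have g1 : cl * L * x <= n%:R * (lam n * k).
  have -> : cl * L * x = n%:R * (cl * tt * k) by rewrite kx -nr -lMn; ring.
  by rewrite ler_wpM2l ?(ltW n0) // ler_wpM2r.
have g2 : n%:R * (lam n * (Cc * Mn)) <= cl' * Cc * L.
  have -> : cl' * Cc * L = n%:R * (cl' * tt * (Cc * Mn)) by rewrite -nr -lMn; ring.
  by rewrite ler_wpM2l ?(ltW n0) // ler_wpM2r // mulr_ge0 // ltW.
have g3 : 2 * n%:R * (Cc * r) = 2 * Cc * L by rewrite -nr; ring.
have hS : S <= A1 * L - cl * L * x.
  by move: cmp; rewrite g3 /A1 !mulrDl => cmp; exact: num2 cmp hk g1 g2.
have nL : n%:R <= 2 * L * n%:R by rewrite ler_peMl ?(ltW n0).
have n1 : 1 <= n%:R :> R by rewrite ler1n (leq_trans _ n2).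
have Sl : - (n%:R * Kd) <= S.
  have -> : - (n%:R * Kd) = \sum_(i < n) - Kd by rewrite sumrN sumr_const card_ord mulr_natl.
  apply: ler_sum => i _; have := Dl_norm B_gt0 hH (nn a' w') (Z i om).
  by rewrite ler_norml => /andP[].
have xC : x <= C3 * n%:R.
  have h1 : n%:R * Kd <= 2 * L * n%:R * Kd by rewrite ler_wpM2r.
  have h2 : A1 * L <= A1 * L * n%:R by rewrite ler_peMr // mulr_ge0 // ltW.
  have h3 : cl * L * x <= cl * L * (C3 * n%:R).
    have -> : cl * L * (C3 * n%:R) = A1 * L * n%:R + 2 * L * n%:R * Kd.
      by rewrite /C3; field; rewrite gt_eqF.
    exact: num4 hS Sl h1 h2.
  by move: h3; rewrite ler_pM2l // mulr_gt0.
have /andP[tx1 tx2] := truncn_itv x0.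
(* The shift by 2 provides an integer at least 2 even for x = 0; then x < 2^J <= 2 x + 4. *)
have [J [J1 J2 J3]] := @pow2_bracket (Num.truncn x).+2 isT.
set y : R := 2 ^+ J.
have y0 : 0 < y by exact: exprn_gt0.
have xy : x < y.
  by apply: lt_le_trans tx2 _; rewrite /y -natrX ler_nat; apply: leq_trans J1; rewrite leqnSn.
have yx : y <= 2 * x + 4.
  rewrite /y -natrX; apply: (@le_trans _ _ (2 * (Num.truncn x).+2)%:R); first by rewrite ler_nat.
  by rewrite natrM -[(Num.truncn x).+2]addn2 natrD; exact: num5.
have JI : (J < I)%N.
  have q0 : 0 <= C3 * n%:R + 2 by rewrite addr_ge0 // mulr_ge0.
  rewrite /I ltnS; apply: leq_trans J3 _.
  have -> : (Num.truncn x).+2 = Num.truncn ((Num.truncn x).+2%:R : R) by rewrite natrK.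
  by apply: le_truncn; rewrite -addn2 natrD lerD2r (le_trans tx1).
have costg : cost_le (nn a' w') (2 ^+ J * Mn).
  have : (kappa (fhat n om) < (2 ^+ J * Mn)%:E)%E by rewrite kE lte_fin kx ltr_pM2r.
  move=> /kappa_lt_cost [I' [cc [vv [e1 e2]]]]; exists I', cc, vv; split=> // z hz.
  by rewrite -ff // e2.
have V := pl (Ordinal JI) (nn a' w') (nn_measurable a' w') costg (fun i hi => (dat i hi).1).
have [_ mi1 mi2 _] := hmi J.
have hm : Cpeel d B H * ((mi J)%:R * ln n%:R) <= 2 * Cp * y `^ theta R d * L.
  apply: (@le_trans _ _ (Cp * (2 * (t `^ d%:R * y `^ theta R d) * ln n%:R))).
    apply: (@le_trans _ _ (Cp * ((mi J)%:R * ln n%:R))).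
      apply: ler_wpM2r; first by rewrite mulr_ge0.
      by apply: le_trans (ler_norm _) _; rewrite /Cp lerDl.
    by apply: ler_wpM2l; [exact: ltW|exact: ler_wpM2r].
  by rewrite le_eqVlt; apply/orP; left; apply/eqP; rewrite /L; ring.
have hy : 2 * Cp * y `^ theta R d * L <= (cl * y + K0) * L.
  by apply: ler_wpM2r (hK0 y y0); exact: ltW.
have hz : cl * L * y <= cl * L * (2 * x + 4) by apply: ler_wpM2l => //; rewrite mulr_ge0 // ltW.
have V2 : n%:R * Vr (nn a' w') <= C * L.
  exact: num6 V hm hy hz hS.
apply: le_trans (risk_le B_gt0 iid X_ball h_cond hH (nn_measurable a' w') ff) _.
rewrite lee_fin -(ler_pM2l n0); apply: le_trans V2 _.
by rewrite -nr mulrCA.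
Qed.
End Fixed.
End Main.
End Rate.

(** * Discretising measures on the sphere *)

Module Barron.
Import Networks NetApprox FiniteNets Concentration Regression.
Local Open Scope classical_set_scope.

Lemma discretize_family (R : realType) (dT : measure_display) (T : measurableType dT)
    (D : nat) (f : 'I_D -> T -> R) (b eps : R) :
  (forall j, measurable_fun setT (f j)) -> (forall j z, `|f j z| <= b) -> 0 < eps ->
  exists (K : nat) (c : 'I_K -> 'I_D -> R) (q : T -> 'I_K),
    [/\ (forall k, measurable (q @^-1` [set k])),
        (forall j z, `|f j z - c (q z) j| <= eps) & forall k j, `|c k j| <= b].
Proof.
move=> mf hb e0.
have Hj j : exists S : {K : nat & (('I_K -> R) * (T -> 'I_K))%type},
    [/\ (forall k, measurable ((projT2 S).2 @^-1` [set k])),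
        (forall z, `|f j z - (projT2 S).1 ((projT2 S).2 z)| <= eps) &
        forall k, `|(projT2 S).1 k| <= b].
  have [K [c [q [h1 h2 h3]]]] := discretize (mf j) (hb j) e0.
  exists (existT _ K (c, q)); split=> //= z.
  by have [u1 u2] := h2 z; rewrite ger0_norm; lra.
have [S HS] := boolp.choice Hj.
pose I : finType := {dffun forall j, 'I_(projT1 (S j))}.
pose q (z : T) : I := [ffun j => (projT2 (S j)).2 z].
have qE z (k : I) : (q z = k) <-> (forall j, (projT2 (S j)).2 z = k j).
  split=> [<- j|hk]; first by rewrite ffunE.
  by apply/ffunP => j; rewrite ffunE; exact: hk.
exists #|I|, (fun (k : 'I_#|I|) j => (projT2 (S j)).1 ((enum_val k : I) j)), (fun z => enum_rank (q z)); split.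
- move=> k.
  have -> : (fun z => enum_rank (q z)) @^-1` [set k] =
      \bigcap_(j in [set: 'I_D]) ((projT2 (S j)).2 @^-1` [set (enum_val k : I) j]).
    apply/seteqP; split=> z /=.
      by move=> <- j _ /=; rewrite enum_rankK ffunE.
    move=> hz; have -> : q z = enum_val k by apply/qE => j; exact: hz.
    exact: enum_valK.
  by apply: fin_bigcap_measurable => [|j _]; [exact: finite_finset|have [] := HS j].
- by move=> j z; rewrite enum_rankK ffunE; have [] := HS j.
by move=> k j; have [] := HS j.
Qed.

Section Barron.
Variables (R : realType) (d : nat).
Notation BS := (borel_rV R d.+1).

Lemma sphere_measurable : measurable (~` [set v | sphere v] : set BS).
Proof.
apply: measurableC.
have ms : measurable_fun setT (fun x : BS => \sum_j ((x : 'rV[R]_d.+1) 0 j) ^+ 2).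
  by apply: measurable_sum => j; apply: measurable_funX; exact: coord_measurable.
have -> : [set v | sphere v] = (fun x : BS => \sum_j ((x : 'rV[R]_d.+1) 0 j) ^+ 2) @^-1` [set 1].
  apply/seteqP; split=> x /=; rewrite /sphere /norm2 => h; last by rewrite h sqrtr1.
  by rewrite -[LHS]sqr_sqrtr ?h ?expr1n // sumr_ge0 // => j _; exact: sqr_ge0.
by rewrite -[X in measurable X]setTI; apply: ms => //; exact: measurable_set1.
Qed.

(** The identity on the sphere, but bounded on the whole space, so that the integrand becomes a
    bounded function there. *)
Definition clip (v : BS) : 'rV[R]_d.+1 := \row_j clp 1 ((v : 'rV[R]_d.+1) 0 j).

Lemma clip_id (v : 'rV[R]_d.+1) : sphere v -> clip v = v.
Proof.
move=> hv; apply/rowP => j; rewrite mxE clp_id //.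
by rewrite -hv; exact: norm2_coord.
Qed.

Lemma aff_measurable (x : 'rV[R]_d) : measurable_fun setT (fun v : BS => relu (aff x v)).
Proof.
apply: measurable_maxr => //.
have -> : (aff x : BS -> R) = (fun v : BS => \sum_k ext x k * (v : 'rV[R]_d.+1) 0 k).
  by apply/funext => v; rewrite affE.
by apply: measurable_sum => j; apply: measurable_funM => //; exact: coord_measurable.
Qed.

Lemma clip_bm (x : 'rV[R]_d) : inball x -> bm (fun v : BS => relu (aff x (clip v))).
Proof.
move=> hx; split.
  apply: measurable_maxr => //.
  have -> : (fun v : BS => aff x (clip v)) = (fun v : BS => \sum_k ext x k * clp 1 ((v : 'rV[R]_d.+1) 0 k)).
    by apply/funext => v; rewrite affE; apply: eq_bigr => k _; rewrite mxE.
  by apply: measurable_sum => j; apply: measurable_funM => //; exact: (proj1 (clp_measurable ltr01 (coord_measurable _))).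
exists (d.+1%:R * (d.+1%:R * 1)) => v; apply: le_trans (relu_norm _) _.
apply: le_trans (aff_le _ hx) _; rewrite ler_wpM2l // norm2_le_max // => j.
by rewrite mxE clp_norm.
Qed.

(** The coefficients are differences of the two measures on disjoint cells, so their sum is below
    the total variation bound 2 however large [m1] and [m2] are; those sizes influence only the mesh
    [eta]. Representatives lie in the unit cube, hence the factor d + 1. *)
Lemma barron_approx (h : 'rV[R]_d -> R) : F_sigma1 h -> forall eps : R, 0 < eps ->
  exists g : 'rV[R]_d -> R, cost_le g (2 * d.+1%:R) /\ forall x, inball x -> `|g x - h x| <= eps.
Proof.
move=> hF eps e0.
have : (gamma h < 2%:E)%E by apply: le_lt_trans hF _; rewrite lte_fin ltr1n.
move=> /ereal_inf_lt [_ [m1 [m2 [s1 s2 hm ->]]] tv].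
pose Mt := fine (m1 setT) + fine (m2 setT).
have Mt0 : 0 <= Mt by rewrite addr_ge0 // fine_ge0.
pose D : R := d.+1%:R * d.+1%:R; have D0 : 0 < D by rewrite mulr_gt0.
pose eta := eps / (D * (Mt + 1)).
have eta0 : 0 < eta by rewrite divr_gt0 // mulr_gt0 // ltr_wpDl.
pose f (j : 'I_d.+1) (v : BS) := clp 1 ((v : 'rV[R]_d.+1) 0 j).
have mf j : measurable_fun setT (f j) by exact: (proj1 (clp_measurable ltr01 (coord_measurable _))).
have hf j z : `|f j z| <= 1 by exact: clp_norm.
have [K [c [q [mq hq hc]]]] := discretize_family mf hf eta0.
pose u k : 'rV[R]_d.+1 := \row_j c k j.
pose A k := q @^-1` [set k].
pose a k := fine (m1 (A k)) - fine (m2 (A k)).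
pose g (x : 'rV[R]_d) := \sum_k a k * relu (aff x (u k)).
have Sa : \sum_k `|a k| <= 2.
  rewrite -lee_fin; apply: le_trans (ltW tv); apply: ereal_sup_ubound.
  exists K, A; split=> //.
  - by apply/trivIsetP => i j _ _ ij; rewrite -subset0 => z [/= qi qj]; rewrite -qi -qj eqxx in ij.
  by rewrite -subTset => z _; exists (q z).
exists g; split.
  exists 'I_K, a, u; split=> //.
  apply: (@le_trans _ _ (\sum_k `|a k| * d.+1%:R)); last by rewrite -mulr_suml ler_wpM2r.
  apply: ler_sum => k _; rewrite ler_wpM2l // -[leRHS]mulr1; apply: norm2_le_max => j.
  by rewrite mxE.
move=> x hx.
have bx := clip_bm hx.
have one (m : {finite_measure set BS -> \bar R}) : sphere_measure m ->
    `|\sum_k relu (aff x (u k)) * fine (m (A k)) - fine (\int[m]_v (relu (aff x v))%:E)| <= D * eta * fine (m setT).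
  move=> sm.
  have -> : fine (\int[m]_v (relu (aff x v))%:E) = Iv m (fun v : BS => relu (aff x (clip v))).
    rewrite /Iv /Rintegral; congr fine; apply: ae_eq_integral => //.
    - by apply/measurable_EFinP; exact: aff_measurable.
    - by apply/measurable_EFinP; case: bx.
    exists (~` [set v | sphere v]); split=> //; first exact: sphere_measurable.
    by move=> v /= hv; apply: contra_not hv => sv _; rewrite clip_id.
  have [bc <-] := Iv_cells m (fun k => relu (aff x (u k))) mq.
  rewrite -Iv_B //; apply: Iv_norm; first exact: bm_B.
  move=> v; apply: le_trans (relu_lip _ _) _; rewrite -affB.
  apply: le_trans (aff_le _ hx) _; rewrite /D -mulrA ler_wpM2l //; apply: norm2_le_max => j.
  by rewrite !mxE distrC; exact: hq.
rewrite hm // /f_mu /g.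
have -> : \sum_k a k * relu (aff x (u k)) =
    \sum_k relu (aff x (u k)) * fine (m1 (A k)) - \sum_k relu (aff x (u k)) * fine (m2 (A k)).
  by rewrite -sumrB; apply: eq_bigr => k _; rewrite /a; ring.
have o1 := one m1 s1; have o2 := one m2 s2.
set p1 := \sum_k _ * fine (m1 _) in o1 *; set p2 := \sum_k _ * fine (m2 _) in o2 *.
set i1 := fine (\int[m1]_v _)%E in o1 *; set i2 := fine (\int[m2]_v _)%E in o2 *.
have -> : p1 - p2 - (i1 - i2) = (p1 - i1) - (p2 - i2) by ring.
apply: le_trans (ler_normB _ _) _; apply: le_trans (lerD o1 o2) _.
rewrite -mulrDr -/Mt /eta.
have -> : D * (eps / (D * (Mt + 1))) = eps / (Mt + 1) by field; rewrite !gt_eqF // ltr_wpDl.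
rewrite mulrAC ler_pdivrMr ?ltr_wpDl // ler_wpM2l ?(ltW e0) //; lra.
Qed.

(** The cost does not depend on the precision, so any exponent [al] is possible; al - al is the form
    that [tau] takes at the critical value. *)
Lemma barron_scales (h : 'rV[R]_d -> R) (al : R) : F_sigma1 h ->
  forall J : nat, exists g : 'rV[R]_d -> R,
    cost_le g (2 * d.+1%:R * (2 ^+ J) `^ (al - al)) /\
    forall x, inball x -> `|g x - h x| <= 2 * d.+1%:R * (2 ^+ J) `^ (- al).
Proof.
move=> hF J; have J0 : 0 < (2 ^+ J) `^ (- al) :> R by rewrite powR_gt0 // exprn_gt0.
have c1 : 1 <= 2 * d.+1%:R :> R by rewrite -natrM ler1n.
have [g [g1 g2]] := barron_approx hF J0; exists g; split.
  by rewrite subrr powRr0 mulr1.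
by move=> x hx; apply: le_trans (g2 x hx) _; rewrite ler_peMl // ltW.
Qed.

End Barron.
End Barron.

(** * From the scale t to powers of n *)

Module Powers.
Import NetApprox Concentration Rate.
Local Open Scope classical_set_scope.

(** The exponents are characterised by linear identities instead of fractions, so each case can be
    instantiated with the exponents in which it is stated. *)
Lemma rate_powers (R : realType) (d : nat) (B : R)
    (dO : measure_display) (O : measurableType dO) (P : probability O R)
    (X : nat -> O -> 'rV[R]_d) (Y : nat -> O -> R) (h : 'rV[R]_d -> R) (al Cap p q s : R) :
  (0 < d)%N -> 0 < B ->
  iid_seq P (fun i w => ((X i w : borel_rV R d), Y i w)) ->
  P [set w | ~ inball (X 0%N w)] = 0%E ->
  P [set w | B < `|Y 0%N w|] = 0%E ->
  cond_exp_version P (X 0%N) (Y 0%N) h ->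
  0 < al -> 0 <= (d%:R + 3) / 2 - al -> 0 < Cap ->
  (forall J : nat, exists g : 'rV[R]_d -> R,
    cost_le g (Cap * (2 ^+ J) `^ ((d%:R + 3) / 2 - al)) /\
    forall x, inball x -> `|g x - h x| <= Cap * (2 ^+ J) `^ (- al)) ->
  (d%:R + 2 * al) * p = d%:R -> (d%:R + 2 * al) * q = 2 * al + ((d%:R + 3) / 2 - al) ->
  (d%:R + 2 * al) * s = 2 * al ->
  forall (N : nat -> nat) (lam : nat -> R),
  (exists c : R, 0 < c /\ forall n, (2 <= n)%N -> c * n%:R `^ p <= (N n)%:R) ->
  (exists c c' : R, [/\ 0 < c, 0 < c' & forall n, (2 <= n)%N ->
     c * (n%:R `^ (- q) * ln n%:R) <= lam n /\ lam n <= c' * (n%:R `^ (- q) * ln n%:R)]) ->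
  forall fhat : nat -> O -> 'rV[R]_d -> R, is_estimator X Y N lam fhat ->
  exists C c1 c2 : R, [/\ 0 < C, 0 < c1, 0 < c2 & forall n, (2 <= n)%N ->
    exists E : set O, [/\ measurable E,
      E `<=` [set w | (\int[P]_v
           ((truncB B (fhat n w) (X 0%N v) - h (X 0%N v)) ^+ 2)%:E
         <= (C * (n%:R `^ (- s) * ln n%:R))%:E)%E] &
      ((1 - c1 * expR (- (c2 * (n%:R `^ p * ln n%:R))))%:E <= P E)%E]].
Proof.
move=> d0 B0 iid Xb Yb hc al0 tau0 Cap0 app hp hq hs N lam [c [c0 hN]] [cl [cl' [cl0 cl0' hl]]] fhat est.
have e0 : 0 < d%:R + 2 * al by rewrite ltr_wpDl // mulr_gt0.
have pw (n : nat) (t x : R) : n%:R = t `^ (d%:R + 2 * al) -> n%:R `^ x = t `^ ((d%:R + 2 * al) * x).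
  by move=> ->; rewrite -powRrM.
have [|C [c1 [C0 c10 hC]]] := rate d0 B0 iid Xb Yb hc al0 tau0 Cap0 app est c0 cl0 cl0'.
  move=> n t n2 t1 nt; have [h1 h2] := hl n n2; have h3 := hN n n2.
  by move: h1 h2 h3; rewrite !(pw _ _ _ nt) mulrN hp hq.
exists C, c1, 2; split=> // n n2.
pose t : R := n%:R `^ (d%:R + 2 * al)^-1.
have n1 : 1 <= n%:R :> R by rewrite ler1n (leq_trans _ n2).
have t1 : 1 <= t.
  have ei : 0 <= (d%:R + 2 * al)^-1 by rewrite invr_ge0 ltW.
  by have := ler_powR n1 ei; rewrite powRr0.
have nt : n%:R = t `^ (d%:R + 2 * al).
  by rewrite /t -powRrM mulVf ?gt_eqF // powRr1.
have := likely_prob (hC n t n2 t1 nt).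
by rewrite !(pw _ _ _ nt) mulrN hp hs.
Qed.
End Powers.

Local Open Scope classical_set_scope.
Local Open Scope ring_scope.

Theorem theorem9 (R : realType) (d : nat) (B : R)
  (dO : measure_display) (O : measurableType dO) (P : probability O R)
  (X : nat -> O -> 'rV[R]_d) (Y : nat -> O -> R) (h : 'rV[R]_d -> R) :
  (1 <= d)%N -> 0 < B ->
  iid_seq P (fun i w => ((X i w : borel_rV R d), Y i w)) ->
  P [set w | ~ inball (X 0%N w)] = 0%E ->
  P [set w | B < `|Y 0%N w|] = 0%E ->
  cond_exp_version P (X 0%N) (Y 0%N) h ->
  (* (1) Hoelder class *)
  (forall alpha : R, 0 < alpha -> alpha < (d%:R + 3) / 2 -> holder_ball alpha h ->
   forall (N : nat -> nat) (lam : nat -> R),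
   (exists c : R, 0 < c /\ forall n, (2 <= n)%N ->
      c * n%:R `^ (d%:R / (d%:R + 2 * alpha)) <= (N n)%:R) ->
   (exists c c' : R, [/\ 0 < c, 0 < c' & forall n, (2 <= n)%N ->
      c * (n%:R `^ (- ((d%:R + 3 + 2 * alpha) / (2 * d%:R + 4 * alpha))) * ln n%:R)
        <= lam n /\
      lam n <= c' * (n%:R `^ (- ((d%:R + 3 + 2 * alpha) / (2 * d%:R + 4 * alpha)))
                    * ln n%:R)]) ->
   forall fhat : nat -> O -> 'rV[R]_d -> R, is_estimator X Y N lam fhat ->
   exists C c1 c2 : R, [/\ 0 < C, 0 < c1, 0 < c2 & forall n, (2 <= n)%N ->
     exists E : set O, [/\ measurable E,
       E `<=` [set w | (\int[P]_v
            ((truncB B (fhat n w) (X 0%N v) - h (X 0%N v)) ^+ 2)%:E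
          <= (C * (n%:R `^ (- (2 * alpha / (d%:R + 2 * alpha))) * ln n%:R))%:E)%E] &
       ((1 - c1 * expR (- (c2 * (n%:R `^ (d%:R / (d%:R + 2 * alpha)) * ln n%:R))))%:E
          <= P E)%E]])
  /\
  (* (2) F_sigma(1) *)
  (F_sigma1 h ->
   forall (N : nat -> nat) (lam : nat -> R),
   (exists c : R, 0 < c /\ forall n, (2 <= n)%N ->
      c * n%:R `^ (d%:R / (2 * d%:R + 3)) <= (N n)%:R) ->
   (exists c c' : R, [/\ 0 < c, 0 < c' & forall n, (2 <= n)%N ->
      c * (n%:R `^ (- ((d%:R + 3) / (2 * d%:R + 3))) * ln n%:R) <= lam n /\
      lam n <= c' * (n%:R `^ (- ((d%:R + 3) / (2 * d%:R + 3))) * ln n%:R)]) ->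
   forall fhat : nat -> O -> 'rV[R]_d -> R, is_estimator X Y N lam fhat ->
   exists C c1 c2 : R, [/\ 0 < C, 0 < c1, 0 < c2 & forall n, (2 <= n)%N ->
     exists E : set O, [/\ measurable E,
       E `<=` [set w | (\int[P]_v
            ((truncB B (fhat n w) (X 0%N v) - h (X 0%N v)) ^+ 2)%:E
          <= (C * (n%:R `^ (- ((d%:R + 3) / (2 * d%:R + 3))) * ln n%:R))%:E)%E] &
       ((1 - c1 * expR (- (c2 * (n%:R `^ (d%:R / (2 * d%:R + 3)) * ln n%:R))))%:E
          <= P E)%E]]).
Proof.
move=> d0 B0 iid Xb Yb hc.
have dd : 0 < d%:R :> R by rewrite ltr0n.
split=> [al al0 al1 hh|hF].
  have [Cap Cap0 app] := Holder.holder_approx d0 al0 al1 hh.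
  apply: (Powers.rate_powers d0 B0 iid Xb Yb hc al0 _ Cap0 app).
  - by rewrite subr_ge0 ltW.
  - by field; rewrite gt_eqF // ltr_wpDl // mulr_gt0.
  - by field; rewrite !gt_eqF //; lra.
  - by field; rewrite gt_eqF // ltr_wpDl // mulr_gt0.
(* The value with tau = 0, matching approximants whose cost is independent of the precision. *)
pose al : R := (d%:R + 3) / 2.
have al0 : 0 < al by rewrite divr_gt0 // addr_gt0.
have Cap0 : 0 < 2 * d.+1%:R :> R by rewrite mulr_gt0.
have e : d%:R + 2 * al = 2 * d%:R + 3 by rewrite /al; field.
apply: (Powers.rate_powers d0 B0 iid Xb Yb hc al0 _ Cap0 (Barron.barron_scales al hF)).
- by rewrite subrr.
- by rewrite e; field; rewrite gt_eqF //; lra.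
- by rewrite e /al; field; rewrite gt_eqF //; lra.
- by rewrite e /al; field; rewrite gt_eqF //; lra.
Qed.
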